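(* There exists a constant $c>0$, depending only on $s$ and $\lambda_1,\dots,\lambda_s$, such that the following holds. For every integer $N\geq 2$ and every subset $A\subseteq[N]$ of density $\delta=|A|/N$ satisfying $$\delta\geq 2(\log N)^{-c},$$ the set $A$ contains a non-trivial solution $(n_1,\dots,n_s)\in A^s$ of the system $$\lambda_1 n_1+\dots+\lambda_s n_s=0,\qquad \lambda_1 n_1^2+\dots+\lambda_s n_s^2=0.$$
   Context: Fix an integer $s\geq 7$ and integers $\lambda_1,\dots,\lambda_s\in\mathbb{Z}\setminus\{0\}$ with $\lambda_1+\dots+\lambda_s=0$, such that at least two of the $\lambda_i$ are positive and at least two are negative. $[N]=\{1,\dots,N\}$. A solution $(n_1,\dots,n_s)$ of the system $\lambda_1 n_1+\dots+\lambda_s n_s=0$, $\lambda_1 n_1^2+\dots+\lambda_s n_s^2=0$ is called non-trivial if $n_1,\dots,n_s$ are pairwise distinct. *)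

(* Defs.v *)
From Stdlib Require Import Reals ZArith List.
Import ListNotations.

Fixpoint wsum (lam : list Z) (ns : list nat) (f : Z -> Z) : Z :=
  match lam, ns with
  | l :: lam', n :: ns' => (l * f (Z.of_nat n) + wsum lam' ns' f)%Z
  | _, _ => 0%Z
  end.

Definition admissible (lam : list Z) : Prop :=
  (7 <= length lam)%nat /\
  Forall (fun l => l <> 0%Z) lam /\
  fold_right Z.add 0%Z lam = 0%Z /\
  (2 <= length (filter (fun l => Z.ltb 0 l) lam))%nat /\
  (2 <= length (filter (fun l => Z.ltb l 0) lam))%nat.

Definition nontrivial_solution_in (lam : list Z) (A : list nat) (ns : list nat) : Prop :=
  length ns = length lam /\
  (forall n, In n ns -> In n A) /\
  NoDup ns /\
  wsum lam ns (fun x => x) = 0%Z /\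
  wsum lam ns (fun x => (x * x)%Z) = 0%Z.

(* Main.v *)
(* Replace the torus by a finite grid of frequencies, so fine that orthogonality
   is exact: with F_g(x, y) = sum_n g(n) e(x n + y n^2), the solutions with
   weights g_i are counted by the sum over the grid of the product of the
   F_{g_i}(lam_i x, lam_i y). Let A have density delta and no non-trivial
   solution. With all weights 1 the count has the expected order N^(s-3): the
   quadratic form is diagonalised on the hyperplane sum lam_i n_i = 0, a Fejer
   kernel thickens the quadratic equation to a congruence and a bound, and
   congruences are solved prime by prime. Comparison with the weights 1_A, for
   which only the few degenerate solutions remain, gives
   sum |F_f|^s >= c (delta N)^s for f = 1_A - delta. By a restriction estimate
   for the curve (n, n^2), some j has about b^j grid points, b = (8/5)^10, with
   |F_f| >= 2^(-j) delta N. Simultaneous quadratic recurrence cuts [N] into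
   progressions along which all these phases are nearly constant, and by duality
   f has so much energy on the cells that the density of A on one of them is at
   least delta (1 + c 1.01^j), at the price ln N <= C 2^(21 j) ln N' for its
   length N'. For B large this never decreases delta^B ln N, and delta <= 1
   allows finitely many steps only; hence delta^B ln N <= C. *)
Require Import Defs.
From Stdlib Require Import Reals ZArith List.
From mathcomp Require all_boot all_order all_algebra perm Rstruct complex boolp ring lra zify ssrZ.
Open Scope R_scope.

Module QuadraticSystem.
Import all_boot all_order all_algebra perm Rstruct complex ring lra zify ssrZ.
Import Order.TTheory GRing.Theory Num.Theory.
Set Implicit Arguments.
Unset Strict Implicit.
Unset Printing Implicit Defensive.
Local Open Scope ring_scope.
Local Notation R := Rdefinitions.R.
Local Bind Scope ring_scope with RbaseSymbolsImpl.R.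
Local Arguments Rtrigo_def.cos _%_ring_scope.
Local Arguments Rtrigo_def.sin _%_ring_scope.
Local Arguments Rtrigo_def.exp _%_ring_scope.
Local Arguments Rpower.ln _%_ring_scope.
Local Notation "x %:C" := (real_complex R x) : ring_scope.

(** * Exponentials and the distance to the nearest integer *)

(** The price of a step is exponential in j, and 2^j can be as large as a power of 1/delta; a gain
    that stays bounded as j grows could not pay for it. So all large frequencies must be exploited
    at once, and this fixes b. For K frequencies (K small against N) with |F_g| >= h and g of energy
    E = sum |g(n)|^2, duality turns the restriction estimate into (K h)^2 <= C E N K^(17/10). With E
    <= N and h = N / 2^j it bounds level sets by about 2^(20 j / 3); with h = 2^(-j) delta N and K =
    b^j it gives E >= c (b^3 / 2^20)^(j / 10) delta^2 N. Growth in j thus requires b^3 > 2^20, while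
    summing seventh powers over level sets requires b < 2^7. The exponent 17/10 (5/3 would
    correspond to the critical sixth moment) leaves just enough room for (8/5)^10. The exponent of
    the tiling is cubic in the number of phases, about b^j < 2^(7 j), whence 2^(21 j). Seven
    variables leave a diagonal form in at least five, which is what the congruences use at every
    prime, 2 included. *)

Definition cn (z : R[i]) : R := ComplexField.Normc.normc z.

Lemma cnE z : cn z ^+ 2 = complex.Re z ^+ 2 + complex.Im z ^+ 2.
Proof.
case: z => a b; rewrite /cn /= sqr_sqrtr //.
by rewrite addr_ge0 // sqr_ge0.
Qed.

Lemma cn_ge0 z : 0 <= cn z.
Proof. by case: z => a b; rewrite /cn /= sqrtr_ge0. Qed.

Lemma cn0 : cn 0 = 0.
Proof. exact: ComplexField.Normc.normc0. Qed.

Lemma cn1 : cn 1 = 1.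
Proof. exact: ComplexField.Normc.normc1. Qed.

Lemma cnM x y : cn (x * y) = cn x * cn y.
Proof. exact: ComplexField.Normc.normcM. Qed.

Lemma cnN x : cn (- x) = cn x.
Proof. by case: x => a b; rewrite /cn /= !sqrrN. Qed.

Lemma cnD x y : cn (x + y) <= cn x + cn y.
Proof. exact: le_normcD. Qed.

Lemma cnB x y : cn (x - y) <= cn x + cn y.
Proof. by rewrite -(cnN y); exact: cnD. Qed.

Lemma cn_subC x y : cn (x - y) = cn (y - x).
Proof. by rewrite -cnN opprB. Qed.

Definition cj (z : R[i]) : R[i] := conjc z.

Lemma cn_cj x : cn (cj x) = cn x.
Proof. by case: x => a b; rewrite /cn /= sqrrN. Qed.

Lemma cjD x y : cj (x + y) = cj x + cj y.
Proof. exact: (rmorphD conjc). Qed.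

Lemma cjM x y : cj (x * y) = cj x * cj y.
Proof. exact: (rmorphM conjc). Qed.

Lemma cj0 : cj 0 = 0.
Proof. exact: (rmorph0 conjc). Qed.

Lemma cj1 : cj 1 = 1.
Proof. exact: (rmorph1 conjc). Qed.

Lemma cj_sum (I : Type) (r : seq I) (P : pred I) (F : I -> R[i]) :
  cj (\sum_(i <- r | P i) F i) = \sum_(i <- r | P i) cj (F i).
Proof. exact: (big_morph _ cjD cj0). Qed.

Lemma cn_real (x : R) : cn x%:C = `|x|.
Proof. by rewrite /cn /= expr0n /= addr0 sqrtr_sqr. Qed.

Lemma cn_nat (n : nat) : cn n%:R = n%:R.
Proof.
have -> : (n%:R : R[i]) = (n%:R : R)%:C by rewrite rmorph_nat.
by rewrite cn_real ger0_norm.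
Qed.

Lemma cnX x n : cn (x ^+ n) = cn x ^+ n.
Proof. by elim: n => [|n IH]; rewrite ?expr0 ?cn1 // !exprS cnM IH. Qed.

Lemma cn_sum (I : Type) (r : seq I) (P : pred I) (F : I -> R[i]) :
  cn (\sum_(i <- r | P i) F i) <= \sum_(i <- r | P i) cn (F i).
Proof.
elim/big_ind2: _ => [|x a y b h1 h2|//]; first by rewrite cn0.
by apply: (le_trans (cnD _ _)); rewrite lerD.
Qed.

Lemma cn_prod (I : Type) (r : seq I) (P : pred I) (F : I -> R[i]) :
  cn (\prod_(i <- r | P i) F i) = \prod_(i <- r | P i) cn (F i).
Proof. by apply: (big_morph cn cnM cn1). Qed.

Lemma cn_sqC z : (cn z ^+ 2)%:C = z * cj z.
Proof.
by case: z => a b; rewrite cnE; apply/eqP; rewrite eq_complex /=; apply/andP; split; apply/eqP; ring.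
Qed.

Lemma Re_le_cn z : `|complex.Re z| <= cn z.
Proof.
rewrite -(ler_pXn2r (n := 2)) ?nnegrE ?normr_ge0 ?cn_ge0 //.
by rewrite cnE real_normK ?num_real // lerDl sqr_ge0.
Qed.

Lemma ReD (x y : R[i]) : complex.Re (x + y) = complex.Re x + complex.Re y.
Proof. by case: x; case: y. Qed.

Lemma Re_sum (I : Type) (r : seq I) (P : pred I) (F : I -> R[i]) :
  complex.Re (\sum_(i <- r | P i) F i) = \sum_(i <- r | P i) complex.Re (F i).
Proof. by apply: (big_morph _ ReD). Qed.

Lemma real_sumC (I : Type) (r : seq I) (P : pred I) (F : I -> R) :
  (\sum_(i <- r | P i) F i)%:C = \sum_(i <- r | P i) (F i)%:C.
Proof. exact: rmorph_sum. Qed.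

Lemma IZR_pos p : IZR (Z.pos p) = (nat_of_pos p)%:R :> R.
Proof. by rewrite IZRposE INRE. Qed.

Definition e (x : R) : R[i] := Complex (cos (2 * PI * x)) (sin (2 * PI * x)).

Lemma e0 : e 0 = 1.
Proof. by rewrite /e mulr0 cos_0 sin_0. Qed.

Lemma eD x y : e (x + y) = e x * e y.
Proof.
rewrite /e mulrDr cosD sinD; apply/eqP; rewrite eq_complex /=.
by apply/andP; split; apply/eqP; ring.
Qed.

Lemma eN x : e (- x) = cj (e x).
Proof. by rewrite /e mulrN -RoppE cos_neg sin_neg. Qed.

Lemma eB x y : e (x - y) = e x * cj (e y).
Proof. by rewrite eD eN. Qed.

Lemma cn_e x : cn (e x) = 1.
Proof.
apply/eqP; rewrite -(@eqrXn2 _ 2) ?cn_ge0 // cnE /= expr1n; apply/eqP.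
by rewrite addrC; have := sin2_cos2 (2 * PI * x); rewrite /Rsqr !RealsE -!expr2.
Qed.

Lemma e_muln x n : e (x * n%:R) = e x ^+ n.
Proof.
elim: n => [|n IH]; first by rewrite mulr0 e0 expr0.
by rewrite -addn1 natrD mulrDr mulr1 eD IH exprD expr1.
Qed.

Lemma e1 : e 1 = 1.
Proof. by rewrite /e mulr1 cos_2PI sin_2PI. Qed.

Lemma e_int (z : int) : e z%:~R = 1.
Proof.
have en (n : nat) : e n%:R = 1 by rewrite -[n%:R]mul1r e_muln e1 expr1n.
by case: z => n; rewrite ?NegzE ?mulrNz ?eN en // cj1.
Qed.

Lemma e_addint x (z : int) : e (x + z%:~R) = e x.
Proof. by rewrite eD e_int mulr1. Qed.

Lemma e_sum (I : Type) (r : seq I) (P : pred I) (F : I -> R) :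
  e (\sum_(i <- r | P i) F i) = \prod_(i <- r | P i) e (F i).
Proof. exact: (big_morph e eD e0). Qed.

Definition nint (x : R) : int := Num.floor (x + 1 / 2).
Definition dst (x : R) : R := `|x - (nint x)%:~R|.

Lemma dst_ge0 x : 0 <= dst x. Proof. exact: normr_ge0. Qed.

Lemma dst_half x : dst x <= 1 / 2.
Proof.
rewrite /dst /nint; have /andP[h1] := floor_itv (x + 1 / 2).
by rewrite intrD => h2; rewrite ler_norml; apply/andP; split; lra.
Qed.

Lemma dst_le x (z : int) : dst x <= `|x - z%:~R|.
Proof.
have [h|h] := lerP (1 / 2) `|x - z%:~R|; first exact: le_trans (dst_half x) h.
rewrite /dst; suff -> : nint x = z by [].
move: h; rewrite ltr_norml => /andP[h1 h2].
apply/eqP; rewrite /nint -[_ == _]/(_ == _) eq_le; apply/andP; split.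
  rewrite -ltzD1 -(ltr_int R) intrD.
  apply: le_lt_trans (floor_le _) _; lra.
by rewrite floor_ge_int; lra.
Qed.

Lemma dst_int (z : int) : dst z%:~R = 0.
Proof. by apply/eqP; rewrite eq_le dst_ge0 andbT; apply: le_trans (dst_le _ z) _; rewrite subrr normr0. Qed.

Lemma dstD x y : dst (x + y) <= dst x + dst y.
Proof.
apply: (le_trans (dst_le _ (nint x + nint y))); rewrite /dst intrD.
by apply: (le_trans _ (ler_normD _ _)); rewrite opprD addrACA.
Qed.

Lemma dst_addint x (z : int) : dst (x + z%:~R) = dst x.
Proof.
apply/eqP; rewrite eq_le; apply/andP; split.
  by apply: (le_trans (dstD _ _)); rewrite dst_int addr0.
have {1}-> : x = (x + z%:~R) + (- z)%:~R by rewrite mulrNz addrK.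
by apply: (le_trans (dstD _ _)); rewrite dst_int addr0.
Qed.

Lemma dstN x : dst (- x) = dst x.
Proof.
have h y : dst (- y) <= dst y.
  by apply: (le_trans (dst_le _ (- nint y))); rewrite mulrNz -opprD normrN.
by apply/eqP; rewrite eq_le h -{1}(opprK x) h.
Qed.

Lemma dst_muln x (n : nat) : dst (n%:R * x) <= n%:R * dst x.
Proof.
apply: (le_trans (dst_le _ (n%:Z * nint x))).
by rewrite intrM -mulrBr normrM ger0_norm ?ler0n.
Qed.

Lemma dst_mulz x (n : int) : dst (n%:~R * x) <= `|n|%:~R * dst x.
Proof.
apply: (le_trans (dst_le _ (n * nint x))).
by rewrite intrM -mulrBr normrM intr_norm.
Qed.

Lemma dst_le_norm x : dst x <= `|x|.
Proof. by have := dst_le x 0; rewrite subr0. Qed.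

Lemma dst_small x : `|x| <= 1 / 2 -> dst x = `|x|.
Proof.
move=> h; apply/eqP; rewrite eq_le dst_le_norm /=.
have [n0|n0] := eqVneq (nint x) 0; first by rewrite /dst n0 subr0.
have h1 : 1 <= `|(nint x)%:~R : R| by rewrite -intr_norm ler1z; lia.
rewrite /dst.
have := ler_normB ((nint x)%:~R) ((nint x)%:~R - x); move: h1.
have := ler_normD (x - (nint x)%:~R) (- x); rewrite addrAC subrr add0r !normrN; lra.
Qed.

Lemma e_nint x : e x = e (x - (nint x)%:~R).
Proof. by rewrite -mulrNz e_addint. Qed.

Lemma dist_eN x : cn (1 - e (- x)) = cn (1 - e x).
Proof. by rewrite eN -[RHS]cn_cj /cj rmorphB rmorph1. Qed.

Lemma dist_e_double x : cn (1 - e (x + x)) <= 2 * cn (1 - e x).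
Proof.
have -> : 1 - e (x + x) = (1 - e x) * (1 + e x) by rewrite eD; ring.
rewrite cnM mulrC ler_wpM2r ?cn_ge0 //.
by apply: (le_trans (cnD _ _)); rewrite cn1 cn_e; lra.
Qed.

Lemma dist_e_quarter x : 1 / 4 <= x -> x <= 1 / 2 -> 1 <= cn (1 - e x).
Proof.
move=> h1 h2; apply: (le_trans _ (Re_le_cn _)).
have pi0 : 0 < PI by apply/RltP; exact: PI_RGT_0.
have c0 : cos (2 * PI * x) <= 0.
  by apply/RleP; apply: cos_le_0; apply/RleP; rewrite ?RealsE ?IZR_pos /=; nra.
rewrite ger0_norm /=; lra.
Qed.

(** The chord bound is obtained by doubling instead of concavity of the sine: |1 - e(2x)| <= 2 |1 -
    e(x)| carries it from 2x down to x, and k doublings bring x into [1/4, 1/2], where already the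
    real part of 1 - e(x) is at least 1. *)
Lemma dist_e_pos k x : 0 < x -> x <= 1 / 2 -> 1 <= x * 2 ^+ k * 4 -> 2 * x <= cn (1 - e x).
Proof.
elim: k x => [|k IH] x x0 xh; rewrite ?expr0 ?exprS => hk.
  have := @dist_e_quarter x; lra.
have [h|h] := lerP (1 / 4) x; first by have := dist_e_quarter h xh; lra.
have := dist_e_double x; have := IH (x + x); lra.
Qed.

Lemma dst_le_e x : 2 * dst x <= cn (1 - e x).
Proof.
have main y : 0 < y -> y <= 1 / 2 -> 2 * y <= cn (1 - e y).
  move=> y0 yh; have [k h1] : exists k : nat, 1 / y < k%:R.
    by exists (Num.bound (1 / y)); apply: archi_boundP; rewrite divr_ge0 // ltW.
  apply: (@dist_e_pos k) => //.
  have h2 : (k%:R : R) <= 2 ^+ k by rewrite -natrX ler_nat ltnW // ltn_expl.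
  have h3 : 1 < k%:R * y by rewrite -ltr_pdivrMr.
  have : k%:R * y <= 2 ^+ k * y by rewrite ler_wpM2r // ltW.
  rewrite [y * _]mulrC; lra.
rewrite e_nint /dst; set y := x - _.
have yh : `|y| <= 1 / 2 by exact: dst_half.
have [y0|y0|y0] := ltrgt0P y.
- rewrite gtr0_norm // in yh *; exact: main.
- rewrite ltr0_norm // in yh *; have := main (- y); rewrite dist_eN.
  by apply; lra.
- by rewrite mulr0 cn_ge0.
Qed.

(** From |1 - e(x)| = 2 |sin(pi x)| and the crude bound pi <= 4. Stated for |x|, so that it can also
    be used after removing the nearest integer. *)
Lemma e_le_dst x : cn (1 - e x) <= 8 * `|x|.
Proof.
have pi4 : PI <= 4 by apply/RleP; have := PI_4; rewrite ?RealsE ?IZR_pos /=.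
have pi0 : 0 < PI by apply/RltP; exact: PI_RGT_0.
have main y : 0 <= y -> cn (1 - e y) <= 8 * y.
  move=> y0; rewrite -(ler_pXn2r (n := 2)) ?nnegrE ?cn_ge0 //; last by lra.
  have -> : cn (1 - e y) ^+ 2 = (2 * sin (PI * y)) ^+ 2.
    rewrite cnE /=; have -> : 2 * PI * y = PI * y + PI * y by ring.
    rewrite cosD sinD; have := sin2_cos2 (PI * y); rewrite /Rsqr !RealsE => h.
    set s := sin _ in h *; set c := cos _ in h *.
    have -> : (1 - (c * c - s * s)) ^+ 2 + (0 - (s * c + c * s)) ^+ 2 =
       (1 - c * c + s * s) ^+ 2 + 4 * (s * s) * (c * c) by ring.
    have -> : c * c = 1 - s * s by lra.
    by ring.
  have hs : `|sin (PI * y)| <= PI * y.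
    have p0 : 0 <= PI * y by rewrite mulr_ge0 // ltW.
    rewrite ler_norml; apply/andP; split; last first.
      have [->|n0] := eqVneq (PI * y) 0; first by rewrite sin_0.
      by apply/ltW/RltP/sin_lt_x/RltP; rewrite lt_def n0.
    have [->|n0] := eqVneq (PI * y) 0; first by rewrite sin_0 oppr0.
    have hp : 0 < PI * y by rewrite lt_def n0.
    have [h|h] := lerP (PI * y) PI.
      have : 0 <= sin (PI * y) by apply/RleP; apply: sin_ge_0; apply/RleP.
      lra.
    have := SIN_bound (PI * y); case => /RleP h1 _; rewrite ?RealsE ?IZR_pos /= in h1.
    have h3 : 2 <= PI by have /RltP := PI2_1; rewrite ?RealsE ?IZR_pos /=; lra.
    have h4 : IZR (Z.neg 1) = -1 :> R by [].
    rewrite h4 in h1; lra.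
  rewrite !exprMn -(real_normK (num_real (sin _))) -!exprMn ler_pXn2r ?nnegrE ?mulr_ge0 ?normr_ge0 //; first by nra.
have [x0|x0] := lerP 0 x; first by rewrite ger0_norm //; exact: main.
by rewrite ltr0_norm // -dist_eN; apply: main; lra.
Qed.

Lemma geom_sum_dst (x : R) (N : nat) : cn (\sum_(n < N) e (x * n%:R)) * dst x <= 1.
Proof.
have h : (1 - e x) * \sum_(n < N) e (x * n%:R) = 1 - e (x * N%:R).
  rewrite e_muln; under eq_bigr => i _ do rewrite e_muln.
  by rewrite -[in RHS](expr1n _ N) subrXX; under [in RHS]eq_bigr => i _ do rewrite expr1n mul1r.
have h2 : cn (1 - e x) * cn (\sum_(n < N) e (x * n%:R)) <= 2.
  by rewrite -cnM h; apply: (le_trans (cnB _ _)); rewrite cn1 cn_e.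
have := dst_le_e x; have := cn_ge0 (\sum_(n < N) e (x * n%:R)).
set s := cn _ in h2 *; nra.
Qed.

(** * Logarithm inequalities *)

Lemma ln_1 : ln 1 = 0. Proof. exact: ln_1. Qed.

Lemma ln_mul (x y : R) : 0 < x -> 0 < y -> ln (x * y) = ln x + ln y.
Proof. by move=> /RltP h1 /RltP h2; rewrite -RmultE ln_mult. Qed.

Lemma ln_inv (x : R) : 0 < x -> ln (x^-1) = - ln x.
Proof. by move=> /RltP h1; rewrite -RinvE ln_Rinv. Qed.

Lemma ln_div (x y : R) : 0 < x -> 0 < y -> ln (x / y) = ln x - ln y.
Proof. by move=> h1 h2; rewrite ln_mul ?invr_gt0 // ln_inv. Qed.

Lemma ln_le (x y : R) : 0 < x -> x <= y -> ln x <= ln y.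
Proof.
move=> h1; rewrite le_eqVlt => /orP[/eqP->//|h]; apply/ltW/RltP.
by apply: ln_increasing; apply/RltP.
Qed.

Lemma ln_lt (x y : R) : 0 < x -> x < y -> ln x < ln y.
Proof. by move=> h1 h; apply/RltP; apply: ln_increasing; apply/RltP. Qed.

Lemma exp_ge1D (x : R) : 1 + x <= exp x.
Proof. by apply/RleP; exact: exp_ineq1_le. Qed.

Lemma exp_gt0 (x : R) : 0 < exp x. Proof. by apply/RltP; exact: exp_pos. Qed.

Lemma exp_lnK (x : R) : 0 < x -> exp (ln x) = x.
Proof. by move=> /RltP; exact: exp_ln. Qed.

Lemma ln_expK (x : R) : ln (exp x) = x. Proof. exact: ln_exp. Qed.

Lemma exp_add (x y : R) : exp (x + y) = exp x * exp y.
Proof. by rewrite expRD. Qed.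

Lemma exp_muln (x : R) n : exp (x * n%:R) = exp x ^+ n.
Proof. by rewrite expRX mulr_natr. Qed.

Lemma ln_le_sub1 (x : R) : 0 < x -> ln x <= x - 1.
Proof. by move=> h; have := exp_ge1D (ln x); rewrite exp_lnK //; lra. Qed.

Lemma ln_ge_sub (x : R) : 0 < x -> 1 - x^-1 <= ln x.
Proof. by move=> h; have := @ln_le_sub1 (x^-1); rewrite invr_gt0 ln_inv // => /(_ h); lra. Qed.

Lemma ln_ge0 (x : R) : 1 <= x -> 0 <= ln x.
Proof. by move=> h; rewrite -ln_1; apply: ln_le. Qed.

Lemma ln_exp_pow (x : R) n : 0 < x -> ln (x ^+ n) = ln x * n%:R.
Proof. by move=> h; rewrite -[in LHS](exp_lnK h) -exp_muln ln_expK. Qed.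

(** For y = 1 + ln x the inequality y/J <= exp(y/J), raised to the power J, has e x on the right.
    Logarithmic losses are absorbed into powers with this lemma throughout. *)
Lemma ln_pow_le (J : nat) : exists2 C : R, 1 <= C & forall x : R, 1 <= x -> (1 + ln x) ^+ J <= C * x.
Proof.
exists ((J%:R + 1) ^+ J * exp 1) => [|x x1].
  have h1 : 1 <= exp 1 by have := exp_ge1D 1; lra.
  by rewrite mulr_ege1 // exprn_ege1 // lerDr.
have x0 : 0 < x by lra.
have l0 := ln_ge0 x1.
case: J => [|J]; first by rewrite !expr0 mul1r; have := exp_ge1D 1; nra.
set y := 1 + ln x; have y0 : 0 <= y by rewrite /y; lra.
have j0 : 0 < J.+1%:R :> R by rewrite ltr0n.
have h : y / J.+1%:R <= exp (y / J.+1%:R) by apply: (le_trans _ (exp_ge1D _)); rewrite lerDr.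
have h2 : (y / J.+1%:R) ^+ J.+1 <= exp y.
  have -> : exp y = exp (y / J.+1%:R) ^+ J.+1 by rewrite -exp_muln divfK // gt_eqF.
  by rewrite lerXn2r // nnegrE ?divr_ge0 // ltW // exp_gt0.
have -> : y ^+ J.+1 = J.+1%:R ^+ J.+1 * (y / J.+1%:R) ^+ J.+1.
  by rewrite -exprMn mulrC divfK // gt_eqF.
have h3 : exp y = exp 1 * x by rewrite /y exp_add exp_lnK.
rewrite -mulrA -h3; apply: ler_pM => //; first by rewrite exprn_ge0 // ltW.
  by rewrite exprn_ge0 // divr_ge0 // ltW.
by rewrite lerXn2r ?nnegrE ?addr_ge0 ?ler0n // lerDl.
Qed.

Lemma harmonic_le (n : nat) : (0 < n)%N -> \sum_(j < n) (j.+1%:R)^-1 <= 1 + ln n%:R :> R.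
Proof.
elim: n => // -[|n] IH _; first by rewrite big_ord_recl big_ord0 addr0 invr1 ln_1; lra.
rewrite big_ord_recr /=; apply: (le_trans (lerD (IH isT) (lexx _))).
have h1 : (0 : R) < n.+1%:R by rewrite ltr0n.
have h2 : (0 : R) < n.+2%:R by rewrite ltr0n.
have := @ln_ge_sub (n.+2%:R / n.+1%:R); rewrite divr_gt0 // ln_div // invf_div => /(_ isT).
have -> : 1 - n.+1%:R / n.+2%:R = (n.+2%:R)^-1 :> R.
  by rewrite -[in X in X - _](@divff _ (n.+2%:R)) ?gt_eqF // -mulrBl -natrB // subSnn mul1r.
by move=> h; rewrite -addrA lerD2l addrC -lerBrDr.
Qed.

(** The rearrangement by the difference of the indices that underlies Weyl differencing. In the
    induction the new last row and column supply exactly one new term to each diagonal. *)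
Lemma sum_triangle (V : zmodType) (G : nat -> nat -> V) N :
  \sum_(n < N) \sum_(m < N) G n m = \sum_(n < N) G n n +
   \sum_(h < N) \sum_(m < N.-1 - h) (G (m + h.+1)%N m + G m (m + h.+1)%N).
Proof.
elim: N => [|N IH]; first by rewrite !big_ord0 addr0.
rewrite big_ord_recr /=; under eq_bigr => i _ do rewrite big_ord_recr /=.
rewrite big_split /= IH [in RHS]big_ord_recr /= [X in _ = _ + X]big_ord_recr /=.
rewrite subnn [X in _ = _ + (_ + X)]big_ord0 addr0 [X in _ + X = _]big_ord_recr /=.
have -> : \sum_(h < N) \sum_(m < N - h) (G (m + h.+1)%N m + G m (m + h.+1)%N) =
  \sum_(h < N) \sum_(m < N.-1 - h) (G (m + h.+1)%N m + G m (m + h.+1)%N) +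
  \sum_(h < N) (G N h + G h N).
  rewrite [\sum_(h < N) (G N h + _)](reindex_inj rev_ord_inj) -big_split /=; apply: eq_bigr => h _.
  have hN := ltn_ord h.
  have -> : (N - h = (N.-1 - h).+1)%N by lia.
  rewrite big_ord_recr /=; congr (_ + _).
  have -> : (N - h.+1 = N.-1 - h)%N by lia.
  by have -> : (N.-1 - h + h.+1 = N)%N by lia.
by rewrite big_split /= [LHS](AC (3*2) ((1*5)*(2*(4*3)))).
Qed.

(** The usual min(N, 1/||x||) of Weyl's inequality. The test is on the product, so that no value of
    the inverse at 0 is involved. *)
Definition cap (N : nat) (x : R) : R := if dst x * N%:R <= 1 then N%:R else (dst x)^-1.

Lemma cap_ge0 N x : 0 <= cap N x.
Proof. by rewrite /cap; case: ifP => // _; rewrite invr_ge0 dst_ge0. Qed.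

Lemma cap_leN N x : cap N x <= N%:R.
Proof.
rewrite /cap; case: ifP => // /negbT; rewrite -ltNge => h.
have d0 : 0 < dst x by rewrite lt_def dst_ge0 andbT; apply/eqP => h0; rewrite h0 mul0r in h; lra.
by rewrite -div1r ler_pdivrMr // mulrC ltW.
Qed.

Lemma cap_le_inv N x y : 0 < y -> y <= dst x -> cap N x <= y^-1.
Proof.
move=> y0 h; rewrite /cap; have d0 : 0 < dst x by exact: lt_le_trans h.
case: ifP => [h1|_]; last by rewrite lef_pV2.
by rewrite -[leRHS]div1r ler_pdivlMr //; apply: le_trans h1; rewrite mulrC ler_wpM2r.
Qed.

Lemma geom_cap N L x : (L <= N)%N -> cn (\sum_(n < L) e (x * n%:R)) <= cap N x.
Proof.
move=> hL; rewrite /cap; case: ifP => [_|/negbT].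
  apply: (le_trans (cn_sum _ _ _)); under eq_bigr => i _ do rewrite cn_e.
  by rewrite sumr_const card_ord ler_nat.
rewrite -ltNge => h; have d0 : 0 < dst x.
  by rewrite lt_def dst_ge0 andbT; apply/eqP => h0; rewrite h0 mul0r in h; lra.
by rewrite -div1r ler_pdivlMr //; exact: geom_sum_dst.
Qed.

Definition qsum (N : nat) (a b : R) : R[i] := \sum_(n < N) e (a * n%:R + b * n%:R ^+ 2).

Lemma cn_qsum_le N a b : cn (qsum N a b) <= N%:R.
Proof.
apply: (le_trans (cn_sum _ _ _)); under eq_bigr => i _ do rewrite cn_e.
by rewrite sumr_const card_ord.
Qed.

Lemma weyl_differencing N a b :
  cn (qsum N a b) ^+ 2 <= N%:R + 2 * \sum_(h < N) cap N (2 * b * h.+1%:R).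
Proof.
pose f (n : nat) := a * n%:R + b * n%:R ^+ 2.
have -> : cn (qsum N a b) ^+ 2 = cn (\sum_(n < N) \sum_(m < N) e (f n - f m)).
  rewrite -[LHS]ger0_norm ?sqr_ge0 // -cn_real cn_sqC /qsum cj_sum mulr_suml.
  by congr cn; apply: eq_bigr => i _; rewrite mulr_sumr; apply: eq_bigr => j _; rewrite eB.
rewrite (sum_triangle (fun n m => e (f n - f m))).
apply: (le_trans (cnD _ _)); apply: lerD.
  apply: (le_trans (cn_sum _ _ _)); under eq_bigr => i _ do rewrite cn_e.
  by rewrite sumr_const card_ord.
rewrite mulr_sumr; apply: (le_trans (cn_sum _ _ _)); apply: ler_sum => h _.
rewrite big_split /=; apply: (le_trans (cnD _ _)); rewrite mulr_natl mulr2n.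
have key : cn (\sum_(i < N.-1 - h) e (f (i + h.+1)%N - f i)) <= cap N (2 * b * h.+1%:R).
  have -> : \sum_(i < N.-1 - h) e (f (i + h.+1)%N - f i) =
     e (a * h.+1%:R + b * h.+1%:R ^+ 2) * \sum_(i < N.-1 - h) e (2 * b * h.+1%:R * i%:R).
    rewrite mulr_sumr; apply: eq_bigr => i _; rewrite -eD /f natrD; congr e; ring.
  by rewrite cnM cn_e mul1r geom_cap //; lia.
apply: lerD => //; rewrite -[leLHS]cn_cj cj_sum.
by under eq_bigr => i _ do rewrite -eN opprB.
Qed.

Lemma dirichlet_simultaneous (K T : nat) (x : 'I_K -> R) : (0 < T)%N ->
  exists2 d : nat, (0 < d <= T ^ K)%N & forall k, dst (d%:R * x k) * T%:R <= 1.
Proof.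
move=> T0; pose fr (y : R) := y - (Num.floor y)%:~R.
have fr0 y : 0 <= fr y < 1.
  by have /andP[h1 h2] := floor_itv y; rewrite /fr; rewrite intrD in h2; apply/andP; split; lra.
have TR : (0 : R) < T%:R by rewrite ltr0n.
have bx_lt y : (Num.truncn (T%:R * fr y) < T)%N.
  have /andP[h1 h2] := fr0 y.
  have h3 : 0 <= T%:R * fr y by rewrite mulr_ge0 // ltW.
  rewrite -(ltr_nat R); apply: (le_lt_trans (proj1 (andP (truncn_itv h3)))).
  by rewrite gtr_pMr.
pose f (d : 'I_(T ^ K).+1) : {ffun 'I_K -> 'I_T} := [ffun k => Ordinal (bx_lt (d%:R * x k))].
have /injectivePn [d1 [d2 d12 fe]] : ~~ injectiveb f.
  apply/negP => /injectiveP /leq_card; rewrite card_ffun !card_ord; lia.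
wlog lt12 : d1 d2 d12 fe / (d1 < d2)%N.
  move=> hw; have [h|h|h] := ltngtP d1 d2; first exact: (hw d1 d2).
    by apply: (hw d2 d1) => //; rewrite eq_sym.
  by move/eqP: d12; case; apply: val_inj.
exists (d2 - d1)%N; first by have := ltn_ord d2; lia.
move=> k; have := congr1 (fun g : {ffun 'I_K -> 'I_T} => val (g k)) fe; rewrite !ffunE /= => ht.
set y1 := d1%:R * x k in ht; set y2 := d2%:R * x k in ht.
have h1 : 0 <= T%:R * fr y1 by rewrite mulr_ge0 ?(ltW TR) //; case/andP: (fr0 y1).
have h2 : 0 <= T%:R * fr y2 by rewrite mulr_ge0 ?(ltW TR) //; case/andP: (fr0 y2).
have /andP[a1 b1] := truncn_itv h1; have /andP[a2 b2] := truncn_itv h2.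
rewrite ht in a1 b1; rewrite -natr1 in b1; rewrite -natr1 in b2.
have hd : dst ((d2 - d1)%:R * x k) <= `|fr y2 - fr y1|.
  apply: (le_trans (dst_le _ (Num.floor y2 - Num.floor y1))).
  rewrite natrB ?(ltnW lt12) // mulrBl -/y1 -/y2 intrB /fr.
  by rewrite le_eqVlt; apply/orP; left; apply/eqP; congr `|_|; ring.
apply: (le_trans (ler_wpM2r (ltW TR) hd)).
rewrite -[T%:R]ger0_norm ?(ltW TR) // -normrM ler_norml mulrBl ![_ * T%:R]mulrC; apply/andP; split; lra.
Qed.

(** * Weyl sums *)

Lemma sum_const_ord (n : nat) (c : R) : \sum_(j < n) c = n%:R * c.
Proof. by rewrite sumr_const card_ord mulr_natl. Qed.

Lemma sum_blocks (V : nmodType) (G : nat -> V) (J q : nat) :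
  \sum_(l < J * q) G l = \sum_(j < J) \sum_(r < q) G (j * q + r)%N.
Proof.
elim: J => [|J IH]; first by rewrite mul0n !big_ord0.
by rewrite mulSnr big_split_ord /= IH [in RHS]big_ord_recr.
Qed.

Lemma sum_ord_widen (G : nat -> R) (m n : nat) : (m <= n)%N -> (forall i, 0 <= G i) ->
  \sum_(i < m) G i <= \sum_(i < n) G i.
Proof.
move=> mn G0; rewrite -(subnKC mn) big_split_ord /= lerDl; exact: sumr_ge0.
Qed.

Lemma sum_even_le (F : nat -> R) N : (forall i, 0 <= F i) ->
  \sum_(h < N) F (2 * h.+1)%N <= \sum_(l < (2 * N).+1) (if (0 < l)%N then F l else 0).
Proof.
move=> F0; elim: N => [|N IH]; first by rewrite big_ord0 sumr_ge0 // => i _; case: ifP.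
have -> : (2 * N.+1).+1 = (2 * N).+3 by lia.
rewrite big_ord_recr [leRHS]big_ord_recr /= [X in _ <= X + _]big_ord_recr /=.
have -> : (2 * N.+1 = (2 * N).+2)%N by lia.
by rewrite lerD2r; apply: (le_trans IH); rewrite lerDl.
Qed.

Lemma dst_rat_ge (a : int) (q : nat) : (0 < q)%N -> ~~ (q %| a)%Z ->
  (q%:R)^-1 <= dst (a%:~R / q%:R).
Proof.
move=> q0 na; have qR : (0 : R) < q%:R by rewrite ltr0n.
rewrite /dst; set z := nint _.
have -> : a%:~R / q%:R - z%:~R = (a - z * q%:Z)%:~R / q%:R :> R.
  by rewrite intrB intrM mulrBl -[_%:Z%:~R]/(q%:R) mulfK // gt_eqF.
rewrite normrM [`|q%:R^-1|]ger0_norm ?invr_ge0 ?(ltW qR) // ler_peMl ?invr_ge0 ?(ltW qR) //.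
rewrite -intr_norm ler1z; suff : a - z * q != 0 by lia.
by apply: contra na; rewrite subr_eq0 => /eqP ->; rewrite dvdz_mull.
Qed.

(** A maximum of two reciprocals is replaced by their sum, so that summation over r produces two
    harmonic sums. *)
Lemma inv_dst_unit_frac (r q : nat) : (0 < r < q)%N ->
  (dst (r%:R / q%:R))^-1 <= q%:R / r%:R + q%:R / (q - r)%:R.
Proof.
move=> /andP[r0 rq]; have qR : (0 : R) < q%:R by rewrite ltr0n; lia.
have rR : (0 : R) < r%:R by rewrite ltr0n.
have sR : (0 : R) < (q - r)%:R by rewrite ltr0n; lia.
have h : r%:R / q%:R <= dst (r%:R / q%:R) \/ (q - r)%:R / q%:R <= dst (r%:R / q%:R).
  have x1 : r%:R / q%:R < 1 :> R by rewrite ltr_pdivrMr // mul1r ltr_nat.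
  have x0 : 0 < r%:R / q%:R :> R by rewrite divr_gt0.
  have -> : (q - r)%:R / q%:R = 1 - r%:R / q%:R :> R.
    by rewrite natrB ?(ltnW rq) // mulrBl divff // gt_eqF.
  rewrite /dst; set x := r%:R / q%:R in x0 x1 *; set z := nint x.
  have [z1|z1] := leP 1 z.
    right; have : (1 : R) <= z%:~R by rewrite ler1z.
    by rewrite distrC => h; rewrite ger0_norm; lra.
  left; have : (z%:~R : R) <= 0 by rewrite lerz0; lia.
  by move=> h; rewrite ger0_norm; lra.
have p1 : 0 < q%:R / r%:R :> R by rewrite divr_gt0.
have p2 : 0 < q%:R / (q - r)%:R :> R by rewrite divr_gt0.
case: h => h.
  apply: (@le_trans _ _ (q%:R / r%:R)); last by rewrite lerDl ltW.
  by rewrite -[leRHS]invf_div lef_pV2 // posrE ?divr_gt0 // (lt_le_trans _ h) ?divr_gt0.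
apply: (@le_trans _ _ (q%:R / (q - r)%:R)); last by rewrite lerDr ltW.
by rewrite -[leRHS]invf_div lef_pV2 // posrE ?divr_gt0 // (lt_le_trans _ h) ?divr_gt0.
Qed.

Lemma sum_inv_dst_frac (q : nat) : (0 < q)%N ->
  \sum_(r < q | (0 < r)%N) (dst (r%:R / q%:R))^-1 <= 2 * q%:R * (1 + ln q%:R).
Proof.
move=> q0; apply: (@le_trans _ _ (\sum_(r < q | (0 < r)%N) (q%:R / r%:R + q%:R / (q - r)%:R))).
  by apply: ler_sum => r r0; apply: inv_dst_unit_frac; rewrite r0 ltn_ord.
have hh : forall n, \sum_(j < n) (j.+1%:R)^-1 <= 1 + ln q%:R :> R \/ (q <= n)%N.
  move=> n; have [h|h] := leqP q n; [by right|left].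
  apply: (le_trans _ (harmonic_le q0)); apply: (@sum_ord_widen (fun j => (j.+1%:R)^-1)); first lia.
  by move=> i; rewrite invr_ge0.
case: (hh q.-1) => [h|]; last lia.
have e1 : \sum_(r < q | (0 < r)%N) (q%:R / r%:R) = q%:R * \sum_(j < q.-1) (j.+1%:R)^-1 :> R.
  case: q q0 {hh h} => // q _; rewrite big_mkcond big_ord_recl /= add0r mulr_sumr.
  by apply: eq_bigr => i _.
have e2 : \sum_(r < q | (0 < r)%N) (q%:R / (q - r)%:R) = q%:R * \sum_(j < q.-1) (j.+1%:R)^-1 :> R.
  case: q q0 {hh h e1} => // q _; rewrite big_mkcond big_ord_recl /= add0r mulr_sumr.
  rewrite [RHS](reindex_inj rev_ord_inj); apply: eq_bigr => i _ /=.
  by have := ltn_ord i => hi; congr (_ / _%:R); rewrite /bump /=; lia.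
rewrite big_split /= e1 e2 -mulrDr -mulrA mulrCA ler_wpM2l //.
lra.
Qed.

Lemma dvdz_small (q x : int) : (q %| x)%Z -> (`|x| < `|q|)%N -> x = 0.
Proof.
rewrite -[(_ %| _)%Z]/(_ %| _)%N => h lt; apply/eqP; rewrite -absz_eq0.
by apply: contraTT lt => x0; rewrite -leqNgt dvdn_leq // lt0n.
Qed.

(** Multiplication by b permutes the residues modulo q and fixes 0, which reduces to b = 1. *)
Lemma sum_inv_dst (q : nat) (b : int) : (0 < q)%N -> coprime q `|b| ->
  \sum_(r < q | (0 < r)%N) (dst (b%:~R * r%:R / q%:R))^-1 <= 2 * q%:R * (1 + ln q%:R).
Proof.
move=> q0 cop; apply: (le_trans _ (sum_inv_dst_frac q0)).
have qz : (q%:Z != 0) by lia.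
have lt (r : 'I_q) : (`|((b * r%:Z) %% q%:Z)%Z| < q)%N.
  have := ltz_pmod (b * r%:Z) (d := q%:Z); have := modz_ge0 (b * r%:Z) qz; lia.
pose f (r : 'I_q) : 'I_q := Ordinal (lt r).
have fE (r : 'I_q) : (f r)%:Z = ((b * r%:Z) %% q%:Z)%Z.
  by rewrite /= gez0_abs // modz_ge0.
have f_inj : injective f.
  move=> r s /(congr1 (fun t : 'I_q => t%:Z)); rewrite !fE => /eqP.
  rewrite eqz_mod_dvd -mulrBr Gauss_dvdzr; last by rewrite coprimezE.
  move=> hd; apply: val_inj => /=; have := ltn_ord r; have := ltn_ord s.
  move=> sq rq; have := dvdz_small hd; lia.
have fd (r : 'I_q) : dst (b%:~R * r%:R / q%:R) = dst ((f r)%:R / q%:R).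
  have hb : b * r%:Z = (b * r%:Z %/ q%:Z)%Z * q%:Z + (f r)%:Z by rewrite fE -divz_eq.
  have : (b%:~R * r%:R : R) = (b * r%:Z %/ q%:Z)%Z%:~R * q%:R + (f r)%:R.
    by have := congr1 (fun t : int => t%:~R : R) hb; rewrite !(intrM, intrD).
  move=> ->; rewrite mulrDl mulfK; first by rewrite addrC dst_addint.
  by rewrite pnatr_eq0; lia.
rewrite [leRHS](reindex_inj f_inj) /=.
under eq_bigr => r _ do rewrite fd.
rewrite le_eqVlt; apply/orP; left; apply/eqP; apply: eq_bigl => r.
have f0 : f (Ordinal q0) = Ordinal q0 by apply: val_inj; rewrite /= mulr0 mod0z.
rewrite !lt0n; congr (~~ _); apply/eqP/eqP => h.
  by have -> : r = Ordinal q0 by [apply: val_inj]; rewrite -[`|_|%N]/(val (f (Ordinal q0))) f0.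
have : f r = f (Ordinal q0) by rewrite f0; apply: val_inj.
by move/f_inj => ->.
Qed.

Lemma sum_log_le (a : R) (n : nat) : 0 <= a ->
  \sum_(j < n) (a / (1 + a * j.+1%:R)) <= ln (1 + a * n%:R).
Proof.
move=> a0; elim: n => [|n IH]; first by rewrite big_ord0 mulr0 addr0 ln_1.
rewrite big_ord_recr /=.
have p1 : 0 < 1 + a * n%:R by rewrite ltr_wpDr // mulr_ge0.
have p2 : 0 < 1 + a * n.+1%:R by rewrite ltr_wpDr // mulr_ge0.
have := @ln_ge_sub ((1 + a * n.+1%:R) / (1 + a * n%:R)).
rewrite divr_gt0 // ln_div // invf_div => /(_ isT).
have -> : 1 - (1 + a * n%:R) / (1 + a * n.+1%:R) = a / (1 + a * n.+1%:R).
  by rewrite -[in X in X - _](@divff _ (1 + a * n.+1%:R)) ?gt_eqF // -mulrBl -natr1; congr (_ / _); ring.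
move: IH; set s := \sum_(_ < _) _; set t := a / _; set u := ln _; set v := ln _; lra.
Qed.

Lemma dirichlet_coprime (b : R) (T : nat) : (0 < T)%N ->
  exists q : nat, exists a : int, [/\ (0 < q <= T)%N, coprime q `|a| &
    `|b - a%:~R / q%:R| * (q%:R * T%:R) <= 1].
Proof.
move=> T0; have [d /andP[d0 dT] hd] := dirichlet_simultaneous (fun _ : 'I_1 => b) T0.
have {}hd := hd ord0; rewrite expn1 in dT.
pose z := nint (d%:R * b); pose g := gcdn d `|z|.
have g0 : (0 < g)%N by rewrite gcdn_gt0 d0.
have /dvdnP[q dq] : (g %| d)%N by exact: dvdn_gcdl.
have gz : (g%:Z %| z)%Z by rewrite -[(_ %| _)%Z]/(_ %| _)%N; exact: dvdn_gcdr.
case/dvdzP: gz => a za.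
have q0 : (0 < q)%N by rewrite dq muln_gt0 in d0; case/andP: d0.
exists q, a; split.
- by rewrite q0 /=; apply: leq_trans dT; rewrite dq leq_pmulr.
- rewrite /coprime; have : (g * gcdn q `|a| = g * 1)%N.
    by rewrite muln_gcdr muln1 {3}/g dq za abszM /= ![(_ * g)%N]mulnC.
  by move/eqP; rewrite eqn_pmul2l.
have qR : (0 : R) < q%:R by rewrite ltr0n.
have gR : (1 : R) <= g%:R by rewrite ler1n.
have TR : (0 : R) < T%:R by rewrite ltr0n.
have e1 : dst (d%:R * b) = g%:R * (q%:R * `|b - a%:~R / q%:R|).
  rewrite /dst -/z za dq intrM natrM -[g%:Z%:~R]/(g%:R : R).
  have -> : q%:R * g%:R * b - a%:~R * g%:R = g%:R * (q%:R * (b - a%:~R / q%:R)).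
    by field; rewrite gt_eqF.
  by rewrite normrM [`|g%:R|]ger0_norm ?ler0n // normrM [`|q%:R|]ger0_norm ?ler0n.
rewrite e1 in hd; set x := `|_| in hd *.
have x0 : 0 <= x * (q%:R * T%:R) by rewrite !mulr_ge0 ?normr_ge0 ?ler0n.
apply: le_trans hd; have -> : g%:R * (q%:R * x) * T%:R = g%:R * (x * (q%:R * T%:R)) by ring.
by rewrite ler_peMl.
Qed.

(** The second bound adds decay away from a/q: with k = |b - a/q|, the term N^2 / q is replaced by
    ln(1 + N^2 k) / (q k). The factor 8 in the approximation keeps b l close to a l / q for every l
    up to 2N, the range left by differencing. *)
Definition weyl_approx (C : R) (N : nat) (b : R) (q : nat) (a : int) :=
  [/\ (0 < q <= 8 * N)%N, coprime q `|a|,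
      `|b - a%:~R / q%:R| * (8 * q%:R * N%:R) <= 1 &
    forall al, cn (qsum N al b) ^+ 2 <= C * N%:R * (1 + ln N%:R) + C * N%:R ^+ 2 / q%:R /\
     (b != a%:~R / q%:R -> cn (qsum N al b) ^+ 2 <= C * N%:R * (1 + ln N%:R) +
       C / (q%:R * `|b - a%:~R / q%:R|) * ln (1 + N%:R ^+ 2 * `|b - a%:~R / q%:R|))].

(** After differencing, write l = j q + r. For r > 0 the approximation error is at most 1/(4q), so
    ||b l|| is at least half of ||a r / q|| and each block costs q ln q. The terms with r = 0
    satisfy ||b j q|| = j q |b - a/q|; they are bounded either by N each or by a logarithmic sum
    over j, which gives the two estimates. *)
Lemma weyl_bound : forall (N : nat) (b : R), (0 < N)%N ->
  exists q : nat, exists a : int, weyl_approx 2000 N b q a.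
Proof.
move=> N b N0; have [|q [a [/andP[q0 qN] cop hk]]] := @dirichlet_coprime b (8 * N); first by rewrite muln_gt0.
pose ka : R := `|b - a%:~R / q%:R|; rewrite -/ka in hk; rewrite natrM in hk.
have qR : (0 : R) < q%:R by rewrite ltr0n.
have NR : (1 : R) <= N%:R by rewrite ler1n.
have ka0 : 0 <= ka by exact: normr_ge0.
exists q, a; rewrite /weyl_approx -/ka; split=> //; [by rewrite q0|by rewrite [8 * _ * _]mulrAC [8 * _ * _]mulrC|].
move=> al; have lN0 := ln_ge0 NR.
pose G l := if (0 < l <= 2 * N)%N then cap N (b * l%:R) else 0.
have G0 l : 0 <= G l by rewrite /G; case: ifP => // _; exact: cap_ge0.
pose J := ((2 * N) %/ q).+1.
have JqN : (2 * N < J * q)%N by rewrite /J ltn_ceil.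
have JR : (J * q)%:R <= 10 * N%:R :> R.
  rewrite -[10]/(10%:R) -natrM ler_nat /J mulSn; have := leq_divM (2 * N) q; lia.
have key : cn (qsum N al b) ^+ 2 <= N%:R + 2 * (\sum_(j < J) G (j * q)%N + 2 * (J%:R * (2 * q%:R * (1 + ln q%:R)))).
  apply: (le_trans (weyl_differencing N al b)); rewrite lerD2l ler_wpM2l //.
  have -> : \sum_(h < N) cap N (2 * b * h.+1%:R) = \sum_(h < N) cap N (b * (2 * h.+1)%:R).
    by apply: eq_bigr => h _; congr cap; rewrite natrM; ring.
  apply: (le_trans (@sum_even_le (fun l => cap N (b * l%:R)) N _)); first by move=> i; exact: cap_ge0.
  apply: (@le_trans _ _ (\sum_(l < (2 * N).+1) G l)).
    by apply: ler_sum => l _; rewrite /G; have := ltn_ord l; rewrite ltnS => ->; rewrite andbT.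
  apply: (le_trans (@sum_ord_widen G _ _ JqN G0)); rewrite sum_blocks.
  have -> : \sum_(j < J) G (j * q)%N + 2 * (J%:R * (2 * q%:R * (1 + ln q%:R))) =
     \sum_(j < J) (G (j * q)%N + 2 * (2 * q%:R * (1 + ln q%:R))).
    by rewrite big_split /= sum_const_ord mulrCA.
  apply: ler_sum => j _; rewrite (bigD1 (Ordinal q0)) //= addn0 lerD2l.
  apply: (@le_trans _ _ (\sum_(r < q | (0 < r)%N) 2 * (dst (a%:~R * r%:R / q%:R))^-1)); last first.
    by rewrite -mulr_sumr ler_wpM2l // sum_inv_dst.
  rewrite le_eqVlt -[X in X || _]/(_ == _) -le_eqVlt.
  have -> : \sum_(r < q | r != Ordinal q0) G (j * q + r)%N = \sum_(r < q | (0 < r)%N) G (j * q + r)%N.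
    by apply: eq_bigl => r; rewrite lt0n -val_eqE.
  apply: ler_sum => r r0; set D := dst (a%:~R * r%:R / q%:R).
  have ndv : ~~ (q%:Z %| a * r%:Z)%Z.
    rewrite Gauss_dvdzr; last by rewrite coprimezE.
    rewrite -[(_ %| _)%Z]/(q %| r)%N; apply/negP => /dvdn_leq; have := ltn_ord r; lia.
  have Dq : (q%:R)^-1 <= D by have := dst_rat_ge q0 ndv; rewrite intrM.
  have D0 : 0 < D by apply: lt_le_trans Dq; rewrite invr_gt0.
  rewrite /G; case: ifP => [/andP[l0 lN]|_]; last by rewrite mulr_ge0 // invr_ge0 ltW.
  set l := (j * q + r)%N in l0 lN *.
  have -> : 2 * D^-1 = (D / 2)^-1 by rewrite invf_div mulrC.
  apply: cap_le_inv; first by rewrite divr_gt0.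
  have h1 : D <= dst (b * l%:R) + `|(b - a%:~R / q%:R) * l%:R|.
    have -> : D = dst (b * l%:R - (b - a%:~R / q%:R) * l%:R).
      rewrite -mulrBl opprB addrCA subrr addr0 /l natrD natrM /D.
      have -> : a%:~R / q%:R * (j%:R * q%:R + r%:R) = a%:~R * r%:R / q%:R + (a * j%:Z)%:~R :> R.
        by rewrite intrM -[(j%:Z)%:~R]/(j%:R : R); field; rewrite gt_eqF.
      by rewrite dst_addint.
    by apply: (le_trans (dstD _ _)); rewrite dstN lerD2l dst_le_norm.
  have h2 : `|(b - a%:~R / q%:R) * l%:R| <= 1 / (4 * q%:R).
    rewrite normrM -/ka [`|l%:R|]ger0_norm ?ler0n // ler_pdivlMr ?mulr_gt0 //.
    have lN' : l%:R <= 2 * N%:R :> R by rewrite -[2]/(2%:R) -natrM ler_nat.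
    apply: le_trans hk; rewrite -mulrA ler_wpM2l //.
    have := ler_wpM2r (ltW qR) lN'; set u := l%:R * q%:R; set v := 2 * _ * _.
    have -> : v = 2 * (N%:R * q%:R) by rewrite /v; ring.
    have -> : l%:R * (4 * q%:R) = 4 * u by rewrite /u; ring.
    have -> : q%:R * (8%:R * N%:R) = 8 * (N%:R * q%:R) :> R by ring.
    lra.
  have h3 : 1 / (4 * q%:R) <= D / 4 by rewrite mul1r invfM mulrC ler_wpM2r // invr_ge0.
  lra.
have lnq : ln q%:R <= 7 + ln N%:R.
  apply: (le_trans (ln_le qR (y := 8 * N%:R) _)).
    by rewrite -[8]/(8%:R) -natrM ler_nat.
  by rewrite ln_mul ?lerD2r; [have := @ln_le_sub1 8; lra|lra|lra].
have part : 2 * (J%:R * (2 * q%:R * (1 + ln q%:R))) <= 320 * N%:R * (1 + ln N%:R).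
  have -> : 2 * (J%:R * (2 * q%:R * (1 + ln q%:R))) = 4 * ((J * q)%:R * (1 + ln q%:R)) by rewrite natrM; ring.
  have h1 : 1 + ln q%:R <= 8 * (1 + ln N%:R) by lra.
  have h2 : 0 <= 1 + ln q%:R by have := @ln_ge0 q%:R; rewrite ler1n => /(_ q0); lra.
  have : (J * q)%:R * (1 + ln q%:R) <= (10 * N%:R) * (8 * (1 + ln N%:R)) by apply: ler_pM.
  have -> : 10 * N%:R * (8 * (1 + ln N%:R)) = 80 * (N%:R * (1 + ln N%:R)) by ring.
  have -> : 320 * N%:R * (1 + ln N%:R) = 320 * (N%:R * (1 + ln N%:R)) by ring.
  lra.
have NL : N%:R <= N%:R * (1 + ln N%:R) by rewrite ler_peMr //; lra.
have jq (j : 'I_J) : G (j * q)%N <= N%:R /\ (0 < ka -> (0 < j)%N ->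
    G (j * q)%N <= (2 / (q%:R * ka)) * (N%:R * q%:R * ka / (1 + N%:R * q%:R * ka * j%:R))).
  split; first by rewrite /G; case: ifP => _ //; exact: cap_leN.
  move=> k0 j0; have jR : (0 : R) < j%:R by rewrite ltr0n.
  have x0 : 0 < N%:R * q%:R * ka * j%:R by rewrite !mulr_gt0 //; lra.
  have -> : 2 / (q%:R * ka) * (N%:R * q%:R * ka / (1 + N%:R * q%:R * ka * j%:R)) =
      2 * N%:R / (1 + N%:R * q%:R * ka * j%:R).
    by field; rewrite !gt_eqF //; lra.
  rewrite /G; case: ifP => [/andP[l0 lN]|_]; last by rewrite divr_ge0 ?mulr_ge0 ?addr_ge0 // ltW.
  have dE : dst (b * (j * q)%:R) = ka * (j * q)%:R.
    have -> : b * (j * q)%:R = (b - a%:~R / q%:R) * (j * q)%:R + (a * j%:Z)%:~R.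
      rewrite intrM natrM -[(j%:Z)%:~R]/(j%:R : R); field; by rewrite gt_eqF.
    rewrite dst_addint dst_small normrM -/ka [`|(_ * _)%:R|]ger0_norm ?ler0n //.
    have : ka * (j * q)%:R * (4 * q%:R) <= 1.
      apply: le_trans hk; rewrite -mulrA ler_wpM2l //.
      have -> : q%:R * (8%:R * N%:R) = 4 * q%:R * (2 * N%:R) :> R by ring.
      by rewrite mulrC ler_wpM2l ?mulr_ge0 ?(ltW qR) // -[2]/(2%:R) -natrM ler_nat.
    have : (1 : R) <= q%:R by rewrite ler1n.
    have : 0 <= ka * (j * q)%:R by rewrite mulr_ge0.
    set u := ka * _; set v := q%:R; nra.
  have c1 := cap_leN N (b * (j * q)%:R).
  have c2 : cap N (b * (j * q)%:R) <= (ka * (j * q)%:R)^-1.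
    by apply: cap_le_inv; rewrite ?dE // mulr_gt0 // ltr0n muln_gt0 j0.
  have c0 := cap_ge0 N (b * (j * q)%:R).
  rewrite ler_pdivlMr; last by lra.
  move: c0 c1 c2; set c := cap _ _ => c0 c1 c2.
  have c3 : c * (N%:R * q%:R * ka * j%:R) <= N%:R.
    have -> : c * (N%:R * q%:R * ka * j%:R) = N%:R * (c * (ka * (j * q)%:R)) by rewrite natrM; ring.
    rewrite -[leRHS]mulr1 ler_wpM2l // -ler_pdivlMr ?mul1r // mulr_gt0 // ltr0n muln_gt0 j0 //.
  by rewrite mulrDr mulr1; lra.
have G00 : G 0%N = 0 by [].
have JN : J.-1%:R * q%:R <= 2 * N%:R :> R.
  by rewrite /J /= -natrM -[2]/(2%:R) -natrM ler_nat leq_divM.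
have sJ : \sum_(j < J) G (j * q)%N = \sum_(j < J.-1) G (j.+1 * q)%N.
  by rewrite {1}/J big_ord_recl /= mul0n G00 add0r.
split.
  have s1 : \sum_(j < J) G (j * q)%N <= 2 * N%:R ^+ 2 / q%:R.
    rewrite sJ; apply: (@le_trans _ _ (\sum_(j < J.-1) N%:R)).
      apply: ler_sum => j _; have hj : (j.+1 < J)%N by exact: (ltn_ord j).
      by have [] := jq (Ordinal hj).
    rewrite sum_const_ord ler_pdivlMr // mulrAC.
    by rewrite expr2 mulrA ler_wpM2r.
  move: key part s1; set S := \sum_(_ < _) _; set P := 2 * (J%:R * _).
  have -> : 2 * N%:R ^+ 2 / q%:R = 2 * (N%:R ^+ 2 / q%:R) :> R by rewrite mulrA.
  have -> : 2000 * N%:R ^+ 2 / q%:R = 2000 * (N%:R ^+ 2 / q%:R) :> R by rewrite mulrA.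
  rewrite -![_ * N%:R * (1 + _)]mulrA; have : 0 <= N%:R ^+ 2 / q%:R :> R by rewrite divr_ge0 ?sqr_ge0 ?(ltW qR).
  set u := N%:R * (1 + _) in NL *; set v := N%:R ^+ 2 / _; lra.
move=> bq; have k0 : 0 < ka by rewrite normr_gt0 subr_eq0.
have s1 : \sum_(j < J) G (j * q)%N <= 2 / (q%:R * ka) * (2 * ln (1 + N%:R ^+ 2 * ka)).
  rewrite sJ; apply: (@le_trans _ _ (2 / (q%:R * ka) * \sum_(j < J.-1) (N%:R * q%:R * ka / (1 + N%:R * q%:R * ka * j.+1%:R)))).
    rewrite mulr_sumr; apply: ler_sum => j _; have hj : (j.+1 < J)%N by exact: (ltn_ord j).
    by have [_ h] := jq (Ordinal hj); apply: h.
  apply: ler_wpM2l; first by rewrite divr_ge0 // mulr_ge0 // ltW.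
  have a0 : 0 <= N%:R * q%:R * ka by rewrite !mulr_ge0 // ltW.
  apply: (le_trans (sum_log_le _ a0)).
  have x0 : 0 <= N%:R ^+ 2 * ka by rewrite mulr_ge0 // sqr_ge0.
  have -> : 2 * ln (1 + N%:R ^+ 2 * ka) = ln ((1 + N%:R ^+ 2 * ka) ^+ 2) by rewrite ln_exp_pow ?ltr_wpDr // mulrC.
  apply: ln_le; first by rewrite ltr_wpDr // mulr_ge0.
  have h : N%:R * q%:R * ka * J.-1%:R <= 2 * (N%:R ^+ 2 * ka).
    have -> : N%:R * q%:R * ka * J.-1%:R = N%:R * ka * (J.-1%:R * q%:R) by ring.
    have -> : 2 * (N%:R ^+ 2 * ka) = N%:R * ka * (2 * N%:R) by ring.
    by rewrite ler_wpM2l // mulr_ge0.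
  have : 0 <= (N%:R ^+ 2 * ka) ^+ 2 by exact: sqr_ge0.
  rewrite sqrrD expr1n mul1r mulr2n; lra.
have w0 : 0 <= ln (1 + N%:R ^+ 2 * ka).
  by apply: ln_ge0; rewrite lerDl mulr_ge0 // sqr_ge0.
have v0 : 0 <= (q%:R * ka)^-1 by rewrite invr_ge0 mulr_ge0 // ltW.
have vw := mulr_ge0 v0 w0.
move: key part s1; set S := \sum_(_ < _) _; set P := 2 * (J%:R * _).
have -> : 2 / (q%:R * ka) * (2 * ln (1 + N%:R ^+ 2 * ka)) = 4 * ((q%:R * ka)^-1 * ln (1 + N%:R ^+ 2 * ka)) by ring.
have -> : 2000 / (q%:R * ka) * ln (1 + N%:R ^+ 2 * ka) = 2000 * ((q%:R * ka)^-1 * ln (1 + N%:R ^+ 2 * ka)) by ring.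
rewrite -![_ * N%:R * (1 + _)]mulrA.
set u := N%:R * (1 + _) in NL *; set v := _^-1 * ln _ in vw *; lra.
Qed.

Lemma weyl_bound_ex : exists2 C : R, 1 <= C & forall (N : nat) (b : R), (0 < N)%N ->
  exists q : nat, exists a : int, weyl_approx C N b q a.
Proof. by exists 2000 => [|N b N0]; [rewrite ler1n|exact: weyl_bound]. Qed.

(** * Divisor moments and Ramanujan sums *)

Lemma sum_indicator_le (n k : nat) (F : nat -> R) : (forall i, 0 <= F i) ->
  \sum_(i < n) (if nat_of_ord i == k then F i else 0) <= F k.
Proof.
move=> F0; have [kn|kn] := ltnP k n; last first.
  by rewrite big1 // => i _; case: eqP => // ik; have := ltn_ord i; lia.
rewrite (bigD1 (Ordinal kn)) //= eqxx big1 ?addr0 // => i.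
by rewrite -val_eqE /= => /negbTE ->.
Qed.

Lemma sum_multiples_le (X a Y : nat) (F : nat -> R) : (forall i, 0 <= F i) -> (0 < a)%N -> (X <= a * Y + a.-1)%N ->
  \sum_(n < X) (if (a %| n.+1)%N then F n.+1 else 0) <= \sum_(b < Y) F (a * b.+1)%N.
Proof.
move=> F0 a0 XY.
apply: (@le_trans _ _ (\sum_(n < X) \sum_(b < Y) (if nat_of_ord n == (a * b.+1).-1 then F n.+1 else 0))).
  apply: ler_sum => n _; case: ifP => [/dvdnP[b nb]|_]; last by apply: sumr_ge0 => b _; case: ifP.
  have hn := ltn_ord n.
  have bY : (b.-1 < Y)%N by case: b nb => [|b] nb //=; rewrite -(ltn_pmul2l a0); nia.
  have b0 : (0 < b)%N by case: b nb {bY} => //; lia.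
  rewrite (bigD1 (Ordinal bY)) //= prednK // mulnC -nb eqxx lerDl.
  by apply: sumr_ge0 => c _; case: ifP.
rewrite exchange_big /=; apply: ler_sum => b _.
have ab : (0 < a * b.+1)%N by rewrite muln_gt0 a0.
have := @sum_indicator_le X (a * b.+1).-1 (fun i => F i.+1); rewrite prednK // => h; exact: h.
Qed.

(** Divisors are truncated at Q: [tau m m] is the divisor function for m > 0, while the argument 0,
    which does occur below, gives Q. *)
Definition tau (Q m : nat) : nat := #|[pred d : 'I_Q | (d.+1 %| m)%N]|.

Lemma tauE Q m : (tau Q m)%:R = \sum_(d < Q) (if (d.+1 %| m)%N then 1 else 0) :> R.
Proof. by rewrite /tau -sum1_card natr_sum big_mkcond. Qed.

Lemma tau_leQ Q m : (tau Q m <= Q)%N.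
Proof. by rewrite -[leqRHS]card_ord max_card. Qed.

Lemma tau_eq Q m : (0 < m)%N -> (m <= Q)%N -> tau Q m = tau m m.
Proof.
move=> m0 mQ; have wi : injective (widen_ord mQ) by move=> x y /(congr1 val) /= h; apply: val_inj.
rewrite /tau -(card_imset _ wi).
apply: eq_card => d; rewrite !inE; apply/idP/imsetP => [dm|[x xm ->]//].
have dl : (d < m)%N by exact: dvdn_leq dm.
by exists (Ordinal dl) => //; apply: val_inj.
Qed.

(** A divisor x of d m is determined by gcd(x, d) and x / gcd(x, d), and the latter divides m. *)
Lemma tau_mul Q d m : (0 < d)%N -> (0 < m)%N -> (tau Q (d * m) <= tau d d * tau Q m)%N.
Proof.
move=> d0 m0; rewrite /tau.
have l1 (x : 'I_Q) : ((gcdn x.+1 d).-1 < d)%N by have := dvdn_leq d0 (dvdn_gcdr x.+1 d); have := gcdn_gt0 x.+1 d; lia.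
have l2 (x : 'I_Q) : ((x.+1 %/ gcdn x.+1 d).-1 < Q)%N.
  by have := leq_div x.+1 (gcdn x.+1 d); have := ltn_ord x; lia.
pose f (x : 'I_Q) : 'I_d * 'I_Q := (Ordinal (l1 x), Ordinal (l2 x)).
have gp (x : 'I_Q) : (0 < gcdn x.+1 d)%N by rewrite gcdn_gt0.
have dp (x : 'I_Q) : (0 < x.+1 %/ gcdn x.+1 d)%N by rewrite divn_gt0 // dvdn_leq // dvdn_gcdl.
have finj : injective f.
  move=> x y [] h1 h2; apply: val_inj; apply: succn_inj.
  have e1 : gcdn x.+1 d = gcdn y.+1 d by have := gp x; have := gp y; lia.
  rewrite -(divnK (dvdn_gcdl x.+1 d)) -(divnK (dvdn_gcdl y.+1 d)) e1; congr (_ * _)%N.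
  by move: h2 (dp x) (dp y); rewrite e1; lia.
rewrite -(card_imset _ finj) -cardX; apply: subset_leq_card; apply/subsetP => _ /imsetP[x xd ->].
rewrite !inE /= !prednK // dvdn_gcdr /=; rewrite inE in xd.
have cop : coprime (x.+1 %/ gcdn x.+1 d) (d %/ gcdn x.+1 d) by rewrite /coprime -(eqn_pmul2r (gp x)) muln_gcdl !divnK ?dvdn_gcdl ?dvdn_gcdr // mul1n.
rewrite -(Gauss_dvdr _ cop) -(dvdn_pmul2r (gp x)) divnK ?dvdn_gcdl //.
by rewrite mulnAC divnK ?dvdn_gcdr.
Qed.

Definition tsum (j Q : nat) : R := \sum_(d < Q) (tau d.+1 d.+1)%:R ^+ j / (d.+1)%:R.

Lemma tsum_ge0 j Q : 0 <= tsum j Q.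
Proof. by apply: sumr_ge0 => d _; rewrite divr_ge0 // exprn_ge0. Qed.

(** One factor tau(n) is expanded over divisors a; with n = a b, submultiplicativity separates a and
    b and a square appears. *)
Lemma tsumS j Q : tsum j.+1 Q <= tsum j Q ^+ 2.
Proof.
pose F (n : nat) : R := (tau n n)%:R ^+ j / n%:R.
have F0 n : 0 <= F n by rewrite /F divr_ge0 // exprn_ge0.
have -> : tsum j.+1 Q = \sum_(a < Q) \sum_(n < Q) (if (a.+1 %| n.+1)%N then F n.+1 else 0).
  rewrite exchange_big /tsum; apply: eq_bigr => n _.
  rewrite exprS -mulrA -/(F n.+1) -(@tau_eq Q) // tauE mulr_suml.
  by apply: eq_bigr => a _; case: ifP => _; rewrite ?mul1r ?mul0r.
rewrite expr2 {1}/tsum mulr_suml; apply: ler_sum => a _.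
apply: (le_trans (@sum_multiples_le _ a.+1 Q F F0 _ _)) => //; first lia.
rewrite /tsum mulr_sumr; apply: ler_sum => b _; rewrite /F natrM invfM mulrACA -exprMn.
rewrite ler_wpM2r ?mulr_ge0 ?invr_ge0 // lerXn2r ?nnegrE ?mulr_ge0 // -natrM ler_nat.
by apply: leq_trans (tau_mul _ _ _) _ => //; rewrite (@tau_eq (a.+1 * b.+1)) // leq_pmull.
Qed.

Lemma tsum_le j Q : (0 < Q)%N -> tsum j Q <= (1 + ln Q%:R) ^+ (2 ^ j).
Proof.
move=> Q0; have l0 : 0 <= ln Q%:R by apply: ln_ge0; rewrite ler1n.
elim: j => [|j IH].
  rewrite expn0 expr1; apply: (le_trans _ (harmonic_le Q0)).
  by apply: ler_sum => d _; rewrite expr0 mul1r.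
apply: (le_trans (tsumS _ _)); rewrite expnSr exprM lerXn2r // nnegrE ?tsum_ge0 //.
by rewrite exprn_ge0 // addr_ge0.
Qed.

(* Applied to the single term n of the sum, the logarithmic moment bound gives the divisor bound. *)
Lemma tau_bound k : exists2 C : R, 0 < C & forall n, (0 < n)%N -> (tau n n)%:R ^+ k <= C * n%:R ^+ 2 :> R.
Proof.
have [C C1 hC] := ln_pow_le (2 ^ k); exists C => [|n n0]; first by lra.
have nR : (0 : R) < n%:R by rewrite ltr0n.
have h : (tau n n)%:R ^+ k / n%:R <= tsum k n.
  case: n n0 {nR} => // n _; rewrite /tsum big_ord_recr /= lerDr.
  by apply: sumr_ge0 => d _; rewrite divr_ge0 // exprn_ge0.
have := le_trans h (le_trans (tsum_le k n0) (hC n%:R _)); rewrite ler1n => /(_ n0).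
by rewrite ler_pdivrMr // expr2 mulrA.
Qed.

(** Induction on k: one factor is expanded over divisors a, submultiplicativity takes out tau(a)^k,
    and what remains over b <= X / a is the previous moment. *)
Lemma tau_moment k Q X : \sum_(m < X) (tau Q m.+1)%:R ^+ k <= X%:R * \prod_(j < k) tsum j Q :> R.
Proof.
elim: k X => [|k IH] X.
  by rewrite big_ord0 mulr1; under eq_bigr => i _ do rewrite expr0; rewrite sum_const_ord mulr1.
pose F (n : nat) : R := (tau Q n)%:R ^+ k.
have F0 n : 0 <= F n by rewrite /F exprn_ge0.
have P0 : 0 <= \prod_(j < k) tsum j Q by apply: prodr_ge0 => j _; exact: tsum_ge0.
have -> : \sum_(m < X) (tau Q m.+1)%:R ^+ k.+1 = \sum_(a < Q) \sum_(n < X) (if (a.+1 %| n.+1)%N then F n.+1 else 0).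
  rewrite exchange_big; apply: eq_bigr => n _.
  rewrite exprS -/(F n.+1) tauE mulr_suml.
  by apply: eq_bigr => a _; case: ifP => _; rewrite ?mul1r ?mul0r.
rewrite big_ord_recr /= /tsum !mulr_sumr; apply: ler_sum => a _.
apply: (le_trans (@sum_multiples_le _ a.+1 (X %/ a.+1) F F0 _ _)) => //.
  by have := ltn_ceil X (ltn0Sn a); rewrite mulSn mulnC; lia.
apply: (@le_trans _ _ (\sum_(b < X %/ a.+1) (tau a.+1 a.+1)%:R ^+ k * F b.+1)).
  apply: ler_sum => b _; rewrite /F -exprMn lerXn2r ?nnegrE ?mulr_ge0 // -natrM ler_nat.
  exact: tau_mul.
rewrite -mulr_sumr; set t := _ ^+ k; set L := \prod_(i < k) _.
have aR : (0 : R) < a.+1%:R by rewrite ltr0n.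
have -> : X%:R * (L * (t / a.+1%:R)) = t * (X%:R / a.+1%:R * L) by ring.
rewrite ler_wpM2l ?exprn_ge0 //; apply: (le_trans (IH _)).
by rewrite ler_wpM2r // ler_pdivlMr // -natrM ler_nat leq_divM.
Qed.

Lemma sum_e_period (P : nat) (x : int) : (0 < P)%N ->
  \sum_(n < P) e (x%:~R * n%:R / P%:R) = if (P%:Z %| x)%Z then P%:R else 0.
Proof.
move=> P0; have PR : (P%:R : R) != 0 by rewrite pnatr_eq0; lia.
have -> : \sum_(n < P) e (x%:~R * n%:R / P%:R) = \sum_(n < P) e (x%:~R / P%:R) ^+ n.
  by apply: eq_bigr => n _; rewrite -e_muln; congr e; rewrite mulrAC.
case: ifP => [/dvdzP[k ->]|nd].
  rewrite intrM -[_%:Z%:~R]/(P%:R : R) mulfK // e_int.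
  by under eq_bigr => n _ do rewrite expr1n; rewrite sumr_const card_ord.
have h : (1 - e (x%:~R / P%:R)) * \sum_(n < P) e (x%:~R / P%:R) ^+ n = 0.
  have -> : \sum_(n < P) e (x%:~R / P%:R) ^+ n = \sum_(i < P) (1 ^+ (P.-1 - i) * e (x%:~R / P%:R) ^+ i).
    by apply: eq_bigr => n _; rewrite expr1n mul1r.
  by rewrite -subrXX expr1n -e_muln divfK // e_int subrr.
move/eqP: h; rewrite mulf_eq0 => /orP[/eqP h|/eqP //]; exfalso.
have := dst_le_e (x%:~R / P%:R); rewrite h cn0.
have := dst_rat_ge P0 (negbT nd); have : 0 < (P%:R)^-1 :> R by rewrite invr_gt0 ltr0n.
lra.
Qed.

Definition ramanujan (q : nat) (m : int) : R[i] :=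
  \sum_(b < q | coprime q b) e (m%:~R * b%:R / q%:R).

(* Inclusion-exclusion over the primes dividing q, one prime at a time; x runs over the squarefree divisors met. *)
Lemma ramanujan_sieve (q : nat) (m : int) (ps : seq nat) (D : nat) : (0 < q)%N ->
  uniq ps -> all prime ps -> all (fun p => ~~ (p %| D)%N) ps -> (D * \prod_(p <- ps) p %| q)%N ->
  cn (\sum_(b < q | (D %| b)%N && all (fun p => ~~ (p %| b)%N) ps) e (m%:~R * b%:R / q%:R)) <=
  \sum_(x < q.+1 | (D %| x)%N && (x %| D * \prod_(p <- ps) p)%N)
     (if ((q %/ x)%N%:Z %| m)%Z then (q %/ x)%:R else 0).
Proof.
move=> q0; elim: ps D => [|p ps IH] D /=.
  rewrite big_nil muln1 => _ _ _ Dq; have D0 : (0 < D)%N by exact: dvdn_gt0 Dq.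
  have Dlt : (D < q.+1)%N by rewrite ltnS dvdn_leq.
  rewrite [leRHS](bigD1 (Ordinal Dlt)) /= ?dvdnn // [X in _ <= _ + X]big1 ?addr0; last first.
    move=> x /andP[/andP[h1 h2]]; rewrite -val_eqE /= => /negP[].
    by rewrite eqn_dvd h1 h2.
  have [k qk] := dvdnP Dq; have k0 : (0 < k)%N by rewrite qk muln_gt0 in q0; case/andP: q0.
  have -> : \sum_(b < q | (D %| b)%N && true) e (m%:~R * b%:R / q%:R) = \sum_(j < k) e (m%:~R * j%:R / k%:R).
    rewrite big_mkcond /= qk (sum_blocks (fun b => if (D %| b)%N && true then e (m%:~R * b%:R / (k * D)%:R) else 0)).
    apply: eq_bigr => j _; rewrite (bigD1 (Ordinal D0)) //= addn0 dvdn_mull //= big1 ?addr0.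
      congr e; rewrite !natrM; field; rewrite !pnatr_eq0; lia.
    move=> r; rewrite -val_eqE /= => r0; rewrite dvdn_addr ?dvdn_mull //.
    by case: ifP => //; rewrite andbT => /dvdn_leq; have := ltn_ord r; lia.
  rewrite sum_e_period // qk mulnK //; case: ifP => _; first by rewrite cn_nat.
  by rewrite cn0.
rewrite big_cons => /andP[pps ups] /andP[pp aps] /andP[pD aD] Dq.
have DpE : (D * (p * \prod_(j <- ps) j) = D * p * \prod_(j <- ps) j)%N by rewrite mulnA.
have h1 : (D * \prod_(p0 <- ps) p0 %| q)%N by apply: dvdn_trans Dq; rewrite DpE mulnAC dvdn_mulr.
have h2 : (D * p * \prod_(p0 <- ps) p0 %| q)%N by rewrite -DpE.
have aDp : all (fun p0 => ~~ (p0 %| D * p)%N) ps.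
  apply/allP => r rps; rewrite Euclid_dvdM; last by exact: (allP aps).
  rewrite negb_or (allP aD) //= dvdn_prime2 //; last by exact: (allP aps).
  by apply: contraNneq pps => <-.
have npps : ~~ (p %| \prod_(j <- ps) j)%N.
  elim: ps pps aps {IH ups aD Dq DpE h1 h2 aDp} => [|r ps IH] /=; first by rewrite big_nil dvdn1 => _ _; case: p pp pD => [|[|]].
  rewrite inE negb_or big_cons => /andP[pr pps] /andP[rr aps].
  by rewrite Euclid_dvdM // negb_or IH // andbT dvdn_prime2.
have cDp : coprime D p by rewrite coprime_sym prime_coprime.
set f := fun b : 'I_q => e (m%:~R * b%:R / q%:R).
have -> : \sum_(b < q | (D %| b)%N && (~~ (p %| b)%N && all (fun p0 => ~~ (p0 %| b)%N) ps)) f b =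
   \sum_(b < q | (D %| b)%N && all (fun p0 => ~~ (p0 %| b)%N) ps) f b -
   \sum_(b < q | (D * p %| b)%N && all (fun p0 => ~~ (p0 %| b)%N) ps) f b.
  rewrite big_mkcond [X in X - _]big_mkcond [X in _ - X]big_mkcond -sumrB; apply: eq_bigr => b _.
  rewrite Gauss_dvd //; case: (D %| b)%N => /=; last by rewrite subr0.
  by case: (p %| b)%N => /=; case: all; rewrite ?subr0 ?subrr.
apply: (le_trans (cnB _ _)); apply: (le_trans (lerD (IH D ups aps aD h1) (IH (D * p)%N ups aps aDp h2))).
rewrite big_mkcond [X in _ + X]big_mkcond -big_split /= [leRHS]big_mkcond; apply: ler_sum => x _ /=; rewrite DpE.
set w : R := if ((q %/ x)%N %| m)%Z then _ else 0; have w0 : 0 <= w by rewrite /w; case: ifP.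
have i1 : (D * p %| x)%N -> (D %| x)%N by apply: dvdn_trans; rewrite dvdn_mulr.
have i2 : (x %| D * \prod_(j <- ps) j)%N -> (x %| D * p * \prod_(j <- ps) j)%N.
  by move/dvdn_trans; apply; rewrite mulnAC dvdn_mulr.
have i3 : (D * p %| x)%N -> ~~ (x %| D * \prod_(j <- ps) j)%N.
  move=> hx; apply/negP => hy; have := dvdn_trans hx hy; have D0 : (0 < D)%N by rewrite lt0n; apply: contraNneq pD => ->; rewrite dvdn0.
  by rewrite dvdn_pmul2l //; apply/negP.
case: (boolP (D * p %| x)%N) => [hx|_] /=.
  by rewrite (i1 hx) (negbTE (i3 hx)) /= add0r.
rewrite addr0; case: (D %| x)%N => //=; case: (boolP (x %| D * _)%N) => [/i2 ->//|_]; by case: ifP.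
Qed.

(** This is |c_q(m)| <= sum of the common divisors d of q and m, written with d = q / x. Admitting
    also those x that are not squarefree only adds nonnegative terms to the sieve bound. *)
Lemma ramanujan_le (q : nat) (m : int) : (0 < q)%N ->
  cn (ramanujan q m) <= \sum_(x < q) (if (x.+1 %| q)%N && ((q %/ x.+1)%N%:Z %| m)%Z then (q %/ x.+1)%:R else 0).
Proof.
move=> q0.
have pu : uniq (primes q) by exact: primes_uniq.
have pp : all prime (primes q) by apply/allP => p; rewrite mem_primes => /andP[].
have p1 : all (fun p => ~~ (p %| 1)%N) (primes q).
  by apply/allP => p /(allP pp) h; rewrite dvdn1; case: p h => [|[|]].
have pq : (1 * \prod_(p <- primes q) p %| q)%N.
  rewrite mul1n {2}(prod_prime_decomp q0) prime_decompE big_map /=.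
  have : {subset primes q <= primes q} by [].
  elim: {1 3 4}(primes q) => [|r s IH] hs; first by rewrite !big_nil.
  rewrite !big_cons; apply: dvdn_mul; last by apply: IH => p hp; apply: hs; rewrite inE hp orbT.
  by rewrite -{1}(expn1 r) dvdn_exp2l // logn_gt0 hs // inE eqxx.
have := ramanujan_sieve m q0 pu pp p1 pq.
have -> : \sum_(b < q | (1 %| b)%N && all (fun p => ~~ (p %| b)%N) (primes q)) e (m%:~R * b%:R / q%:R) = ramanujan q m.
  apply: eq_bigl => b; rewrite dvd1n /=; apply/allP/idP => [h|cop p]; last first.
    rewrite mem_primes => /and3P[pr _ pq']; apply/negP => pb.
    have : (p %| gcdn q b)%N by rewrite dvdn_gcd pq' pb.
    by rewrite (eqP cop) dvdn1; case: p pr {pq' pb} => [|[|]].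
  rewrite /coprime; apply/eqP; apply/eqP; rewrite eqn_leq gcdn_gt0 q0 andbT leqNgt; apply/negP => g1.
  have pg := pdiv_prime g1; have dg := pdiv_dvd (gcdn q b).
  have := h (pdiv (gcdn q b)); rewrite mem_primes pg q0 (dvdn_trans dg (dvdn_gcdl _ _)) => /(_ isT).
  by rewrite (dvdn_trans dg (dvdn_gcdr _ _)).
move=> h; apply: (le_trans h); rewrite mul1n in pq *.
rewrite big_mkcond big_ord_recl /= dvd0n.
have -> : (\prod_(p <- primes q) p == 0)%N = false by apply/negbTE; rewrite -lt0n; apply: dvdn_gt0 pq.
rewrite add0r; apply: ler_sum => x _; rewrite dvd1n /= /bump add1n.
case: ifP => [hx|_]; last by case: ifP.
by rewrite (dvdn_trans hx pq).
Qed.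

Lemma sum_divisor_pairs (Q : nat) (H : nat -> nat -> R) : (forall x y, 0 <= H x y) ->
  \sum_(q < Q) \sum_(x < q.+1) (if (x.+1 %| q.+1)%N then H x.+1 (q.+1 %/ x.+1)%N else 0) <=
  \sum_(x < Q) \sum_(y < Q) H x.+1 y.+1.
Proof.
move=> H0.
apply: (@le_trans _ _ (\sum_(q < Q) \sum_(x < Q) (if (x.+1 %| q.+1)%N then H x.+1 (q.+1 %/ x.+1)%N else 0))).
  apply: ler_sum => q _.
  apply: (@sum_ord_widen (fun x => if (x.+1 %| q.+1)%N then H x.+1 (q.+1 %/ x.+1)%N else 0)) => //.
  by move=> i; case: ifP.
rewrite exchange_big /=; apply: ler_sum => x _.
apply: (le_trans (@sum_multiples_le _ x.+1 Q (fun n => H x.+1 (n %/ x.+1)%N) _ _ _)) => //; first lia.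
by apply: ler_sum => y _; rewrite mulKn.
Qed.

(** Put q = x y: the condition y | m leaves a harmonic sum over x. It is this average over q that
    makes the Fourier coefficients of [major] divisor-bounded. *)
Lemma ramanujan_sum_le (Q : nat) (m : int) : (0 < Q)%N ->
  \sum_(q < Q) cn (ramanujan q.+1 m) / q.+1%:R <= (tau Q `|m|)%:R * (1 + ln Q%:R).
Proof.
move=> Q0.
pose H (x y : nat) : R := if (y%:Z %| m)%Z then (x%:R)^-1 else 0.
have H0 x y : 0 <= H x y by rewrite /H; case: ifP => // _; rewrite invr_ge0.
apply: (@le_trans _ _ (\sum_(q < Q) \sum_(x < q.+1) (if (x.+1 %| q.+1)%N then H x.+1 (q.+1 %/ x.+1)%N else 0))).
  apply: ler_sum => q _; rewrite ler_pdivrMr ?ltr0n //.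
  apply: (le_trans (ramanujan_le m (ltn0Sn q))); rewrite mulr_suml; apply: ler_sum => x _.
  rewrite /H; case: (boolP (x.+1 %| q.+1)%N) => [dx|_] /=; last by rewrite mul0r.
  case: ifP => _; last by rewrite mul0r.
  have e2 : (q.+1)%:R = (q.+1 %/ x.+1)%:R * x.+1%:R :> R by rewrite -natrM divnK.
  by rewrite [X in _ * X]e2 mulrCA mulVf ?mulr1 // pnatr_eq0.
apply: (le_trans (sum_divisor_pairs _ H0)); rewrite exchange_big tauE mulr_suml.
apply: ler_sum => y _; rewrite /H -[(_ %| _)%Z]/(_ %| _)%N /=.
case: ifP => _; rewrite ?mul1r ?mul0r; first exact: harmonic_le.
by rewrite big1.
Qed.

(** * The restriction estimate *)

(** The Fejer kernel divided by M, so that its value at the integers is 1 when M > 0. *)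
Definition fejer (M : nat) (x : R) : R := (cn (\sum_(j < M) e (x * j%:R)) / M%:R) ^+ 2.

Lemma fejer_ge0 M x : 0 <= fejer M x.
Proof. exact: sqr_ge0. Qed.

Lemma fejer_le1 M x : fejer M x <= 1.
Proof.
rewrite /fejer expr_le1 ?divr_ge0 ?cn_ge0 //.
case: M => [|M]; first by rewrite invr0 mulr0.
rewrite ler_pdivrMr ?ltr0n // mul1r; apply: (le_trans (cn_sum _ _ _)).
by under eq_bigr => j _ do rewrite cn_e; rewrite sum_const_ord mulr1.
Qed.

Lemma fejer_addint M x (z : int) : fejer M (x + z%:~R) = fejer M x.
Proof.
rewrite /fejer; have -> : \sum_(j < M) e ((x + z%:~R) * j%:R) = \sum_(j < M) e (x * j%:R) by
  apply: eq_bigr => j _; rewrite mulrDl -[z%:~R * _](intrM R z j) e_addint.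
by [].
Qed.

Lemma fejer_decay M x : fejer M x * (M%:R * dst x) ^+ 2 <= 1.
Proof.
rewrite /fejer -exprMn expr_le1 ?mulr_ge0 ?divr_ge0 ?cn_ge0 ?dst_ge0 ?invr_ge0 //.
case: M => [|M]; first by rewrite mul0r mulr0.
by rewrite mulrA divfK ?pnatr_eq0 //; exact: geom_sum_dst.
Qed.

Lemma fejer_center M x : (0 < M)%N -> 1 - fejer M x <= 16 * (M%:R * `|x|).
Proof.
move=> M0; have MR : (0 : R) < M%:R by rewrite ltr0n.
rewrite /fejer; set D := \sum_(j < M) _.
have h : M%:R - 8 * (M%:R * `|x|) * M%:R <= cn D.
  have h1 : M%:R - cn D <= cn (\sum_(j < M) (1 - e (x * j%:R))).
    have -> : \sum_(j < M) (1 - e (x * j%:R)) = M%:R - D by rewrite sumrB sumr_const card_ord.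
    rewrite lerBlDr; apply: (le_trans _ (cnD _ _)).
    by rewrite subrK cn_nat.
  have h2 : cn (\sum_(j < M) (1 - e (x * j%:R))) <= 8 * (M%:R * `|x|) * M%:R.
    apply: (le_trans (cn_sum _ _ _)); rewrite mulrC -sum_const_ord; apply: ler_sum => j _.
    apply: (le_trans (e_le_dst _)); rewrite ler_wpM2l // normrM mulrC ler_wpM2r //.
    by rewrite ger0_norm // ler_nat ltnW // ltn_ord.
  lra.
have h3 : 1 - 8 * (M%:R * `|x|) <= cn D / M%:R.
  by rewrite ler_pdivlMr // mulrBl mul1r.
have h4 : 0 <= cn D / M%:R by rewrite divr_ge0 ?cn_ge0.
have h5 : 0 <= M%:R * `|x| by rewrite mulr_ge0.
move: h3 h4 h5; set u := cn D / _; set v := M%:R * _ => h3 h4 h5; nra.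
Qed.

Lemma fejer_expand M x :
  (fejer M x)%:C = (M%:R ^- 2)%:C * \sum_(j < M) \sum_(k < M) e (x * (j%:R - k%:R)).
Proof.
rewrite /fejer expr_div_n mulrC rmorphM /= cn_sqC; congr (_ * _).
rewrite cj_sum mulr_suml; apply: eq_bigr => j _; rewrite mulr_sumr.
by apply: eq_bigr => k _; rewrite mulrBr eB.
Qed.

(** Indices stand for denominators less one, here and in [farey]. A Fejer kernel of this length has
    the width Q / ((q+1) N^2) of the major arc, and the length stays below N^2, so that the
    displacements it creates remain in range. *)
Definition arc_width (N Q q : nat) : nat := ((q.+1 * N ^ 2) %/ Q)%N.
Definition farey (Q : nat) (p : 'I_Q * 'I_Q) : bool := (p.2 <= p.1)%N && coprime p.1.+1 p.2.
Definition frac_of (Q : nat) (p : 'I_Q * 'I_Q) : R := p.2%:R / p.1.+1%:R.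

(* A nonnegative trigonometric polynomial close to 1 on the major arcs |b - a/q| <= Q/(q N^2), q <= Q. *)
Definition major (N Q : nat) (b : R) : R :=
  \sum_(p : 'I_Q * 'I_Q | farey p) fejer (arc_width N Q p.1) (b - frac_of p).

Lemma farey_sep Q (p r : 'I_Q * 'I_Q) : farey p -> farey r -> p != r ->
  1 <= dst (frac_of p - frac_of r) * Q%:R ^+ 2.
Proof.
case: p => q b; case: r => q' b'; rewrite /farey /frac_of /= => /andP[bq cb] /andP[bq' cb'] ne.
have -> : b%:R / q.+1%:R - b'%:R / q'.+1%:R = (b%:Z * q'.+1%:Z - b'%:Z * q.+1%:Z)%:~R / (q.+1 * q'.+1)%:R :> R.
  have gen (x y u v : R) : x != 0 -> y != 0 -> u / x - v / y = (u * y - v * x) / (x * y).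
    by move=> hx hy; field; rewrite hx hy.
  by rewrite intrB !intrM natrM gen ?pnatr_eq0.
have ndv : ~~ ((q.+1 * q'.+1)%N%:Z %| b%:Z * q'.+1%:Z - b'%:Z * q.+1%:Z)%Z.
  apply: contra ne => hd.
  have [k hk] := dvdzP hd; move/eqP: hk; rewrite subr_eq PoszM => /eqP hk.
  have d1 : (q.+1 %| q'.+1)%N.
    have h : (q.+1%:Z %| b%:Z * q'.+1%:Z)%Z.
      by apply/dvdzP; exists (k * q'.+1%:Z + b'%:Z); rewrite hk; ring.
    by rewrite Gauss_dvdzr ?coprimezE in h.
  have d2 : (q'.+1 %| q.+1)%N.
    have h : (q'.+1%:Z %| b'%:Z * q.+1%:Z)%Z.
      apply/dvdzP; exists (b%:Z - k * q.+1%:Z); rewrite mulrBl hk; ring.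
    by rewrite Gauss_dvdzr ?coprimezE in h.
  have qq : q.+1 = q'.+1 by apply/eqP; rewrite eqn_dvd d1 d2.
  have qq' : q = q' by apply: val_inj; case: qq.
  subst q'; move: hd; rewrite -mulrBl PoszM mulrC dvdz_mul2l //= => hd.
  have := dvdz_small hd => h; rewrite xpair_eqE eqxx /= -val_eqE /=.
  have : b%:Z - b'%:Z = 0 by apply: h; lia.
  lia.
have qR : (0 : R) < (q.+1 * q'.+1)%:R by rewrite ltr0n.
have := dst_rat_ge (isT : (0 < q.+1 * q'.+1)%N) ndv; set d := dst _ => hd.
apply: (@le_trans _ _ (d * (q.+1 * q'.+1)%:R)); first by rewrite -ler_pdivrMr // div1r.
by rewrite ler_wpM2l ?dst_ge0 // -natrX ler_nat expnS expn1 leq_mul // ltn_ord.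
Qed.

(** Decay beats the number Q^2 of terms: at distance at least 1/(2 Q^2) from its centre each kernel
    is at most Q^(-3), thanks to N >= Q^10. *)
Lemma major_tail N Q (b : R) (p0 : 'I_Q * 'I_Q) (P : pred ('I_Q * 'I_Q)) : (2 <= Q)%N -> (Q ^ 10 <= N)%N ->
  (forall p, farey p -> P p -> 1 <= 2 * dst (b - frac_of p) * Q%:R ^+ 2) ->
  \sum_(p | farey p && P p) fejer (arc_width N Q p.1) (b - frac_of p) <= (Q%:R)^-1.
Proof.
move=> Q2 QN far; have QR : (2 : R) <= Q%:R by rewrite -[2]/(2%:R) ler_nat.
have Q0 : (0 : R) < Q%:R by lra.
have QNR : Q%:R ^+ 10 <= N%:R :> R by rewrite -natrX ler_nat.
have N1 : (1 : R) <= N%:R by apply: le_trans QNR; rewrite exprn_ege1 //; lra.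
apply: (@le_trans _ _ (\sum_(p : 'I_Q * 'I_Q) (Q%:R ^- 3))); last first.
  rewrite sumr_const card_prod !card_ord -[leLHS]mulr_natr natrM exprSr exprSr expr1.
  by rewrite !invfM; rewrite le_eqVlt; apply/orP; left; apply/eqP; field; rewrite gt_eqF.
rewrite big_mkcond; apply: ler_sum => p _; case: ifP => [/andP[fp Pp]|_]; last by rewrite invr_ge0 exprn_ge0 // ltW.
have := fejer_decay (arc_width N Q p.1) (b - frac_of p); have := far p fp Pp.
set d := dst _; set f := fejer _ _ => h1 h2.
have f0 : 0 <= f by exact: fejer_ge0.
have hM : N%:R ^+ 2 <= 2 * Q%:R * (arc_width N Q p.1)%:R :> R.
  have N2 : (Q <= N ^ 2)%N.
    apply: leq_trans (leq_trans QN _); first by rewrite -{1}(expn1 Q) leq_exp2l.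
    by rewrite -{1}(expn1 N) leq_pexp2l //; move: N1; rewrite ler1n.
  rewrite -natrX -[2]/(2%:R) -!natrM ler_nat /arc_width.
  have := ltn_ceil (p.1.+1 * N ^ 2) (ltnW Q2); set w := (_ %/ Q)%N => hw.
  have w1 : (0 < w)%N.
    by rewrite divn_gt0 ?(ltnW Q2) // (leq_trans N2) // leq_pmull.
  have : (N ^ 2 <= p.1.+1 * N ^ 2)%N by rewrite leq_pmull.
  nia.
set M : R := (arc_width N Q p.1)%:R in h2 hM.
have d0 : 0 <= d by exact: dst_ge0.
have M0 : 0 <= M by rewrite ler0n.
have h3 : N%:R ^+ 2 <= 4 * Q%:R ^+ 3 * (M * d).
  have : N%:R ^+ 2 * 1 <= (2 * Q%:R * M) * (2 * d * Q%:R ^+ 2) by apply: ler_pM => //; rewrite sqr_ge0.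
  have -> : 2 * Q%:R * M * (2 * d * Q%:R ^+ 2) = 4 * Q%:R ^+ 3 * (M * d) by ring.
  by rewrite mulr1.
have h4 : Q%:R ^+ 5 <= M * d.
  have : Q%:R ^+ 20 <= 4 * Q%:R ^+ 3 * (M * d).
    apply: le_trans h3; have -> : Q%:R ^+ 20 = (Q%:R ^+ 10) ^+ 2 :> R by rewrite -exprM.
    by rewrite lerXn2r // nnegrE ?exprn_ge0 // ltW.
  have -> : Q%:R ^+ 20 = Q%:R ^+ 3 * (Q%:R ^+ 12 * Q%:R ^+ 5) :> R by rewrite -!exprD.
  have -> : 4 * Q%:R ^+ 3 * (M * d) = Q%:R ^+ 3 * (4 * (M * d)) by ring.
  rewrite ler_pM2l ?exprn_gt0 // => h.
  have : 4 <= Q%:R ^+ 12 :> R.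
    apply: (@le_trans _ _ (2 ^+ 12)); first by rewrite -natrX ler_nat.
    by rewrite lerXn2r // nnegrE // ltW.
  have : 0 <= Q%:R ^+ 5 :> R by rewrite exprn_ge0 // ltW.
  set u := Q%:R ^+ 12 in h *; set v := Q%:R ^+ 5 in h *; nra.
have h5 : Q%:R ^+ 3 <= (M * d) ^+ 2.
  apply: (@le_trans _ _ ((Q%:R ^+ 5) ^+ 2)); last by rewrite lerXn2r // nnegrE ?mulr_ge0 // exprn_ge0 // ltW.
  by rewrite -exprM ler_weXn2l //; lra.
have q3 : 0 < Q%:R ^+ 3 :> R by rewrite exprn_gt0.
rewrite -[leRHS]div1r ler_pdivlMr //; apply: le_trans h2; by rewrite ler_wpM2l.
Qed.

Lemma major_ge0 N Q b : 0 <= major N Q b.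
Proof. by apply: sumr_ge0 => p _; exact: fejer_ge0. Qed.

Lemma major_near N Q (b : R) (p0 : 'I_Q * 'I_Q) : (2 <= Q)%N -> (Q ^ 10 <= N)%N -> farey p0 ->
  2 * dst (b - frac_of p0) * Q%:R ^+ 2 <= 1 ->
  fejer (arc_width N Q p0.1) (b - frac_of p0) <= major N Q b <=
  fejer (arc_width N Q p0.1) (b - frac_of p0) + (Q%:R)^-1.
Proof.
move=> Q2 QN fp0 near; rewrite /major (bigD1 p0) //=; apply/andP; split.
  by rewrite lerDl sumr_ge0 // => p _; exact: fejer_ge0.
rewrite lerD2l; apply: (@major_tail N Q b p0 (fun p => p != p0)) => // p fp np.
have := farey_sep fp fp0 np.
have -> : frac_of p - frac_of p0 = (b - frac_of p0) - (b - frac_of p) by ring.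
have := dstD (b - frac_of p0) (- (b - frac_of p)); rewrite dstN.
have q2 : 0 <= Q%:R ^+ 2 :> R by rewrite sqr_ge0.
move: near; set d0 := dst (b - frac_of p0); set d := dst (b - frac_of p); set d1 := dst _; set w := Q%:R ^+ 2 in q2 *.
move=> n1 n2 n3; have := ler_wpM2r q2 n2; rewrite mulrDl; lra.
Qed.

Lemma major_le2 N Q b : (2 <= Q)%N -> (Q ^ 10 <= N)%N -> major N Q b <= 2.
Proof.
move=> Q2 QN; have QR : (2 : R) <= Q%:R by rewrite -[2]/(2%:R) ler_nat.
have Qi : (Q%:R)^-1 <= 1 :> R by rewrite invf_le1; lra.
case: (boolP [exists p : 'I_Q * 'I_Q, farey p && (2 * dst (b - frac_of p) * Q%:R ^+ 2 <= 1)]).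
  move=> /existsP[p /andP[fp near]]; have /andP[_] := major_near Q2 QN fp near.
  have := fejer_le1 (arc_width N Q p.1) (b - frac_of p); lra.
rewrite negb_exists => /forallP h.
have Q0 : (0 < Q)%N by lia.
have : major N Q b <= (Q%:R)^-1; last by lra.
rewrite /major; under eq_bigl => p do rewrite -[farey p]andbT.
apply: (@major_tail N Q b (Ordinal Q0, Ordinal Q0) predT) => // p fp _.
by have := h p; rewrite fp /= -ltNge => /ltW.
Qed.

Lemma ln1D_le (x : R) : 1 <= x -> ln (1 + x) <= 1 + ln x.
Proof.
move=> x1; have -> : 1 + x = x * (1 + x^-1) by rewrite mulrDr mulr1 divff ?gt_eqF //; lra.
have xi : 0 < x^-1 by rewrite invr_gt0; lra.
have xi1 : x^-1 <= 1 by rewrite invf_le1; lra.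
rewrite ln_mul; [|lra|lra]; have := @ln_le_sub1 (1 + x^-1); lra.
Qed.

(** A substitute for the monotonicity of ln(1 + Y) / Y, from ln t <= t - 1 at t = Y / Y0. *)
Lemma ln_ratio (Y Y0 : R) : 0 < Y0 -> Y0 <= Y -> ln (1 + Y) / Y <= (1 + ln (1 + Y0)) / Y0.
Proof.
move=> y0 yy; have Y1 : 0 < Y by lra.
have h : ln (1 + Y) <= ln (1 + Y0) + (Y / Y0 - 1).
  have p : 0 < Y / Y0 by rewrite divr_gt0.
  have := @ln_le_sub1 (Y / Y0) p.
  have : ln (1 + Y) <= ln ((1 + Y0) * (Y / Y0)).
    apply: ln_le; first lra.
    have -> : (1 + Y0) * (Y / Y0) = Y / Y0 + Y by field; rewrite gt_eqF.
    rewrite lerD2r ler_pdivlMr //; lra.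
  rewrite ln_mul //; lra.
have l0 : 0 <= ln (1 + Y0) by apply: ln_ge0; lra.
rewrite ler_pdivrMr //.
have -> : (1 + ln (1 + Y0)) / Y0 * Y = Y / Y0 + ln (1 + Y0) * (Y / Y0) by field; rewrite gt_eqF.
have : 1 <= Y / Y0 by rewrite ler_pdivlMr // mul1r.
set r := Y / Y0 in h *; nra.
Qed.

(** Only the product has to be small. If q > Q, or if b is far from a/q on the scale Q / (q N^2),
    the Weyl sum itself saves. Otherwise b lies in a major arc; there 1 - [major] is small in
    proportion to |b - a/q|, which compensates the weakness of Weyl's bound near a/q. *)
Lemma minor_bound : exists2 C : R, 1 <= C & forall (N Q : nat) (al b : R), (2 <= Q)%N -> (Q ^ 10 <= N)%N ->
  (cn (qsum N al b) * `|1 - major N Q b|) ^+ 2 <= C * N%:R ^+ 2 * (1 + ln Q%:R) / Q%:R.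
Proof.
have [C2 C21 hC2] := ln_pow_le 2.
have [W W1 hWeyl] := weyl_bound_ex.
exists (100 * W * C2) => [|N Q al b Q2 QN]; first by nra.
have QR : (2 : R) <= Q%:R by rewrite -[2]/(2%:R) ler_nat.
have Q0 : (0 : R) < Q%:R by lra.
have QNR : Q%:R ^+ 10 <= N%:R :> R by rewrite -natrX ler_nat.
have Q1N : Q%:R ^+ 3 <= N%:R :> R by apply: le_trans QNR; rewrite ler_weXn2l //; lra.
have N1 : (1 : R) <= N%:R by apply: le_trans QNR; rewrite exprn_ege1 //; lra.
have N0 : (0 < N)%N by move: N1; rewrite ler1n.
have NR : (0 : R) < N%:R by lra.
have lN : 0 <= ln N%:R by exact: ln_ge0.
have lQ : 0 <= ln Q%:R by apply: ln_ge0; lra.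
have err : N%:R * (1 + ln N%:R) <= C2 * (N%:R ^+ 2 / Q%:R).
  have h1 : ((1 + ln N%:R) * Q%:R) ^+ 2 <= (C2 * N%:R) ^+ 2.
    rewrite exprMn [leRHS]exprMn; apply: (@le_trans _ _ ((C2 * N%:R) * N%:R)).
      apply: ler_pM; rewrite ?sqr_ge0 ?hC2 //.
      apply: le_trans Q1N; rewrite ler_weXn2l //; lra.
    rewrite -mulrA -expr2 ler_wpM2r ?sqr_ge0 // expr2; nra.
  have h2 : (1 + ln N%:R) * Q%:R <= C2 * N%:R.
    rewrite -(ler_pXn2r (n := 2)) // nnegrE mulr_ge0 //; lra.
  rewrite mulrA ler_pdivlMr //; have -> : C2 * N%:R ^+ 2 = N%:R * (C2 * N%:R) by ring.
  by rewrite -mulrA ler_wpM2l // ltW.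
have U0 : 0 <= N%:R ^+ 2 / Q%:R :> R by rewrite divr_ge0 ?sqr_ge0 //; lra.
set U := N%:R ^+ 2 / Q%:R in err U0.
pose V := W * (C2 * U).
have -> : 100 * W * C2 * N%:R ^+ 2 * (1 + ln Q%:R) / Q%:R = 100 * V * (1 + ln Q%:R) by rewrite /V /U; ring.
have CU : U <= C2 * U by rewrite ler_peMl.
have UL0 : 0 <= U * ln Q%:R by rewrite mulr_ge0.
have WUV : W * U <= V by rewrite ler_wpM2l //; lra.
have UV : U <= V by apply: le_trans WUV; rewrite ler_peMl.
have V0 : 0 <= V by exact: le_trans UV.
have VL0 : 0 <= V * ln Q%:R by rewrite mulr_ge0.
have CUL : W * U * ln Q%:R <= V * ln Q%:R by rewrite ler_wpM2r.
have errV : W * (N%:R * (1 + ln N%:R)) <= V by rewrite ler_wpM2l //; lra.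
have [q [a [/andP[q0 qN] cop hk hw]]] := hWeyl N b N0.
have qR : (0 : R) < q%:R by rewrite ltr0n.
have [hw1 hw2] := hw al; clear hw.
set ka := `|b - a%:~R / q%:R| in hk hw2.
have ka0 : 0 <= ka by exact: normr_ge0.
set K := cn (qsum N al b) in hw1 hw2 *.
have K0 : 0 <= K by exact: cn_ge0.
have D1 : `|1 - major N Q b| <= 1.
  by have := major_ge0 N Q b; have := major_le2 b Q2 QN; rewrite ler_norml => ? ?; apply/andP; split; lra.
have triv : K ^+ 2 <= 10 * V * (1 + ln Q%:R) -> (K * `|1 - major N Q b|) ^+ 2 <= 100 * V * (1 + ln Q%:R).
  move=> h; apply: (@le_trans _ _ (K ^+ 2)); last by apply: (le_trans h); rewrite !mulrDr !mulr1; lra.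
  by rewrite lerXn2r ?nnegrE ?mulr_ge0 // ler_piMr.
have [qQ|qQ] := ltP Q%:R (q%:R : R).
  apply: triv; apply: (le_trans hw1).
  have : N%:R ^+ 2 / q%:R <= U by rewrite ler_wpM2l ?sqr_ge0 // lef_pV2 ?posrE // ltW.
  have -> : W * N%:R ^+ 2 / q%:R = W * (N%:R ^+ 2 / q%:R) :> R by rewrite [RHS]mulrA.
  rewrite -[W * N%:R * _]mulrA [10 * V * _]mulrDr mulr1; set w := N%:R ^+ 2 / q%:R => hw.
  have := ler_wpM2l (le_trans ler01 W1) hw; lra.
have [YQ|YQ] := lerP (q%:R * (N%:R ^+ 2 * ka)) Q%:R; last first.
  have k0 : 0 < ka.
    by rewrite lt_def ka0 andbT; apply/eqP => k0; rewrite k0 !mulr0 in YQ; lra.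
  have bq : b != a%:~R / q%:R by rewrite -subr_eq0 -normr_gt0.
  apply: triv; apply: (le_trans (hw2 bq)).
  have := @ln_ratio (N%:R ^+ 2 * ka) (Q%:R / q%:R).
  rewrite divr_gt0 // ler_pdivrMr // [N%:R ^+ 2 * ka * q%:R]mulrC (ltW YQ) => /(_ isT isT) h.
  have h1 : ln (1 + Q%:R / q%:R) <= 1 + ln Q%:R.
    apply: (le_trans _ (ln1D_le (x := Q%:R) _)); last lra.
    apply: ln_le; first by rewrite ltr_wpDr // ltW // divr_gt0.
    by rewrite lerD2l ler_pdivrMr // ler_peMr ?ler1n // ltW.
  have h2 : W / (q%:R * ka) * ln (1 + N%:R ^+ 2 * ka) = W * (N%:R ^+ 2 / q%:R * (ln (1 + N%:R ^+ 2 * ka) / (N%:R ^+ 2 * ka))).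
    field; rewrite !gt_eqF //.
  have h3 : N%:R ^+ 2 / q%:R * (ln (1 + N%:R ^+ 2 * ka) / (N%:R ^+ 2 * ka)) <= N%:R ^+ 2 / q%:R * ((2 + ln Q%:R) / (Q%:R / q%:R)).
    rewrite ler_wpM2l ?divr_ge0 ?sqr_ge0 ?(ltW qR) //; apply: (le_trans h).
    by rewrite ler_wpM2r ?invr_ge0 ?divr_ge0 ?(ltW qR) ?(ltW Q0) //; lra.
  have h4 : N%:R ^+ 2 / q%:R * ((2 + ln Q%:R) / (Q%:R / q%:R)) = U * (2 + ln Q%:R).
    by rewrite /U; field; rewrite !gt_eqF.
  rewrite h2 -[W * N%:R * _]mulrA; rewrite h4 in h3; have := ler_wpM2l (le_trans ler01 W1) h3.
  rewrite [10 * V * _]mulrDr mulr1; set w := N%:R ^+ 2 / q%:R * _.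
  have -> : W * (U * (2 + ln Q%:R)) = 2 * (W * U) + W * U * ln Q%:R by ring.
  lra.
have qQn : (q.-1 < Q)%N by rewrite prednK //; move: qQ; rewrite ler_nat.
have qz : q%:Z != 0 by clear -q0; lia.
have a0 : 0 <= (a %% q)%Z by exact: modz_ge0.
have alt : (a %% q < q%:Z)%Z by apply: ltz_pmod; clear -q0; lia.
have blt : (`|(a %% q)%Z| < q)%N by clear -a0 alt; lia.
have bQn : (`|(a %% q)%Z| < Q)%N by clear -blt qQn q0; lia.
pose p0 : 'I_Q * 'I_Q := (Ordinal qQn, Ordinal bQn).
have fp0 : farey p0.
  rewrite /farey /= prednK //; apply/andP; split; first by clear -blt; lia.
  have := gcdz_modr q a; rewrite /gcdz => -[hg]; move: cop; rewrite /coprime -hg => /eqP hc; exact/eqP.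
have fE : b - frac_of p0 = (b - a%:~R / q%:R) + ((a %/ q)%Z)%:~R.
  rewrite /frac_of /= prednK //.
  have -> : (`|(a %% q)%Z|%:R : R) = ((a %% q)%Z)%:~R by rewrite natr_absz ger0_norm.
  have := congr1 (fun t : int => t%:~R : R) (divz_eq a q); rewrite !(intrD, intrM) -[(q%:Z)%:~R]/(q%:R : R).
  move=> ->; field; by rewrite gt_eqF.
have kaS : ka <= Q%:R / N%:R ^+ 2.
  rewrite ler_pdivlMr ?exprn_gt0 //; apply: le_trans YQ; rewrite mulrC ler_peMl ?ler1n //.
  by rewrite mulr_ge0 // sqr_ge0.
have near : 2 * dst (b - frac_of p0) * Q%:R ^+ 2 <= 1.
  rewrite fE dst_addint; apply: (@le_trans _ _ (2 * (Q%:R / N%:R ^+ 2) * Q%:R ^+ 2)).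
    by rewrite ler_wpM2r ?sqr_ge0 // ler_wpM2l //; apply: (le_trans (dst_le_norm _)).
  have -> : 2 * (Q%:R / N%:R ^+ 2) * Q%:R ^+ 2 = 2 * Q%:R ^+ 3 / N%:R ^+ 2 :> R by ring.
  rewrite ler_pdivrMr ?exprn_gt0 // mul1r expr2; apply: ler_pM => //; first by rewrite exprn_ge0 // ltW.
  apply: le_trans QNR; apply: (@le_trans _ _ Q%:R); first lra.
  by rewrite -{1}(expr1 Q%:R) ler_weXn2l //; lra.
have /andP[m1 m2] := major_near Q2 QN fp0 near.
rewrite fE fejer_addint in m1 m2.
have Mw : (arc_width N Q p0.1)%:R <= q%:R * U.
  rewrite /arc_width /= prednK // /U mulrA ler_pdivlMr // -natrX -!natrM ler_nat; exact: leq_divM.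
have M0 : (0 < arc_width N Q p0.1)%N.
  rewrite /arc_width /= prednK // divn_gt0; last by exact: ltnW.
  apply: (@leq_trans (Q ^ 10)); first by rewrite -{1}(expn1 Q) leq_exp2l.
  apply: (leq_trans QN); rewrite -{1}(expn1 N) -[X in (X <= _)%N]mul1n; apply: leq_mul => //.
  by rewrite leq_pexp2l.
have c1 := fejer_center (b - a%:~R / q%:R) M0; have c2 := fejer_ge0 (arc_width N Q p0.1) (b - a%:~R / q%:R).
have c3 := fejer_le1 (arc_width N Q p0.1) (b - a%:~R / q%:R).
rewrite -/ka in c1; move: c1 c2 c3 m1 m2; set f := fejer _ _; set Dm := major N Q b => c1 c2 c3 m1 m2.
set Mr : R := (arc_width N Q p0.1)%:R in c1 Mw.
have Qi0 : 0 < (Q%:R)^-1 :> R by rewrite invr_gt0.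
have Qi1 : (Q%:R)^-1 <= 1 :> R by rewrite invf_le1 //; clear -QR; lra.
have d1 : `|1 - Dm| ^+ 2 <= (1 - f) + (Q%:R)^-1.
  clear -Qi0 Qi1 c1 c2 c3 m1 m2; rewrite real_normK ?num_real //; set g := 1 - f; have : 1 - Dm <= g by rewrite /g; lra.
  have : g - (Q%:R)^-1 <= 1 - Dm by rewrite /g; lra.
  have : 0 <= g <= 1 by rewrite /g; apply/andP; split; lra.
  by set t := 1 - Dm; set i := Q%:R^-1 in Qi0 Qi1 *; case/andP => *; nra.
have KN : K <= N%:R by exact: cn_qsum_le.
have k1 : K ^+ 2 / Q%:R <= U by rewrite ler_wpM2r ?(ltW Qi0) // lerXn2r // nnegrE.
(* The factor |b - a/q| in the bound for 1 - f cancels the one in the denominator of Weyl's second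
   estimate. *)
have main : K ^+ 2 * (1 - f) <= V + 16 * (W * U * (1 + ln Q%:R)).
  have [k0|k0] := eqVneq ka 0.
    rewrite k0 !mulr0 in c1; have -> : 1 - f = 0 by clear -c1 c3; lra.
    by rewrite mulr0 addr_ge0 // mulr_ge0 // mulr_ge0 ?addr_ge0 // mulr_ge0 // ltW // (lt_le_trans _ W1).
  have k0' : 0 < ka by rewrite lt_def k0.
  have bq : b != a%:~R / q%:R by rewrite -subr_eq0 -normr_gt0.
  have h1 := hw2 bq.
  have g0 : 0 <= 1 - f by clear -c3; lra.
  have g1 : 1 - f <= 1 by clear -c2; lra.
  have W0' : 0 <= W by exact: le_trans W1.
  apply: (le_trans (ler_wpM2r g0 h1)); rewrite mulrDl; apply: lerD.
    apply: (@le_trans _ _ (W * N%:R * (1 + ln N%:R))).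
      by rewrite ler_piMr // !mulr_ge0 ?addr_ge0 // ltW.
    by rewrite -mulrA.
  have L0 : 0 <= ln (1 + N%:R ^+ 2 * ka) by apply: ln_ge0; rewrite lerDl mulr_ge0 // sqr_ge0.
  have L1 : ln (1 + N%:R ^+ 2 * ka) <= 1 + ln Q%:R.
    apply: (le_trans _ (ln1D_le (x := Q%:R) _)); last by clear -QR; lra.
    apply: ln_le; first by rewrite ltr_wpDr // mulr_ge0 // sqr_ge0.
    rewrite lerD2l; apply: le_trans YQ; rewrite ler_peMl ?ler1n // mulr_ge0 // sqr_ge0 //.
  apply: (@le_trans _ _ (W / (q%:R * ka) * (1 + ln Q%:R) * (16 * (q%:R * U * ka)))).
    have W0 : 0 <= W / (q%:R * ka) by rewrite divr_ge0 // mulr_ge0 // ltW.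
    apply: ler_pM => //; first by rewrite mulr_ge0.
      by rewrite ler_wpM2l.
    by apply: (le_trans c1); rewrite ler_wpM2l // ler_wpM2r.
  have -> : W / (q%:R * ka) * (1 + ln Q%:R) * (16 * (q%:R * U * ka)) = 16 * (W * U * (1 + ln Q%:R)) by field; rewrite !gt_eqF.
  by [].
rewrite exprMn; apply: (@le_trans _ _ (K ^+ 2 * (1 - f) + K ^+ 2 / Q%:R)).
  by rewrite -mulrDr ler_wpM2l // sqr_ge0.
move: main k1; rewrite !mulrDr !mulr1; clear -V0 VL0 UV WUV CUL; lra.
Qed.

Lemma real_natC (n : nat) : (n%:R : R)%:C = n%:R.
Proof. exact: rmorph_nat. Qed.

Lemma realCM (x y : R) : (x * y)%:C = x%:C * y%:C.
Proof. exact: rmorphM. Qed.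

Lemma grid_orth (P1 P2 : nat) (x y : int) : (0 < P1)%N -> (0 < P2)%N ->
  \sum_(a < P1) \sum_(b < P2) e (x%:~R * a%:R / P1%:R + y%:~R * b%:R / P2%:R) =
  if (P1%:Z %| x)%Z && (P2%:Z %| y)%Z then (P1 * P2)%:R else 0.
Proof.
move=> p1 p2; under eq_bigr => a _ do (under eq_bigr => b _ do rewrite eD; rewrite -mulr_sumr sum_e_period //).
rewrite -mulr_suml sum_e_period //; case: (P1%:Z %| x)%Z; case: (P2%:Z %| y)%Z => //=; rewrite ?mulr0 ?mul0r //.
by rewrite natrM.
Qed.

Lemma cn_sum_sqC (I : finType) (F : I -> R[i]) :
  (cn (\sum_i F i) ^+ 2)%:C = \sum_i \sum_j F i * cj (F j).
Proof.
by rewrite cn_sqC cj_sum mulr_suml; apply: eq_bigr => i _; rewrite mulr_sumr.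
Qed.

Lemma grid_parseval (I : finType) (c : I -> R[i]) (x y : I -> int) (P1 P2 : nat) :
  (0 < P1)%N -> (0 < P2)%N ->
  (\sum_(a < P1) \sum_(b < P2) cn (\sum_i c i * e ((x i)%:~R * a%:R / P1%:R + (y i)%:~R * b%:R / P2%:R)) ^+ 2)%:C =
  (P1 * P2)%:R * \sum_i \sum_j (if (P1%:Z %| x i - x j)%Z && (P2%:Z %| y i - y j)%Z then c i * cj (c j) else 0).
Proof.
move=> p1 p2; rewrite real_sumC; under eq_bigr => a _ do rewrite real_sumC.
under eq_bigr => a _ do under eq_bigr => b _ do rewrite cn_sum_sqC.
under eq_bigr => a _ do rewrite exchange_big /=.
rewrite exchange_big mulr_sumr /=; apply: eq_bigr => i _.
under eq_bigr => a _ do rewrite exchange_big /=.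
rewrite exchange_big mulr_sumr /=; apply: eq_bigr => j _.
transitivity (c i * cj (c j) * \sum_(a < P1) \sum_(b < P2) e ((x i - x j)%:~R * a%:R / P1%:R + (y i - y j)%:~R * b%:R / P2%:R)).
  rewrite mulr_sumr; apply: eq_bigr => a _; rewrite mulr_sumr; apply: eq_bigr => b _.
  rewrite cjM mulrACA -eB; congr (_ * e _); rewrite !intrB; ring.
by rewrite grid_orth //; case: ifP => _; rewrite ?mulr0 // mulrC.
Qed.

Lemma grid_parseval_distinct (I : finType) (c : I -> R[i]) (x y : I -> int) (P1 P2 : nat) :
  (0 < P1)%N -> (0 < P2)%N ->
  (forall i j, (P1%:Z %| x i - x j)%Z -> (P2%:Z %| y i - y j)%Z -> i = j) ->
  \sum_(a < P1) \sum_(b < P2) cn (\sum_i c i * e ((x i)%:~R * a%:R / P1%:R + (y i)%:~R * b%:R / P2%:R)) ^+ 2 =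
  (P1 * P2)%:R * \sum_i cn (c i) ^+ 2.
Proof.
move=> p1 p2 dis; apply: (@complexI R); rewrite grid_parseval // [RHS]realCM real_natC real_sumC; congr (_ * _).
apply: eq_bigr => i _; rewrite (bigD1 i) //= !subrr !dvdz0 /= big1 ?addr0 ?cn_sqC // => j ji.
case: ifP => // /andP[h1 h2]; case/eqP: ji; exact/esym/dis.
Qed.

Lemma sum_ord_shift_le (H : nat -> R) (s M n : nat) : (s + M <= n)%N -> (forall i, 0 <= H i) ->
  \sum_(j < M) H (j + s)%N <= \sum_(t < n) H t.
Proof.
move=> h H0; apply: (@le_trans _ _ (\sum_(t < s + M) H t)); last exact: sum_ord_widen.
rewrite big_split_ord /=; under [X in _ + X]eq_bigr => j _ do rewrite addnC.
by rewrite lerDr sumr_ge0.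
Qed.

Lemma prod_tsum_le k : exists J : nat, forall Q, (0 < Q)%N ->
  \prod_(j < k) tsum j Q <= (1 + ln Q%:R) ^+ J.
Proof.
elim: k => [|k [J IH]]; first by exists 0%N => Q _; rewrite big_ord0 expr0.
exists (J + 2 ^ k)%N => Q Q0; rewrite big_ord_recr /= exprD; apply: ler_pM; rewrite ?tsum_ge0 ?IH ?tsum_le //.
by apply: prodr_ge0 => j _; exact: tsum_ge0.
Qed.

Lemma exchange_big3 (V : nmodType) (A B D : finType) (F : A -> B -> D -> V) :
  \sum_i \sum_j \sum_k F i j k = \sum_k \sum_i \sum_j F i j k.
Proof. by rewrite [RHS]exchange_big; apply: eq_bigr => i _; rewrite [RHS]exchange_big. Qed.

(** The term t = X has argument 0, where [tau] equals Q; it accounts for Q^k. *)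
Lemma tau_moment_sym k Q X : \sum_(t < 2 * X) (tau Q `|X%:Z - t%:Z|)%:R ^+ k <=
  Q%:R ^+ k + 2 * (X%:R * \prod_(j < k) tsum j Q) :> R.
Proof.
pose F (t : nat) : R := (tau Q `|X%:Z - t%:Z|)%:R ^+ k.
have F0 t : 0 <= F t by rewrite exprn_ge0.
rewrite mul2n -addnn big_split_ord /=.
have h1 : \sum_(t < X) F t <= X%:R * \prod_(j < k) tsum j Q.
  apply: le_trans (tau_moment k Q X); rewrite [leLHS](reindex_inj rev_ord_inj) /=.
  apply: ler_sum => t _; rewrite /F /=; have := ltn_ord t => ht.
  have -> // : `|X%:Z - (X - t.+1)%N%:Z|%N = t.+1 by clear -ht; lia.
have h2 : \sum_(t < X) F (X + t)%N <= Q%:R ^+ k + X%:R * \prod_(j < k) tsum j Q.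
  apply: (@le_trans _ _ (\sum_(t < X.+1) F (X + t)%N)).
    by apply: (@sum_ord_widen (fun t => F (X + t)%N)).
  rewrite big_ord_recl /=; apply: lerD; first by rewrite /F lerXn2r ?nnegrE // ler_nat tau_leQ.
  apply: le_trans (tau_moment k Q X); apply: ler_sum => t _; rewrite /F /= /bump add1n.
  have -> // : `|X%:Z - (X + t.+1)%N%:Z|%N = t.+1 by clear; lia.
by rewrite -/(F _); move: h1 h2; rewrite /F; set a := \sum_(_ < _) _; set b := \sum_(_ < _) _; set w := _ * \prod_(_ < _) _; clear; lra.
Qed.

Section Restriction.
Variables (I : finType) (c : I -> R[i]) (x y : I -> int) (P1 P2 N Q : nat).
Hypotheses (c1 : forall i, cn (c i) <= 1) (P1N : (N <= P1)%N) (P2N : (3 * N ^ 2 <= P2)%N).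
Hypotheses (Q2 : (2 <= Q)%N) (QN : (Q ^ 10 <= N)%N).
Hypothesis dis : forall i j, (P1%:Z %| x i - x j)%Z -> (P2%:Z %| y i - y j)%Z -> i = j.

Let al i : R := (x i)%:~R / P1%:R.
Let be i : R := (y i)%:~R / P2%:R.
Let g (n : nat) (v : R) : R[i] := \sum_i c i * e (al i * n%:R + be i * v).
(** The dual sum is sampled off the parabola: t - N^2 is the displacement of the second variable
    from n^2, and t = N^2 is the parabola itself. *)
Let w (n t : nat) : R := cn (g n (n%:R ^+ 2 + t%:R - N%:R ^+ 2)) ^+ 2.
Let r : R := #|I|%:R.

Lemma restr_N0 : (0 < N)%N.
Proof. by apply: leq_trans QN; rewrite expn_gt0; clear -Q2; lia. Qed.

Lemma restr_w_ge0 n t : 0 <= w n t. Proof. exact: sqr_ge0. Qed.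

Lemma restr_w_le n t : w n t <= r ^+ 2.
Proof.
rewrite /w lerXn2r ?nnegrE ?cn_ge0 // /r; apply: (le_trans (cn_sum _ _ _)).
rewrite -sum1_card natr_sum; apply: ler_sum => i _; rewrite cnM cn_e mulr1; exact: c1.
Qed.

(** The points (n, n^2 + t) with n < N and t < 2 N^2 are distinct grid points because 3 N^2 <= P2,
    so Parseval over the whole grid bounds their sum; the shift by N^2 is absorbed into the
    coefficients. *)
Lemma restr_w_sum : \sum_(n < N) \sum_(t < 2 * N ^ 2) w n t <= (P1 * P2)%:R * r.
Proof.
have N0 := restr_N0.
have p1 : (0 < P1)%N by exact: leq_trans P1N.
have p2 : (0 < P2)%N by apply: leq_trans P2N; rewrite muln_gt0 expn_gt0 N0.
pose c' i := c i * e (- be i * N%:R ^+ 2).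
pose h (n v : nat) := cn (\sum_i c' i * e ((x i)%:~R * n%:R / P1%:R + (y i)%:~R * v%:R / P2%:R)) ^+ 2.
have h0 n v : 0 <= h n v by exact: sqr_ge0.
have wh n t : w n t = h n (t + n ^ 2)%N.
  rewrite /w /h /g; congr (cn _ ^+ 2); apply: eq_bigr => i _; rewrite /c' -mulrA -eD; congr (_ * e _).
  rewrite /al /be natrD natrX; ring.
apply: (@le_trans _ _ (\sum_(n < P1) \sum_(v < P2) h n v)).
  apply: (@le_trans _ _ (\sum_(n < N) \sum_(v < P2) h n v)).
    apply: ler_sum => n _; under eq_bigr => t _ do rewrite wh.
    apply: (@sum_ord_shift_le (h n)) => //; apply: leq_trans P2N.
    have : (n ^ 2 <= N ^ 2)%N by rewrite leq_exp2r // ltnW // ltn_ord.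
    by clear; lia.
  by apply: (@sum_ord_widen (fun n => \sum_(v < P2) h n v)) => // n; rewrite sumr_ge0.
rewrite /h grid_parseval_distinct // ler_wpM2l // /r -sum1_card natr_sum; apply: ler_sum => i _.
by rewrite expr_le1 ?cn_ge0 // /c' cnM cn_e mulr1 c1.
Qed.

(** Expanding [major] in its frequencies turns multiplication by it into an average of |g|^2 over
    points displaced from the parabola by k - l, with Ramanujan sums as weights. Summed over
    denominators, these weights are at most the divisor function of the displacement. *)
Lemma restr_major_part :
  cn (\sum_i \sum_j c i * cj (c j) * qsum N (al i - al j) (be i - be j) * (major N Q (be i - be j))%:C) <=
  2 * Q%:R / N%:R ^+ 2 * (1 + ln Q%:R) * \sum_(n < N) \sum_(t < 2 * N ^ 2) (tau Q `|(N ^ 2)%N%:Z - t%:Z|)%:R * w n t.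
Proof.
have N0 := restr_N0; have NR : (0 : R) < N%:R by rewrite ltr0n.
have Q0 : (0 < Q)%N by exact: ltnW.
have QR : (0 : R) < Q%:R by rewrite ltr0n.
pose M (q : nat) := arc_width N Q q.
have gE n (v : R) : (cn (g n v) ^+ 2)%:C = \sum_i \sum_j c i * cj (c j) * e ((al i - al j) * n%:R + (be i - be j) * v).
  rewrite cn_sum_sqC; apply: eq_bigr => i _; apply: eq_bigr => j _.
  rewrite cjM mulrACA -eB; congr (_ * e _); ring.
have -> : \sum_i \sum_j c i * cj (c j) * qsum N (al i - al j) (be i - be j) * (major N Q (be i - be j))%:C =
  \sum_(q < Q) ((M q)%:R ^- 2)%:C * \sum_(k < M q) \sum_(l < M q) ramanujan q.+1 (l%:Z - k%:Z) *
     (\sum_(n < N) cn (g n (n%:R ^+ 2 + k%:R - l%:R)) ^+ 2)%:C.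
  have E1 i j : c i * cj (c j) * qsum N (al i - al j) (be i - be j) * (major N Q (be i - be j))%:C =
    \sum_(q < Q) ((M q)%:R ^- 2)%:C * \sum_(k < M q) \sum_(l < M q) ramanujan q.+1 (l%:Z - k%:Z) *
     \sum_(n < N) c i * cj (c j) * e ((al i - al j) * n%:R + (be i - be j) * (n%:R ^+ 2 + k%:R - l%:R)).
    have -> : (major N Q (be i - be j))%:C = \sum_(q < Q) ((M q)%:R ^- 2)%:C * \sum_(k < M q) \sum_(l < M q)
        ramanujan q.+1 (l%:Z - k%:Z) * e ((be i - be j) * (k%:R - l%:R)).
      rewrite /major real_sumC.
      rewrite -(pair_big_dep xpredT (fun q b : 'I_Q => (b <= q)%N && coprime q.+1 b)
         (fun q b : 'I_Q => (fejer (arc_width N Q q) (be i - be j - b%:R / q.+1%:R))%:C)) /=.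
      apply: eq_bigr => q _.
      have -> : \sum_(b < Q | (b <= q)%N && coprime q.+1 b) (fejer (arc_width N Q q) (be i - be j - b%:R / q.+1%:R))%:C =
                \sum_(b < q.+1 | coprime q.+1 b) (fejer (arc_width N Q q) (be i - be j - b%:R / q.+1%:R))%:C.
        rewrite [RHS](big_ord_widen_cond Q (fun b => coprime q.+1 b) (fun b => (fejer (arc_width N Q q) (be i - be j - b%:R / q.+1%:R))%:C)) //.
        by apply: eq_bigl => b; rewrite andbC ltnS.
      rewrite (eq_bigr _ (fun (b : 'I_q.+1) _ => fejer_expand (arc_width N Q q) (be i - be j - b%:R / q.+1%:R))).
      rewrite -mulr_sumr; congr (_ * _).
      rewrite exchange_big; apply: eq_bigr => k _; rewrite exchange_big; apply: eq_bigr => l _.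
      rewrite /ramanujan mulr_suml; apply: eq_bigr => b _; rewrite -eD; congr e.
      rewrite intrB -![_%:Z%:~R]/(_%:R : R); ring.
    rewrite mulr_sumr; apply: eq_bigr => q _; rewrite mulrCA; congr (_ * _).
    rewrite mulr_sumr; apply: eq_bigr => k _; rewrite mulr_sumr; apply: eq_bigr => l _.
    set A := c i * cj (c j); set Rm := ramanujan _ _; set E := e _.
    have -> : A * qsum N (al i - al j) (be i - be j) * (Rm * E) = Rm * (A * (qsum N (al i - al j) (be i - be j) * E)) by ring.
    rewrite /qsum [_ * E]mulr_suml [A * _]mulr_sumr; congr (_ * _); apply: eq_bigr => n _.
    rewrite /E -eD; congr (_ * e _); ring.
  under eq_bigr => i _ do under eq_bigr => j _ do rewrite E1.
  rewrite exchange_big3; apply: eq_bigr => q _.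
  under eq_bigr => i _ do rewrite -mulr_sumr.
  rewrite -mulr_sumr; congr (_ * _); rewrite exchange_big3; apply: eq_bigr => k _.
  rewrite exchange_big3; apply: eq_bigr => l _.
  under eq_bigr => i _ do rewrite -mulr_sumr.
  rewrite -mulr_sumr; congr (_ * _); rewrite real_sumC exchange_big3.
  by apply: eq_bigr => n _; rewrite gE.
apply: (le_trans (cn_sum _ _ _)).
pose H (q t : nat) : R := cn (ramanujan q.+1 ((N ^ 2)%N%:Z - t%:Z)) * \sum_(n < N) w n t.
have H0 q t : 0 <= H q t by rewrite mulr_ge0 ?cn_ge0 // sumr_ge0 // => n _; exact: restr_w_ge0.
apply: (@le_trans _ _ (\sum_(q < Q) (2 * Q%:R / (q.+1%:R * N%:R ^+ 2)) * \sum_(t < 2 * N ^ 2) H q t)).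
  apply: ler_sum => q _; rewrite cnM cn_real.
  have MN : (M q <= N ^ 2)%N.
    rewrite /M /arc_width; apply: leq_trans (leq_div2r Q (_ : (_ <= Q * N ^ 2)%N)) _; first by rewrite leq_mul2r ltn_ord orbT.
    by rewrite mulKn.
  have Mpos : (0 < M q)%N.
    rewrite /M /arc_width divn_gt0 //; apply: leq_trans (leq_pmull _ _) => //.
    apply: leq_trans (leq_trans QN _); first by rewrite -{1}(expn1 Q) leq_exp2l.
    by rewrite -{1}(expn1 N) leq_pexp2l.
  have MR : (0 : R) < (M q)%:R by rewrite ltr0n.
  have hM : q.+1%:R * N%:R ^+ 2 <= 2 * Q%:R * (M q)%:R :> R.
    rewrite -natrX -[2]/(2%:R) -!natrM ler_nat; have := ltn_ceil (q.+1 * N ^ 2) Q0.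
    rewrite -/(arc_width N Q q) -/(M q); move: Mpos; set m := M q; set z := (_ * N ^ 2)%N.
    by clear; rewrite mulSn => h1 h2; have : (Q <= m * Q)%N by [rewrite leq_pmull]; lia.
  have inner : cn (\sum_(k < M q) \sum_(l < M q) ramanujan q.+1 (l%:Z - k%:Z) * (\sum_(n < N) cn (g n (n%:R ^+ 2 + k%:R - l%:R)) ^+ 2)%:C)
     <= (M q)%:R * \sum_(t < 2 * N ^ 2) H q t.
    rewrite exchange_big /=; apply: (le_trans (cn_sum _ _ _)); rewrite -sum_const_ord; apply: ler_sum => l _.
    apply: (le_trans (cn_sum _ _ _)).
    have lM := ltn_ord l.
    apply: (@le_trans _ _ (\sum_(k < M q) H q (k + (N ^ 2 - l))%N)); last first.
      by apply: (@sum_ord_shift_le (H q)) => //; clear -MN lM; lia.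
    apply: ler_sum => k _; rewrite cnM cn_real ger0_norm; last by rewrite sumr_ge0 // => n _; exact: sqr_ge0.
    rewrite /H; have lN2 : (l <= N ^ 2)%N by clear -MN lM; lia.
    have -> : (N ^ 2)%N%:Z - (k + (N ^ 2 - l))%N%:Z = l%:Z - k%:Z by move: lN2; clear; lia.
    rewrite ler_wpM2l ?cn_ge0 //; apply: ler_sum => n _; rewrite /w.
    have -> // : n%:R ^+ 2 + (k + (N ^ 2 - l))%:R - N%:R ^+ 2 = n%:R ^+ 2 + k%:R - l%:R :> R.
    by rewrite natrD natrB // natrX; ring.
  rewrite ger0_norm ?invr_ge0 ?sqr_ge0 //.
  have h1 : 0 <= (M q)%:R ^- 2 :> R by rewrite invr_ge0 sqr_ge0.
  apply: (le_trans (ler_wpM2l h1 inner)); rewrite mulrA ler_wpM2r ?sumr_ge0 //.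
  have -> : (M q)%:R ^- 2 * (M q)%:R = ((M q)%:R)^-1 :> R by field; rewrite gt_eqF.
  have z0 : 0 < q.+1%:R * N%:R ^+ 2 :> R by rewrite mulr_gt0 ?exprn_gt0 ?ltr0n.
  by rewrite -[leLHS]div1r ler_pdivlMr // mulrAC ler_pdivrMr // mul1r.
have -> : \sum_(q < Q) (2 * Q%:R / (q.+1%:R * N%:R ^+ 2)) * \sum_(t < 2 * N ^ 2) H q t =
   2 * Q%:R / N%:R ^+ 2 * \sum_(t < 2 * N ^ 2) (\sum_(q < Q) cn (ramanujan q.+1 ((N ^ 2)%N%:Z - t%:Z)) / q.+1%:R) * \sum_(n < N) w n t.
  rewrite mulr_sumr; under [RHS]eq_bigr => t _ do rewrite mulr_suml mulr_sumr.
  rewrite exchange_big /=; apply: eq_bigr => q _; rewrite mulr_sumr; apply: eq_bigr => t _; rewrite /H.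
  set u := cn _; set z := \sum_(n < N) _; field; rewrite (gt_eqF NR) /=; by rewrite ?natr1 ?nat1r pnatr_eq0.
have U0 : 0 <= 2 * Q%:R / N%:R ^+ 2 :> R by rewrite divr_ge0 ?sqr_ge0 // mulr_ge0 // ltW.
rewrite -[leRHS]mulrA ler_wpM2l // exchange_big mulr_sumr /=; apply: ler_sum => t _.
have W0 : 0 <= \sum_(n < N) w n t by rewrite sumr_ge0 // => n _; exact: restr_w_ge0.
apply: (le_trans (ler_wpM2r W0 (ramanujan_sum_le _ Q0))).
by rewrite -mulr_sumr mulrCA mulrA.
Qed.

(** Opening the square gives a double sum over frequencies against [qsum], and 1 = (1 - [major]) +
    [major] is inserted. The minor part is estimated termwise. In the major part the values tau <= T
    are handled by Parseval and the larger ones by a divisor moment together with the trivial bound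
    on [w]. *)
Lemma restr_core (k T : nat) (s : R) : (0 < T)%N -> 0 <= s ->
  (forall a b, cn (qsum N a b) * `|1 - major N Q b| <= N%:R * s) ->
  \sum_(n < N) cn (g n (n%:R ^+ 2)) ^+ 2 <= r ^+ 2 * (N%:R * s) +
   2 * Q%:R / N%:R ^+ 2 * (1 + ln Q%:R) * (T%:R * ((P1 * P2)%:R * r) +
     N%:R * r ^+ 2 / T%:R ^+ k * (Q%:R ^+ k.+1 + 2 * ((N ^ 2)%:R * \prod_(j < k.+1) tsum j Q))).
Proof.
move=> T0 s0 hs; have N0 := restr_N0; have NR : (0 : R) < N%:R by rewrite ltr0n.
have TR : (0 : R) < T%:R by rewrite ltr0n.
have Q0 : (0 < Q)%N by exact: ltnW.
have QR : (0 : R) < Q%:R by rewrite ltr0n.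
set S := \sum_(n < N) _; have S0 : 0 <= S by rewrite sumr_ge0 // => n _; exact: sqr_ge0.
pose cc i j := c i * cj (c j) * qsum N (al i - al j) (be i - be j).
have SE : S%:C = \sum_i \sum_j cc i j.
  rewrite /S real_sumC; under eq_bigr => n _ do rewrite /g cn_sum_sqC.
  rewrite exchange_big; apply: eq_bigr => i _; rewrite exchange_big; apply: eq_bigr => j _.
  rewrite /cc /qsum mulr_sumr; apply: eq_bigr => n _.
  rewrite cjM mulrACA -eB; congr (_ * e _); ring.
have -> : S = cn (S%:C) by rewrite cn_real ger0_norm.
have -> : S%:C = \sum_i \sum_j cc i j * (1 - major N Q (be i - be j))%:C + \sum_i \sum_j cc i j * (major N Q (be i - be j))%:C.
  rewrite SE -big_split; apply: eq_bigr => i _; rewrite -big_split; apply: eq_bigr => j _ /=.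
  by rewrite -mulrDr -rmorphD /= subrK mulr1.
apply: (le_trans (cnD _ _)); apply: lerD.
  apply: (le_trans (cn_sum _ _ _)).
  have -> : r ^+ 2 * (N%:R * s) = \sum_(i : I) \sum_(j : I) N%:R * s.
    by rewrite !sumr_const -mulrnA -[RHS]mulr_natl natrM -/r expr2.
  apply: ler_sum => i _; apply: (le_trans (cn_sum _ _ _)); apply: ler_sum => j _.
  rewrite cnM cn_real /cc !cnM cn_cj -[leLHS]mulrA; apply: le_trans (hs (al i - al j) (be i - be j)).
  rewrite ler_piMl ?mulr_ge0 ?cn_ge0 //.
  by rewrite -[1]mulr1; apply: ler_pM; rewrite ?cn_ge0 ?c1.
apply: (le_trans restr_major_part).
have lQ : 0 <= ln Q%:R by apply: ln_ge0; rewrite ler1n.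
apply: ler_wpM2l; first by rewrite mulr_ge0 ?addr_ge0 // divr_ge0 ?sqr_ge0 // mulr_ge0 // ltW.
(* Either u <= T, or (u / T)^k >= 1 and the trivial bound for z can be paid for by a moment. *)
have tauT (u : nat) (z : R) : 0 <= z -> z <= r ^+ 2 -> u%:R * z <= T%:R * z + r ^+ 2 / T%:R ^+ k * u%:R ^+ k.+1.
  move=> z0 zr; have [uT|uT] := leqP u T.
    by rewrite (@le_trans _ _ (T%:R * z)) ?ler_wpM2r ?ler_nat // lerDl mulr_ge0 ?exprn_ge0 // divr_ge0 ?sqr_ge0 ?exprn_ge0 // ltW.
  apply: (@le_trans _ _ (r ^+ 2 / T%:R ^+ k * u%:R ^+ k.+1)); last by rewrite lerDr mulr_ge0 // ltW.
  have -> : r ^+ 2 / T%:R ^+ k * u%:R ^+ k.+1 = u%:R * (r ^+ 2 * (u%:R ^+ k / T%:R ^+ k)).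
    by rewrite [u%:R ^+ k.+1]exprS; move: (u%:R ^+ k) (T%:R ^+ k) => z1 z2; ring.
  rewrite ler_wpM2l // -[leLHS]mulr1; apply: ler_pM => //.
  by rewrite ler_pdivlMr ?exprn_gt0 // mul1r lerXn2r ?nnegrE ?ler_nat // ltnW.
apply: (@le_trans _ _ (\sum_(n < N) \sum_(t < 2 * N ^ 2) (T%:R * w n t + r ^+ 2 / T%:R ^+ k * (tau Q `|(N ^ 2)%N%:Z - t%:Z|)%:R ^+ k.+1))).
  apply: ler_sum => n _; apply: ler_sum => t _; apply: tauT; [exact: restr_w_ge0|exact: restr_w_le].
under eq_bigr => n _ do rewrite big_split -!mulr_sumr /=.
rewrite big_split -mulr_sumr sum_const_ord; apply: lerD.
  by rewrite ler_wpM2l ?(ltW TR) // restr_w_sum.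
rewrite mulrA [N%:R * (_ / _)]mulrA ler_wpM2l ?tau_moment_sym // divr_ge0 ?exprn_ge0 ?(ltW TR) // mulr_ge0 ?sqr_ge0 //.
Qed.
End Restriction.

(* With rho^16 >= #|I| the three error sources balance at rho^27. *)
Lemma restriction_log : exists (C : R) (J : nat), 1 <= C /\
  forall (I : finType) (c : I -> R[i]) (x y : I -> int) (P1 P2 N rho : nat) (Lam : R),
  (forall i, cn (c i) <= 1) -> (N <= P1)%N -> (3 * N ^ 2 <= P2)%N ->
  (2 <= rho)%N -> (rho ^ 100 <= N)%N -> (#|I| <= rho ^ 16)%N -> 1 <= Lam ->
  (P1 * P2)%:R <= Lam * N%:R ^+ 3 ->
  (forall i j, (P1%:Z %| x i - x j)%Z -> (P2%:Z %| y i - y j)%Z -> i = j) ->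
  \sum_(n < N) cn (\sum_i c i * e ((x i)%:~R / P1%:R * n%:R + (y i)%:~R / P2%:R * n%:R ^+ 2)) ^+ 2 <=
  C * Lam * N%:R * rho%:R ^+ 27 * (1 + ln rho%:R) ^+ J.
Proof.
have [C1 C11 hminor] := minor_bound.
have [J0 hJ0] := prod_tsum_le 16.
exists (10 * C1 + 20 * (1 + (1 + 2 * 10 ^+ J0))), J0.+1; split.
  by have : (0 : R) <= 10 ^+ J0 by [rewrite exprn_ge0]; lra.
move=> I c x y P1 P2 N rho Lam c1 P1N P2N r2 rN Ir L1 PL dis.
have rR : (2 : R) <= rho%:R by rewrite -[2]/(2%:R) ler_nat.
have r0 : (0 : R) < rho%:R by lra.
pose Q := (rho ^ 10)%N.
have Q2 : (2 <= Q)%N by apply: (leq_trans r2); rewrite /Q -{1}(expn1 rho) leq_exp2l.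
have QN : (Q ^ 10 <= N)%N by rewrite /Q -expnM.
have Q0 : (0 < Q)%N by exact: ltnW.
have QE : (Q%:R : R) = rho%:R ^+ 10 by rewrite natrX.
have l0 : 0 <= ln rho%:R by apply: ln_ge0; lra.
set L := 1 + ln rho%:R; have L01 : 1 <= L by rewrite /L; lra.
have lQ : 1 + ln Q%:R <= 10 * L by rewrite QE ln_exp_pow // /L -[10%:R]/(10 : R); lra.
have lQ0 : 0 <= ln Q%:R by apply: ln_ge0; rewrite ler1n.
have N0 : (0 < N)%N by apply: leq_trans rN; rewrite expn_gt0 (ltnW r2).
have NR : (0 : R) < N%:R by rewrite ltr0n.
have [s sE] : exists s : R, s = 10 * C1 * L / rho%:R ^+ 5 by eexists.
have s0 : 0 <= s by rewrite sE divr_ge0 ?exprn_ge0 ?(ltW r0) // mulr_ge0 //; lra.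
have hs a b : cn (qsum N a b) * `|1 - major N Q b| <= N%:R * s.
  have Ns0 : 0 <= N%:R * s by rewrite mulr_ge0 // ltW.
  rewrite -(ler_pXn2r (n := 2)) ?nnegrE ?mulr_ge0 ?cn_ge0 //.
  apply: (le_trans (hminor N Q a b Q2 QN)); rewrite ler_pdivrMr ?ltr0n //.
  have -> : (N%:R * s) ^+ 2 * Q%:R = 100 * (C1 * L) ^+ 2 * N%:R ^+ 2.
    by rewrite sE QE; field; rewrite gt_eqF.
  have -> : C1 * N%:R ^+ 2 * (1 + ln Q%:R) = C1 * (1 + ln Q%:R) * N%:R ^+ 2 by ring.
  rewrite ler_wpM2r ?sqr_ge0 //.
  have : C1 * (1 + ln Q%:R) <= C1 * (10 * L) by rewrite ler_wpM2l //; lra.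
  have : 1 <= C1 * L by rewrite mulr_ege1.
  rewrite expr2; set u := C1 * L; have -> : C1 * (10 * L) = 10 * u by rewrite /u; ring.
  move=> h1 h2; have : u <= u * u by rewrite ler_peMl //; lra.
  lra.
(* With Q = rho^10, T = rho and k = 15 the powers of rho are 32 - 5 for the minor part, 10 + 1 + 16
   for Parseval and 10 + 32 - 15 for the divisor moment. *)
have := @restr_core I c x y P1 P2 N Q c1 P1N P2N Q2 QN dis 15 rho s (ltnW r2) s0 hs.
set B := \sum_(n < N) _; set r : R := #|I|%:R => hB.
have rr : r <= rho%:R ^+ 16 by rewrite /r -natrX ler_nat.
have rr0 : 0 <= r by rewrite /r.
have rr2 : r ^+ 2 <= rho%:R ^+ 32.
  have -> : rho%:R ^+ 32 = (rho%:R ^+ 16) ^+ 2 :> R by rewrite -exprM.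
  by rewrite lerXn2r // nnegrE exprn_ge0 // ltW.
apply: (le_trans hB); clear hB.
have LJ : L <= L ^+ J0.+1 by rewrite exprS ler_peMr ?exprn_ege1 //; lra.
have LJ0 : 0 <= L ^+ J0.+1 by rewrite exprn_ge0 //; lra.
set Y := Lam * N%:R * rho%:R ^+ 27 * L ^+ J0.+1.
have N27 : 0 <= N%:R * rho%:R ^+ 27 :> R by rewrite mulr_ge0 ?exprn_ge0 // ltW.
have Y1 : N%:R * rho%:R ^+ 27 * L <= Y.
  have -> : Y = N%:R * rho%:R ^+ 27 * (Lam * L ^+ J0.+1) by rewrite /Y; move: (rho%:R ^+ 27) (L ^+ J0.+1) => z1 z2; ring.
  by rewrite ler_wpM2l //; apply: (le_trans LJ); rewrite ler_peMl.
have t1 : r ^+ 2 * (N%:R * s) <= 10 * C1 * Y.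
  apply: (@le_trans _ _ (10 * C1 * (N%:R * rho%:R ^+ 27 * L))).
    apply: (@le_trans _ _ (rho%:R ^+ 32 * (N%:R * s))); first by rewrite ler_wpM2r // mulr_ge0 // ltW.
    by rewrite sE le_eqVlt; apply/orP; left; apply/eqP; field; rewrite gt_eqF.
  by rewrite ler_wpM2l //; lra.
have u01 : 0 <= 2 * Q%:R / N%:R ^+ 2 * (1 + ln Q%:R) /\ 2 * Q%:R / N%:R ^+ 2 * (1 + ln Q%:R) <= 20 * L * (rho%:R ^+ 10 / N%:R ^+ 2).
  have q0 : 0 <= rho%:R ^+ 10 / N%:R ^+ 2 :> R by rewrite divr_ge0 ?exprn_ge0 // ltW.
  have -> : 2 * Q%:R / N%:R ^+ 2 * (1 + ln Q%:R) = 2 * (1 + ln Q%:R) * (rho%:R ^+ 10 / N%:R ^+ 2) by rewrite QE; ring.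
  have lQ1 : 0 <= 1 + ln Q%:R by rewrite addr_ge0.
  split; first by rewrite mulr_ge0 // mulr_ge0.
  by rewrite ler_wpM2r //; clear -lQ; lra.
have v1 : rho%:R * ((P1 * P2)%:R * r) <= Lam * N%:R ^+ 3 * rho%:R ^+ 17.
  apply: (@le_trans _ _ (rho%:R * (Lam * N%:R ^+ 3 * rho%:R ^+ 16))); last by rewrite le_eqVlt; apply/orP; left; apply/eqP; ring.
  by rewrite ler_wpM2l ?(ltW r0) //; apply: ler_pM.
have v2 : N%:R * r ^+ 2 / rho%:R ^+ 15 * (Q%:R ^+ 16 + 2 * ((N ^ 2)%:R * \prod_(j < 16) tsum j Q)) <=
   N%:R * rho%:R ^+ 17 * (N%:R ^+ 2 * ((1 + 2 * 10 ^+ J0) * L ^+ J0)).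
  apply: ler_pM.
  - by rewrite divr_ge0 ?exprn_ge0 ?(ltW r0) // mulr_ge0 ?sqr_ge0 // ltW.
  - by rewrite addr_ge0 ?exprn_ge0 // !mulr_ge0 // prodr_ge0 // => j _; exact: tsum_ge0.
  - rewrite ler_pdivrMr ?exprn_gt0 // -mulrA -exprD ler_wpM2l // ltW //.
  have a1 : Q%:R ^+ 16 <= N%:R ^+ 2 * L ^+ J0 :> R.
    have h : Q%:R ^+ 16 <= N%:R ^+ 2 :> R.
      rewrite -!natrX ler_nat; apply: (@leq_trans ((Q ^ 10) ^ 2)); last by rewrite leq_exp2r.
      by rewrite -expnM leq_pexp2l.
    by apply: (le_trans h); rewrite ler_peMr ?sqr_ge0 // exprn_ege1.
  have a2 : \prod_(j < 16) tsum j Q <= 10 ^+ J0 * L ^+ J0.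
    apply: (le_trans (hJ0 Q Q0)); rewrite -exprMn lerXn2r ?nnegrE ?addr_ge0 ?mulr_ge0 //; lra.
  rewrite natrX; have := ler_wpM2l (sqr_ge0 (N%:R : R)) a2; move: a1.
  set z := N%:R ^+ 2; set z1 := \prod_(_ < _) _; set z2 := L ^+ J0; set z3 := 10 ^+ J0; clear.
  have -> : z * ((1 + 2 * z3) * z2) = z * z2 + 2 * (z * (z3 * z2)) by ring.
  lra.
have N3 : 0 <= N%:R ^+ 3 * rho%:R ^+ 17 :> R by rewrite mulr_ge0 ?exprn_ge0 // ltW.
have v3 : rho%:R * ((P1 * P2)%:R * r) + N%:R * r ^+ 2 / rho%:R ^+ 15 * (Q%:R ^+ 16 + 2 * ((N ^ 2)%:R * \prod_(j < 16) tsum j Q)) <=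
   (1 + (1 + 2 * 10 ^+ J0)) * (Lam * (N%:R ^+ 3 * rho%:R ^+ 17) * L ^+ J0).
  rewrite [leRHS]mulrDl [1 * (Lam * _ * _)]mul1r; apply: lerD.
    apply: (le_trans v1); rewrite -mulrA ler_peMr ?exprn_ege1 // mulr_ge0 //; lra.
  apply: (le_trans v2).
  have -> : N%:R * rho%:R ^+ 17 * (N%:R ^+ 2 * ((1 + 2 * 10 ^+ J0) * L ^+ J0)) = (1 + 2 * 10 ^+ J0) * (1 * (N%:R ^+ 3 * rho%:R ^+ 17) * L ^+ J0) by ring.
  have j0 : (0 : R) <= 10 ^+ J0 by rewrite exprn_ge0.
  rewrite ler_wpM2l //; first by lra.
  by rewrite ler_wpM2r ?exprn_ge0 // ?ler_wpM2r //; lra.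
have t3 : 2 * Q%:R / N%:R ^+ 2 * (1 + ln Q%:R) * (rho%:R * ((P1 * P2)%:R * r) + N%:R * r ^+ 2 / rho%:R ^+ 15 * (Q%:R ^+ 16 + 2 * ((N ^ 2)%:R * \prod_(j < 16) tsum j Q)))
   <= 20 * (1 + (1 + 2 * 10 ^+ J0)) * Y.
  case: u01 => u0 u1; apply: (le_trans (ler_wpM2l u0 v3)).
  have Z0 : 0 <= (1 + (1 + 2 * 10 ^+ J0)) * (Lam * (N%:R ^+ 3 * rho%:R ^+ 17) * L ^+ J0).
    have j0 : (0 : R) <= 10 ^+ J0 by rewrite exprn_ge0.
    rewrite mulr_ge0 ?addr_ge0 ?mulr_ge0 ?exprn_ge0 ?(ltW r0) ?(ltW NR) //.
    by exact: le_trans L1.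
    by exact: le_trans L01.
  apply: (le_trans (ler_wpM2r Z0 u1)); rewrite /Y le_eqVlt; apply/orP; left; apply/eqP.
  rewrite [L ^+ J0.+1]exprS; field; rewrite gt_eqF //.
apply: (le_trans (lerD t1 t3)); rewrite -mulrDl.
have -> : forall z, z * Lam * N%:R * rho%:R ^+ 27 * L ^+ J0.+1 = z * Y by move=> z; rewrite /Y !mulrA.
exact: lexx.
Qed.

(** The tenth power gives room for an integral exponent: 272 = 270 + 2, the extra rho^2 absorbing
    all logarithms. *)
Lemma restriction : exists2 C : R, 1 <= C &
  forall (I : finType) (c : I -> R[i]) (x y : I -> int) (P1 P2 N rho : nat) (Lam : R),
  (forall i, cn (c i) <= 1) -> (N <= P1)%N -> (3 * N ^ 2 <= P2)%N ->
  (2 <= rho)%N -> (rho ^ 100 <= N)%N -> (#|I| <= rho ^ 16)%N -> 1 <= Lam ->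
  (P1 * P2)%:R <= Lam * N%:R ^+ 3 ->
  (forall i j, (P1%:Z %| x i - x j)%Z -> (P2%:Z %| y i - y j)%Z -> i = j) ->
  (\sum_(n < N) cn (\sum_i c i * e ((x i)%:~R / P1%:R * n%:R + (y i)%:~R / P2%:R * n%:R ^+ 2)) ^+ 2) ^+ 10 <=
  C * Lam ^+ 10 * N%:R ^+ 10 * rho%:R ^+ 272.
Proof.
have [C [J [C1 h]]] := restriction_log; have [D D1 hD] := ln_pow_le (J * 5).
exists (C ^+ 10 * D ^+ 2); first by rewrite mulr_ege1 // exprn_ege1.
move=> I c x y P1 P2 N rho Lam c1 P1N P2N r2 rN Ir L1 PL dis.
have := h I c x y P1 P2 N rho Lam c1 P1N P2N r2 rN Ir L1 PL dis.
set B := \sum_(n < N) _ => hB.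
have r1 : (1 : R) <= rho%:R by rewrite ler1n; clear -r2; lia.
have l0 : 0 <= 1 + ln rho%:R by have := ln_ge0 r1; lra.
have B0 : 0 <= B by rewrite sumr_ge0 // => n _; exact: sqr_ge0.
have V0 : 0 <= C * Lam * N%:R * rho%:R ^+ 27 * (1 + ln rho%:R) ^+ J by exact: le_trans hB.
apply: (@le_trans _ _ ((C * Lam * N%:R * rho%:R ^+ 27 * (1 + ln rho%:R) ^+ J) ^+ 10)).
  by rewrite lerXn2r ?nnegrE.
have -> : (C * Lam * N%:R * rho%:R ^+ 27 * (1 + ln rho%:R) ^+ J) ^+ 10 =
   C ^+ 10 * Lam ^+ 10 * N%:R ^+ 10 * rho%:R ^+ 270 * ((1 + ln rho%:R) ^+ (J * 5)) ^+ 2.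
  have -> : ((1 + ln rho%:R) ^+ (J * 5)) ^+ 2 = ((1 + ln rho%:R) ^+ J) ^+ 10 by rewrite -!exprM -mulnA.
  have -> : rho%:R ^+ 270 = (rho%:R ^+ 27) ^+ 10 :> R by rewrite -exprM.
  by move: (rho%:R ^+ 27) ((1 + ln rho%:R) ^+ J) => z1 z2; rewrite !exprMn.
have -> : C ^+ 10 * D ^+ 2 * Lam ^+ 10 * N%:R ^+ 10 * rho%:R ^+ 272 = C ^+ 10 * Lam ^+ 10 * N%:R ^+ 10 * rho%:R ^+ 270 * (D * rho%:R) ^+ 2.
  rewrite exprMn (_ : 272 = 270 + 2)%N // exprD; ring.
have C0 : 0 <= C by exact: le_trans C1.
have La0 : 0 <= Lam by exact: le_trans L1.
have D0 : 0 <= D by exact: le_trans D1.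
have K0 : 0 <= C ^+ 10 * Lam ^+ 10 * N%:R ^+ 10 * rho%:R ^+ 270 by rewrite !mulr_ge0 // exprn_ge0.
apply: ler_wpM2l => //; rewrite lerXn2r ?nnegrE ?exprn_ge0 ?mulr_ge0 //.
exact: hD.
Qed.

(** * Moments and level sets of exponential sums *)

Definition fsum (N : nat) (g : nat -> R[i]) (P1 P2 : nat) (a b : int) : R[i] :=
  \sum_(n < N) g n * e (a%:~R / P1%:R * n%:R + b%:~R / P2%:R * n%:R ^+ 2).

Lemma fsum_le N g P1 P2 a b : (forall n, (n < N)%N -> cn (g n) <= 1) -> cn (fsum N g P1 P2 a b) <= N%:R.
Proof.
move=> g1; apply: (le_trans (cn_sum _ _ _)); rewrite -[leRHS]mulr1 -sum_const_ord.
by apply: ler_sum => n _; rewrite cnM cn_e mulr1 g1.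
Qed.

Lemma card_pair (A B : finType) (Q : A -> pred B) :
  #|[pred p : A * B | Q p.1 p.2]| = (\sum_a #|Q a|)%N.
Proof.
rewrite -sum1_card -(pair_big_dep xpredT Q (fun _ _ => 1%N)) /=.
by apply: eq_bigr => a _; rewrite sum1_card.
Qed.

Lemma sum_cube (I : finType) (F : I -> R[i]) :
  (\sum_i F i) * (\sum_i F i) * (\sum_i F i) = \sum_x \sum_y \sum_z F x * F y * F z.
Proof.
rewrite !mulr_suml; apply: eq_bigr => x _; rewrite [F x * _]mulr_sumr mulr_suml.
by apply: eq_bigr => y _; rewrite mulr_sumr.
Qed.

Section SixthMoment.
Variable N : nat.
Let T := ('I_N * 'I_N * 'I_N)%type.
Definition tsum1 (t : T) : int := t.1.1%:Z + t.1.2%:Z + t.2%:Z.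
Definition tsum2 (t : T) : int := t.1.1%:Z ^+ 2 + t.1.2%:Z ^+ 2 + t.2%:Z ^+ 2.
Definition sol6 (p : T * T) : bool := (tsum1 p.1 == tsum1 p.2) && (tsum2 p.1 == tsum2 p.2).
Definition J3 : nat := #|[pred p | sol6 p]|.
Let uu (t : T) : int := (t.1.1%:Z - t.2%:Z) * (t.1.2%:Z - t.2%:Z).
Let base (p : T * T) : T := (p.1.1.1, p.1.1.2, p.2.2).
Let pp (p : T * T) : int := p.1.2%:Z - p.2.1.1%:Z.
Let qq (p : T * T) : int := p.1.2%:Z - p.2.1.2%:Z.

(* The identity u1 u2 = (x3 - y1)(x3 - y2), u_i = x_i - y3, makes the sixth moment a divisor problem. *)
Lemma sol6_uu p : sol6 p -> uu (base p) = pp p * qq p.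
Proof.
case: p => [[[x1 x2] x3] [[y1 y2] y3]]; rewrite /sol6 /uu /pp /qq /tsum1 /tsum2 /=.
move=> /andP[/eqP h1 /eqP h2].
have h3 : x3%:Z = y1%:Z + y2%:Z + y3%:Z - x1%:Z - x2%:Z by rewrite -h1; ring.
move: h2; rewrite h3; move: (x1%:Z) (x2%:Z) (y1%:Z) (y2%:Z) (y3%:Z); clear => a b c d f h.
set X := c + d + f - a - b in h *.
have h2 : 2 * ((a - f) * (b - f) - (X - c) * (X - d)) = (c ^+ 2 + d ^+ 2 + f ^+ 2) - (a ^+ 2 + b ^+ 2 + X ^+ 2) by rewrite /X; ring.
by move: h2; rewrite h subrr; clear; lia.
Qed.

(** The linear equation recovers x3 from x1, x2, y3 and the sum of the two differences x3 - y1 and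
    x3 - y2; the differences then give y1 and y2. *)
Lemma sol6_det p q : sol6 p -> sol6 q -> base p = base q -> pp p = pp q -> qq p = qq q -> p = q.
Proof.
case: p => [[[x1 x2] x3] [[y1 y2] y3]]; case: q => [[[x1' x2'] x3'] [[y1' y2'] y3']].
rewrite /sol6 /base /pp /qq /tsum1 /tsum2 /= => /andP[/eqP h1 _] /andP[/eqP h2 _] [? ? ?] hp hq; subst.
have e3 : x3 = x3' by apply: val_inj => /=; clear -h1 h2 hp hq; lia.
have e1 : y1 = y1' by apply: val_inj => /=; move: hp; rewrite e3; clear; lia.
have e2 : y2 = y2' by apply: val_inj => /=; move: hq; rewrite e3; clear; lia.
by rewrite e1 e2 e3.
Qed.

Lemma uu_le t : (`|uu t| <= N ^ 2)%N.
Proof.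
case: t => [[a b] d]; rewrite /uu /= abszM expnS expn1.
move: (ltn_ord a) (ltn_ord b) (ltn_ord d); move: (nat_of_ord a) (nat_of_ord b) (nat_of_ord d).
by clear => x y z hx hy hz; apply: leq_mul; lia.
Qed.

(** Fix the base (x1, x2, y3). If u1 u2 is nonzero, then x3 - y1 is one of at most 2D signed
    divisors of it. If it vanishes, the base is one of at most 2 N^2, one of the differences x3 -
    y1, x3 - y2 is 0, and the solution is determined by x3 and by whether the former vanishes. *)
Lemma J3_le (D : nat) : (forall n, (0 < n <= N ^ 2)%N -> (tau n n <= D)%N) ->
  (J3 <= N ^ 3 * (2 * D) + 4 * N ^ 3)%N.
Proof.
move=> hD; have -> : J3 = (#|[pred p | sol6 p & uu (base p) != 0]| + #|[pred p | sol6 p & uu (base p) == 0]|)%N.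
  rewrite /J3 -(cardID [pred p | uu (base p) != 0] [pred p | sol6 p]).
  by congr (_ + _)%N; apply: eq_card => p; rewrite !inE ?negbK andbC.
apply: leq_add.
  pose Q (t : T) : pred (bool * 'I_(N ^ 2)) := fun sd => (uu t != 0) && (sd.2.+1 %| `|uu t|)%N.
  have hQ : (#|[pred p : T * (bool * 'I_(N ^ 2)) | Q p.1 p.2]| <= N ^ 3 * (2 * D))%N.
    rewrite card_pair; apply: (@leq_trans (\sum_(t : T) 2 * D)); last by rewrite sum_nat_const !card_prod !card_ord -!mulnA.
    apply: leq_sum => t _; rewrite /Q; have [u0|u0] := eqVneq (uu t) 0; first by rewrite eq_card0.
    have un := uu_le t.
    have -> : #|[pred sd : bool * 'I_(N ^ 2) | true && (sd.2.+1 %| `|uu t|)%N]| = (2 * tau (N ^ 2) `|uu t|)%N.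
      by rewrite -(card_bool) -[RHS]cardX; apply: eq_card => -[s d]; rewrite !inE.
    rewrite leq_mul2l /= tau_eq ?hD //; by rewrite lt0n absz_eq0 u0.
  apply: leq_trans hQ.
  have [z0|N0] := posnP (N ^ 2).
    have Nz : N = 0%N by apply/eqP; move/eqP: z0; rewrite expn_eq0 andbT.
    rewrite eq_card0 // => -[[[x1 x2] x3] y]; have := ltn_ord x1; by rewrite {2}Nz.
  have Npos : (0 < N)%N by move: N0; rewrite expn_gt0 orbF.
  have le12 : (0 < N)%N -> (N <= N ^ 2)%N by clear; case: N => // n _; rewrite -{1}(expn1 n.+1) leq_pexp2l.
  (* The divisor is stored as its sign and its absolute value less one; [pb] shows that the default
     of [insubd] is not reached on the set in question. *)
  pose f (p : T * T) : T * (bool * 'I_(N ^ 2)) := (base p, (0 <= pp p, insubd (Ordinal N0) (`|pp p|%N.-1))).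
  have pb p : sol6 p -> uu (base p) != 0 -> [/\ pp p != 0, (`|pp p| %| `|uu (base p)|)%N & (`|pp p|.-1 < N ^ 2)%N].
    move=> sp up; have hu := sol6_uu sp; split.
    - by apply: contraNneq up => p0; rewrite hu p0 mul0r.
    - by rewrite hu abszM dvdn_mulr.
    have : (`|pp p| <= N)%N by rewrite /pp; have := ltn_ord p.1.2; have := ltn_ord p.2.1.1; clear; lia.
    move=> hp; apply: (@leq_trans N); last exact: le12.
    by move: hp Npos; clear; lia.
  rewrite -(card_in_imset (f := f) (D := [pred p | sol6 p & uu (base p) != 0])).
    apply: subset_leq_card; apply/subsetP => z /imsetP[p pin ->]; move: pin; rewrite !inE => /andP[sp up].
    have [p0 pd pl] := pb p sp up; rewrite /Q /f /= up /= val_insubd pl prednK // lt0n absz_eq0 //.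
  move=> p q; rewrite !inE => /andP[sp up] /andP[sq uq] [hb1 hb2 hb3 hs hd].
  have [p0 pd pl] := pb p sp up; have [q0 qd ql] := pb q sq uq.
  have hv := congr1 val hd; rewrite /= !val_insubd pl ql in hv.
  have hb : base p = base q by rewrite /base hb1 hb2 hb3.
  have pq : pp p = pp q by move: hs hv p0 q0; clear; lia.
  by apply: sol6_det => //; apply: (mulfI p0); rewrite -(sol6_uu sp) hb (sol6_uu sq) pq.
pose Q (t : T) : pred (bool * 'I_N) := fun sd => (uu t == 0).
have hQ : (#|[pred p : T * (bool * 'I_N) | Q p.1 p.2]| <= 4 * N ^ 3)%N.
  rewrite card_pair; apply: (@leq_trans (\sum_(t : T) ((t.1.1 == t.2) + (t.1.2 == t.2)) * (2 * N))).
    apply: leq_sum => t _; rewrite /Q /uu mulf_eq0 !subr_eq0.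
    have c2 : #|{: bool * 'I_N}| = (2 * N)%N by rewrite card_prod card_bool card_ord.
    have e1 (i j : 'I_N) : (i%:Z == j%:Z) = (i == j) by rewrite eqz_nat.
    rewrite !e1; case: (t.1.1 == t.2) => /=; first by rewrite -c2 -[leqLHS]mul1n leq_mul // max_card.
    case: (t.1.2 == t.2) => /=; first by rewrite -c2 -[leqLHS]mul1n leq_mul // max_card.
    by rewrite eq_card0.
  rewrite -big_distrl /= big_split /=.
  have s1 : (\sum_(t : T) (t.1.1 == t.2) <= N ^ 2)%N.
    rewrite -(pair_bigA _ (fun (ab : 'I_N * 'I_N) c => (ab.1 == c : nat))) /=.
    apply: (@leq_trans (\sum_(ab : 'I_N * 'I_N) 1)); last by rewrite sum1_card card_prod card_ord.
    apply: leq_sum => ab _; rewrite (bigD1 ab.1) //= eqxx big1 // => c; rewrite eq_sym => /negbTE ->. by [].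
  have s2 : (\sum_(t : T) (t.1.2 == t.2) <= N ^ 2)%N.
    rewrite -(pair_bigA _ (fun (ab : 'I_N * 'I_N) c => (ab.2 == c : nat))) /=.
    apply: (@leq_trans (\sum_(ab : 'I_N * 'I_N) 1)); last by rewrite sum1_card card_prod card_ord.
    apply: leq_sum => ab _; rewrite (bigD1 ab.2) //= eqxx big1 // => c; rewrite eq_sym => /negbTE ->. by [].
  apply: leq_trans (leq_mul (leq_add s1 s2) (leqnn (2 * N))) _; rewrite expnS; move: (N ^ 2)%N; clear => n; nia.
apply: leq_trans hQ.
pose f (p : T * T) : T * (bool * 'I_N) := (base p, (pp p == 0, p.1.2)).
rewrite -(card_in_imset (f := f) (D := [pred p | sol6 p & uu (base p) == 0])).
  by apply: subset_leq_card; apply/subsetP => z /imsetP[p pin ->]; move: pin; rewrite !inE => /andP[sp up].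
have lin p : sol6 p -> (p.1.1.1%:Z - p.2.2%:Z) + p.1.1.2%:Z - p.1.2%:Z + pp p + qq p = 0.
  case: p => [[[x1 x2] x3] [[y1 y2] y3]]; rewrite /sol6 /pp /qq /tsum1 /= => /andP[/eqP h _].
  by move: h; clear; lia.
move=> p q; rewrite !inE => /andP[sp /eqP up] /andP[sq /eqP uq] [h1 h2 h3 hs h4].
have hb : base p = base q by rewrite /base h1 h2 h3.
have lp := lin p sp; have lq := lin q sq; rewrite h1 h2 h3 h4 in lp.
have zp := sol6_uu sp; have zq := sol6_uu sq; rewrite up in zp; rewrite uq in zq.
have [pq qp] : pp p = pp q /\ qq p = qq q.
  move: hs zp zq lp lq; move: (pp p) (pp q) (qq p) (qq q) => a b c d.
  case: (eqVneq a 0) => [->|a0]; case: (eqVneq b 0) => [->|b0] // _.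
    by clear; lia.
  move=> z1 z2; have c0 : c = 0 by move/esym/eqP: z1; rewrite mulf_eq0 (negbTE a0) => /eqP.
  have d0 : d = 0 by move/esym/eqP: z2; rewrite mulf_eq0 (negbTE b0) => /eqP.
  by rewrite c0 d0; clear; lia.
exact: sol6_det.
Qed.

Lemma sixth_moment (g : nat -> R[i]) (P1 P2 : nat) : (forall n, (n < N)%N -> cn (g n) <= 1) ->
  (3 * N <= P1)%N -> (3 * N ^ 2 <= P2)%N -> (0 < N)%N ->
  \sum_(a < P1) \sum_(b < P2) cn (fsum N g P1 P2 a b) ^+ 6 <= (P1 * P2)%:R * J3%:R.
Proof.
move=> g1 P1N P2N N0.
have p1 : (0 < P1)%N by apply: leq_trans P1N; rewrite muln_gt0.
have p2 : (0 < P2)%N by apply: leq_trans P2N; rewrite muln_gt0 expn_gt0 N0.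
pose c (t : T) := g t.1.1 * g t.1.2 * g t.2.
have E a b : cn (fsum N g P1 P2 a b) ^+ 6 =
  cn (\sum_t c t * e ((tsum1 t)%:~R * a%:~R / P1%:R + (tsum2 t)%:~R * b%:~R / P2%:R)) ^+ 2.
  rewrite -[6%N]/(3 * 2)%N exprM -cnX; congr (cn _ ^+ 2).
  set h := fun n : 'I_N => g n * e (a%:~R / P1%:R * n%:R + b%:~R / P2%:R * n%:R ^+ 2).
  have -> : fsum N g P1 P2 a b ^+ 3 = (\sum_n h n) * (\sum_n h n) * (\sum_n h n) by rewrite /fsum -/h; ring.
  rewrite -(pair_bigA _ (fun (ab : 'I_N * 'I_N) (z : 'I_N) => c (ab, z) * e ((tsum1 (ab, z))%:~R * a%:~R / P1%:R + (tsum2 (ab, z))%:~R * b%:~R / P2%:R))) /=.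
  rewrite -(pair_bigA _ (fun (x y : 'I_N) => \sum_(z < N) c ((x, y), z) * e ((tsum1 ((x, y), z))%:~R * a%:~R / P1%:R + (tsum2 ((x, y), z))%:~R * b%:~R / P2%:R))) /=.
  rewrite sum_cube; apply: eq_bigr => x _; apply: eq_bigr => y _; apply: eq_bigr => z _; rewrite /h /c /= /tsum1 /tsum2 /=.
  rewrite !intrD -!natrX -![(_%:Z)%:~R]/(_%:R : R) !natrX.
  set ex := e (_ * x%:R + _); set ey := e (_ * y%:R + _); set ez := e (_ * z%:R + _).
  have -> : g x * ex * (g y * ey) * (g z * ez) = g x * g y * g z * (ex * ey * ez) by ring.
  rewrite /ex /ey /ez -!eD; congr (_ * e _); rewrite ?rmorphXn /=; ring.
under eq_bigr => a _ do under eq_bigr => b _ do rewrite E.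
have := grid_parseval c tsum1 tsum2 p1 p2 => hP.
set S := \sum_(a < P1) _ in hP *.
have S0 : 0 <= S by apply: sumr_ge0 => a _; apply: sumr_ge0 => b _; exact: sqr_ge0.
have -> : S = cn S%:C by rewrite cn_real ger0_norm.
rewrite hP cnM cn_nat ler_wpM2l //.
apply: (le_trans (cn_sum _ _ _)).
rewrite /J3 (card_pair (fun t u => sol6 (t, u))) natr_sum; apply: ler_sum => t _.
apply: (le_trans (cn_sum _ _ _)); rewrite -sum1_card natr_sum big_mkcond [leRHS]big_mkcond; apply: ler_sum => u _ /=.
have ct v : cn (c v) <= 1.
  by rewrite /c !cnM !mulr_ile1 ?cn_ge0 ?mulr_ge0 ?cn_ge0 ?g1 // ltn_ord.
case: ifP => [/andP[d1 d2]|_]; last by rewrite cn0; case: ifP.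
have b1 v : 0 <= tsum1 v < (3 * N)%N%:Z.
  rewrite /tsum1; have := ltn_ord v.1.1; have := ltn_ord v.1.2; have := ltn_ord v.2; clear; lia.
have sq (n : 'I_N) : 0 <= n%:Z ^+ 2 < (N ^ 2)%N%:Z.
  by rewrite expr2 -PoszM ltz_nat expnS expn1 ltn_mul // ltn_ord.
have b2 v : 0 <= tsum2 v < (3 * N ^ 2)%N%:Z.
  rewrite /tsum2; have := sq v.1.1; have := sq v.1.2; have := sq v.2; clear; lia.
have e1 : tsum1 t - tsum1 u = 0 by apply: (dvdz_small d1); have := b1 t; have := b1 u; move: P1N; clear; lia.
have e2 : tsum2 t - tsum2 u = 0 by apply: (dvdz_small d2); have := b2 t; have := b2 u; move: P2N; clear; lia.
have h1 : tsum1 t = tsum1 u by apply/eqP; rewrite -subr_eq0 e1.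
have h2 : tsum2 t = tsum2 u by apply/eqP; rewrite -subr_eq0 e2.
have -> : (u \in (fun u0 : T => sol6 (t, u0))) = true by rewrite unfold_in /sol6 /= h1 h2 !eqxx.
by rewrite cnM cn_cj mulr_ile1 ?cn_ge0.
Qed.
End SixthMoment.

(** A bound N^eps is expressed by taking powers: the 4k-th power of the divisor function at
    arguments up to N^2 costs N^4, hence its k-th power costs N. *)
Lemma J3_bound k : (0 < k)%N -> exists2 C : R, 1 <= C & forall N, (0 < N)%N -> ((J3 N)%:R / N%:R ^+ 3) ^+ k <= C * N%:R :> R.
Proof.
move=> k0; have [C C0 hC] := tau_bound (4 * k).
exists (6 ^+ k * (1 + C)) => [|N N0].
  by rewrite mulr_ege1 ?exprn_ege1 //; [rewrite ler1n|lra].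
have NR : (1 : R) <= N%:R by rewrite ler1n.
pose D := \max_(n < (N ^ 2).+1) tau n n.
have hD n : (0 < n <= N ^ 2)%N -> (tau n n <= D)%N.
  by move=> /andP[_ h]; apply: (@leq_bigmax _ (fun n : 'I_(N ^ 2).+1 => tau n n) (Ordinal (h : (n < (N ^ 2).+1)%N))).
have D1 : (1 <= D)%N by apply: leq_trans (hD 1%N _); rewrite ?expn_gt0 ?N0 //; apply/card_gt0P; exists ord0.
have Dk : D%:R ^+ k <= (1 + C) * N%:R :> R.
  have [n nE] : exists n : 'I_(N ^ 2).+1, D = tau n n.
    by case: (@bigop.eq_bigmax _ (fun n : 'I_(N ^ 2).+1 => tau n n)) => [|n hn]; [rewrite card_ord|exists n].
  have n0 : (0 < n)%N.
    by case: posnP => // z; move: D1; rewrite nE z; have := tau_leQ 0 0; clear; lia.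
  have h1 := hC n n0; rewrite -nE mulnC exprM in h1.
  have h2 : (D%:R ^+ k) ^+ 4 <= ((1 + C) * N%:R) ^+ 4 :> R.
    have C1 : 1 <= 1 + C by rewrite lerDl ltW.
    have hn : (n%:R : R) <= N%:R ^+ 2 by rewrite -natrX ler_nat -ltnS ltn_ord.
    apply: (le_trans h1); rewrite exprMn; apply: ler_pM; [exact: ltW|exact: sqr_ge0| |].
      apply: (@le_trans _ _ (1 + C)); first by rewrite lerDr.
      by rewrite exprS ler_peMr ?exprn_ege1 //; exact: le_trans C1.
    have -> : N%:R ^+ 4 = (N%:R ^+ 2) ^+ 2 :> R by rewrite -exprM.
    by rewrite lerXn2r // nnegrE // sqr_ge0.
  by rewrite -(ler_pXn2r (n := 4)) // nnegrE ?exprn_ge0 // mulr_ge0 //; lra.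
have N3 : 0 < N%:R ^+ 3 :> R by rewrite exprn_gt0 //; lra.
have hJ : (J3 N)%:R / N%:R ^+ 3 <= 6 * D%:R :> R.
  rewrite ler_pdivrMr // -natrX -[6]/(6%:R) -!natrM ler_nat; apply: (leq_trans (J3_le hD)).
  have : (N ^ 3 <= D * N ^ 3)%N by rewrite leq_pmull.
  clear; lia.
apply: (@le_trans _ _ ((6 * D%:R) ^+ k)).
  by rewrite lerXn2r // nnegrE ?divr_ge0 ?mulr_ge0 // ltW.
by rewrite exprMn -mulrA ler_wpM2l // exprn_ge0.
Qed.

Lemma cauchy_schwarz (I : finType) (a b : I -> R) :
  (\sum_i a i * b i) ^+ 2 <= (\sum_i a i ^+ 2) * (\sum_i b i ^+ 2).
Proof.
have h : 0 <= \sum_i \sum_j (a i * b j - a j * b i) ^+ 2.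
  by apply: sumr_ge0 => i _; apply: sumr_ge0 => j _; exact: sqr_ge0.
have e1 : (\sum_i a i ^+ 2) * (\sum_i b i ^+ 2) = \sum_i \sum_j a i ^+ 2 * b j ^+ 2.
  by rewrite mulr_suml; apply: eq_bigr => i _; rewrite mulr_sumr.
have e2 : (\sum_i a i ^+ 2) * (\sum_i b i ^+ 2) = \sum_i \sum_j a j ^+ 2 * b i ^+ 2.
  by rewrite e1 exchange_big.
have e3 : (\sum_i a i * b i) ^+ 2 = \sum_i \sum_j (a i * b i) * (a j * b j).
  by rewrite expr2 mulr_suml; apply: eq_bigr => i _; rewrite mulr_sumr.
have e4 : \sum_i \sum_j (a i * b j - a j * b i) ^+ 2 =
  (\sum_i \sum_j a i ^+ 2 * b j ^+ 2 + \sum_i \sum_j a j ^+ 2 * b i ^+ 2) - 2 * \sum_i \sum_j (a i * b i) * (a j * b j).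
  rewrite mulr_sumr -big_split -sumrB /=; apply: eq_bigr => i _.
  rewrite mulr_sumr -big_split -sumrB /=; apply: eq_bigr => j _; ring.
move: h; rewrite e4 -e1 -e2 -e3; set u := _ * _; set v := _ ^+ 2; clear; lra.
Qed.

Lemma subset_of_card (T : finType) (S : {set T}) (k : nat) : (k <= #|S|)%N ->
  exists2 S' : {set T}, S' \subset S & #|S'| = k.
Proof.
move=> kS; exists [set x in take k (enum S)].
  by apply/subsetP => x; rewrite inE => /mem_take; rewrite mem_enum.
rewrite cardsE (card_uniqP _) ?take_uniq ?enum_uniq // size_take -cardE.
by case: ltngtP kS => // ->.
Qed.

(** Fine enough for orthogonality in the sixth moment, yet with only O(N^3) points, so that sums
    over the grid behave like integrals over the torus multiplied by N^3. *)
Definition grid_ok (Lam : R) (N P1 P2 : nat) :=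
  [/\ (0 < N)%N, (6 * N <= P1)%N, (6 * N ^ 2 <= P2)%N & (P1 * P2)%:R <= Lam * N%:R ^+ 3].

(** With c the conjugate phases of the F(p), the sum of the |F(p)| is the pairing of g with the dual
    exponential sum, and Cauchy-Schwarz brings in the restriction estimate. The weights g enter
    through their energy alone, which is what the increment step needs. *)
Lemma large_values_dual : exists2 C : R, 1 <= C &
  forall (N P1 P2 rho : nat) (Lam : R) (g : nat -> R[i]) (S : {set 'I_P1 * 'I_P2}),
  grid_ok Lam N P1 P2 -> 1 <= Lam -> (2 <= rho)%N -> (rho ^ 100 <= N)%N -> (#|S| <= rho ^ 16)%N ->
  (\sum_(p in S) cn (fsum N g P1 P2 p.1 p.2)) ^+ 20 <=
  C * Lam ^+ 10 * (\sum_(n < N) cn (g n) ^+ 2) ^+ 10 * N%:R ^+ 10 * rho%:R ^+ 272.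
Proof.
have [C C1 hC] := restriction; exists C => // N P1 P2 rho Lam g S [N0 P1N P2N PL] L1 r2 rN Sr.
pose I := 'I_#|S|; pose pt (i : I) : 'I_P1 * 'I_P2 := enum_val i.
pose x (i : I) : int := (pt i).1%:Z; pose y (i : I) : int := (pt i).2%:Z.
pose F i := fsum N g P1 P2 (x i) (y i).
pose c i : R[i] := cj (F i) * ((cn (F i))^-1)%:C.
have c1 i : cn (c i) <= 1.
  rewrite /c cnM cn_cj cn_real ger0_norm ?invr_ge0 ?cn_ge0 //.
  by have [->|h] := eqVneq (cn (F i)) 0; rewrite ?mul0r // divff.
have cF i : (cn (F i))%:C = F i * c i.
  rewrite /c mulrA -cn_sqC -realCM; congr (_%:C).
  by have [->|h] := eqVneq (cn (F i)) 0; [rewrite expr0n mul0r|rewrite expr2 mulfK].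
have dis i j : (P1%:Z %| x i - x j)%Z -> (P2%:Z %| y i - y j)%Z -> i = j.
  move=> h1 h2; have e1 := dvdz_small h1; have e2 := dvdz_small h2.
  have l1 := ltn_ord (pt i).1; have l2 := ltn_ord (pt j).1; have l3 := ltn_ord (pt i).2; have l4 := ltn_ord (pt j).2.
  have e3 : (pt i).1 = (pt j).1 by apply: val_inj => /=; move: l1 l2 e1; rewrite /x; clear; lia.
  have e4 : (pt i).2 = (pt j).2 by apply: val_inj => /=; move: l3 l4 e2; rewrite /y; clear; lia.
  by apply: enum_val_inj; rewrite -/(pt i) -/(pt j) [LHS]surjective_pairing e3 e4 -surjective_pairing.
have q1 : (N <= P1)%N by move: P1N; clear; lia.
have q2 : (3 * N ^ 2 <= P2)%N by move: P2N; clear; lia.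
have Ir : (#|{: I}| <= rho ^ 16)%N by rewrite card_ord.
have := hC I c x y P1 P2 N rho Lam c1 q1 q2 r2 rN Ir L1 PL dis.
set B := \sum_(n < N) _ => hB.
have sE : \sum_(p in S) cn (fsum N g P1 P2 p.1 p.2) = \sum_(i : I) cn (F i) by rewrite big_enum_val.
set A := \sum_(n < N) cn (g n) ^+ 2.
have main : (\sum_(i : I) cn (F i)) ^+ 2 <= A * B.
  pose G (n : 'I_N) := \sum_i c i * e ((x i)%:~R / P1%:R * n%:R + (y i)%:~R / P2%:R * n%:R ^+ 2).
  apply: le_trans (cauchy_schwarz (fun n : 'I_N => cn (g n)) (fun n => cn (G n))).
  have s0 : 0 <= \sum_(i : I) cn (F i) by apply: sumr_ge0 => i _; exact: cn_ge0.
  have t0 : 0 <= \sum_(n < N) cn (g n) * cn (G n) by apply: sumr_ge0 => i _; rewrite mulr_ge0 ?cn_ge0.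
  rewrite lerXn2r ?nnegrE // -[leLHS]ger0_norm // -cn_real real_sumC.
  have -> : \sum_(i : I) (cn (F i))%:C = \sum_(n < N) g n * G n.
    under eq_bigr => i _ do rewrite cF /F /fsum mulr_suml.
    rewrite exchange_big; apply: eq_bigr => n _; rewrite mulr_sumr; apply: eq_bigr => i _.
    by rewrite -mulrA [e _ * _]mulrC.
  by apply: (le_trans (cn_sum _ _ _)); apply: ler_sum => n _; rewrite cnM.
have A0 : 0 <= A by apply: sumr_ge0 => n _; exact: sqr_ge0.
have B0 : 0 <= B by apply: sumr_ge0 => n _; exact: sqr_ge0.
rewrite sE -[20%N]/(2 * 10)%N exprM.
apply: (@le_trans _ _ ((A * B) ^+ 10)); first by rewrite lerXn2r ?nnegrE ?sqr_ge0 // mulr_ge0.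
rewrite exprMn; apply: (le_trans (ler_wpM2l (exprn_ge0 10 A0) hB)).
rewrite le_eqVlt; apply/orP; left; apply/eqP; move: (A ^+ 10) (Lam ^+ 10) (N%:R ^+ 10) (rho%:R ^+ 272) => z1 z2 z3 z4; ring.
Qed.

(* Level sets at height [N / 2 ^ j] have at most [C grow ^ j] elements; that [grow < 2 ^ 7] makes the seventh moment converge. *)
Definition grow : R := (8 / 5) ^+ 10.

Lemma grow_bounds : [/\ 96 <= grow, grow <= 112 & 2 ^+ 20 <= grow ^+ 3].
Proof.
have e4 : 655 / 100 <= (8 / 5) ^+ 4 :> R /\ (8 / 5) ^+ 4 <= 656 / 100 :> R by rewrite !exprS expr0; split; lra.
have e5 : 104 / 10 <= (8 / 5) ^+ 5 :> R /\ (8 / 5) ^+ 5 <= 105 / 10 :> R by case: e4 => h1 h2; rewrite exprS; split; lra.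
have e10 : grow = ((8 / 5) ^+ 5) ^+ 2 by rewrite /grow -exprM.
split.
- by rewrite e10; case: e5 => h1 h2; rewrite expr2; move: h1 h2; set t := _ ^+ 5; clear; nra.
- by rewrite e10; case: e5 => h1 h2; rewrite expr2; move: h1 h2; set t := _ ^+ 5; clear; nra.
have -> : grow ^+ 3 = ((8 / 5) ^+ 3) ^+ 10 by rewrite /grow -!exprM.
have -> : 2 ^+ 20 = (2 ^+ 2) ^+ 10 :> R by rewrite -exprM.
rewrite lerXn2r ?nnegrE ?exprn_ge0 // ?divr_ge0 //; by rewrite !exprS expr0; lra.
Qed.

(** Applied to rho^16 points of the set, duality gives rho^48 <= D 2^(20 j), since 16 times 20 is
    272 + 48. For the least rho violating this the set has fewer than rho^16 elements, and rho^48 is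
    still comparable with 2^(20 j) <= [grow]^(3 j). The lower bound on N guarantees rho^100 <= N. *)
Lemma level_set_bound (Lam : R) : 1 <= Lam -> exists2 C : R, 1 <= C &
  forall (N P1 P2 j : nat) (g : nat -> R[i]) (S : {set 'I_P1 * 'I_P2}),
  grid_ok Lam N P1 P2 -> (forall n, (n < N)%N -> cn (g n) <= 1) -> C * 2 ^+ (60 * j) <= N%:R ->
  (forall p, p \in S -> N%:R <= cn (fsum N g P1 P2 p.1 p.2) * 2 ^+ j) ->
  #|S|%:R <= C * grow ^+ j.
Proof.
move=> L1; have [C0 C01 hC] := large_values_dual.
pose D := C0 * Lam ^+ 10; have D1 : 1 <= D by rewrite mulr_ege1 // exprn_ege1.
have [E EE] : exists E : R, E = 2 ^+ 48 * D by eexists.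
have E1 : 1 <= E by rewrite EE mulr_ege1 // exprn_ege1 // ler1n.
exists (E ^+ 3) => [|N P1 P2 j g S ok g1 jN hS]; first by rewrite exprn_ege1.
have [N0 _ _ _] := ok; have NR : (0 : R) < N%:R by rewrite ltr0n.
have D2j : 1 <= D * 2 ^+ (20 * j) by rewrite mulr_ege1 // exprn_ege1 // ler1n.
have key : exists2 rho : nat, (2 <= rho)%N & D * 2 ^+ (20 * j) < rho%:R ^+ 48 <= E * 2 ^+ (20 * j).
  pose P (r : nat) := D * 2 ^+ (20 * j) < r.+2%:R ^+ 48 :> R.
  have exP : exists r, P r.
    exists (Num.bound (D * 2 ^+ (20 * j))); rewrite /P.
    have b0 : 0 <= D * 2 ^+ (20 * j) by exact: le_trans D2j.
    apply: (lt_le_trans (archi_boundP b0)); set m := Num.bound _.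
    apply: (@le_trans _ _ m.+2%:R); first by rewrite ler_nat; clear; lia.
    by rewrite exprS ler_peMr // exprn_ege1 // ler1n.
  case: (ex_minnP exP) => r Pr minr; exists r.+2 => //; apply/andP; split; first exact: Pr.
  have E20 : E * 2 ^+ (20 * j) = 2 ^+ 48 * (D * 2 ^+ (20 * j)) by rewrite EE mulrA.
  case: r Pr minr => [|r] Pr minr; first by rewrite E20 ler_peMr // exprn_ge0.
  have nP : ~~ P r by apply/negP => /minr; rewrite ltnn.
  rewrite /P -leNgt in nP; rewrite E20; apply: (@le_trans _ _ (2 ^+ 48 * r.+2%:R ^+ 48)); last by rewrite ler_wpM2l // exprn_ge0.
  rewrite -exprMn lerXn2r ?nnegrE ?mulr_ge0 // -[2]/(2%:R) -natrM ler_nat; clear; lia.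
case: key => rho r2 /andP[r_gt r_le].
have rR : (1 : R) <= rho%:R by rewrite ler1n; exact: ltnW.
have rN : (rho ^ 100 <= N)%N.
  rewrite -(ler_nat R) natrX; apply: (@le_trans _ _ (rho%:R ^+ 144)); first by rewrite ler_weXn2l.
  have -> : rho%:R ^+ 144 = (rho%:R ^+ 48) ^+ 3 :> R by rewrite -exprM.
  apply: le_trans jN; have -> : E ^+ 3 * 2 ^+ (60 * j) = (E * 2 ^+ (20 * j)) ^+ 3.
    by rewrite exprMn -exprM mulnAC.
  by rewrite lerXn2r ?nnegrE ?exprn_ge0 // mulr_ge0 ?exprn_ge0 // (le_trans ler01 E1).
have cS : (#|S| < rho ^ 16)%N.
  rewrite ltnNge; apply/negP => /subset_of_card [S' S'S cS'].
  have := hC N P1 P2 rho Lam g S' ok L1 r2 rN; rewrite cS' leqnn => /(_ isT).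
  set Z := \sum_(p in S') _ => hZ.
  have Zlow : rho%:R ^+ 16 * (N%:R / 2 ^+ j) <= Z.
    rewrite -natrX -cS' -sum1_card natr_sum mulr_suml; apply: ler_sum => p pS'.
    by rewrite mul1r ler_pdivrMr ?exprn_gt0 // hS // (subsetP S'S).
  have gN : \sum_(n < N) cn (g n) ^+ 2 <= N%:R.
    rewrite -[leRHS]mulr1 -sum_const_ord; apply: ler_sum => n _.
    by rewrite expr_le1 ?cn_ge0 // g1.
  have g0 : 0 <= \sum_(n < N) cn (g n) ^+ 2 by apply: sumr_ge0 => n _; exact: sqr_ge0.
  have low0 : 0 <= rho%:R ^+ 16 * (N%:R / 2 ^+ j) :> R by rewrite mulr_ge0 ?divr_ge0 ?exprn_ge0.
  have h1 : (rho%:R ^+ 16 * (N%:R / 2 ^+ j)) ^+ 20 <= D * N%:R ^+ 10 * N%:R ^+ 10 * rho%:R ^+ 272.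
    apply: le_trans (le_trans _ hZ) _; first by rewrite lerXn2r ?nnegrE // (le_trans low0).
    rewrite -/D; do 2 (apply: ler_wpM2r; first by rewrite exprn_ge0).
    by rewrite ler_wpM2l ?(le_trans ler01 D1) // lerXn2r ?nnegrE.
  have h2 : (rho%:R ^+ 16 * (N%:R / 2 ^+ j)) ^+ 20 = rho%:R ^+ 48 * rho%:R ^+ 272 * N%:R ^+ 20 / 2 ^+ (20 * j) :> R.
    rewrite [(20 * j)%N]mulnC exprM; move: (2 ^+ j) (rho%:R : R) (N%:R : R) => u a n; clear.
    by rewrite exprMn expr_div_n -exprM -exprD mulrA.
  have p2 : 0 < 2 ^+ (20 * j) :> R by rewrite exprn_gt0.
  have pN : 0 < N%:R ^+ 20 :> R by rewrite exprn_gt0.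
  have pr : 0 < rho%:R ^+ 272 :> R by rewrite exprn_gt0 // (lt_le_trans ltr01).
  have h3 : D * N%:R ^+ 10 * N%:R ^+ 10 * rho%:R ^+ 272 = D * rho%:R ^+ 272 * N%:R ^+ 20.
    by rewrite -[D * _ * _]mulrA -exprD mulrAC.
  move: h1; rewrite h2 h3 ler_pdivrMr // => h1.
  move: r_gt h1 pN pr; move: (rho%:R ^+ 48 : R) (rho%:R ^+ 272 : R) (N%:R ^+ 20 : R) (2 ^+ (20 * j) : R); clear.
  move=> u v w z h1 h2 w0 v0; move: h2; rewrite -[u * v * w]mulrA -[D * v * w]mulrA [_ * (v * w) * z]mulrAC.
  by rewrite ler_pM2r ?mulr_gt0 // => h3; have := lt_le_trans h1 h3; rewrite ltxx.
have [b96 _ b3] := grow_bounds.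
have h3 : #|S|%:R ^+ 3 <= (E ^+ 3 * grow ^+ j) ^+ 3.
  apply: (@le_trans _ _ (rho%:R ^+ 48)).
    have -> : rho%:R ^+ 48 = (rho%:R ^+ 16) ^+ 3 :> R by rewrite -exprM.
    by rewrite lerXn2r ?nnegrE ?exprn_ge0 // -natrX ler_nat ltnW.
  apply: (le_trans r_le); rewrite exprMn; apply: ler_pM; rewrite ?exprn_ge0 ?(le_trans ler01 E1) //.
    by rewrite -exprM exprS ler_peMr ?exprn_ege1 // (le_trans ler01 E1).
  move: b96 b3; move: grow; clear => G b96 b3; rewrite exprAC exprM.
  have G3 : 0 <= G ^+ 3 by rewrite exprn_ge0 // (le_trans _ b96).
  have b0 : 0 <= 2 ^+ 20 :> R by rewrite exprn_ge0.
  by rewrite lerXn2r ?nnegrE.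
rewrite -(ler_pXn2r (n := 3)) // nnegrE // mulr_ge0 ?exprn_ge0 ?(le_trans ler01 E1) //.
by rewrite divr_ge0.
Qed.

(** Here 128 = 2^7: level j contributes about [ratio]^j to a normalised seventh moment. *)
Definition ratio : R := grow / 128.

(** Level sets are under control up to the last j0 with C0 2^(60 j0) <= N. Beyond it the sixth
    moment takes over: its divisor loss N^(1/120) is about 2^(j0 / 2), which is below ([grow] /
    64)^j0. The levels from j0 up to height i are then added one at a time. *)
Lemma tail_bound (Lam : R) : 1 <= Lam -> exists2 C : R, 1 <= C &
  forall (N P1 P2 i : nat) (g : nat -> R[i]),
  grid_ok Lam N P1 P2 -> (forall n, (n < N)%N -> cn (g n) <= 1) -> C * 2 ^+ (60 * i) <= N%:R ->
  \sum_(p : 'I_P1 * 'I_P2 | cn (fsum N g P1 P2 p.1 p.2) * 2 ^+ i <= N%:R)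
     (cn (fsum N g P1 P2 p.1 p.2) / N%:R) ^+ 7 <= C * ratio ^+ i.
Proof.
move=> L1; have [C0 C01 hlev] := level_set_bound L1.
have [C1 C11 hJ] := @J3_bound 120 isT.
have [b96 b112 _] := grow_bounds.
have [W WE] : exists W : R, W = C1 * C0 * 2 ^+ 60 by eexists.
have W1 : 1 <= W by rewrite WE; apply: mulr_ege1; [exact: mulr_ege1|rewrite exprn_ege1 // ler1n].
have ra0 : 0 <= ratio by rewrite /ratio divr_ge0 //; lra.
have ra1 : ratio <= 7 / 8 by rewrite /ratio; lra.
(* As [ratio] <= 7/8, the second summand makes C3 [ratio] + C0 [grow] <= C3, which closes the
   descending induction; the first covers its base. *)
pose C3 := Lam * W + C0 * (8 * grow).
have C3C0 : C0 <= C3.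
  rewrite /C3; have : C0 * 1 <= C0 * (8 * grow) by rewrite ler_wpM2l //; lra.
  have : 0 <= Lam * W by rewrite mulr_ge0 //; lra.
  by rewrite mulr1; lra.
exists C3 => [|N P1 P2 i g ok g1 iN]; first by apply: le_trans C3C0.
have [N0 P1N P2N PL] := ok; have NR : (0 : R) < N%:R by rewrite ltr0n.
pose X (p : 'I_P1 * 'I_P2) := cn (fsum N g P1 P2 p.1 p.2).
have X0 p : 0 <= X p by exact: cn_ge0.
have XN0 p : 0 <= X p / N%:R by rewrite divr_ge0.
pose A (i : nat) := \sum_(p | X p * 2 ^+ i <= N%:R) (X p / N%:R) ^+ 7.
rewrite -/(A i).
have iN0 : C0 * 2 ^+ (60 * i) <= N%:R by apply: le_trans iN; rewrite ler_wpM2r // exprn_ge0.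
have [j0 j0N jmax] : exists2 j0, C0 * 2 ^+ (60 * j0) <= N%:R & forall j, C0 * 2 ^+ (60 * j) <= N%:R -> (j <= j0)%N.
  have bd j : C0 * 2 ^+ (60 * j) <= N%:R -> (j <= N)%N.
    move=> h; rewrite -(ler_nat R); apply: le_trans h; apply: (@le_trans _ _ (2 ^+ (60 * j))).
      by rewrite -natrX ler_nat (leq_trans (ltnW (ltn_expl j (isT : 1 < 2)%N))) // leq_exp2l // leq_pmull.
    by rewrite ler_peMl // exprn_ge0.
  have ex : exists j, C0 * 2 ^+ (60 * j) <= N%:R by exists i.
  by case: (ex_maxnP ex bd) => j h1 h2; exists j.
have step j : (j < j0)%N -> A j <= A j.+1 + C0 * grow * ratio ^+ j.
  move=> jj; have jN : C0 * 2 ^+ (60 * j.+1) <= N%:R.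
    by apply: le_trans j0N; rewrite ler_wpM2l ?(le_trans ler01 C01) // ler_weXn2l ?ler1n // leq_mul2l.
  pose S := [set p | N%:R <= X p * 2 ^+ j.+1].
  have cS : #|S|%:R <= C0 * grow ^+ j.+1.
    by apply: (hlev N P1 P2 j.+1 g S ok g1 jN) => p; rewrite inE.
  apply: (@le_trans _ _ (A j.+1 + #|S|%:R * (2 ^+ (7 * j))^-1)); last first.
    rewrite lerD2l; have p7 : 0 < 2 ^+ (7 * j) :> R by rewrite exprn_gt0.
    rewrite ler_pdivrMr // -[leRHS]mulrA /ratio expr_div_n [2 ^+ (7 * j)]exprM.
    have -> : 2 ^+ 7 = 128 :> R by rewrite !exprS expr0; lra.
    rewrite divfK; last by rewrite gt_eqF // exprn_gt0.
    by rewrite -mulrA -exprS.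
  rewrite -sum1_card natr_sum mulr_suml /A big_mkcond [X in _ <= X + _]big_mkcond [X in _ <= _ + X]big_mkcond -big_split.
  apply: ler_sum => p _ /=; rewrite inE mul1r.
  have v0 : 0 <= (X p / N%:R) ^+ 7 by rewrite exprn_ge0.
  have i0 : 0 <= (2 ^+ (7 * j))^-1 :> R by rewrite invr_ge0 exprn_ge0.
  case: (lerP (X p * 2 ^+ j.+1) N%:R) => h1.
    by apply: (@le_trans _ _ ((X p / N%:R) ^+ 7)); [case: ifP|rewrite lerDl; case: ifP].
  rewrite (ltW h1) add0r; case: ifP => // h2.
  have : X p / N%:R <= (2 ^+ j)^-1 by rewrite ler_pdivrMr // mulrC ler_pdivlMr ?exprn_gt0.
  move=> h3; rewrite mulnC exprM -exprVn.
  by rewrite lerXn2r ?nnegrE // invr_ge0 exprn_ge0.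
have base : A j0 <= Lam * W * ratio ^+ j0.
  have P1N' : (3 * N <= P1)%N by move: P1N; clear; lia.
  have P2N' : (3 * N ^ 2 <= P2)%N by move: P2N; clear; lia.
  have six := sixth_moment g1 P1N' P2N' N0.
  have a1 : A j0 <= (2 ^+ j0)^-1 * (Lam * ((J3 N)%:R / N%:R ^+ 3)).
    apply: (@le_trans _ _ (\sum_p (2 ^+ j0)^-1 * (X p / N%:R) ^+ 6)).
      rewrite /A big_mkcond; apply: ler_sum => p _; case: ifP => h.
        rewrite exprS ler_wpM2r ?exprn_ge0 // ler_pdivrMr // mulrC ler_pdivlMr ?exprn_gt0 //.
      by rewrite mulr_ge0 ?invr_ge0 ?exprn_ge0.
    rewrite -mulr_sumr ler_wpM2l ?invr_ge0 ?exprn_ge0 //.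
    have -> : \sum_p (X p / N%:R) ^+ 6 = (\sum_(a < P1) \sum_(b < P2) cn (fsum N g P1 P2 a b) ^+ 6) / N%:R ^+ 6.
      rewrite pair_bigA mulr_suml; apply: eq_bigr => p _; by rewrite expr_div_n.
    rewrite ler_pdivrMr ?exprn_gt0 //; apply: (le_trans six).
    have -> : Lam * ((J3 N)%:R / N%:R ^+ 3) * N%:R ^+ 6 = Lam * N%:R ^+ 3 * (J3 N)%:R.
      by field; rewrite gt_eqF.
    by rewrite ler_wpM2r.
  have N60 : N%:R <= C0 * 2 ^+ 60 * 2 ^+ (60 * j0).
    rewrite -mulrA -exprD -mulnS leNgt; apply/negP => /ltW /jmax; by rewrite ltnn.
  have g64 : 1 <= grow / 64 by lra.
  have a2 : (J3 N)%:R / N%:R ^+ 3 <= W * (grow / 64) ^+ j0.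
    have J0 : 0 <= (J3 N)%:R / N%:R ^+ 3 :> R by rewrite divr_ge0 ?exprn_ge0.
    have r0 : 0 <= W * (grow / 64) ^+ j0 by rewrite mulr_ge0 ?exprn_ge0 ?(le_trans ler01) //.
    rewrite -(ler_pXn2r (n := 120)) //.
    apply: (le_trans (hJ N N0)); apply: (@le_trans _ _ (W * 2 ^+ (60 * j0))).
      have C1ge0 : 0 <= C1 by exact: le_trans C11.
      have := ler_wpM2l C1ge0 N60; rewrite WE !mulrA; apply.
    rewrite exprMn; apply: ler_pM; rewrite ?exprn_ge0 ?(le_trans ler01 W1) //.
      by rewrite exprS ler_peMr ?exprn_ege1 // (le_trans ler01 W1).
    rewrite -exprM [(j0 * 120)%N]mulnC -[120%N]/(2 * 60)%N -mulnA [X in _ <= X]exprM lerXn2r ?nnegrE ?sqr_ge0 //.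
    have : 3 / 2 <= grow / 64 by lra.
    by rewrite expr2; set z := grow / 64; clear; nra.
  apply: (le_trans a1); apply: (@le_trans _ _ ((2 ^+ j0)^-1 * (Lam * (W * (grow / 64) ^+ j0)))).
    by rewrite ler_wpM2l ?invr_ge0 ?exprn_ge0 // ler_wpM2l // (le_trans ler01 L1).
  have -> : ratio ^+ j0 = (2 ^+ j0)^-1 * (grow / 64) ^+ j0.
    by rewrite -exprVn -exprMn /ratio; congr (_ ^+ _); field.
  by rewrite !mulrA; move: (_^-1) ((grow / 64) ^+ j0) => z1 z2; rewrite le_eqVlt; apply/orP; left; apply/eqP; ring.
have down d : (d <= j0)%N -> A (j0 - d)%N <= C3 * ratio ^+ (j0 - d).
  elim: d => [|d IH] dj.
    rewrite subn0; apply: (le_trans base); rewrite ler_wpM2r ?exprn_ge0 // /C3 lerDl mulr_ge0 //; lra.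
  have jE : (j0 - d = (j0 - d.+1).+1)%N by move: dj; clear; lia.
  have := IH (ltnW dj); rewrite jE; set j := (j0 - d.+1)%N => hj.
  apply: (le_trans (step j _)); first by rewrite /j; move: dj; clear; lia.
  apply: (le_trans (lerD hj (lexx _))); rewrite exprS mulrA -mulrDl ler_wpM2r ?exprn_ge0 //.
  have : C3 * ratio <= C3 * (7 / 8) by rewrite ler_wpM2l // (le_trans _ C3C0) // (le_trans ler01).
  have : C0 * (8 * grow) <= C3 by rewrite /C3 lerDr mulr_ge0 //; lra.
  by clear; lra.
have ij : (i <= j0)%N by exact: jmax.
by have := down (j0 - i)%N (leq_subr _ _); rewrite subKn.
Qed.

Lemma full_moment_bound (Lam : R) : 1 <= Lam -> exists2 C : R, 1 <= C &
  forall (N P1 P2 s : nat) (g : nat -> R[i]), (7 <= s)%N ->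
  grid_ok Lam N P1 P2 -> (forall n, (n < N)%N -> cn (g n) <= 1) ->
  \sum_(p : 'I_P1 * 'I_P2) cn (fsum N g P1 P2 p.1 p.2) ^+ s <= C * N%:R ^+ s.
Proof.
move=> L1; have [C C1 hC] := tail_bound L1; exists (C + Lam * C ^+ 3).
  by rewrite (le_trans C1) // lerDl mulr_ge0 ?exprn_ge0 //; lra.
move=> N P1 P2 s g s7 ok g1; have [N0 _ _ PL] := ok; have NR : (0 : R) < N%:R by rewrite ltr0n.
have x1 (p : 'I_P1 * 'I_P2) : cn (fsum N g P1 P2 p.1 p.2) / N%:R <= 1.
  by rewrite ler_pdivrMr // mul1r fsum_le.
have x0 (p : 'I_P1 * 'I_P2) : 0 <= cn (fsum N g P1 P2 p.1 p.2) / N%:R by rewrite divr_ge0 ?cn_ge0.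
rewrite -ler_pdivrMr ?exprn_gt0 // mulr_suml.
under eq_bigr => p _ do rewrite -expr_div_n.
have C0 : 0 <= C by exact: le_trans C1.
have La0 : 0 <= Lam by exact: le_trans L1.
have [CN|CN] := lerP C N%:R; last first.
  apply: (@le_trans _ _ (\sum_(p : 'I_P1 * 'I_P2) 1)); first by apply: ler_sum => p _; rewrite exprn_ile1.
  rewrite sumr_const card_prod !card_ord; apply: (le_trans PL).
  apply: (@le_trans _ _ (Lam * C ^+ 3)); last by rewrite lerDr.
  by rewrite ler_wpM2l // lerXn2r ?nnegrE // ltW.
apply: (@le_trans _ _ C); last by rewrite lerDl mulr_ge0 ?exprn_ge0.
have := hC N P1 P2 0%N g ok g1; rewrite muln0 expr0 mulr1 => /(_ CN) h; apply: le_trans h.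
rewrite [leRHS]big_mkcond; apply: ler_sum => p _; rewrite mulr1 fsum_le // ler_wiXn2l //.
Qed.

(** * Simultaneous quadratic recurrence *)

(** The condition C <= eta^4 Y makes the error Y (1 + ln Y) in Weyl's bound negligible, so the first
    estimate bounds q by eta^(-2). Put Z = Y^2 |b - a/q|: for Z <= 1 this bound on q suffices, and
    for Z > 1 the second estimate with ln(1 + Z)^2 <= C (1 + Z) bounds q^2 eta^4 Z. *)
Lemma weyl_inverse : exists2 C : R, 1 <= C & forall (Y : nat) (b al eta : R), 0 < eta -> eta <= 1 ->
  C <= eta ^+ 4 * Y%:R -> eta * Y%:R <= cn (qsum Y al b) ->
  exists r : nat, [/\ (0 < r)%N, r%:R * eta ^+ 2 <= C & dst (r%:R * b) * (eta ^+ 4 * Y%:R ^+ 2) <= C].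
Proof.
have [C0 C01 hW] := weyl_bound_ex; have [C1 C11 hL] := ln_pow_le 2.
have P1 : 1 <= C0 ^+ 2 * C1 by rewrite mulr_ege1 // exprn_ege1.
have P2 : C0 <= C0 ^+ 2 * C1.
  by rewrite expr2 -mulrA ler_peMr ?mulr_ege1 //; lra.
exists (8 * (C0 ^+ 2 * C1)) => [|Y b al eta e0 e1 eY hS]; first by lra.
have Y0 : (0 < Y)%N.
  by case: posnP eY => // ->; rewrite mulr0; lra.
have YR : (1 : R) <= Y%:R by rewrite ler1n.
have [q [a [/andP[q0 _] cqa hk /(_ al) [h1 h2]]]] := hW Y b Y0.
have qR : (1 : R) <= q%:R by rewrite ler1n.
set S := cn _ in hS h1 h2; set kap := `|_| in hk h2.
have S2 : eta ^+ 2 * Y%:R ^+ 2 <= S ^+ 2.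
  by rewrite -exprMn lerXn2r ?nnegrE ?cn_ge0 // mulr_ge0 //; lra.
have e2 : 0 < eta ^+ 2 by rewrite exprn_gt0.
have e21 : eta ^+ 2 <= 1 by rewrite expr_le1 // ltW.
have e4 : eta ^+ 4 = (eta ^+ 2) ^+ 2 by rewrite -exprM.
have lnY := ln_ge0 YR.
have small : 2 * (C0 * Y%:R * (1 + ln Y%:R)) <= eta ^+ 2 * Y%:R ^+ 2.
  have h3 := hL _ YR.
  have h4 : (2 * (C0 * (1 + ln Y%:R))) ^+ 2 <= (eta ^+ 2 * Y%:R) ^+ 2.
    rewrite [leRHS]exprMn -e4 (_ : eta ^+ 4 * Y%:R ^+ 2 = eta ^+ 4 * Y%:R * Y%:R); last by rewrite expr2 mulrA.
    apply: (@le_trans _ _ (8 * (C0 ^+ 2 * C1) * Y%:R)); last by rewrite ler_wpM2r.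
    move: h3; set L := 1 + ln _ => h3.
    have : C0 ^+ 2 * L ^+ 2 <= C0 ^+ 2 * (C1 * Y%:R) by rewrite ler_wpM2l // sqr_ge0.
    have : 0 <= C0 ^+ 2 * L ^+ 2 by rewrite mulr_ge0 ?sqr_ge0.
    have -> : (2 * (C0 * L)) ^+ 2 = 4 * (C0 ^+ 2 * L ^+ 2) by ring.
    by rewrite -[8 * _ * _]mulrA -[C0 ^+ 2 * C1 * _]mulrA; move: (C0 ^+ 2 * L ^+ 2) (C0 ^+ 2 * _) => u v; clear; lra.
  have t1 : 0 <= 2 * (C0 * (1 + ln Y%:R)) by rewrite !mulr_ge0 //; lra.
  have t2 : 0 <= eta ^+ 2 * Y%:R by rewrite mulr_ge0 // ltW.
  have h5 : 2 * (C0 * (1 + ln Y%:R)) <= eta ^+ 2 * Y%:R by rewrite -(ler_pXn2r (n := 2)).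
  rewrite expr2 [leRHS]mulrA; have := ler_wpM2r (ler0n R Y) h5; set u := _ * _ * Y%:R.
  by apply: le_trans; rewrite le_eqVlt; apply/orP; left; apply/eqP; rewrite /u; ring.
exists q; split => //.
  have : eta ^+ 2 * Y%:R ^+ 2 <= 2 * (C0 * Y%:R ^+ 2 / q%:R) by move: S2 h1 small; clear; lra.
  have Y2 : 0 < Y%:R ^+ 2 :> R by rewrite exprn_gt0 //; lra.
  rewrite mulrA ler_pdivlMr; last by lra.
  rewrite mulrAC [2 * _]mulrA ler_pM2r // mulrC => h; move: h P2 C01; clear; lra.
have dk : dst (q%:R * b) <= q%:R * kap.
  apply: (le_trans (dst_le _ a)); rewrite /kap -{2}[q%:R]ger0_norm // -normrM.
  by rewrite mulrBr mulrCA divff ?mulr1 // gt_eqF //; lra.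
have t4 : 0 <= eta ^+ 4 * Y%:R ^+ 2 by rewrite mulr_ge0 // exprn_ge0 // ltW.
apply: (le_trans (ler_wpM2r t4 dk)).
have [bE|bE] := eqVneq b (a%:~R / q%:R).
  by rewrite /kap bE subrr normr0 mulr0 mul0r; lra.
have {}h2 := h2 bE.
have k0 : 0 < kap by rewrite /kap normr_gt0 subr_eq0.
set Z := Y%:R ^+ 2 * kap in h2.
have Z0 : 0 < Z by rewrite mulr_gt0 // exprn_gt0 //; lra.
have -> : q%:R * kap * (eta ^+ 4 * Y%:R ^+ 2) = q%:R * Z * eta ^+ 4 by rewrite /Z; ring.
have qe : q%:R * eta ^+ 2 <= 2 * C0.
  have : eta ^+ 2 * Y%:R ^+ 2 <= 2 * (C0 * Y%:R ^+ 2 / q%:R) by move: S2 h1 small; clear; lra.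
  have Y2 : 0 < Y%:R ^+ 2 :> R by rewrite exprn_gt0 //; lra.
  rewrite mulrA ler_pdivlMr; last by lra.
  by rewrite mulrAC [2 * _]mulrA ler_pM2r // mulrC.
have [Z1|Z1] := lerP Z 1.
  have : q%:R * eta ^+ 2 * (Z * eta ^+ 2) <= 2 * C0 * 1.
    apply: ler_pM; rewrite ?mulr_ge0 //; try exact: ltW.
    by rewrite mulr_ile1 // ltW.
  rewrite e4 -[q%:R * Z * _]mulrA => h; have -> : q%:R * (Z * (eta ^+ 2) ^+ 2) = q%:R * eta ^+ 2 * (Z * eta ^+ 2) by ring.
  by apply: (le_trans h); move: P2 C01; clear; lra.
have h3 : eta ^+ 2 * Y%:R ^+ 2 <= 2 * (C0 / (q%:R * kap) * ln (1 + Z)) by move: S2 h2 small; clear; lra.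
have qk : 0 < q%:R * kap by rewrite mulr_gt0 //; lra.
have h4 : eta ^+ 2 * (q%:R * Z) <= 2 * C0 * ln (1 + Z).
  have := ler_wpM2r (ltW qk) h3; rewrite [leRHS](_ : _ = 2 * C0 * ln (1 + Z)); last first.
    by field; rewrite !gt_eqF //; lra.
  by apply: le_trans; rewrite le_eqVlt; apply/orP; left; apply/eqP; rewrite /Z; ring.
have l0 : 0 <= ln (1 + Z) by apply: ln_ge0; lra.
have h5 : (eta ^+ 2 * (q%:R * Z)) ^+ 2 <= (2 * C0) ^+ 2 * (C1 * (1 + Z)).
  apply: (@le_trans _ _ ((2 * C0 * ln (1 + Z)) ^+ 2)).
    by rewrite lerXn2r ?nnegrE // !mulr_ge0 //; try exact: ltW; lra.
  rewrite [leLHS]exprMn ler_wpM2l ?sqr_ge0 //.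
  have h6 : 1 <= 1 + Z by lra.
  apply: le_trans (hL _ h6); rewrite lerXn2r ?nnegrE //; lra.
have h6 : q%:R ^+ 2 * eta ^+ 4 * Z <= 8 * (C0 ^+ 2 * C1).
  rewrite -(ler_pM2r Z0) ; apply: (@le_trans _ _ ((eta ^+ 2 * (q%:R * Z)) ^+ 2)).
    by rewrite e4; move: (eta ^+ 2) => u; rewrite le_eqVlt; apply/orP; left; apply/eqP; ring.
  apply: (le_trans h5); have c0 : 0 <= C0 ^+ 2 * C1 by lra.
  have : C0 ^+ 2 * C1 * (1 + Z) <= C0 ^+ 2 * C1 * (2 * Z) by rewrite ler_wpM2l //; lra.
  by rewrite exprMn -[2 ^+ 2]/(2 * 2) -!mulrA; clear; lra.
apply: le_trans h6; rewrite mulrAC expr2 -!mulrA ler_wpM2l // ler_peMl // !mulr_ge0 // ?exprn_ge0 // ltW //.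
Qed.

Lemma quarter_gap (z u s : R) : 0 < z -> u <= z / 16 -> z / 2 <= s -> s <= u + z / 4 -> False.
Proof. lra. Qed.

Lemma eq_ler (x y : R) : x = y -> x <= y.
Proof. by move->. Qed.

Section FejerRecurrence.
Variables (K H Y : nat) (gam : nat -> 'I_K -> R).
Hypotheses (K0 : (0 < K)%N) (H0 : (0 < H)%N).
Let U := {ffun 'I_K * 'I_K -> 'I_H}.
Let sg (u : U) (k : 'I_K) : nat := (\sum_(l < K) u (k, l))%N.
Let S (m : 'I_K -> int) : R[i] := \sum_(y < Y) e (\sum_k (m k)%:~R * gam y k).
(** By [frec_prod] this is the product over k of the K-th powers of Dirichlet kernels at gam y k.
    The power K lets a single coordinate far from the integers push |G|^2 below its maximum by more
    than (K H)^K, the bound on the number of frequency vectors that occur. *)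
Let G (y : nat) : R[i] := \sum_(u : U) e (\sum_(p : 'I_K * 'I_K) gam y p.1 * (u p)%:R).

Lemma frec_sg_lt u k : (sg u k < K * H)%N.
Proof.
apply: (@leq_ltn_trans (\sum_(l < K) H.-1)).
  by apply: leq_sum => l _; rewrite -ltnS prednK.
by rewrite sum_nat_const card_ord ltn_pmul2l // prednK.
Qed.

(** The vector of sums [sg] takes at most (K H)^K values, so by Cauchy-Schwarz pairs with equal
    vectors, which give the frequency 0, form at least that proportion of all pairs. *)
Lemma frec_pairs : #|{: U}|%:R ^+ 2 <= (K * H)%:R ^+ K * #|[pred p : U * U | [forall k, sg p.1 k == sg p.2 k]]|%:R :> R.
Proof.
pose V := {ffun 'I_K -> 'I_(K * H)}.
pose s (u : U) : V := [ffun k => Ordinal (frec_sg_lt u k)].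
pose n (v : V) : nat := #|[pred u | s u == v]|.
have e1 : #|{: U}|%:R = \sum_v (n v)%:R * 1 :> R.
  rewrite -sum1_card (partition_big s xpredT) //= natr_sum.
  by apply: eq_bigr => v _; rewrite mulr1 /n -sum1_card; congr (_%:R); apply: eq_bigl => u; rewrite inE.
have := cauchy_schwarz (fun v => (n v)%:R) (fun v : V => 1); rewrite -e1 => h; apply: (le_trans h).
rewrite mulrC; have -> : \sum_(i : V) (1 : R) ^+ 2 = (K * H)%:R ^+ K.
  by rewrite (eq_bigr (fun=> 1)) => [|i _]; rewrite ?expr1n // sumr_const card_ffun !card_ord natrX.
rewrite ler_wpM2l ?exprn_ge0 //.
rewrite (card_pair (fun u u' : U => [forall k, sg u k == sg u' k])) natr_sum (partition_big s xpredT) //=.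
apply: ler_sum => v _; rewrite /n expr2 -{1}sum1_card natr_sum mulr_suml.
rewrite le_eqVlt; apply/orP; left; apply/eqP; apply: eq_big => [u|u]; rewrite inE //.
move=> /eqP <-; rewrite mul1r; congr (_%:R); apply: eq_card => u'; rewrite !unfold_in /=.
apply/eqP/forallP => [/ffunP h1 k|h1].
  by have := h1 k; rewrite !ffunE => /(congr1 val) /= ->.
by apply/ffunP => k; rewrite !ffunE; apply: val_inj => /=; rewrite (eqP (h1 k)).
Qed.

Lemma frec_prod y : G y = \prod_(p : 'I_K * 'I_K) \sum_(h < H) e (gam y p.1 * h%:R).
Proof. by rewrite bigA_distr_bigA; apply: eq_bigr => u _; rewrite e_sum. Qed.

Lemma frec_expand : \sum_(y < Y) cn (G y) ^+ 2 =
  \sum_(u : U) \sum_(u' : U) complex.Re (S (fun k => (sg u k)%:Z - (sg u' k)%:Z)).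
Proof.
have E y : (cn (G y) ^+ 2)%:C = \sum_(u : U) \sum_(u' : U) e (\sum_k ((sg u k)%:Z - (sg u' k)%:Z)%:~R * gam y k).
  rewrite /G cn_sum_sqC; apply: eq_bigr => u _; apply: eq_bigr => u' _.
  rewrite -eB; congr e.
  have P (v : U) : \sum_(p : 'I_K * 'I_K) gam y p.1 * (v p)%:R = \sum_k (sg v k)%:R * gam y k.
    rewrite (eq_bigr (fun p => gam y p.1 * (v (p.1, p.2))%:R)) => [|[k l] _] //.
    rewrite -(pair_bigA _ (fun k l => gam y k * (v (k, l))%:R)) /=.
    by apply: eq_bigr => k _; rewrite -mulr_sumr mulrC /sg natr_sum.
  rewrite !P -sumrB; apply: eq_bigr => k _; by rewrite intrB mulrBl.
transitivity (complex.Re (\sum_(y < Y) cn (G y) ^+ 2)%:C); first by [].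
rewrite real_sumC; under eq_bigr => y _ do rewrite E.
by rewrite -exchange_big3 Re_sum; apply: eq_bigr => u _; rewrite Re_sum.
Qed.

(** The sum of |G(y)|^2 is bounded in two ways. In the expansion the frequency 0 contributes Y |U|^2
    / W and all others lose at most half of it. Without a good y > 0 every term except y = 0 is at
    most |U|^2 / (4 W). The hypothesis is one-sided: a frequency may have a large sum as long as its
    real part is nonnegative. *)
Lemma fejer_recurrence (eta : R) : 0 <= eta -> eta * (2 * (K * H)%:R ^+ K) <= 1 ->
  16 * (K * H)%:R ^+ K <= Y%:R :> R ->
  (forall m : 'I_K -> int, (forall k, (`|m k| <= K * H)%N) -> 0 <= complex.Re (S m) \/ cn (S m) <= eta * Y%:R) ->
  exists2 y : nat, (0 < y < Y)%N & forall k, dst (gam y k) ^+ 2 * H%:R <= 4 * K%:R.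
Proof.
move=> eta0 etaW YW hS.
have [W WE] : exists W : R, W = (K * H)%:R ^+ K by eexists.
rewrite -WE in etaW YW.
have KH1 : (1 : R) <= (K * H)%:R by rewrite ler1n muln_gt0 K0.
have W1 : 1 <= W by rewrite WE exprn_ege1.
have W0 : 0 < W by exact: lt_le_trans W1.
have YR : (0 : R) < Y%:R by apply: lt_le_trans YW; rewrite mulr_gt0.
have Y0 : (0 < Y)%N by rewrite -(ltr0n R).
have [UU UE] : exists u : R, u = #|{: U}|%:R ^+ 2 by eexists.
have UP : 0 < UU.
  rewrite UE exprn_gt0 // ltr0n; apply/card_gt0P; exists [ffun=> Ordinal H0]; by [].
have low : Y%:R * UU / (2 * W) <= \sum_(y < Y) cn (G y) ^+ 2.
  rewrite frec_expand.
  pose np := #|[pred p : U * U | [forall k, sg p.1 k == sg p.2 k]]|.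
  apply: (@le_trans _ _ (Y%:R * np%:R - eta * Y%:R * UU)).
    have h1 : UU / W <= np%:R by rewrite ler_pdivrMr // mulrC UE WE; exact: frec_pairs.
    have h2 : eta <= (2 * W)^-1 by rewrite -[leRHS]mul1r ler_pdivlMr // mulr_gt0.
    have h3 : Y%:R * (UU / W) <= Y%:R * np%:R by rewrite ler_wpM2l.
    have h4 : eta * (Y%:R * UU) <= (2 * W)^-1 * (Y%:R * UU) by rewrite ler_wpM2r // mulr_ge0 // ltW.
    have h5 : Y%:R * (UU / W) = 2 * (Y%:R * UU / (2 * W)) by field; rewrite gt_eqF.
    by move: h3 h4; rewrite h5 [_^-1 * _]mulrC mulrA; clear; lra.
  rewrite UE expr2 {1}/np (card_pair (fun u u' : U => [forall k, sg u k == sg u' k])) natr_sum mulr_sumr.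
  have cU : #|{: U}|%:R = \sum_(u' : U) (1 : R) by rewrite -sum1_card natr_sum.
  rewrite {1}cU mulr_suml mulr_sumr -sumrB; apply: ler_sum => u _.
  rewrite mul1r cU -sum1_card natr_sum !mulr_sumr.
  rewrite big_mkcond -sumrB; apply: ler_sum => u' _; rewrite !mulr1 unfold_in /=.
  have m1 k : (`|(sg u k)%:Z - (sg u' k)%:Z| <= K * H)%N.
    by have := frec_sg_lt u k; have := frec_sg_lt u' k; clear; lia.
  have eY : 0 <= eta * Y%:R by rewrite mulr_ge0.
  case: ifP => [/forallP hk|_].
    have -> : S (fun k => (sg u k)%:Z - (sg u' k)%:Z) = (Y%:R : R)%:C.
      rewrite /S (eq_bigr (fun=> 1)) => [|y _].
        by rewrite sumr_const card_ord real_natC.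
      rewrite big1 ?e0 // => k _; by rewrite (eqP (hk k)) subrr mul0r.
    by rewrite /= lerBlDr lerDl.
  rewrite sub0r; have [h|h] := hS _ m1; first by apply: le_trans h; rewrite oppr_le0.
  by rewrite lerNl; apply: le_trans h; apply: (le_trans _ (Re_le_cn _)); rewrite -normrN ler_norm.
have [y hy|none] := pickP [pred y : 'I_Y | (0 < y)%N && [forall k, dst (gam y k) ^+ 2 * H%:R <= 4 * K%:R]].
  by case/andP: hy => y0 /forallP hk; exists y => //; rewrite y0 ltn_ord.
exfalso.
have KR : (1 : R) <= K%:R by rewrite ler1n.
have HR : (1 : R) <= H%:R by rewrite ler1n.
have Uc : #|{: U}|%:R = (H%:R ^+ K) ^+ K :> R by rewrite card_ffun card_prod !card_ord natrX exprM.
have g1 y k : cn (\sum_(h < H) e (gam y k * h%:R)) <= H%:R.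
  by apply: (le_trans (cn_sum _ _ _)); rewrite -[leRHS]mulr1 -sum_const_ord; apply: ler_sum => h _; rewrite cn_e.
have GE y : cn (G y) ^+ 2 = (\prod_(k < K) cn (\sum_(h < H) e (gam y k * h%:R)) ^+ 2) ^+ K.
  rewrite frec_prod cn_prod -(pair_bigA _ (fun (k l : 'I_K) => cn (\sum_(h < H) e (gam y k * h%:R)))) /=.
  under eq_bigr => k _ do rewrite prodr_const card_ord.
  by rewrite !prodrXl -!exprM mulnC.
have up y : (0 < y)%N -> (y < Y)%N -> cn (G y) ^+ 2 <= UU / (4 * W).
  move=> y0 yY; have := none (Ordinal yY); rewrite /= y0 /= => /negbT; rewrite negb_forall => /existsP[k].
  rewrite -ltNge => hk; rewrite GE.
  have hk2 : cn (\sum_(h < H) e (gam y k * h%:R)) ^+ 2 <= H%:R / (4 * K%:R).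
    rewrite ler_pdivlMr ?mulr_gt0 ?(lt_le_trans ltr01 KR) //.
    have := geom_sum_dst (gam y k) H; move: hk; set t := cn _; set d := dst _ => hk td.
    have t0 : 0 <= t by exact: cn_ge0.
    have d0 : 0 <= d by exact: dst_ge0.
    have td2 : (t * d) ^+ 2 <= 1 by rewrite expr_le1 // mulr_ge0.
    apply: (@le_trans _ _ (t ^+ 2 * (d ^+ 2 * H%:R))); first by rewrite ler_wpM2l ?sqr_ge0 // ltW.
    by rewrite mulrA -exprMn ler_piMl.
  have : \prod_(k < K) cn (\sum_(h < H) e (gam y k * h%:R)) ^+ 2 <= (H%:R ^+ K) ^+ 2 / (4 * (K * H)%:R).
    rewrite (bigD1 k) //=.
    apply: (@le_trans _ _ (H%:R / (4 * K%:R) * \prod_(i < K | i != k) H%:R ^+ 2)).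
      apply: ler_pM => //; first exact: sqr_ge0.
        by apply: prodr_ge0 => i _; exact: sqr_ge0.
      apply: ler_prod => i _; rewrite sqr_ge0 /= lerXn2r ?nnegrE ?cn_ge0 //.
    have -> : \prod_(i < K | i != k) (H%:R : R) ^+ 2 = (H%:R ^+ 2) ^+ K.-1.
      by rewrite prodr_const; congr (_ ^+ _); rewrite (cardC1 k) card_ord.
    have -> : (H%:R ^+ K) ^+ 2 = H%:R ^+ 2 * (H%:R ^+ 2) ^+ K.-1 :> R by rewrite -exprM mulnC exprM -exprS prednK.
    move: (_ ^+ K.-1) => z; rewrite natrM le_eqVlt; apply/orP; left; apply/eqP; field.
    by rewrite !gt_eqF // (lt_le_trans ltr01).
  set P := \prod_(k < K) _ => hP.
  have P0 : 0 <= P by apply: prodr_ge0 => i _; exact: sqr_ge0.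
  have b0 : 0 <= (H%:R ^+ K) ^+ 2 / (4 * (K * H)%:R) :> R by rewrite divr_ge0 ?sqr_ge0 // mulr_ge0.
  apply: (@le_trans _ _ (((H%:R ^+ K) ^+ 2 / (4 * (K * H)%:R)) ^+ K)); first by rewrite lerXn2r ?nnegrE.
  rewrite expr_div_n UE Uc -!exprM [(K * 2)%N]mulnC mulnA [(K * 2 * K)%N]mulnAC.
  rewrite -[(2 * K * K)%N]mulnA [(2 * (K * K))%N]mulnC ler_wpM2l ?exprn_ge0 // lef_pV2 ?posrE ?exprn_gt0 ?mulr_gt0 ?(lt_le_trans ltr01 KH1) //.
  by rewrite exprMn -WE ler_wpM2r ?(le_trans ler01 W1) // -{1}(expr1 4) ler_weXn2l // ler1n.
have upper : \sum_(y < Y) cn (G y) ^+ 2 <= UU + Y%:R * (UU / (4 * W)).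
  rewrite [X in X + _](_ : UU = \sum_(y < Y) (if nat_of_ord y == 0%N then UU else 0)); last first.
    by rewrite (bigD1 (Ordinal Y0)) //= big1 ?addr0 // => i; rewrite -val_eqE /= => /negbTE ->.
  rewrite -sum_const_ord -big_split; apply: ler_sum => y _ /=; case: eqP => [->|/eqP y0]; last first.
    by rewrite add0r up // lt0n.
  rewrite -[leLHS]addr0 lerD //; last by rewrite divr_ge0 ?mulr_ge0 // ltW.
  rewrite UE lerXn2r ?nnegrE ?cn_ge0 //; apply: (le_trans (cn_sum _ _ _)).
  by rewrite -sum1_card natr_sum; apply: ler_sum => u _; rewrite cn_e.
move: low upper; have : UU <= Y%:R * UU / (16 * W).
  by rewrite ler_pdivlMr ?mulr_gt0 // [Y%:R * _]mulrC ler_pM2l.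
have -> : Y%:R * UU / (16 * W) = Y%:R * UU / W / 16 by field; rewrite gt_eqF.
have -> : Y%:R * UU / (2 * W) = Y%:R * UU / W / 2 by field; rewrite gt_eqF.
have -> : Y%:R * (UU / (4 * W)) = Y%:R * UU / W / 4 by field; rewrite gt_eqF.
have : 0 < Y%:R * UU / W by rewrite divr_gt0 ?mulr_gt0.
exact: quarter_gap.
Qed.
End FejerRecurrence.

(** * Integer determinants and independent relations *)

Lemma PoszX m n : (m ^ n)%N%:Z = m%:Z ^+ n.
Proof. by elim: n => [|n IH]; rewrite ?expr0 // expnS PoszM IH exprS. Qed.

Lemma sumz_const n (c : nat) : \sum_(i < n) c%:Z = (n * c)%N%:Z.
Proof. by rewrite sumr_const card_ord -mulr_natl natz PoszM. Qed.

Lemma det_bound n (A : 'M[int]_n) (W : nat) : (forall i j, `|A i j| <= W%:Z) -> `|\det A| <= (n`! * W ^ n)%N%:Z.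
Proof.
move=> hA; apply: (le_trans (ler_norm_sum _ _ _)).
apply: (@le_trans _ _ (\sum_(s : 'S_n) (W%:Z ^+ n))); last first.
  by rewrite sumr_const card_Sn PoszM PoszX -mulr_natl natz.
apply: ler_sum => s _; rewrite normrM normrX normrN1 expr1n mul1r normr_prod.
rewrite -[X in W%:Z ^+ X]card_ord -prodr_const; apply: ler_prod => i _.
by rewrite normr_ge0 hA.
Qed.

Lemma adj_bound n (A : 'M[int]_n) (W : nat) i j : (0 < W)%N -> (forall i j, `|A i j| <= W%:Z) ->
  `|(\adj A) i j| <= (n`! * W ^ n)%N%:Z.
Proof.
move=> W0 hA; rewrite mxE /cofactor normrM normrX normrN1 expr1n mul1r.
apply: (le_trans (det_bound (W := W) _)) => [i' j'|]; first by rewrite !mxE.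
rewrite lez_nat leq_mul //; first by rewrite leq_fact // leq_pred.
by rewrite leq_pexp2l // leq_pred.
Qed.

(* Schur complement: if all bordered determinants vanish then [m] is a rational combination of the rows of [A]. *)
Lemma det_bordered (j K : nat) (A : 'M[int]_(j, K)) (f : 'I_j -> 'I_K) (m : 'rV[int]_K) (k : 'I_K) :
  let f' := (fun i : 'I_(j + 1) => match split i with inl i' => f i' | inr _ => k end) in
  \det (colsub f A) != 0 -> \det (colsub f' (col_mx A m)) = 0 ->
  \det (colsub f A) * m 0 k = (colsub f m *m \adj (colsub f A) *m A) 0 k.
Proof.
move=> f' d0; set B := colsub f A in d0 *.
have -> : colsub f' (col_mx A m) = block_mx B (col k A) (colsub f m) (col k m).
  apply/matrixP => i i'; rewrite !mxE /f'; case: (split i) => a; rewrite !mxE; case: (split i') => b; rewrite !mxE //.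
move=> hd.
pose X : 'M[int]_(j + 1) := block_mx 1%:M (- (\adj B *m col k A)) 0 (\det B)%:M.
have h : block_mx B (col k A) (colsub f m) (col k m) *m X =
  block_mx B 0 (colsub f m) (\det B *: col k m - colsub f m *m (\adj B *m col k A)).
  rewrite mulmx_block !mulmx1 !mulmx0 !addr0; congr block_mx.
    by rewrite mulmxN mulmxA mul_mx_adj mul_scalar_mx mul_mx_scalar addNr.
  by rewrite mulmxN mul_mx_scalar addrC.
have := congr1 determinant h; rewrite det_mulmx hd mul0r det_lblock => /esym/eqP.
rewrite mulf_eq0 (negbTE d0) /= det_mx11 => /eqP.
have -> : (\det B *: col k m - colsub f m *m (\adj B *m col k A)) 0 0 =
  \det B * m 0 k - (colsub f m *m \adj B *m A) 0 k.
  rewrite mulmxA [LHS]mxE [X in X + _]mxE [col k m _ _]mxE [X in _ + X]mxE; congr (_ + _).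
  rewrite mxE [in RHS]mxE; congr (- _); by apply: eq_bigr => i _; rewrite [col k A _ _]mxE.
by move/eqP; rewrite subr_eq0 => /eqP.
Qed.

Lemma Re_e_ge0 x : 8 * dst x <= 1 -> 0 <= complex.Re (e x).
Proof.
move=> h; rewrite e_nint; have := e_le_dst (x - (nint x)%:~R); rewrite -/(dst x) => h1.
have := le_trans (Re_le_cn _) (le_trans h1 h).
by rewrite ler_norml ReD -[complex.Re (- _)]/(- complex.Re (e (x - (nint x)%:~R))) -[complex.Re 1]/(1 : R) => /andP[_]; lra.
Qed.

Section QuadraticRecurrence.
Variables (C : R) (K H G : nat) (be : 'I_K -> R).
Hypothesis hC : 1 <= C.
Hypothesis weyl_inv : forall (Y : nat) (b al eta : R), 0 < eta -> eta <= 1 ->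
  C <= eta ^+ 4 * Y%:R -> eta * Y%:R <= cn (qsum Y al b) ->
  exists r : nat, [/\ (0 < r)%N, r%:R * eta ^+ 2 <= C & dst (r%:R * b) * (eta ^+ 4 * Y%:R ^+ 2) <= C].
Hypotheses (K0 : (0 < K)%N) (H0 : (0 < H)%N).
Let W := (K * H)%N.
Let B0 := (K`! * W ^ K)%N.
Hypothesis hG1 : 64 * C ^+ 2 * W%:R ^+ (6 * K) <= G%:R ^+ 2.
Hypothesis hG2 : 4 * C * W%:R ^+ (2 * K) * B0%:R <= G%:R.
Hypothesis hG3 : (8 * K ^ 2 * W * B0 ^ 2 <= G ^ 2)%N.
Hypothesis hG4 : 16 * C * W%:R ^+ (4 * K) <= G%:R.

Let lin (m : 'I_K -> int) : R := \sum_k (m k)%:~R * be k.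

(** The state of an induction on rank: j integer combinations of the be k, independent because of a
    nonzero minor, that become integers up to G^(-2 ee) after multiplication by q^2. *)
Definition relations (j q ee : nat) : Prop :=
  exists (A : 'M[int]_(j, K)) (f : 'I_j -> 'I_K),
  [/\ \det (colsub f A) != 0, forall i k, `|A i k| <= W%:Z &
      forall i, dst (q%:R ^+ 2 * lin (A i)) * G%:R ^+ (2 * ee) <= 1].

(** Suppose every m with a large Weyl sum for (q D)^2 [lin] m, D being the absolute value of the
    minor, lies in the rational span of the known rows. Then its phases are almost integral, their
    real parts are nonnegative and the Fejer recurrence succeeds. Otherwise an m outside the span
    gives, by Weyl's inverse theorem, one more independent relation for q D r in place of q. *)
Lemma relations_step (j q ee : nat) : (j <= K)%N -> (1 < ee)%N -> (0 < q)%N -> relations j q ee ->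
  (exists2 x : nat, (0 < x <= q * G ^ ee)%N & forall k, dst (x%:R ^+ 2 * be k) ^+ 2 * H%:R <= 4 * K%:R) \/
  (exists2 q' : nat, (0 < q' <= q * G)%N & relations (j + 1) q' (ee - 2)).
Proof.
move=> jK e1 q0 [A [f [d0 hA hd]]].
have W0 : (0 < W)%N by rewrite muln_gt0 K0.
have W1 : (1 : R) <= W%:R by rewrite ler1n.
have G1 : (0 < G)%N.
  rewrite -(ltr0n R); apply: lt_le_trans hG4; rewrite !mulr_gt0 ?exprn_gt0 //; first exact: lt_le_trans hC.
  exact: lt_le_trans W1.
have B01 : (0 < B0)%N by rewrite muln_gt0 fact_gt0 expn_gt0 W0.
set B := colsub f A in d0.
pose D := `|\det B|%N.
have D0 : (0 < D)%N by rewrite absz_gt0.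
have jB : (j`! * W ^ j <= B0)%N by rewrite leq_mul ?leq_pexp2l // leq_fact.
have hB i k : `|B i k| <= W%:Z by rewrite mxE.
have DB : (D <= B0)%N by apply: leq_trans jB; rewrite -lez_nat abszE det_bound.
have DB' : (D%:R : R) <= B0%:R by rewrite ler_nat.
pose Y := (G ^ ee.-1)%N.
have YR : (Y%:R : R) = G%:R ^+ ee.-1 by rewrite natrX.
have GR : (1 : R) <= G%:R by rewrite ler1n.
have G0 : (0 : R) < G%:R by rewrite ltr0n.
have GY : (G%:R : R) <= Y%:R.
  rewrite YR -{1}(expr1 G%:R) ler_weXn2l //; move: e1; clear; lia.
pose eta : R := (2 * W%:R ^+ K)^-1.
have WK : 1 <= W%:R ^+ K :> R by rewrite exprn_ege1.
have eta0 : 0 < eta by rewrite invr_gt0 mulr_gt0 // (lt_le_trans ltr01).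
have eta1 : eta <= 1 by rewrite invf_le1 ?mulr_gt0 ?(lt_le_trans ltr01 WK) // mulr_ege1 // ler1n.
have C0 : 0 <= C by exact: le_trans hC.
have eta4 : C <= eta ^+ 4 * Y%:R.
  rewrite exprVn mulrC ler_pdivlMr ?exprn_gt0 ?mulr_gt0 ?(lt_le_trans ltr01 WK) //.
  apply: le_trans GY; apply: le_trans hG4; rewrite exprMn -exprM [(K * 4)%N]mulnC.
  by apply: eq_ler; move: (W%:R ^+ _) => z; ring.
pose b (m : 'I_K -> int) : R := (q * D)%N%:R ^+ 2 * lin m.
(* Membership of m in the rational row space of A, with denominators cleared by Cramer's rule; if it
   fails, some bordered minor is nonzero. *)
pose res (m : 'I_K -> int) := [forall k, \det B * m k == (colsub f (\row_k m k) *m \adj B *m A) 0 k].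
have [[m [mW mS mres]]|nobad] := boolp.pselect (exists m : 'I_K -> int,
    [/\ forall k, (`|m k| <= W)%N, eta * Y%:R <= cn (qsum Y 0 (b m)) & ~~ res m]).
  right; have [r [r0 r1 r2]] := weyl_inv eta0 eta1 eta4 mS.
  have W2 : W%:R ^+ (2 * K) = (W%:R ^+ K) ^+ 2 :> R by rewrite mulnC exprM.
  have r1' : r%:R <= 4 * C * W%:R ^+ (2 * K).
    move: r1; rewrite exprVn ler_pdivrMr ?exprn_gt0 ?mulr_gt0 ?(lt_le_trans ltr01 WK) // W2.
    by move=> h; apply: (le_trans h); apply: eq_ler; move: (W%:R ^+ _) => z; ring.
  have W4 : W%:R ^+ (4 * K) = (W%:R ^+ K) ^+ 4 :> R by rewrite mulnC exprM.
  have r2' : dst (r%:R * b m) * Y%:R ^+ 2 <= 16 * C * W%:R ^+ (4 * K).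
    move: r2; rewrite mulrCA exprVn mulrC ler_pdivrMr ?exprn_gt0 ?mulr_gt0 ?(lt_le_trans ltr01 WK) // W4.
    by move=> h; apply: (le_trans h); apply: eq_ler; move: (W%:R ^+ _) => z; ring.
  have rD : r%:R * D%:R <= G%:R :> R.
    by apply: le_trans hG2; apply: ler_pM.
  exists (q * D * r)%N; first by rewrite !muln_gt0 q0 D0 r0 /= -mulnA leq_mul2l -(ler_nat R) natrM mulrC rD orbT.
  move: mres; rewrite negb_forall => /existsP[k nk].
  exists (col_mx A (\row_k m k)), (fun i : 'I_(j + 1) => match split i with inl i' => f i' | inr _ => k end); split.
  - apply: contra nk => /eqP h; apply/eqP; have := det_bordered d0 h; by rewrite mxE.
  - move=> i k'; rewrite mxE; case: (split i) => a; rewrite ?hA // mxE -abszE lez_nat //.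
  have e2 : (2 * ee = 2 * (ee - 2) + 4)%N by move: e1; clear; lia.
  move=> i; have -> : lin (col_mx A (\row_k m k) i) = match split i with inl i' => lin (A i') | inr _ => lin m end.
    rewrite /lin; under eq_bigr => k' _ do rewrite mxE.
    by case: (split i) => a //; apply: eq_bigr => k' _; rewrite mxE.
  case: (split i) => a.
    have -> : (q * D * r)%N%:R ^+ 2 * lin (A a) = ((D * r) ^ 2)%N%:R * (q%:R ^+ 2 * lin (A a)) :> R.
      by rewrite natrX !natrM; ring.
    apply: (@le_trans _ _ (((D * r) ^ 2)%N%:R * dst (q%:R ^+ 2 * lin (A a)) * G%:R ^+ (2 * (ee - 2)))).
      by rewrite ler_wpM2r ?exprn_ge0 // dst_muln.
    apply: le_trans (hd a); rewrite mulrC mulrA mulrC ler_wpM2l ?dst_ge0 // e2 exprD ler_wpM2l ?exprn_ge0 //.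
    rewrite natrX natrM mulrC; apply: (@le_trans _ _ (G%:R ^+ 2)); first by rewrite lerXn2r ?nnegrE // mulr_ge0.
    by rewrite ler_weXn2l.
  (* The new multiplier enters squared: one factor r comes from the inverse theorem, the other
     enlarges the error by at most r. *)
  have -> : (q * D * r)%N%:R ^+ 2 * lin m = r%:R * (r%:R * b m) by rewrite /b !natrM; ring.
  apply: (@le_trans _ _ (r%:R * dst (r%:R * b m) * G%:R ^+ (2 * (ee - 2)))).
    by rewrite ler_wpM2r ?exprn_ge0 // dst_muln.
  have Y2 : Y%:R ^+ 2 = G%:R ^+ (2 * (ee - 2)) * G%:R ^+ 2 :> R.
    by rewrite YR -exprM -exprD; congr (_ ^+ _); move: e1; clear; lia.
  have G2 : 0 < G%:R ^+ 2 :> R by rewrite exprn_gt0.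
  rewrite -(ler_pM2r G2) mul1r -[leLHS]mulrA -Y2 -mulrA.
  apply: (le_trans (ler_pM (ler0n _ _) _ r1' r2')); first by rewrite mulr_ge0 ?dst_ge0 ?exprn_ge0.
  apply: le_trans hG1; rewrite (_ : (6 * K = 2 * K + 4 * K)%N) ?exprD; last by rewrite -mulnDl.
  by apply: eq_ler; move: (W%:R ^+ _) (W%:R ^+ _) => z z'; ring.
left.
have etaW : eta * (2 * (K * H)%:R ^+ K) <= 1 by rewrite mulVf // gt_eqF // mulr_gt0 // (lt_le_trans ltr01).
have YW : 16 * (K * H)%:R ^+ K <= Y%:R :> R.
  apply: le_trans GY; apply: le_trans hG4; apply: ler_pM => //; rewrite ?exprn_ge0 //; first by rewrite ler_peMr.
  by rewrite ler_weXn2l // leq_pmull.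
have hb m y : \sum_k (m k)%:~R * ((q * D * y)%N%:R ^+ 2 * be k) = b m * y%:R ^+ 2.
  rewrite /b -mulrA [lin m * _]mulrC mulrA -exprMn -natrM /lin mulr_sumr.
  by apply: eq_bigr => k _; rewrite mulrCA.
have [|y /andP[y0 yY] hy] := @fejer_recurrence K H Y (fun y k => (q * D * y)%N%:R ^+ 2 * be k) K0 H0 eta (ltW eta0) etaW YW; last first.
  exists (q * D * y)%N => //; rewrite !muln_gt0 q0 D0 y0 /= -mulnA leq_mul2l; apply/orP; right.
  have -> : (ee = ee.-1.+1)%N by move: e1; clear; lia.
  rewrite expnS leq_mul // ?(ltnW yY) //; apply: (leq_trans DB).
  rewrite -(ler_nat R); apply: le_trans hG2; rewrite ler_peMl // mulr_ege1 ?exprn_ege1 //.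
  by rewrite mulr_ege1 // ler1n.
move=> m mW.
have -> : \sum_(y < Y) e (\sum_k (m k)%:~R * ((q * D * y)%N%:R ^+ 2 * be k)) = qsum Y 0 (b m).
  by apply: eq_bigr => y _; rewrite hb mul0r add0r.
have [hlt|hge] := lerP (eta * Y%:R) (cn (qsum Y 0 (b m))); last by right; apply: ltW.
left; have /forallP hres : res m by apply: contra_notT nobad => nr; exists m.
rewrite /qsum Re_sum; apply: sumr_ge0 => y _; apply: Re_e_ge0; rewrite mul0r add0r.
pose c i := (colsub f (\row_k m k) *m \adj B) 0 i.
have cb i : `|c i| <= (K * W * B0)%N%:Z.
  rewrite /c mxE; apply: (le_trans (ler_norm_sum _ _ _)).
  apply: (@le_trans _ _ (\sum_(i < j) (W * B0)%N%:Z)); last first.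
    by rewrite sumz_const lez_nat -mulnA leq_mul.
  apply: ler_sum => l _; rewrite normrM PoszM; apply: ler_pM; rewrite ?normr_ge0 //.
    by rewrite !mxE -abszE lez_nat.
  by apply: le_trans (adj_bound _ _ W0 hB) _; rewrite lez_nat.
(* One of the two factors D of b m is spent on Cramer's rule, the other stays in the coefficients; z
   is the sign of the minor. *)
have bE : exists z : int, (`|z| <= 1)%N /\ b m = (z * (D%:Z))%:~R * \sum_i (c i)%:~R * (q%:R ^+ 2 * lin (A i)).
  exists (Num.sg (\det B)); split; first by rewrite -lez_nat abszE; case: sgrP.
  have -> : \sum_i (c i)%:~R * (q%:R ^+ 2 * lin (A i)) = q%:R ^+ 2 * ((\det B)%:~R * lin m) :> R.
    rewrite /lin !mulr_sumr; under eq_bigr => i _ do rewrite !mulr_sumr.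
    rewrite exchange_big; apply: eq_bigr => k _;
    have -> : q%:R ^+ 2 * ((\det B)%:~R * ((m k)%:~R * be k)) = (\det B * m k)%:~R * (q%:R ^+ 2 * be k) by rewrite intrM; ring.
    rewrite (eqP (hres k)) [in RHS]mxE rmorph_sum /= mulr_suml; apply: eq_bigr => i _.
    by rewrite -[_ 0 i in RHS]/(c i) intrM; ring.
  have -> : Num.sg (\det B) * D%:Z = \det B by rewrite /D abszE -numEsg.
  rewrite /b natrM; have : (D%:R : R) ^+ 2 = (\det B)%:~R ^+ 2.
    by rewrite /D natr_absz intr_norm real_normK ?num_real.
  by rewrite exprMn => ->; rewrite expr2; ring.
case: bE => z [z1 ->].
have -> : (z * D%:Z)%:~R * (\sum_i (c i)%:~R * (q%:R ^+ 2 * lin (A i))) * y%:R ^+ 2 =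
  \sum_i (z * D%:Z * (y ^ 2)%N%:Z * c i)%:~R * (q%:R ^+ 2 * lin (A i)) :> R.
  rewrite mulrAC mulr_sumr; apply: eq_bigr => i _; rewrite !intrM -!pmulrn natrX; ring.
have dsum (I : finType) (F : I -> R) : dst (\sum_i F i) <= \sum_i dst (F i).
  elim/big_ind2 : _ => // [|x1 x2 y1 y2 h1 h2]; first by have := dst_int 0; rewrite /= => ->.
  exact: le_trans (dstD _ _) (lerD h1 h2).
have GE : 0 < G%:R ^+ (2 * ee) :> R by rewrite exprn_gt0.
apply: (@le_trans _ _ (8 * \sum_(i < j) ((B0 * Y ^ 2 * (K * W * B0))%N%:R / G%:R ^+ (2 * ee)))).
  rewrite ler_wpM2l //; apply: (le_trans (dsum _ _)); apply: ler_sum => i _.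
  apply: (le_trans (dst_mulz _ _)); rewrite ler_pdivlMr // -[leLHS]mulrA.
  apply: (@le_trans _ _ ((B0 * Y ^ 2 * (K * W * B0))%N%:R * 1)); last by rewrite mulr1.
  apply: ler_pM => //; rewrite ?mulr_ge0 ?dst_ge0 ?(ltW GE) //.
  rewrite -abszE -pmulrn ler_nat !abszM /=; apply: leq_mul; last by rewrite -lez_nat abszE.
  rewrite leq_mul //; last by rewrite leq_sqr ltnW.
  by rewrite -[B0]mul1n leq_mul.
rewrite sum_const_ord.
apply: (@le_trans _ _ ((8 * K ^ 2 * W * B0 ^ 2)%N%:R * Y%:R ^+ 2 / G%:R ^+ (2 * ee))).
  have -> : 8 * (j%:R * ((B0 * Y ^ 2 * (K * W * B0))%:R / G%:R ^+ (2 * ee))) = (8 * j * (B0 * Y ^ 2 * (K * W * B0)))%N%:R / G%:R ^+ (2 * ee) :> R.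
    by rewrite !natrM; ring.
  rewrite ler_wpM2r ?invr_ge0 ?(ltW GE) // -natrX -natrM ler_nat.
  rewrite [leqRHS](_ : _ = 8 * K * (B0 * Y ^ 2 * (K * W * B0)))%N; last by ring.
  by rewrite leq_mul // leq_mul.
rewrite ler_pdivrMr // mul1r.
have -> : (2 * ee = 2 + ee.-1 * 2)%N by move: e1; clear; lia.
rewrite exprD YR -exprM ler_wpM2r ?exprn_ge0 // -natrX ler_nat; exact: hG3.
Qed.

(** There are at most K independent relations: a minor of order K + 1 would repeat a column. The
    precision starts at 2 (K + 2) and loses 2 per relation, so it lasts up to j = K, and q together
    with the final search stays below G^(2 K + 4) <= G^(8 K). *)
Lemma quadratic_recurrence_G : exists2 x : nat, (0 < x <= G ^ (8 * K))%N &
  forall k, dst (x%:R ^+ 2 * be k) ^+ 2 * H%:R <= 4 * K%:R.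
Proof.
have G1 : (0 < G)%N.
  rewrite -(ltr0n R); apply: lt_le_trans hG4; rewrite !mulr_gt0 ?exprn_gt0 //; first exact: lt_le_trans hC.
  by rewrite ltr0n muln_gt0 K0.
have main j : (j <= K.+1)%N ->
  (exists2 x : nat, (0 < x <= G ^ (8 * K))%N & forall k, dst (x%:R ^+ 2 * be k) ^+ 2 * H%:R <= 4 * K%:R) \/
  (exists2 q : nat, (0 < q <= G ^ j)%N & relations j q (2 * (K.+2 - j))).
  elim: j => [|j IH] jK.
    right; exists 1%N => //; exists 0, (fun=> Ordinal K0).
    by rewrite det_mx00 oner_neq0; split=> // -[].
  have [|[q /andP[q0 qG] hq]] := IH (ltnW jK); first by left.
  have [||[x /andP[x0 xG] hx]|[q' /andP[q'0 q'G] hq']] := relations_step _ _ q0 hq; rewrite ?ltnS //.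
  - by move: jK; clear; lia.
  - left; exists x => //; rewrite x0 /=; apply: (leq_trans xG).
    apply: (@leq_trans (G ^ j * G ^ (2 * (K.+2 - j)))); first by rewrite leq_mul2r qG orbT.
    by rewrite -expnD leq_pexp2l //; move: jK K0; clear; lia.
  right; exists q'; first by rewrite q'0 (leq_trans q'G) // expnSr leq_mul2r qG orbT.
  by rewrite -addn1; have -> : (2 * (K.+2 - (j + 1)) = 2 * (K.+2 - j) - 2)%N by move: jK; clear; lia.
have [//|[q _ [A [f [/eqP d0 _ _]]]]] := main _ (leqnn _).
exfalso; apply: d0.
have /injectivePn [i [i' ii' ff]] : ~~ injectiveb f.
  apply/negP => /injectiveP /leq_card; by rewrite !card_ord ltnn.
rewrite -det_tr; apply: (determinant_alternate ii') => k; by rewrite !mxE ff.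
Qed.
End QuadraticRecurrence.

Lemma fact_le_exp n : (n`! <= n ^ n)%N.
Proof.
elim: n => // n IH; rewrite factS expnS leq_mul2l /=; apply: (leq_trans IH).
by case: n {IH} => // n; rewrite leq_exp2r.
Qed.

Lemma quadratic_recurrence : exists2 C : nat, (0 < C)%N & forall (K H : nat) (be : 'I_K -> R),
  (0 < K)%N -> (0 < H)%N ->
  exists2 x : nat, (0 < x <= (C * (K * H)) ^ (96 * K ^ 2))%N &
    forall k, dst (x%:R ^+ 2 * be k) ^+ 2 * H%:R <= 4 * K%:R.
Proof.
have [C C1 hC] := weyl_inverse.
pose c := Num.bound C; have Cc : C <= c%:R by apply/ltW/archi_boundP; lra.
have C0 : 0 <= C by lra.
have c0 : (0 < c)%N by rewrite -(ltr0n R); lra.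
exists (512 * c ^ 2)%N => [|K H be K0 H0]; first by rewrite muln_gt0 expn_gt0 c0.
pose W := (K * H)%N; have W0 : (0 < W)%N by rewrite muln_gt0 K0.
(* All four size conditions ask for at most W^(12 K) up to constants; 12 K times 8 K gives the final
   exponent 96 K^2. *)
pose G := ((512 * c ^ 2 * W) ^ (12 * K))%N.
have c20 : (0 < 512 * c ^ 2)%N by rewrite muln_gt0 expn_gt0 c0.
have c2W : (0 < 512 * c ^ 2 * W)%N by rewrite muln_gt0 c20.
have bd a d : (a <= 512 * c ^ 2)%N -> (d <= 12 * K)%N -> (a * W ^ d <= G)%N.
  move=> ha hd; rewrite /G expnMn leq_mul ?leq_pexp2l //.
  apply: (leq_trans ha); move: c20; move: (512 * c ^ 2)%N => z z0; rewrite -{1}(expn1 z) leq_pexp2l //.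
  by rewrite muln_gt0.
have G0 : (0 < G)%N by rewrite expn_gt0 c2W.
have GG : (G <= G ^ 2)%N by rewrite -{1}(expn1 G) leq_pexp2l.
have B0W : (K`! * W ^ K <= W ^ (2 * K))%N.
  rewrite mul2n -addnn expnD leq_mul2r; apply/orP; right; apply: (leq_trans (fact_le_exp K)).
  by rewrite leq_exp2r // leq_pmulr.
have cc : (c <= c ^ 2)%N by rewrite -{1}(expn1 c) leq_pexp2l.
have [|||| x hx1 hx2] := @quadratic_recurrence_G C K H G be C1 hC K0 H0.
- apply: (@le_trans _ _ (64 * c ^ 2 * W ^ (6 * K))%N%:R).
    rewrite -/W natrM natrX ler_wpM2r ?exprn_ge0 // natrM ler_wpM2l // natrX lerXn2r ?nnegrE //.
  rewrite -natrX ler_nat; apply: leq_trans GG; apply: bd; first by rewrite leq_mul2r orbT.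
  by rewrite leq_mul2r orbT.
- apply: (@le_trans _ _ (4 * c * W ^ (4 * K))%N%:R).
    have -> : (4 * c * W ^ (4 * K))%N%:R = 4 * c%:R * W%:R ^+ (2 * K) * (W ^ (2 * K))%N%:R :> R.
      rewrite natrM (natrM _ 4) !natrX -[RHS]mulrA -exprD; congr (_ * _ ^+ _); clear; lia.
    rewrite -/W; apply: ler_pM; rewrite ?mulr_ge0 ?exprn_ge0 // ?ler_nat //.
    by rewrite ler_wpM2r ?exprn_ge0 // ler_wpM2l.
  rewrite ler_nat; apply: bd; first by rewrite leq_mul.
  by rewrite leq_mul2r orbT.
- apply: leq_trans GG; apply: (@leq_trans (8 * W ^ (3 + 4 * K))%N).
    have s1 : (K ^ 2 * W <= W ^ 3)%N by rewrite [leqRHS]expnSr leq_mul2r leq_sqr leq_pmulr ?orbT.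
    have s2 : ((K`! * W ^ K) ^ 2 <= W ^ (4 * K))%N.
      apply: (@leq_trans ((W ^ (2 * K)) ^ 2)%N); first by rewrite leq_sqr.
      by rewrite -expnM leq_pexp2l //; clear; lia.
    by rewrite -/W expnD -[(8 * K ^ 2 * W)%N]mulnA -mulnA leq_mul2l /= leq_mul.
  apply: bd; first by rewrite (leq_trans (isT : 8 <= 512 * 1)%N) // leq_mul2l /= expn_gt0 c0.
  by move: K0; clear; lia.
- apply: (@le_trans _ _ (16 * c * W ^ (4 * K))%N%:R).
    by rewrite -/W natrM natrX ler_wpM2r ?exprn_ge0 // natrM ler_wpM2l.
  rewrite ler_nat; apply: bd; first by rewrite leq_mul.
  by rewrite leq_mul2r orbT.
exists x => //; case/andP: hx1 => -> hx /=; apply: (leq_trans hx).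
rewrite /G -expnM leq_pexp2l //.
clear; nia.
Qed.

(** * Density increment on progressions *)

(* A cell [(a, d, l)] stands for the progression [a + d t], [t < l]. *)
Definition tiles (P : seq (nat * nat * nat)) (N : nat) : Prop :=
  (forall c t, c \in P -> (t < c.2)%N -> (c.1.1 + c.1.2 * t < N)%N) /\
  forall (V : nmodType) (phi : nat -> V),
    \sum_(n < N) phi n = \sum_(c <- P) \sum_(t < c.2) phi (c.1.1 + c.1.2 * t)%N.

Lemma tiles_residues (N d : nat) : (0 < d)%N ->
  tiles [seq (r, d, ((N - r + d.-1) %/ d)%N) | r <- iota 0 d] N.
Proof.
move=> d0; have lt r t : (t < (N - r + d.-1) %/ d)%N = (r + d * t < N)%N.
  rewrite leq_divRL // mulSn mulnC; have [p ->] : exists p, d = p.+1 by exists d.-1; rewrite prednK.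
  by move: (p.+1 * t)%N => z /=; apply/idP/idP; lia.
split=> [c t /mapP[r _ ->] /=|V phi]; first by rewrite lt.
rewrite big_map -[d in iota 0 d]subn0 -/(index_iota 0 d) big_mkord.
have [B NB] : exists B, (N <= B * d)%N by exists N; rewrite leq_pmulr.
rewrite (big_ord_widen _ phi NB) big_mkcond /=.
rewrite (sum_blocks (fun n => if (n < N)%N then phi n else 0)) exchange_big /=.
apply: eq_bigr => r _; have lB : ((N - r + d.-1) %/ d <= B)%N.
  rewrite leqNgt; apply/negP; rewrite lt => h; have := leq_trans h NB.
  by rewrite mulnC ltnNge leq_addl.
rewrite (big_ord_widen _ (fun t => phi (r + d * t)%N) lB) [RHS]big_mkcond.
by apply: eq_bigr => t _; rewrite lt addnC mulnC.
Qed.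

Lemma tiles_shift (P Q : seq (nat * nat * nat)) (m N : nat) : tiles P m -> tiles Q N ->
  tiles (P ++ [seq ((m + c.1.1)%N, c.1.2, c.2) | c <- Q]) (m + N).
Proof.
move=> [P1 P2] [Q1 Q2]; split=> [c t|V phi].
  rewrite mem_cat => /orP[cP ct|/mapP[c' cQ ->] /= ct].
    by apply: (leq_trans (P1 _ _ cP ct)); rewrite leq_addr.
  by rewrite -addnA ltn_add2l Q1.
rewrite big_split_ord /= big_cat big_map /= (P2 _ phi) (Q2 _ (fun n => phi (m + n)%N)).
by congr (_ + _); apply: eq_bigr => c _; apply: eq_bigr => t _; rewrite addnA.
Qed.

(** Intervals of length d M are peeled off while more than 2 d M remains. Inside an interval of
    between d M and 2 d M integers each residue class modulo d has between M and 2 M elements. *)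
Lemma tiles_progressions (d M : nat) : (0 < d)%N -> (0 < M)%N -> forall N, (d * M <= N)%N ->
  exists2 P, tiles P N & forall c, c \in P -> [/\ c.1.2 = d, (M <= c.2)%N & (c.2 <= 2 * M)%N].
Proof.
move=> d0 M0; have res N : (d * M <= N <= 2 * (d * M))%N ->
    exists2 P, tiles P N & forall c, c \in P -> [/\ c.1.2 = d, (M <= c.2)%N & (c.2 <= 2 * M)%N].
  move=> /andP[N1 N2]; exists [seq (r, d, ((N - r + d.-1) %/ d)%N) | r <- iota 0 d]; first exact: tiles_residues.
  move=> c /mapP[r]; rewrite mem_iota add0n /= => rd -> /=; split=> //.
    by rewrite leq_divRL // mulnC; move: N1 rd; move: (d * M)%N => z; lia.
  rewrite -ltnS ltn_divLR // mulSn -mulnA [(M * d)%N]mulnC; move: d0 N2; move: (d * M)%N => z; lia.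
have dM0 : (0 < d * M)%N by rewrite muln_gt0 d0.
elim/ltn_ind => N IH hN; have [h|h] := leqP N (2 * (d * M)); first by apply: res; rewrite hN.
have [P0 P1 P2] : exists2 P, tiles P (d * M) & forall c, c \in P -> [/\ c.1.2 = d, (M <= c.2)%N & (c.2 <= 2 * M)%N].
  by apply: res; rewrite leqnn leq_pmull.
have [||Q Q1 Q2] := IH (N - d * M)%N; [by move: dM0 h; clear; lia|by move: h; clear; lia|].
exists (P0 ++ [seq ((d * M + c.1.1)%N, c.1.2, c.2) | c <- Q]).
  by have := tiles_shift P1 Q1; rewrite subnKC.
by move=> c; rewrite mem_cat => /orP[/P2//|/mapP[c' /Q2 hc ->]].
Qed.

Lemma tiles_comp (P : seq (nat * nat * nat)) (N : nat) (Q : nat * nat * nat -> seq (nat * nat * nat)) :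
  tiles P N -> (forall c, c \in P -> tiles (Q c) c.2) ->
  tiles (flatten [seq [seq ((c.1.1 + c.1.2 * x.1.1)%N, (c.1.2 * x.1.2)%N, x.2) | x <- Q c] | c <- P]) N.
Proof.
move=> [P1 P2] hQ; split=> [c t /flattenP[s /mapP[c' c'P ->] /mapP[x xQ ->]] /= tx|V phi].
  have [Q1 _] := hQ _ c'P; rewrite -addnA -mulnA -mulnDr; exact: P1 (Q1 _ _ xQ tx).
rewrite big_flatten big_map P2 [LHS]big_seq [RHS]big_seq; apply: eq_bigr => c cP.
have [_ Q2] := hQ _ cP; rewrite big_map (Q2 _ (fun t => phi (c.1.1 + c.1.2 * t)%N)).
by apply: eq_bigr => x _; apply: eq_bigr => t _; rewrite mulnDr addnA mulnA.
Qed.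

Definition phase (x y : R) (n : nat) : R := x * n%:R + y * n%:R ^+ 2.

Lemma dst_muln_le (w : R) (z V m c : nat) : dst w * (m * V)%N%:R <= 1 -> (z <= c * m)%N ->
  dst (z%:R * w) * V%:R <= c%:R.
Proof.
move=> h1 h2; apply: (@le_trans _ _ ((c * m)%N%:R * dst w * V%:R)).
  rewrite ler_wpM2r //; apply: (le_trans (dst_muln _ _)); by rewrite ler_wpM2r ?dst_ge0 // ler_nat.
have := ler_wpM2l (ler0n R c) h1; rewrite mulr1; apply: le_trans; apply: eq_ler; rewrite !natrM; ring.
Qed.

(* First a common square difference [q] linearises all the quadratic phases on progressions of length about [L]; then Dirichlet's theorem on each of them freezes the linear phases. *)
Lemma constant_phase_tiling : exists2 C : nat, (0 < C)%N & forall (K M V N : nat) (x y : 'I_K -> R),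
  (0 < K)%N -> (0 < M)%N -> (0 < V)%N ->
  let L := ((M * V) ^ K * M)%N in
  ((C * (K * (4 * K * V ^ 2 * L ^ 4))) ^ (96 * K ^ 2) * L <= N)%N ->
  exists2 P, tiles P N & forall c, c \in P -> (M <= c.2)%N /\ (0 < c.1.2)%N /\
    forall k t, (t < c.2)%N ->
    dst (phase (x k) (y k) (c.1.1 + c.1.2 * t) - phase (x k) (y k) c.1.1) * V%:R <= 6.
Proof.
have [C C0 hC] := quadratic_recurrence; exists C => // K M V N x y K0 M0 V0 L hN.
have L0 : (0 < L)%N by rewrite muln_gt0 expn_gt0 muln_gt0 M0 V0.
have [|q /andP[q0 qX] hq] := hC K (4 * K * V ^ 2 * L ^ 4)%N y K0.
  by rewrite muln_gt0 (expn_gt0 L) L0 andbT muln_gt0 (expn_gt0 V) V0 muln_gt0 K0.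
have [|P P1 P2] := tiles_progressions q0 L0 (N := N); first by apply: leq_trans hN; rewrite leq_mul2r qX orbT.
(* The value H = 4 K V^2 L^4 was chosen so that the square root of the recurrence bound reads
   exactly like this. *)
have hq2 k : dst (q%:R ^+ 2 * y k) * (V * L ^ 2)%N%:R <= 1.
  have h := hq k; rewrite -(ler_pXn2r (n := 2)) ?nnegrE ?mulr_ge0 ?dst_ge0 // expr1n exprMn.
  have K4 : (0 : R) < 4 * K%:R by rewrite mulr_gt0 // ltr0n.
  rewrite -(ler_pM2r K4) mul1r; apply: le_trans h; apply: eq_ler.
  by rewrite !natrM !natrX; ring.
(* The slope of the k-th phase in s on the points a + q s of the cell; the remaining part y k q^2
   s^2 is controlled by [hq2]. *)
pose al (c : nat * nat * nat) (k : 'I_K) : R := x k * q%:R + 2 * y k * c.1.1%:R * q%:R.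
have hd (c : nat * nat * nat) : exists d : nat, (0 < d <= (M * V) ^ K)%N && [forall k, dst (d%:R * al c k) * (M * V)%:R <= 1].
  have [|d d1 d2] := dirichlet_simultaneous (T := (M * V)%N) (al c); first by rewrite muln_gt0 M0.
  by exists d; rewrite d1; apply/forallP.
pose dd c := xchoose (hd c).
have [Q hQ] : exists Q : nat * nat * nat -> seq (nat * nat * nat), forall c, c \in P ->
   tiles (Q c) c.2 /\ forall z, z \in Q c -> [/\ z.1.2 = dd c, (M <= z.2)%N & (z.2 <= 2 * M)%N].
  have hc c : exists Qc, c \in P -> tiles Qc c.2 /\ forall z, z \in Qc -> [/\ z.1.2 = dd c, (M <= z.2)%N & (z.2 <= 2 * M)%N].
    case cP : (c \in P); last by exists [::].
    have [_ Lc _] := P2 _ cP; have /andP[/andP[d0 dM] _] := xchooseP (hd c).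
    have [|Qc Q1 Q2] := tiles_progressions d0 M0 (N := c.2); last by exists Qc.
    by apply: leq_trans Lc; rewrite leq_mul2r dM orbT.
  by have [Q hQ] := boolp.choice hc; exists Q.
exists (flatten [seq [seq ((c.1.1 + c.1.2 * z.1.1)%N, (c.1.2 * z.1.2)%N, z.2) | z <- Q c] | c <- P]).
  by apply: tiles_comp P1 _ => c /hQ[].
move=> c /flattenP[s /mapP[c' c'P ->] /mapP[z zQ ->]] /=.
have [c'q Lc' c'L] := P2 _ c'P; have [[Q1 _] Q2] := hQ _ c'P; have [zd Mz zM] := Q2 _ zQ.
have /andP[/andP[d0 dM] /forallP dk] := xchooseP (hd c'); rewrite -/(dd c') in d0 dM dk.
split=> //; rewrite c'q zd; split=> [|k t tz]; first by rewrite muln_gt0 q0.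
have := Q1 _ _ zQ tz; rewrite zd; move: (dk k); rewrite /al.
move: (c'.1.1) (z.1.1) (dd c') => a b d hdk btd.
pose Z := ((b + d * t) ^ 2 - b ^ 2)%N.
have ZE : (Z%:R : R) = (b + d * t)%N%:R ^+ 2 - b%:R ^+ 2.
  by rewrite /Z natrB ?leq_sqr ?leq_addr // !natrX.
have -> : phase (x k) (y k) (a + q * b + q * d * t) - phase (x k) (y k) (a + q * b) =
   t%:R * (d%:R * (x k * q%:R + 2 * y k * a%:R * q%:R)) + Z%:R * (q%:R ^+ 2 * y k).
  by rewrite ZE /phase !(natrD, natrM); ring.
(* The linear part has t <= 2 M, giving 2; the quadratic part has (b + d t)^2 <= (2 L)^2, giving
   4. *)
apply: (@le_trans _ _ (2%:R + 4%:R)); last by rewrite -natrD.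
apply: (le_trans (ler_wpM2r (ler0n _ V) (dstD _ _))); rewrite mulrDl; apply: lerD.
  by apply: (dst_muln_le hdk); rewrite ltnW // (leq_trans tz).
apply: (dst_muln_le (m := (L ^ 2)%N)); first by rewrite mulnC hq2.
apply: (@leq_trans ((b + d * t) ^ 2)%N); first exact: leq_subr.
by rewrite -[4%N]/(2 ^ 2)%N -expnMn leq_sqr ltnW // (leq_trans btd).
Qed.

(** * Averages over cells and their energy *)

Definition indic (A : pred nat) (n : nat) : R := if A n then 1 else 0.
Definition dens (A : pred nat) (N : nat) : R := (\sum_(n < N) indic A n) / N%:R.
Definition balanced (A : pred nat) (N : nat) (n : nat) : R[i] := (indic A n - dens A N)%:C.
Definition subdens (A : pred nat) (c : nat * nat * nat) : R := dens (fun t => A (c.1.1 + c.1.2 * t)%N) c.2.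

Lemma dens_ge0 A N : 0 <= dens A N.
Proof. by rewrite divr_ge0 // sumr_ge0 // => n _; rewrite /indic; case: ifP. Qed.

Lemma dens_le1 A N : dens A N <= 1.
Proof.
case: N => [|N]; first by rewrite /dens big_ord0 mul0r.
rewrite /dens ler_pdivrMr ?ltr0n // mul1r -[leRHS]mulr1 -sum_const_ord; apply: ler_sum => n _.
by rewrite /indic; case: ifP.
Qed.

Lemma dens_sum A N : \sum_(n < N) indic A n = dens A N * N%:R.
Proof.
case: N => [|N]; first by rewrite big_ord0 mulr0.
by rewrite /dens divfK // pnatr_eq0.
Qed.

Section CellAverage.
Variables (A : pred nat) (N : nat) (P : seq (nat * nat * nat)).
Hypothesis tP : tiles P N.
Let de := dens A N.
Let w (c : nat * nat * nat) (n : nat) : R := \sum_(t < c.2) (if (c.1.1 + c.1.2 * t == n)%N then 1 else 0).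

(* The conditional expectation of the balanced function on the cells, written as a weighted sum so that disjointness of the cells need not be discussed. *)
Definition cell_average (n : nat) : R := \sum_(c <- P) (subdens A c - de) * w c n.
Definition cell_energy : R := \sum_(c <- P) c.2%:R * (subdens A c - de) ^+ 2.

Let w_ge0 c n : 0 <= w c n.
Proof. by apply: sumr_ge0 => t _; case: ifP. Qed.

Let w_sum n : (n < N)%N -> \sum_(c <- P) w c n = 1.
Proof.
move=> nN; have [_ h] := tP; rewrite -(h _ (fun m => if m == n then 1 else 0)).
rewrite (bigD1 (Ordinal nN)) //= eqxx big1 ?addr0 // => i /negbTE.
by rewrite -val_eqE /= => ->.
Qed.

Let sum_w (V : nmodType) (F : nat -> R) c : c \in P -> \sum_(n < N) F n * w c n = \sum_(t < c.2) F (c.1.1 + c.1.2 * t)%N.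
Proof.
move=> cP; under eq_bigr => n _ do rewrite mulr_sumr.
rewrite exchange_big; apply: eq_bigr => t _; have [h _] := tP; have hN := h _ _ cP (ltn_ord t).
rewrite (bigD1 (Ordinal hN)) //= eqxx mulr1 big1 ?addr0 // => i; rewrite -val_eqE /= eq_sym => /negbTE ->.
by rewrite mulr0.
Qed.

(** Jensen's inequality for the weights w c n, which sum to 1 over the cells: the variance about
    [cell_average] is nonnegative. *)
Lemma cell_average_energy : \sum_(n < N) cell_average n ^+ 2 <= cell_energy.
Proof.
apply: (@le_trans _ _ (\sum_(n < N) \sum_(c <- P) (subdens A c - de) ^+ 2 * w c n)).
  apply: ler_sum => n _; have w1 := w_sum (ltn_ord n).
  have : 0 <= \sum_(c <- P) ((subdens A c - de) - cell_average n) ^+ 2 * w c n.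
    by apply: sumr_ge0 => c _; rewrite mulr_ge0 ?sqr_ge0.
  have -> : \sum_(c <- P) ((subdens A c - de) - cell_average n) ^+ 2 * w c n =
    \sum_(c <- P) (subdens A c - de) ^+ 2 * w c n - 2 * cell_average n * \sum_(c <- P) (subdens A c - de) * w c n
      + cell_average n ^+ 2 * \sum_(c <- P) w c n.
    move: (cell_average n) => B; rewrite mulr_sumr [B ^+ 2 * _]mulr_sumr -sumrB -big_split; apply: eq_bigr => c _ /=.
    by move: (w c n) => z; ring.
  rewrite w1 -/(cell_average n); set u := \sum_(c <- P) _; set v := cell_average n; clear => h.
  by move: h; rewrite expr2; lra.
rewrite exchange_big /cell_energy [leLHS]big_seq [leRHS]big_seq /=; apply: ler_sum => c cP.
by rewrite (sum_w R (fun=> (subdens A c - de) ^+ 2) cP) sum_const_ord.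
Qed.

Lemma cell_length_sum : \sum_(c <- P) c.2%:R = N%:R :> R.
Proof.
have [_ h] := tP; have := h R (fun=> 1); rewrite sum_const_ord mulr1 => ->.
by apply: eq_bigr => c _; rewrite sum_const_ord mulr1.
Qed.

Lemma cell_density_sum : \sum_(c <- P) c.2%:R * (subdens A c - de) = 0.
Proof.
under eq_bigr => c _ do rewrite mulrBr [_ * subdens _ _]mulrC -dens_sum.
rewrite sumrB -mulr_suml cell_length_sum; have [_ h] := tP.
by rewrite -(h R (indic A)) dens_sum /de mulrC subrr.
Qed.

(** A one-sided bound suffices because the deviations x, weighted by cell length, sum to 0: for x
    between -de and tau de one has x^2 <= (1 + tau) de (2 tau de - x), and the linear term
    disappears in the sum. *)
Lemma energy_le (tau : R) : 0 <= tau -> (forall c, c \in P -> subdens A c <= de * (1 + tau)) ->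
  cell_energy <= 2 * (1 + tau) * tau * de ^+ 2 * N%:R.
Proof.
move=> t0 hc; have de0 : 0 <= de by exact: dens_ge0.
apply: (@le_trans _ _ (\sum_(c <- P) (1 + tau) * de * (c.2%:R * (2 * (tau * de) - (subdens A c - de))))).
  rewrite /cell_energy [leLHS]big_seq [leRHS]big_seq; apply: ler_sum => c cP.
  rewrite [leRHS]mulrCA ler_wpM2l //; have := hc c cP; have : 0 <= subdens A c by exact: dens_ge0.
  move: t0 de0; move: (subdens A c) de => x d; clear => t0 d0 x0 xd.
  have [h|h] := lerP 0 (x - d).
    have h1 : x - d <= tau * d by lra.
    apply: (@le_trans _ _ ((tau * d) * (tau * d))); first by rewrite expr2; apply: ler_pM.
    apply: ler_pM => //; rewrite ?mulr_ge0 //; lra.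
  have h1 : (x - d) ^+ 2 = (d - x) * (d - x) by ring.
  rewrite h1; apply: ler_pM; try lra; have : 0 <= tau * d by rewrite mulr_ge0.
    by lra.
  by lra.
rewrite -mulr_sumr; under eq_bigr => c _ do rewrite mulrBr.
by rewrite sumrB cell_density_sum -mulr_suml cell_length_sum subr0; apply: eq_ler; ring.
Qed.

(** On a cell the indicator minus its mean sums to 0, so the phase may be replaced by its difference
    from the value at the first point. Each term is then at most 2 times 8 times 6 / V, whence
    96. *)
Lemma fsum_cell_average (V P1 P2 : nat) (a b : int) : (0 < V)%N ->
  (forall c t, c \in P -> (t < c.2)%N ->
    dst (phase (a%:~R / P1%:R) (b%:~R / P2%:R) (c.1.1 + c.1.2 * t) - phase (a%:~R / P1%:R) (b%:~R / P2%:R) c.1.1) * V%:R <= 6) ->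
  cn (fsum N (balanced A N) P1 P2 a b - fsum N (fun n => (cell_average n)%:C) P1 P2 a b) * V%:R <= 96 * N%:R.
Proof.
move=> V0 hP; have VR : (0 : R) < V%:R by rewrite ltr0n.
pose ph := phase (a%:~R / P1%:R) (b%:~R / P2%:R).
have -> : fsum N (balanced A N) P1 P2 a b = \sum_(c <- P) \sum_(t < c.2) balanced A N (c.1.1 + c.1.2 * t)%N * e (ph (c.1.1 + c.1.2 * t)%N).
  by have [_ h] := tP; rewrite -(h _ (fun n => balanced A N n * e (ph n))).
have -> : fsum N (fun n => (cell_average n)%:C) P1 P2 a b = \sum_(c <- P) \sum_(t < c.2) (subdens A c - de)%:C * e (ph (c.1.1 + c.1.2 * t)%N).
  rewrite /fsum; under eq_bigr => n _ do rewrite /cell_average real_sumC mulr_suml.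
  rewrite exchange_big [LHS]big_seq [RHS]big_seq; apply: eq_bigr => c cP.
  under eq_bigr => n _ do rewrite /w realCM real_sumC mulr_sumr mulr_suml.
  rewrite exchange_big; apply: eq_bigr => t _; have [h _] := tP; have hN := h _ _ cP (ltn_ord t).
  rewrite (bigD1 (Ordinal hN)) //= eqxx mulr1 big1 ?addr0 // => i; rewrite -val_eqE /= eq_sym => /negbTE ->.
  by rewrite mulr0 mul0r.
rewrite -sumrB -cell_length_sum.
apply: (le_trans (ler_wpM2r (ltW VR) (cn_sum _ _ _))); rewrite mulr_suml mulr_sumr [leLHS]big_seq [leRHS]big_seq.
apply: ler_sum => c cP; rewrite -sumrB.
have -> : \sum_(t < c.2) (balanced A N (c.1.1 + c.1.2 * t)%N * e (ph (c.1.1 + c.1.2 * t)%N) - (subdens A c - de)%:C * e (ph (c.1.1 + c.1.2 * t)%N)) =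
  \sum_(t < c.2) (indic A (c.1.1 + c.1.2 * t)%N - subdens A c)%:C * (e (ph (c.1.1 + c.1.2 * t)%N) - e (ph c.1.1)).
  under [RHS]eq_bigr => t _ do rewrite mulrBr.
  rewrite [RHS]sumrB -mulr_suml -real_sumC.
  have -> : \sum_(t < c.2) (indic A (c.1.1 + c.1.2 * t)%N - subdens A c) = 0.
    by rewrite sumrB sum_const_ord -[\sum_(t < c.2) _]/(\sum_(t < c.2) indic (fun t => A (c.1.1 + c.1.2 * t)%N) t) dens_sum -/(subdens A c) mulrC subrr.
  rewrite mul0r subr0; apply: eq_bigr => t _; rewrite -mulrBl; congr (_ * _).
  by rewrite /balanced -/de -rmorphB; congr (_ %:C); ring.
apply: (le_trans (ler_wpM2r (ltW VR) (cn_sum _ _ _))); rewrite mulr_suml [leRHS]mulrC -sum_const_ord.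
apply: ler_sum => t _; rewrite cnM cn_real -mulrA.
have h1 : `|indic A (c.1.1 + c.1.2 * t) - subdens A c| <= 2.
  have := dens_ge0 (fun t => A (c.1.1 + c.1.2 * t)%N) c.2; have := dens_le1 (fun t => A (c.1.1 + c.1.2 * t)%N) c.2.
  rewrite -/(subdens A c) /indic; case: ifP => _; rewrite ler_norml => h1 h2; apply/andP; split; lra.
have -> : 96 = 2 * (8 * 6) :> R by lra.
apply: ler_pM; rewrite ?normr_ge0 ?mulr_ge0 ?cn_ge0 ?(ltW VR) //.
have -> : e (ph (c.1.1 + c.1.2 * t)%N) - e (ph c.1.1) = e (ph c.1.1) * (e (ph (c.1.1 + c.1.2 * t)%N - ph c.1.1) - 1).
  by rewrite mulrBr mulr1 -eD addrCA subrr addr0.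
rewrite cnM cn_e mul1r cn_subC e_nint; apply: (le_trans (ler_wpM2r (ltW VR) (e_le_dst _))).
by rewrite -/(dst _) -mulrA ler_wpM2l // hP.
Qed.
End CellAverage.

Lemma ln_le_self (x : R) : 0 < x -> ln x <= x.
Proof. by move=> x0; have := ln_le_sub1 x0; lra. Qed.

Lemma ln_nat_pow_le (m E N : nat) : (0 < m)%N -> (0 < N)%N -> E%:R * ln (m%:R : R) <= ln (N%:R : R) -> (m ^ E <= N)%N.
Proof.
move=> m0 N0 h; rewrite leqNgt; apply/negP => hlt.
have NR : (0 : R) < N%:R by rewrite ltr0n.
have mR : (0 : R) < m%:R by rewrite ltr0n.
have h1 : (N%:R : R) < m%:R ^+ E by rewrite -natrX ltr_nat.
have := ln_lt NR h1; rewrite ln_exp_pow // mulrC ltNge; by rewrite h.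
Qed.

Lemma max_root (V E N : nat) : (0 < V)%N -> (0 < E)%N -> (V ^ E <= N)%N ->
  exists M, [/\ (0 < M)%N, ((M * V) ^ E <= N)%N & (N < (M.+1 * V) ^ E)%N].
Proof.
move=> V0 E0 hN; pose p M := ((M * V) ^ E <= N)%N.
have ex : exists M, p M by exists 1%N; rewrite /p mul1n.
have bd M : p M -> (M <= N)%N.
  apply: leq_trans; apply: (@leq_trans (M * V)%N); first by rewrite leq_pmulr.
  by case: (posnP (M * V)%N) => [->//|h]; rewrite -{1}(expn1 (M * V)) leq_pexp2l.
case: (ex_maxnP ex bd) => M hM maxM; exists M; split=> //.
  by apply: maxM; rewrite /p mul1n.
by rewrite ltnNge; apply/negP => /maxM; rewrite ltnn.
Qed.

Lemma root16 (K : nat) : (0 < K)%N -> exists rho, [/\ (2 <= rho)%N, (K <= rho ^ 16)%N, (rho ^ 16 <= 2 ^ 16 * K)%N & (rho <= 2 * K)%N].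
Proof.
move=> K0; pose p r := (K <= r.+1 ^ 16)%N.
have ex : exists r, p r.
  by exists K; rewrite /p (@leq_trans K.+1) // -{1}(expn1 K.+1) leq_pexp2l.
case: (ex_minnP ex) => r hr minr; case: r hr minr => [|r] hr minr.
  exists 2%N; split=> //; first by apply: leq_trans hr _; rewrite leq_exp2r.
    by rewrite leq_pmulr.
  by rewrite leq_pmulr.
have nr : (r.+1 ^ 16 < K)%N by rewrite ltnNge; apply/negP => /minr; rewrite ltnn.
have r2 : (r.+2 <= 2 * r.+1)%N by clear; lia.
exists r.+2; split=> //.
  by apply: (@leq_trans ((2 * r.+1) ^ 16)%N); [rewrite leq_exp2r|rewrite expnMn leq_mul2l ltnW ?orbT].
apply: (leq_trans r2); rewrite leq_mul2l; apply/orP; right; apply: leq_trans (ltnW nr).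
by rewrite -{1}(expn1 r.+1) leq_pexp2l.
Qed.

(** Everything is a power of T = M V: L <= T^(K+1), the base is at most T^(11 K), and 11 times 96
    plus 2 is 1058. This K^3 with K about 2^(7 j) is where the price 2^(21 j) comes from. *)
Lemma tiling_exponent (C K M V L : nat) : (0 < C)%N -> (0 < K)%N -> (0 < V)%N -> (4 * C * K ^ 2 <= M)%N ->
  L = ((M * V) ^ K * M)%N ->
  ((C * (K * (4 * K * V ^ 2 * L ^ 4))) ^ (96 * K ^ 2) * L <= (M * V) ^ (1058 * K ^ 3))%N.
Proof.
move=> C0 K0 V0 hM LE.
have M0 : (0 < M)%N by apply: leq_trans hM; rewrite muln_gt0 expn_gt0 K0 muln_gt0 C0.
pose T := (M * V)%N; have T0 : (0 < T)%N by rewrite muln_gt0 M0.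
have MT : (M <= T)%N by rewrite leq_pmulr.
have VT : (V <= T)%N by rewrite leq_pmull.
have LT : (L <= T ^ K.+1)%N by rewrite LE -/T expnSr leq_mul.
have h1 : (C * (K * (4 * K * V ^ 2 * L ^ 4)) <= T ^ (11 * K))%N.
  have -> : (C * (K * (4 * K * V ^ 2 * L ^ 4)) = 4 * C * K ^ 2 * V ^ 2 * L ^ 4)%N by ring.
  apply: (@leq_trans (T * T ^ 2 * (T ^ K.+1) ^ 4)%N).
    apply: leq_mul; last by rewrite leq_exp2r.
    by apply: leq_mul; [apply: leq_trans MT|rewrite leq_exp2r].
  by rewrite -expnM -expnS -expnD leq_pexp2l //; move: K0; clear; lia.
apply: (@leq_trans ((T ^ (11 * K)) ^ (96 * K ^ 2) * T ^ (2 * K))%N).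
  apply: leq_mul; last by apply: (leq_trans LT); rewrite leq_pexp2l //; move: K0; clear; lia.
  by rewrite leq_exp2r // muln_gt0 expn_gt0 K0.
rewrite -expnM -expnD leq_pexp2l //; apply: (@leq_trans (1056 * K ^ 3 + 2 * K ^ 3)%N); last by rewrite -mulnDl.
rewrite leq_add //; first by apply: eq_leq; ring.
by rewrite leq_mul2l -{1}(expn1 K) leq_pexp2l.
Qed.

(** With K = #|S| comparable to rho^16, duality reads K^20 (de N / 2^(j+1))^20 <= C E^10 N^10 K^17.
    A factor K^3 / 2^(20 j) survives, at least c ([grow]^3 / 2^20)^j, and [grow]^3 / 2^20 =
    (1.024)^10 exceeds ((1.01)^2)^10. *)
Lemma energy_lower (Lam c0 : R) : 1 <= Lam -> 0 < c0 -> c0 <= 1 -> exists2 c : R, 0 < c <= 1 &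
  forall (N P1 P2 j rho : nat) (g : nat -> R[i]) (S : {set 'I_P1 * 'I_P2}) (de En : R),
  grid_ok Lam N P1 P2 -> (2 <= rho)%N -> (rho ^ 100 <= N)%N -> (#|S| <= rho ^ 16)%N -> (rho ^ 16 <= 2 ^ 16 * #|S|)%N ->
  c0 * grow ^+ j <= #|S|%:R -> 0 < de ->
  (forall p, p \in S -> de * N%:R <= cn (fsum N g P1 P2 p.1 p.2) * (2 * 2 ^+ j)) ->
  \sum_(n < N) cn (g n) ^+ 2 <= En -> c * ((101 / 100) ^+ 2) ^+ j * de ^+ 2 * N%:R < En.
Proof.
move=> L1 c00 c01; have [C C1 hC] := large_values_dual.
have [D DE] : exists D : R, D = C * Lam ^+ 10 * (2 ^+ 16) ^+ 17 * 2 ^+ 20 by eexists.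
have D1 : 1 <= D.
  rewrite DE; do 2 (apply: mulr_ege1; last by rewrite exprn_ege1 // ?exprn_ege1 // ler1n).
  by rewrite mulr_ege1 // exprn_ege1.
have D0 : 0 < D by exact: lt_le_trans D1.
have c30 : 0 < c0 ^+ 3 by rewrite exprn_gt0.
have c31 : c0 ^+ 3 <= 1 by rewrite exprn_ile1 // ltW.
pose c := c0 ^+ 3 / (2 * D).
have cc0 : 0 < c by rewrite divr_gt0 // mulr_gt0.
have cc1 : c <= 1 by rewrite ler_pdivrMr ?mulr_gt0 // mul1r; move: c31 D1; clear; lra.
exists c; first by rewrite cc0.
move=> N P1 P2 j rho g S de En ok r2 rN Sr rS cS de0 hS hE; rewrite ltNge; apply/negP => hle.
have [N0 _ _ _] := ok; have NR : (0 : R) < N%:R by rewrite ltr0n.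
have := hC N P1 P2 rho Lam g S ok L1 r2 rN Sr; set Z := \sum_(p in S) _; set A := \sum_(n < N) _ => h.
have A0 : 0 <= A by apply: sumr_ge0 => n _; exact: sqr_ge0.
have [g96 _ _] := grow_bounds; have g0 : 0 < grow by exact: lt_le_trans g96.
have SR : (0 : R) < #|S|%:R by apply: lt_le_trans cS; rewrite mulr_gt0 // exprn_gt0.
have j2 : (0 : R) < 2 ^+ j by rewrite exprn_gt0.
have Zlow : #|S|%:R * (de * N%:R / (2 * 2 ^+ j)) <= Z.
  rewrite -sum1_card natr_sum mulr_suml; apply: ler_sum => p pS.
  by rewrite mul1r ler_pdivrMr ?mulr_gt0 // hS.
have low0 : 0 < #|S|%:R * (de * N%:R / (2 * 2 ^+ j)) by rewrite mulr_gt0 // divr_gt0 ?mulr_gt0.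
have h1 : (#|S|%:R * (de * N%:R / (2 * 2 ^+ j))) ^+ 20 <= Z ^+ 20.
  by rewrite lerXn2r ?nnegrE // ltW // (lt_le_trans low0).
have Ale : A <= c * ((101 / 100) ^+ 2) ^+ j * de ^+ 2 * N%:R by exact: le_trans hle.
have A10 : A ^+ 10 <= c * (grow ^+ 3 / 2 ^+ 20) ^+ j * de ^+ 20 * N%:R ^+ 10.
  apply: (@le_trans _ _ ((c * ((101 / 100) ^+ 2) ^+ j * de ^+ 2 * N%:R) ^+ 10)).
    by rewrite lerXn2r ?nnegrE // (le_trans A0).
  rewrite 3!exprMn -[(de ^+ 2) ^+ 10]exprM ler_wpM2r ?exprn_ge0 // ler_wpM2r ?exprn_ge0 ?(ltW de0) //.
  apply: ler_pM; rewrite ?exprn_ge0 ?(ltW cc0) //; first by rewrite divr_ge0.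
    by rewrite exprS ler_piMr ?(ltW cc0) // exprn_ile1 // ltW.
  have -> : grow ^+ 3 / 2 ^+ 20 = (((8 / 5) ^+ 3 / 4) ^+ 10) :> R.
    rewrite expr_div_n exprAC -/grow; congr (_ / _).
    by rewrite (_ : 20 = 2 * 10)%N // exprM; congr (_ ^+ _); rewrite expr2; clear; lra.
  have e8 : (101 / 100) ^+ 2 <= (8 / 5) ^+ 3 / 4 :> R by rewrite !exprS expr0; clear; lra.
  have e80 : 0 <= (8 / 5) ^+ 3 / 4 :> R by apply: le_trans e8; rewrite sqr_ge0.
  move: e8 e80 (sqr_ge0 (101 / 100 : R)); move: ((101 / 100) ^+ 2) ((8 / 5) ^+ 3 / 4) => u v; clear => uv v0 u0.
  by rewrite [leLHS]exprAC lerXn2r ?nnegrE ?exprn_ge0 // lerXn2r ?nnegrE.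
have r272 : rho%:R ^+ 272 <= (2 ^+ 16 * #|S|%:R) ^+ 17 :> R.
  have -> : rho%:R ^+ 272 = (rho%:R ^+ 16) ^+ 17 :> R by rewrite -exprM.
  by rewrite lerXn2r ?nnegrE ?exprn_ge0 ?mulr_ge0 ?exprn_ge0 // -!natrX -natrM ler_nat.
have CL : 0 <= C * Lam ^+ 10 by rewrite mulr_ge0 ?exprn_ge0 //; apply: le_trans ler01 _.
have h2 : (#|S|%:R * (de * N%:R / (2 * 2 ^+ j))) ^+ 20 <=
   C * Lam ^+ 10 * (c * (grow ^+ 3 / 2 ^+ 20) ^+ j * de ^+ 20 * N%:R ^+ 10) * N%:R ^+ 10 * (2 ^+ 16 * #|S|%:R) ^+ 17.
  apply: (le_trans h1); apply: (le_trans h); apply: ler_pM => //.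
  - by rewrite mulr_ge0 ?exprn_ge0 // mulr_ge0 ?exprn_ge0.
  - by rewrite exprn_ge0.
  - by rewrite ler_wpM2r ?exprn_ge0 // ler_wpM2l.
have S17 : 0 < #|S|%:R ^+ 17 :> R by rewrite exprn_gt0.
have dN : 0 < de ^+ 20 * N%:R ^+ 20 by rewrite mulr_gt0 ?exprn_gt0.
have j20 : 0 < (2 ^+ 20) ^+ j :> R by rewrite !exprn_gt0.
have h3 : #|S|%:R ^+ 3 <= D * c * (grow ^+ 3) ^+ j.
  rewrite -(ler_pM2r (mulr_gt0 S17 dN)).
  have -> : #|S|%:R ^+ 3 * (#|S|%:R ^+ 17 * (de ^+ 20 * N%:R ^+ 20)) = (#|S|%:R * (de * N%:R / (2 * 2 ^+ j))) ^+ 20 * (2 ^+ 20 * (2 ^+ 20) ^+ j) :> R.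
    rewrite mulrA -exprD exprMn [(de * _ / _) ^+ 20]expr_div_n [(de * _) ^+ 20]exprMn [(2 * _) ^+ 20]exprMn [(2 ^+ j) ^+ 20]exprAC.
    rewrite -[RHS]mulrA divfK // gt_eqF // mulr_gt0 //; by rewrite exprn_gt0.
  apply: (le_trans (ler_wpM2r _ h2)); first by rewrite mulr_ge0 ?(ltW j20) ?exprn_ge0.
  have -> : N%:R ^+ 20 = N%:R ^+ 10 * N%:R ^+ 10 :> R by rewrite -exprD.
  rewrite DE [(grow ^+ 3 / _) ^+ j]expr_div_n [(2 ^+ 16 * _) ^+ 17]exprMn; move: j20.
  move: ((2 ^+ 20) ^+ j : R) ((2 ^+ 16) ^+ 17 : R) (2 ^+ 20 : R) ((grow ^+ 3) ^+ j : R) (N%:R ^+ 10 : R) (de ^+ 20) (#|S|%:R ^+ 17 : R) (Lam ^+ 10).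
  move=> z1 z2 z3 z4 z5 z6 z7 z8 z10; apply: eq_ler; field; by rewrite gt_eqF.
have h4 : c0 ^+ 3 * (grow ^+ 3) ^+ j <= #|S|%:R ^+ 3.
  rewrite [(grow ^+ 3) ^+ j]exprAC -exprMn lerXn2r ?nnegrE //; exact: (mulr_ge0 (ltW c00) (exprn_ge0 j (ltW g0))).
have := le_trans h4 h3; rewrite ler_pM2r; last by apply: exprn_gt0; apply: exprn_gt0.
rewrite /c.
have -> : D * (c0 ^+ 3 / (2 * D)) = c0 ^+ 3 / 2 by field; rewrite gt_eqF.
by move: c30; clear; lra.
Qed.

Lemma nat_ceil (x : R) : 0 <= x -> exists n : nat, x <= n%:R <= x + 1.
Proof.
move=> x0; pose p n := x <= (n%:R : R).
have ex : exists n, p n by exists (Num.bound x); apply/ltW/archi_boundP.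
case: (ex_minnP ex) => n hn minn; exists n; apply/andP; split; first exact: hn.
case: n hn minn => [|n] _ minn; first by rewrite addr_ge0.
have : ~~ p n by apply/negP => /minn; rewrite ltnn.
by rewrite /p -ltNge -natr1 lerD2r => /ltW.
Qed.

(** On cells where all phases of S are frozen, the cell average keeps at least half of each large
    coefficient, so [energy_lower] bounds its energy from below. If no cell reached density de (1 +
    tau), [energy_le] would contradict this. *)
Lemma spectrum_increment (Lam c0 : R) : 1 <= Lam -> 0 < c0 -> c0 <= 1 ->
  exists (C : nat) (c : R), [/\ (0 < C)%N, 0 < c, c <= 1 &
  forall (N P1 P2 j : nat) (A : pred nat) (S : {set 'I_P1 * 'I_P2}),
  grid_ok Lam N P1 P2 -> c0 * grow ^+ j <= #|S|%:R -> #|S|%:R <= 2 * grow ^+ j -> 0 < dens A N ->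
  (forall p, p \in S -> dens A N * N%:R <= cn (fsum N (balanced A N) P1 P2 p.1 p.2) * 2 ^+ j) ->
  C%:R * (2 ^+ j / dens A N) ^+ 36 <= ln N%:R ->
  exists a d N' : nat, [/\ (0 < d)%N, (0 < N')%N, forall t, (t < N')%N -> (a + d * t < N)%N,
    ln N%:R <= C%:R * 2 ^+ (21 * j) * ln N'%:R &
    dens A N * (1 + c * (101 / 100) ^+ j) <= dens (fun t => A (a + d * t)%N) N']].
Proof.
move=> L1 c00 c01; have [c1 /andP[c10 c11] hE] := energy_lower L1 c00 c01.
have [C0 C00 hT] := constant_phase_tiling.
have [C /andP[hC _]] := @nat_ceil (100 ^+ 4 * C0%:R) (mulr_ge0 (exprn_ge0 4 (ler0n R 100)) (ler0n R C0)).
have C0R : (1 : R) <= C0%:R by rewrite ler1n.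
have hC8 : 100 ^+ 4 <= C%:R :> R by apply: le_trans hC; rewrite ler_peMr // exprn_ge0.
exists C, (c1 / 4); split.
- by rewrite -(ltr0n R); apply: lt_le_trans hC8; rewrite exprn_gt0.
- by rewrite divr_gt0.
- by move: c11; clear; lra.
move=> N P1 P2 j A S ok Klow Kup; set de := dens A N => de0 hS lnN.
have de1 : de <= 1 by exact: dens_le1.
have [N0 _ _ _] := ok; have NR : (0 : R) < N%:R by rewrite ltr0n.
have j1 : 1 <= 2 ^+ j :> R by rewrite exprn_ege1 // ler1n.
have j0 : 0 < 2 ^+ j :> R by exact: lt_le_trans j1.
pose Z : R := 2 ^+ j / de.
have Zj : 2 ^+ j <= Z by rewrite ler_pdivlMr // ler_piMr // ltW.
have Z1 : 1 <= Z by exact: le_trans Zj.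
have Z0 : 0 < Z by exact: lt_le_trans Z1.
have [g96 g112 _] := grow_bounds; have g0 : 0 < grow by exact: lt_le_trans g96.
have gj : grow ^+ j <= (2 ^+ j) ^+ 7.
  have -> : (2 ^+ j) ^+ 7 = (2 ^+ 7) ^+ j :> R by rewrite exprAC.
  have e128 : 2 ^+ 7 = 128 :> R by rewrite !exprS expr0; clear; lra.
  rewrite e128 lerXn2r ?nnegrE //; first exact: ltW.
  by apply: le_trans g112 _; rewrite ler_nat.
set K := #|S| in Klow Kup.
have K0 : (0 < K)%N.
  by rewrite -(ltr0n R); apply: lt_le_trans Klow; rewrite mulr_gt0 // exprn_gt0.
have KR : (1 : R) <= K%:R by rewrite ler1n.
have Kj : K%:R <= 2 * (2 ^+ j) ^+ 7 :> R.
  by apply: (le_trans Kup); rewrite ler_pM2l.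
have KZ : K%:R <= 2 * Z ^+ 7 :> R.
  by apply: (le_trans Kj); rewrite ler_pM2l // lerXn2r ?nnegrE // ltW.
(* V >= 192 2^j / de makes the error 96 N / V at most half of de N / 2^j. *)
have [V /andP[V1 V2]] := @nat_ceil (192 * Z) (mulr_ge0 (ler0n R 192) (ltW Z0)).
have VZ : V%:R <= 193 * Z by move: V2 Z1; clear; lra.
have VR : (1 : R) <= V%:R by move: V1 Z1; clear; lra.
have V0 : (0 < V)%N by rewrite -(ltr0n R); exact: lt_le_trans VR.
pose E0 := (1058 * K ^ 3)%N.
have E00 : (0 < E0)%N by rewrite muln_gt0 expn_gt0 K0.
have E0j : E0%:R <= 100 ^+ 2 * (2 ^+ j) ^+ 21 :> R.
  rewrite natrM natrX; apply: (@le_trans _ _ (1058 * (2 * (2 ^+ j) ^+ 7) ^+ 3)).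
    by rewrite ler_wpM2l // lerXn2r ?nnegrE // mulr_ge0 // exprn_ge0 // ltW.
  move: (2 ^+ j) j0 => u u0; have -> : (2 * u ^+ 7) ^+ 3 = 8 * u ^+ 21 by ring.
  by rewrite mulrA ler_wpM2r ?exprn_ge0 ?(ltW u0) // expr2; clear; lra.
have E0Z : E0%:R <= 100 ^+ 2 * Z ^+ 21 :> R.
  by apply: (le_trans E0j); rewrite ler_wpM2l ?exprn_ge0 // lerXn2r ?nnegrE // ltW.
pose M0 := (4 * C0 * K ^ 2)%N.
have M00 : (0 < M0)%N by rewrite muln_gt0 expn_gt0 K0 muln_gt0 C00.
have M0V : (M0 * V)%N%:R <= 100 ^+ 2 * C0%:R * Z ^+ 15 :> R.
  rewrite natrM (natrM _ _ (K ^ 2)) natrM natrX.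
  apply: (@le_trans _ _ (4 * C0%:R * (2 * Z ^+ 7) ^+ 2 * (193 * Z))).
    apply: ler_pM => //; first by rewrite !mulr_ge0 ?exprn_ge0.
    by rewrite ler_wpM2l // ?mulr_ge0 // lerXn2r ?nnegrE // mulr_ge0 // exprn_ge0 // ltW.
  have -> : 4 * C0%:R * (2 * Z ^+ 7) ^+ 2 * (193 * Z) = 3088 * (C0%:R * Z ^+ 15) by ring.
  have CZ : 0 <= C0%:R * Z ^+ 15 by rewrite mulr_ge0 // exprn_ge0 // ltW.
  by rewrite -[leRHS]mulrA; apply: ler_wpM2r => //; rewrite expr2; clear; lra.
have lnN1 : C%:R * Z ^+ 36 <= ln N%:R by exact: lnN.
have Z36 : 0 < Z ^+ 36 by rewrite exprn_gt0.
have hbase : ((M0 * V) ^ E0 <= N)%N.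
  apply: ln_nat_pow_le => //; first by rewrite muln_gt0 M00.
  apply: le_trans lnN1; apply: (@le_trans _ _ (100 ^+ 2 * Z ^+ 21 * (100 ^+ 2 * C0%:R * Z ^+ 15))).
    apply: ler_pM => //; first by apply: ln_ge0; rewrite ler1n muln_gt0 M00.
    by apply: le_trans M0V; apply: ln_le_self; rewrite ltr0n muln_gt0 M00.
  have -> : 100 ^+ 2 * Z ^+ 21 * (100 ^+ 2 * C0%:R * Z ^+ 15) = 100 ^+ 4 * C0%:R * Z ^+ 36.
    by rewrite (exprD Z 21 15) (exprD 100 2 2); ring.
  by rewrite ler_wpM2r // ltW.
(* M is maximal, so N < ((M+1) V)^E0 later turns into a lower bound for ln M. *)
have [|M [M1 hM hM1]] := max_root V0 E00 (N := N).
  by apply: leq_trans hbase; rewrite leq_exp2r // leq_pmull.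
have M0M : (M0 <= M)%N.
  by have := leq_ltn_trans hbase hM1; rewrite ltn_exp2r // ltn_pmul2r.
have [rho [rho2 rhoK rhoK2 rho3]] := root16 K0.
have rN : (rho ^ 100 <= N)%N.
  apply: (@leq_trans ((2 * K) ^ 100)%N); first by rewrite leq_exp2r.
  apply: ln_nat_pow_le => //; first by rewrite muln_gt0 K0.
  apply: le_trans lnN1; apply: (@le_trans _ _ (100 * (4 * Z ^+ 7))).
    rewrite ler_wpM2l //; apply: (@le_trans _ _ (2 * K)%N%:R).
      by apply: ln_le_self; rewrite ltr0n muln_gt0 K0.
    by rewrite natrM; move: KZ; clear; lra.
  rewrite mulrA; apply: ler_pM; [by rewrite mulr_ge0|by rewrite exprn_ge0 // ltW| |by rewrite ler_weXn2l].
  by apply: le_trans hC8; rewrite !exprS expr0; clear; lra.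
pose p0 (k : 'I_K) : 'I_P1 * 'I_P2 := enum_val k.
have [|P tP hP] := hT K M V N (fun k => ((p0 k).1%:Z)%:~R / P1%:R) (fun k => ((p0 k).2%:Z)%:~R / P2%:R) K0 M1 V0.
  exact: leq_trans (tiling_exponent C00 K0 V0 M0M (erefl _)) hM.
have hph p : p \in S -> forall c t, c \in P -> (t < c.2)%N ->
    dst (phase (p.1%:Z%:~R / P1%:R) (p.2%:Z%:~R / P2%:R) (c.1.1 + c.1.2 * t) - phase (p.1%:Z%:~R / P1%:R) (p.2%:Z%:~R / P2%:R) c.1.1) * V%:R <= 6.
  move=> pS c t cP ct; have [_ [_ h]] := hP c cP; have := h (enum_rank_in pS p) t ct.
  by rewrite /p0 enum_rankK_in.
(* With h = 1.01^j, 2 (1 + tau) tau <= 4 h tau = c1 h^2, the lower bound of [energy_lower]; the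
   contradiction comes from its strictness. *)
pose tau : R := c1 / 4 * (101 / 100) ^+ j.
have h1 : 1 <= (101 / 100) ^+ j :> R by rewrite exprn_ege1 //; clear; lra.
have tau0 : 0 <= tau by rewrite mulr_ge0 ?exprn_ge0 ?divr_ge0 // ltW.
case: (boolP (has (fun c => de * (1 + tau) <= subdens A c) P)) => [/hasP[c cP hc]|/hasPn none].
  have [Mc [c0' _]] := hP c cP; have [tP1 _] := tP.
  exists c.1.1, c.1.2, c.2; split=> //; first exact: leq_trans M1 Mc.
    by move=> t; exact: tP1.
  have MR : (1 : R) <= M%:R by rewrite ler1n.
  have lM : ln M%:R <= ln c.2%:R by apply: ln_le; rewrite ?ltr0n // ler_nat.
  have l1 : ln N%:R <= E0%:R * (ln M%:R + ln (2 * V%:R)).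
    have MV0 : (0 : R) < (M * (2 * V))%N%:R by rewrite ltr0n !muln_gt0 M1 V0.
    have -> : ln M%:R + ln (2 * V%:R) = ln (M * (2 * V))%N%:R.
      have M0R : (0 : R) < M%:R by rewrite ltr0n.
      have V0R : 0 < 2 * V%:R :> R by rewrite mulr_gt0 // ltr0n.
      by rewrite -ln_mul // !natrM.
    rewrite mulrC -ln_exp_pow //; apply: ln_le => //; rewrite -natrX ler_nat; apply: (leq_trans (ltnW hM1)).
    by rewrite leq_exp2r // mulnCA mulnA leq_mul2r; move: M1; clear; lia.
  (* The contribution of V is at most half of ln N, so ln N <= 2 E0 ln M remains. *)
  have l2 : E0%:R * ln (2 * V%:R) * 2 <= ln N%:R.
    apply: le_trans lnN1; apply: (@le_trans _ _ (100 ^+ 2 * Z ^+ 21 * (2 * (193 * Z)) * 2)).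
      rewrite ler_wpM2r //; apply: ler_pM => //; first by apply: ln_ge0; move: VR; clear; lra.
      apply: (@le_trans _ _ (2 * V%:R)); last by rewrite ler_pM2l.
      by apply: ln_le_self; move: VR; clear; lra.
    apply: (@le_trans _ _ (100 ^+ 4 * Z ^+ 22)); last first.
      apply: ler_pM; rewrite ?exprn_ge0 ?(ltW Z0) //; by rewrite ler_weXn2l.
    have -> : 100 ^+ 2 * Z ^+ 21 * (2 * (193 * Z)) * 2 = 772 * 100 ^+ 2 * Z ^+ 22 by rewrite (exprS Z 21); move: (100 ^+ 2) (Z ^+ 21) => u v; ring.
    by rewrite ler_wpM2r ?exprn_ge0 ?(ltW Z0) // (exprD 100 2 2) ler_wpM2r ?exprn_ge0 // expr2; clear; lra.
  have l3 : ln N%:R <= 2 * E0%:R * ln M%:R by move: l1 l2; rewrite mulrDr; clear; lra.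
  apply: (le_trans l3); apply: ler_pM => //; [by rewrite mulr_ge0|exact: ln_ge0|].
  apply: (@le_trans _ _ (2 * (100 ^+ 2 * (2 ^+ j) ^+ 21))); first by rewrite ler_pM2l.
  rewrite mulrA mulnC exprM ler_wpM2r ?exprn_ge0 ?(ltW j0) //.
  by apply: le_trans hC8; rewrite (exprD 100 2 2) ler_wpM2r ?exprn_ge0 // expr2; clear; lra.
exfalso.
have en := @energy_le A N P tP tau tau0; have {en} : cell_energy A N P <= 2 * (1 + tau) * tau * de ^+ 2 * N%:R.
  by apply: en => c cP; rewrite ltW // ltNge none.
have elow := hE N P1 P2 j rho (fun n => (cell_average A N P n)%:C) S de (cell_energy A N P) ok rho2 rN rhoK rhoK2 Klow de0.
apply/negP; rewrite -ltNge; apply: (@le_lt_trans _ _ (c1 * ((101 / 100) ^+ 2) ^+ j * de ^+ 2 * N%:R)).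
  rewrite ler_wpM2r // ler_wpM2r ?sqr_ge0 // exprAC expr2 /tau; move: h1 c10 c11; move: ((101 / 100) ^+ j) => h; clear => h1 c10 c11.
  have w0 : c1 / 4 * h <= 1 / 4 * h by rewrite ler_wpM2r //; lra.
  have u0 : 0 <= c1 * (h * h) by rewrite !mulr_ge0 //; lra.
  have v0 : 0 <= c1 / 4 * h by rewrite mulr_ge0 //; lra.
  have : 2 * (1 + c1 / 4 * h) * (c1 / 4 * h) <= 2 * (2 * h) * (c1 / 4 * h) by rewrite ler_wpM2r //; lra.
  by rewrite (_ : 2 * (2 * h) * (c1 / 4 * h) = c1 * (h * h)); [lra|field].
apply: elow => [p pS|]; last first.
  apply: le_trans (cell_average_energy A tP); apply: ler_sum => n _; by rewrite cn_real real_normK ?num_real.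
have hp := hS p pS; have hd := fsum_cell_average A tP V0 (hph p pS).
set F := fsum N (balanced A N) _ _ _ _ in hp hd; set F' := fsum N _ _ _ _ _ in hd *.
have tri : cn F <= cn F' + cn (F - F') by rewrite -{1}(subrK F' F) addrC; exact: cnD.
have d1 : cn (F - F') * (2 * 2 ^+ j) <= de * N%:R.
  have h2 : 192 * 2 ^+ j <= V%:R * de by rewrite -ler_pdivrMr // -mulrA.
  have h3 : cn (F - F') * (192 * 2 ^+ j) <= 96 * (de * N%:R).
    apply: (le_trans (ler_wpM2l (cn_ge0 _) h2)); rewrite (_ : 96 * (de * N%:R) = 96 * N%:R * de); last by ring.
    by rewrite [leLHS]mulrA ler_wpM2r // ltW.
  by move: h3; move: (cn _) (2 ^+ j) => u v; clear; lra.
have := ler_wpM2r (ltW j0) tri; rewrite mulrDl; move: hp d1; move: (cn F) (cn F') (cn (F - F')) (2 ^+ j) (de * N%:R) => u1 u2 u3 u4 u5.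
by clear; lra.
Qed.

(** * Local solutions *)

Definition quad m (a z : 'I_m -> int) : int := \sum_k a k * z k ^+ 2.
Definition nsol m (a : 'I_m -> int) (W : nat) : nat :=
  #|[pred z : {ffun 'I_m -> 'I_W} | (W%:Z %| quad a (fun k => (z k)%:Z))%Z]|.

Lemma quad_dvd m (a z z' : 'I_m -> int) (d : int) : (forall k, (d %| z k - z' k)%Z) ->
  (d %| quad a z)%Z = (d %| quad a z')%Z.
Proof.
move=> h; rewrite -(subrK (quad a z') (quad a z)) rpredDl // /quad -sumrB.
by apply: rpred_sum => k _; rewrite -mulrBr subr_sqr mulrCA dvdz_mulr.
Qed.

Lemma zord_subproof (W : nat) (x : int) : (0 < W)%N -> (`|(x %% W%:Z)%Z|%N < W)%N.
Proof.
move=> W0; rewrite -ltz_nat abszE ger0_norm ?modz_ge0 //; last by rewrite eqz_nat -lt0n.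
by rewrite ltz_mod // eqz_nat -lt0n.
Qed.

Lemma zord_dvd (W : nat) (x : int) : (0 < W)%N -> (W%:Z %| (`|(x %% W%:Z)%Z|%N)%:Z - x)%Z.
Proof.
move=> W0; rewrite abszE ger0_norm ?modz_ge0 //; last by rewrite eqz_nat -lt0n.
by rewrite -eqz_mod_dvd modz_mod.
Qed.

Lemma nsol_ge m (a : 'I_m -> int) (W : nat) (T : finType) (F : T -> 'I_m -> int) : (0 < W)%N ->
  (forall t, (W%:Z %| quad a (F t))%Z) ->
  (forall t t', (forall k, (W%:Z %| F t k - F t' k)%Z) -> t = t') -> (#|T| <= nsol a W)%N.
Proof.
move=> W0 hF inj; pose f t : {ffun 'I_m -> 'I_W} := [ffun k => Ordinal (zord_subproof (F t k) W0)].
have injf : injective f.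
  move=> t t' /ffunP h; apply: inj => k; have := h k; rewrite !ffunE => /(congr1 val) /= hk.
  have h1 := zord_dvd (F t k) W0; have h2 := zord_dvd (F t' k) W0; rewrite -hk in h2.
  by have := rpredB h2 h1; rewrite (_ : _ - _ = F t k - F t' k) //; ring.
rewrite -(card_imset _ injf); apply/subset_leq_card/subsetP => z /imsetP[t _ ->].
rewrite inE (quad_dvd a (z' := F t)) // => k; rewrite ffunE; exact: zord_dvd.
Qed.

Lemma dvdz_mod_nat (W x y : nat) : x = y %[mod W] -> (W%:Z %| x%:Z - y%:Z)%Z.
Proof. by move=> h; rewrite -eqz_mod_dvd !modz_nat h. Qed.

Lemma residue_inj (W : nat) (x y : 'I_W) (F G : int) :
  (W%:Z %| F - x%:Z)%Z -> (W%:Z %| G - y%:Z)%Z -> (W%:Z %| F - G)%Z -> x = y.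
Proof.
move=> h1 h2 h3; have : (W%:Z %| x%:Z - y%:Z)%Z.
  have -> : x%:Z - y%:Z = (F - G) - (F - x%:Z) + (G - y%:Z) by move: (x%:Z) (y%:Z) => u v; ring.
  by rewrite rpredD // rpredB.
move=> /dvdz_small h; apply: val_inj => /=; have : x%:Z - y%:Z = 0.
  by apply: h; have := ltn_ord x; have := ltn_ord y; clear; lia.
by clear; lia.
Qed.

Lemma nsol_mul m (a : 'I_m -> int) (W1 W2 : nat) : (0 < W1)%N -> (0 < W2)%N -> coprime W1 W2 ->
  (nsol a W1 * nsol a W2 <= nsol a (W1 * W2))%N.
Proof.
move=> W10 W20 co.
pose T1 := {z : {ffun 'I_m -> 'I_W1} | (W1%:Z %| quad a (fun k => (z k)%:Z))%Z}.
pose T2 := {z : {ffun 'I_m -> 'I_W2} | (W2%:Z %| quad a (fun k => (z k)%:Z))%Z}.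
have -> : (nsol a W1 * nsol a W2 = #|{: T1 * T2}|)%N by rewrite card_prod !card_sig.
pose F (t : T1 * T2) k : int := (chinese W1 W2 (val t.1 k) (val t.2 k))%:Z.
have m1 t k : (W1%:Z %| F t k - (val t.1 k)%:Z)%Z by apply: dvdz_mod_nat; exact: chinese_modl.
have m2 t k : (W2%:Z %| F t k - (val t.2 k)%:Z)%Z by apply: dvdz_mod_nat; exact: chinese_modr.
apply: (nsol_ge (F := F)); first by rewrite muln_gt0 W10.
  move=> t; rewrite PoszM Gauss_dvdz // (quad_dvd a (m1 t)) (quad_dvd a (m2 t)).
  by rewrite (valP t.1) (valP t.2).
move=> [t1 t2] [u1 u2] h; congr (_, _); apply: val_inj; apply/ffunP => k.
  apply: (residue_inj (m1 (t1, t2) k) (m1 (u1, u2) k)).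
  by apply: dvdz_trans (h k); rewrite PoszM dvdz_mulr.
apply: (residue_inj (m2 (t1, t2) k) (m2 (u1, u2) k)).
by apply: dvdz_trans (h k); rewrite PoszM dvdz_mull.
Qed.

Definition gauss (W : nat) (b : int) : R[i] := \sum_(x < W) e (b%:~R * (x ^ 2)%N%:R / W%:R).

Lemma nsol_gauss m (a : 'I_m -> int) (W : nat) : (0 < W)%N ->
  (W * nsol a W)%N%:R = \sum_(t < W) \prod_k gauss W (a k * t%:Z) :> R[i].
Proof.
move=> W0; have -> : \sum_(t < W) \prod_k gauss W (a k * t%:Z) =
   \sum_(z : {ffun 'I_m -> 'I_W}) \sum_(t < W) e ((quad a (fun k => (z k)%:Z))%:~R * t%:R / W%:R).
  rewrite exchange_big; apply: eq_bigr => t _; rewrite /gauss bigA_distr_bigA; apply: eq_bigr => z _.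
  rewrite -e_sum /quad rmorph_sum /= !mulr_suml; congr e; apply: eq_bigr => k _.
  by rewrite [in RHS]intrM rmorphXn /= [in LHS]intrM natrX -!pmulrn; ring.
under eq_bigr => z _ do rewrite sum_e_period //.
by rewrite -big_mkcond sumr_const natrM mulr_natr /nsol; congr (_ *+ _); apply: eq_card => z; rewrite !inE.
Qed.

Lemma sum_periodic_shift (V : nmodType) (f : nat -> V) (W y : nat) : (0 < W)%N -> (forall x, f (x %% W)%N = f x) ->
  \sum_(h < W) f (y + h)%N = \sum_(x < W) f x.
Proof.
move=> W0 per; pose s (h : 'I_W) : 'I_W := Ordinal (ltn_pmod (y + h) W0).
have injs : injective s.
  move=> h h' /(congr1 val) /= /eqP; rewrite eqn_modDl => /eqP; rewrite !modn_small // => hh; exact: val_inj.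
by rewrite [RHS](reindex_inj injs); apply: eq_bigr => h _; rewrite /= per.
Qed.

Lemma card_multiples (W D q : nat) : (0 < D)%N -> W = (D * q)%N -> (#|[pred t : 'I_W | (D %| t)%N]| <= q)%N.
Proof.
move=> D0 WE; have [q0|q0] := posnP q.
  by rewrite eq_card0 // => t; have := ltn_ord t; rewrite {2}WE q0 muln0.
pose f (t : 'I_W) : 'I_q := insubd (Ordinal q0) (t %/ D)%N.
have lt (t : 'I_W) : (t %/ D < q)%N by rewrite ltn_divLR // mulnC -WE.
rewrite -(card_in_imset (f := f)); first by apply: (leq_trans (max_card _)); rewrite card_ord.
move=> t t'; rewrite !inE => Dt Dt' /(congr1 val); rewrite /= !val_insubd !lt => h.
by apply: val_inj => /=; rewrite -(divnK Dt) -(divnK Dt') h.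
Qed.

(** Differencing: the inner sum over y vanishes unless W divides 2 b h. As W is odd this means W /
    gcd(b, W) divides h, which leaves at most gcd(b, W) values of h. *)
Lemma gauss_le (W : nat) (b : int) : odd W -> cn (gauss W b) ^+ 2 <= (W * gcdn `|b| W)%N%:R.
Proof.
move=> oW; have W0 : (0 < W)%N by case: W oW.
have WR : (W%:R : R) != 0 by rewrite pnatr_eq0 -lt0n.
pose f (x : nat) := e (b%:~R * (x ^ 2)%N%:R / W%:R).
have per x : f (x %% W)%N = f x.
  rewrite /f {2}(divn_eq x W); set q := (x %/ W)%N; set r := (x %% W)%N.
  have -> : b%:~R * ((q * W + r) ^ 2)%N%:R / W%:R = b%:~R * (r ^ 2)%N%:R / W%:R + (b * (q * (q * W + 2 * r))%N%:Z)%:~R :> R.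
    by rewrite !natrX intrM -!pmulrn !(natrD, natrM); field.
  by rewrite e_addint.
have E : (cn (gauss W b) ^+ 2)%:C = \sum_(h < W) f h * \sum_(y < W) e ((2 * b * h%:Z)%:~R * y%:R / W%:R).
  rewrite cn_sqC /gauss cj_sum mulr_sumr.
  under eq_bigr => y _ do rewrite -(sum_periodic_shift y W0 per) mulr_suml.
  rewrite exchange_big; apply: eq_bigr => h _; rewrite mulr_sumr; apply: eq_bigr => y _.
  rewrite /f -eB -eD; congr e; rewrite !intrM -!pmulrn !natrX natrD; by field.
have -> : cn (gauss W b) ^+ 2 = cn (cn (gauss W b) ^+ 2)%:C by rewrite cn_real ger0_norm // sqr_ge0.
rewrite E; apply: (le_trans (cn_sum _ _ _)).
pose D := (W %/ gcdn `|b| W)%N.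
have g0 : (0 < gcdn `|b| W)%N by rewrite gcdn_gt0 W0 orbT.
have gW : (gcdn `|b| W %| W)%N by exact: dvdn_gcdr.
have D0 : (0 < D)%N by rewrite divn_gt0 // dvdn_leq.
have WE : W = (D * gcdn `|b| W)%N by rewrite /D divnK.
apply: (@le_trans _ _ (\sum_(h < W) (if (D %| h)%N then W%:R else 0))).
  apply: ler_sum => h _; rewrite cnM cn_e mul1r sum_e_period //; case: ifP => [hd|_]; last by rewrite cn0; case: ifP.
  rewrite cn_nat; suff -> : (D %| h)%N by [].
  move: hd; rewrite dvdzE -mulrA !abszM /= Gauss_dvdr; last by rewrite coprimen2.
  have [bb bE] : exists bb, `|b|%N = (bb * gcdn `|b| W)%N.
    by exists (`|b| %/ gcdn `|b| W)%N; rewrite divnK // dvdn_gcdl.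
  rewrite {1}WE {2}bE mulnAC dvdn_pmul2r // Gauss_dvdr //.
  rewrite /coprime -(eqn_pmul2r g0) mul1n muln_gcdl -WE -bE gcdnC //.
by rewrite -big_mkcond sumr_const -[leLHS]mulr_natr -natrM ler_nat leq_mul2l (card_multiples D0 WE) orbT.
Qed.

(** The denominator of t / W in lowest terms, not the product of the primes dividing it. *)
Definition rad (W t : nat) : nat := (W %/ gcdn t W)%N.

(** In the Gauss sum formula t = 0 gives W^m. Since the coefficients are units, every other factor
    depends only on the reduced denominator of t / W. *)
Lemma nsol_error m (a : 'I_m -> int) (W : nat) : odd W -> (forall k, coprime `|a k| W) ->
  (W%:R ^+ m - \sum_(t < W | (0 < t)%N) (W%:R / Num.sqrt (rad W t)%:R) ^+ m <= (W * nsol a W)%N%:R :> R).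
Proof.
move=> oW co; have W0 : (0 < W)%N by case: W oW co.
have h := nsol_gauss a W0; rewrite (bigD1 (Ordinal W0)) //= in h.
have g0 : \prod_k gauss W (a k * 0) = W%:R ^+ m.
  rewrite -[X in _ ^+ X]card_ord -prodr_const; apply: eq_bigr => k _.
  rewrite mulr0 /gauss (eq_bigr (fun=> 1)) => [|x _]; first by rewrite sumr_const card_ord.
  by rewrite !mul0r e0.
rewrite g0 in h; set E := \sum_(t < W | _) _ in h.
have hE : cn E <= \sum_(t < W | (0 < t)%N) (W%:R / Num.sqrt (rad W t)%:R) ^+ m.
  apply: (le_trans (cn_sum _ _ _)); rewrite (eq_bigl (fun t : 'I_W => (0 < t)%N)); last first.
    by move=> t; rewrite -val_eqE /= lt0n.
  apply: ler_sum => t t0; rewrite cn_prod -[X in _ <= _ ^+ X]card_ord -prodr_const; apply: ler_prod => k _.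
  rewrite cn_ge0 /=; have gg : gcdn `|a k * t%:Z| W = gcdn t W by rewrite abszM /= gcdnC Gauss_gcdr 1?gcdnC // coprime_sym.
  have gt0 : (0 < gcdn t W)%N by rewrite gcdn_gt0 W0 orbT.
  have r0 : (0 < rad W t)%N by rewrite /rad divn_gt0 // dvdn_leq // dvdn_gcdr.
  have rR : (0 : R) < (rad W t)%:R by rewrite ltr0n.
  have sq := sqr_sqrtr (ltW rR).
  rewrite -(ler_pXn2r (n := 2)) ?nnegrE ?cn_ge0 ?divr_ge0 ?sqrtr_ge0 //.
  apply: (le_trans (gauss_le _ oW)); rewrite gg expr_div_n sq ler_pdivlMr // -natrX -natrM ler_nat.
  by rewrite -mulnA mulnC [(gcdn _ _ * _)%N]mulnC divnK ?dvdn_gcdr // expnS expn1.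
have : (W%:R ^+ m : R) <= (W * nsol a W)%N%:R + cn E.
  have -> : (W%:R ^+ m : R) = cn (W%:R ^+ m) by rewrite cnX cn_nat.
  have -> : W%:R ^+ m = (W * nsol a W)%N%:R - E by rewrite h addrK.
  by apply: (le_trans (cnB _ _)); rewrite cn_nat.
by move: hE; clear; lra.
Qed.

(** At most d of the fractions t / W have reduced denominator d. *)
Lemma sum_rad_le (W B : nat) (f : nat -> R) : (0 < W)%N -> (forall d, 0 <= f d) ->
  (forall t, (0 < t < W)%N -> (B <= rad W t)%N) ->
  \sum_(t < W | (0 < t)%N) f (rad W t) <= \sum_(d < W.+1 | (B <= d)%N) d%:R * f d.
Proof.
move=> W0 f0 hB; have lt t : (rad W t < W.+1)%N by rewrite ltnS leq_div.
rewrite (partition_big (fun t : 'I_W => Ordinal (lt t)) (fun d : 'I_W.+1 => B <= d)%N) /=; last first.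
  by move=> t t0; rewrite hB // t0 ltn_ord.
apply: ler_sum => d Bd.
rewrite (eq_bigr (fun=> f d)) => [|t /andP[_ /eqP <-] //].
rewrite sumr_const -[leLHS]mulr_natl ler_wpM2r // ler_nat.
have [d0|d0] := posnP d.
  rewrite eq_card0 ?d0 // => t; rewrite inE; apply/negbTE/negP => /andP[_ /eqP /(congr1 val) /= h].
  have : (0 < rad W t)%N by rewrite /rad divn_gt0 ?gcdn_gt0 ?W0 ?orbT // dvdn_leq // dvdn_gcdr.
  by rewrite h d0.
have [dW|ndW] := boolP (d %| W)%N; last first.
  rewrite eq_card0 // => t; rewrite inE; apply/negbTE/negP => /andP[_ /eqP /(congr1 val) /= h].
  by move/negP: ndW; apply; rewrite -h; apply/dvdnP; exists (gcdn t W); rewrite mulnC divnK // dvdn_gcdr.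
have WE : W = (W %/ d * d)%N by rewrite divnK.
apply: leq_trans (card_multiples _ WE); last by rewrite divn_gt0 // dvdn_leq.
apply/subset_leq_card/subsetP => t; rewrite !inE => /andP[_ /eqP /(congr1 val) /= <-].
have g0 : (0 < gcdn t W)%N by rewrite gcdn_gt0 W0 orbT.
have -> : (W %/ rad W t = gcdn t W)%N.
  rewrite /rad -{1}(divnK (dvdn_gcdr t W)) mulKn // divn_gt0 // dvdn_leq // dvdn_gcdr //.
exact: dvdn_gcdl.
Qed.

(** Telescoping: d^(-3/2) <= 2 / sqrt(d - 1) - 2 / sqrt d. *)
Lemma sum_pow32_le (B n : nat) : (1 < B)%N ->
  \sum_(d < B + n | (B <= d)%N) (d%:R * Num.sqrt d%:R)^-1 <= 2 / Num.sqrt (B.-1)%:R - 2 / Num.sqrt (B + n).-1%:R :> R.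
Proof.
move=> B1; elim: n => [|n IH].
  by rewrite addn0 subrr big1 // => d h; have := ltn_ord d; rewrite ltnNge h.
rewrite big_mkcond addnS big_ord_recr /= -big_mkcond /= leq_addr; apply: (le_trans (lerD IH (lexx _))).
have [k kE] : exists k, (B + n)%N = k.+2 by exists (B + n).-2; move: B1; clear; lia.
rewrite kE /=; set u : R := Num.sqrt k.+1%:R; set v : R := Num.sqrt k.+2%:R.
have u2 : u ^+ 2 = k.+1%:R by rewrite sqr_sqrtr.
have v2 : v ^+ 2 = k.+2%:R by rewrite sqr_sqrtr.
have u0 : 0 < u by rewrite sqrtr_gt0 ltr0n.
have v0 : 0 < v by rewrite sqrtr_gt0 ltr0n.
have uv : u <= v by rewrite ler_sqrt ?ltr0n // ler_nat.
have vu : (v - u) * (v + u) = 1 by rewrite -subr_sqr u2 v2 -natrB // subSnn.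
rewrite -v2; suff : (v ^+ 2 * v)^-1 <= 2 / u - 2 / v by lra.
have -> : 2 / u - 2 / v = 2 * (v - u) / (u * v) by field; rewrite !gt_eqF.
have vu0 : 0 < v + u by rewrite addr_gt0.
have -> : v - u = (v + u)^-1.
  by apply: (mulIf (_ : v + u != 0)); rewrite ?vu ?mulVf // gt_eqF.
rewrite -[leLHS]mul1r ler_pdivrMr ?mulr_gt0 ?exprn_gt0 //.
have -> : 2 * (v + u)^-1 / (u * v) * (v ^+ 2 * v) = 2 * (v ^+ 2 * v) / ((v + u) * (u * v)).
  by field; rewrite !gt_eqF.
rewrite ler_pdivlMr ?mulr_gt0 // mul1r expr2; move: u0 v0 uv; clear => u0 v0 uv.
have a0 : u * u <= v * v by apply: ler_pM => //; exact: ltW.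
have a1 : u * (v * v) <= v * (v * v) by rewrite ler_wpM2r // mulr_ge0 // ltW.
have a2 : u * u * v <= v * v * v by rewrite ler_wpM2r // ltW.
by move: a1 a2; clear; lra.
Qed.

Lemma sqrt_nat_gt0 n : (0 < n)%N -> 0 < Num.sqrt n%:R :> R.
Proof. by move=> n0; rewrite sqrtr_gt0 ltr0n. Qed.

(* The singular series of moduli free of small primes is at least 1/2. *)
Lemma nsol_good n (a : 'I_n.+1 -> int) (W : nat) : (5 <= n.+1)%N -> (0 < W)%N ->
  (forall p, prime p -> (p %| W)%N -> (17 <= p)%N /\ forall k, ~~ (p %| `|a k|)%N) ->
  W%:R ^+ n <= 2 * (nsol a W)%:R :> R.
Proof.
move=> n5 W0 hW; have WR : (0 : R) < W%:R by rewrite ltr0n.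
have oW : odd W.
  apply: contraT => ev; have : (2 %| W)%N by rewrite dvdn2 ev.
  by move=> /(hW 2%N isT)[].
have co k : coprime `|a k| W.
  rewrite /coprime -dvdn1; apply: contraT => h; have g1 : (1 < gcdn `|a k| W)%N.
    by rewrite ltn_neqAle gcdn_gt0 W0 orbT andbT; apply: contra h => /eqP <-.
  have [_ /(_ k)] := hW _ (pdiv_prime g1) (dvdn_trans (pdiv_dvd _) (dvdn_gcdr _ _)).
  by rewrite (dvdn_trans (pdiv_dvd _) (dvdn_gcdl _ _)).
have hE := nsol_error oW co.
have h17 t : (0 < t < W)%N -> (17 <= rad W t)%N.
  move=> /andP[t0 tW]; have r1 : (1 < rad W t)%N.
    rewrite /rad ltn_divRL ?dvdn_gcdr // mul1n; apply: leq_ltn_trans tW; exact: dvdn_leq (dvdn_gcdl _ _).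
  have rW : (rad W t %| W)%N by apply/dvdnP; exists (gcdn t W); rewrite mulnC divnK // dvdn_gcdr.
  have [h _] := hW _ (pdiv_prime r1) (dvdn_trans (pdiv_dvd _) rW).
  by apply: (leq_trans h); apply: dvdn_leq (pdiv_dvd _); exact: ltnW.
pose f (d : nat) : R := (W%:R / Num.sqrt d%:R) ^+ n.+1.
have f0 d : 0 <= f d by rewrite exprn_ge0 // divr_ge0 // sqrtr_ge0.
have s1 := sum_rad_le W0 f0 h17.
have s2 : \sum_(d < W.+1 | (17 <= d)%N) d%:R * f d <= W%:R ^+ n.+1 * \sum_(d < 17 + W | (17 <= d)%N) (d%:R * Num.sqrt d%:R)^-1.
  rewrite mulr_sumr [leRHS]big_mkcond [leLHS]big_mkcond.
  apply: (@le_trans _ _ (\sum_(d < W.+1) (if (17 <= d)%N then W%:R ^+ n.+1 * (d%:R * Num.sqrt d%:R)^-1 else 0))).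
    apply: ler_sum => d _; case: ifP => // d17; have d0 : (0 < d)%N by apply: leq_trans d17.
    have sd0 := sqrt_nat_gt0 d0; have dR : (0 : R) < d%:R by rewrite ltr0n.
    have sd1 : 1 <= Num.sqrt d%:R :> R by rewrite -{1}sqrtr1 ler_sqrt // ler1n.
    have sd2 := sqr_sqrtr (ltW dR).
    rewrite /f expr_div_n mulrCA ler_wpM2l ?exprn_ge0 // -[leRHS]mul1r ler_pdivlMr ?mulr_gt0 // mulrAC ler_pdivrMr ?exprn_gt0 // mul1r.
    move: sd1 sd2; set sd := Num.sqrt _ => sd1 sd2.
    apply: (@le_trans _ _ (sd ^+ 5)); last by rewrite ler_weXn2l.
    by rewrite -sd2; apply: eq_ler; ring.
  apply: (sum_ord_widen (G := fun d => if (17 <= d)%N then W%:R ^+ n.+1 * (d%:R * Num.sqrt d%:R)^-1 else 0)); first by rewrite addnC addnS ltnS leq_addr.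
  by move=> d; case: ifP => // _; rewrite mulr_ge0 ?exprn_ge0 ?invr_ge0 ?mulr_ge0 ?sqrtr_ge0.
(* The threshold 17 is chosen because the tail is then at most 2 / sqrt 16 = 1/2. *)
have s3 : \sum_(d < 17 + W | (17 <= d)%N) (d%:R * Num.sqrt d%:R)^-1 <= 1 / 2 :> R.
  apply: (le_trans (sum_pow32_le W (isT : (1 < 17)%N))).
  have -> : (Num.sqrt 17.-1%:R : R) = 4.
    by rewrite -[17.-1%:R]/(16%:R : R) (_ : 16%:R = 4 ^+ 2 :> R) ?sqrtr_sqr ?ger0_norm // expr2; lra.
  have : 0 <= 2 / Num.sqrt (17 + W).-1%:R :> R by rewrite divr_ge0 ?sqrtr_ge0.
  by lra.
have h1 : \sum_(t < W | (0 < t)%N) (W%:R / Num.sqrt (rad W t)%:R) ^+ n.+1 <= W%:R ^+ n.+1 / 2 :> R.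
  apply: (le_trans s1); apply: (le_trans s2); have := ler_wpM2l (exprn_ge0 n.+1 (ltW WR)) s3.
  by rewrite mulrA mulr1.
rewrite -(ler_pM2l WR) -exprS mulrCA -natrM; move: hE h1; clear; lra.
Qed.

Lemma root_le_three_fifths (u x : R) : u ^+ 2 = x -> 3 <= x -> 0 < u -> u <= 3 / 5 * x.
Proof.
move=> u2 x3 u0; have u53 : 5 / 3 <= u by rewrite leNgt; apply/negP => h; move: u2 x3; rewrite expr2; nra.
by rewrite -u2 expr2; nra.
Qed.

Lemma ternary_count_gt1 (u x y : R) : u ^+ 2 = x -> 3 <= x -> 0 < u -> u <= 3 / 5 * x ->
  x ^+ 3 - (x - 1) * u ^+ 3 <= x * y -> 1 < y.
Proof.
move=> u2 x3 u0 ux; have -> : u ^+ 3 = x * u by rewrite exprSr u2.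
have -> : x ^+ 3 - (x - 1) * (x * u) = x * (x ^+ 2 - (x - 1) * u) by ring.
rewrite ler_pM2l; last by lra.
have : (x - 1) * u <= (x - 1) * (3 / 5 * x) by rewrite ler_wpM2l //; lra.
by rewrite expr2; nra.
Qed.

(** For a prime each nonzero t contributes at most p^(3/2) and p^3 - (p - 1) p^(3/2) > p already for
    p >= 3. More than one solution means a nonzero one, the starting point for Hensel's lemma. *)
Lemma nsol3_prime (a : 'I_3 -> int) (p : nat) : prime p -> (2 < p)%N -> (forall k, ~~ (p %| `|a k|)%N) -> (1 < nsol a p)%N.
Proof.
move=> pp p2 ha; have p0 : (0 < p)%N by exact: prime_gt0.
have oW : odd p by apply: contraT => ev; case/even_prime: pp => [pE|]; [by move: p2; rewrite pE|by rewrite (negbTE ev)].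
have co k : coprime `|a k| p by rewrite coprime_sym prime_coprime.
have := nsol_error oW co; have pR : (3 : R) <= p%:R by rewrite ler_nat.
have -> : \sum_(t < p | (0 < t)%N) (p%:R / Num.sqrt (rad p t)%:R) ^+ 3 = p.-1%:R * (p%:R / Num.sqrt p%:R) ^+ 3 :> R.
  rewrite (eq_bigr (fun=> (p%:R / Num.sqrt p%:R) ^+ 3)) => [|t t0].
    rewrite sumr_const -[LHS]mulr_natl; congr (_%:R * _).
    rewrite (eq_card (B := predC1 (Ordinal p0))) ?cardC1 ?card_ord // => t.
    by rewrite inE -[LHS]/(0 < t)%N lt0n -val_eqE.
  have -> : rad p t = p; last by [].
  rewrite /rad; have /eqP -> : coprime t p; last by rewrite divn1.
  by rewrite coprime_sym prime_coprime // gtnNdvd.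
have sp0 := sqrt_nat_gt0 p0; have pR0 : (0 : R) < p%:R by rewrite ltr0n.
have sp2 := sqr_sqrtr (ltW pR0).
have -> : p%:R / Num.sqrt p%:R = Num.sqrt p%:R :> R by rewrite -{1}sp2 expr2 mulfK // gt_eqF.
have sle := root_le_three_fifths sp2 pR sp0.
have -> : (p.-1%:R : R) = p%:R - 1 by rewrite -{2}(prednK p0) -natr1 addrK.
by rewrite natrM -(ltr_nat R) => h; apply: (ternary_count_gt1 sp2 pR sp0 sle h).
Qed.

(** * Hensel lifting and the small primes *)

Definition upd m (z : 'I_m -> int) (j : 'I_m) (x : int) : 'I_m -> int := fun k => if k == j then x else z k.

Lemma quad_upd m (a z : 'I_m -> int) j x y : quad a (upd z j y) = quad a (upd z j x) + a j * (y ^+ 2 - x ^+ 2).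
Proof.
rewrite /quad (bigD1 j) //= [in RHS](bigD1 j) //= /upd !eqxx.
rewrite (eq_bigr (fun k => a k * (if k == j then x else z k) ^+ 2)) => [|k /negbTE -> //].
by ring.
Qed.

Lemma mod_inverse (p : nat) (d u : int) : prime p -> ~~ (p %| d)%Z -> exists t : int, (p %| u + d * t)%Z.
Proof.
move=> pp nd; have co : coprimez p d by rewrite coprimezE prime_coprime.
have [x [y]] := Bezoutz p d; rewrite (eqP co) => h; exists (- (u * y)).
apply/dvdzP; exists (u * x); have : u * (x * p%:Z + y * d) = u * 1 by rewrite h.
by clear; lia.
Qed.

(** Newton's method in the single variable j, where p^v exactly divides the derivative 2 b_j y_j.
    Adding p^(n - v) t to x changes the form by p^n d t modulo p^(n+1) with d prime to p. The other
    coordinates may be arbitrary in their residue classes, and this freedom is what produces many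
    solutions. *)
Lemma hensel_lift m (b y0 : 'I_m -> int) (j : 'I_m) (p v E : nat) : prime p ->
  (p%:Z ^+ v.*2.+1 %| quad b y0)%Z -> (p%:Z ^+ v %| 2 * b j * y0 j)%Z -> ~~ (p%:Z ^+ v.+1 %| 2 * b j * y0 j)%Z ->
  forall z : 'I_m -> int, (forall k, (p%:Z ^+ v.*2.+1 %| z k - y0 k)%Z) ->
  exists x : int, (p%:Z ^+ v.+1 %| x - y0 j)%Z /\ (p%:Z ^+ (v.*2.+1 + E) %| quad b (upd z j x))%Z.
Proof.
move=> pp h0 hv nv z hz; elim: E => [|E [x [hx hQ]]].
  exists (y0 j); rewrite subrr dvdz0 addn0; split=> //; rewrite (quad_dvd b (z' := y0)) // => k.
  by rewrite /upd; case: eqP => [->|]; rewrite ?subrr ?dvdz0.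
set n := (v.*2.+1 + E)%N in hQ *.
have [u uE] := dvdzP hQ.
have hD : (p%:Z ^+ v %| 2 * b j * x)%Z /\ ~~ (p%:Z ^+ v.+1 %| 2 * b j * x)%Z.
  have e1 : 2 * b j * x = 2 * b j * y0 j + 2 * b j * (x - y0 j) by ring.
  have d1 : (p%:Z ^+ v.+1 %| 2 * b j * (x - y0 j))%Z by exact: dvdz_mull.
  split; last by rewrite e1 rpredDr.
  by rewrite e1 rpredD //; apply: dvdz_trans d1; rewrite exprS dvdz_mull.
case: hD => /dvdzP[d dE] nd.
have nd' : ~~ (p %| d)%Z by apply: contra nd => pd; rewrite dE exprS dvdz_mul.
have [t ht] := mod_inverse u pp nd'.
have n1 : (v + v.+1 <= n)%N by rewrite /n addnS addnn leq_addr.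
exists (x + p%:Z ^+ (n - v) * t); split.
  rewrite addrAC rpredD //; apply: dvdz_mulr; apply: dvdz_exp2l.
  by move: n1; clear; lia.
rewrite (quad_upd b z j x) uE.
have -> : u * p%:Z ^+ n + b j * ((x + p%:Z ^+ (n - v) * t) ^+ 2 - x ^+ 2) =
   p%:Z ^+ n * (u + d * t) + b j * t ^+ 2 * (p%:Z ^+ (n - v)) ^+ 2.
  have -> : p%:Z ^+ n = p%:Z ^+ v * p%:Z ^+ (n - v) by rewrite -exprD; congr (_ ^+ _); move: n1; clear; lia.
  have : 2 * b j * x * t * p%:Z ^+ (n - v) = d * p%:Z ^+ v * t * p%:Z ^+ (n - v) by rewrite dE.
  move: (p%:Z ^+ (n - v)) (p%:Z ^+ v) => P Pv h; clear -h.
  have -> : (x + P * t) ^+ 2 - x ^+ 2 = 2 * x * P * t + P ^+ 2 * t ^+ 2 by ring.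
  rewrite mulrDr [X in _ + (X + _)](_ : _ = d * Pv * t * P); last by rewrite -h; ring.
  by ring.
rewrite rpredD //; first by rewrite addnS exprSr dvdz_mul.
apply: dvdz_mull; rewrite -exprM; apply: dvdz_exp2l; rewrite /n; move: n1; rewrite /n; clear; lia.
Qed.

(* The substitution [z = p^t y] turns [a] into [p^s b]; Hensel's lemma is applied to [b], whose coefficients may be taken of valuation 0 or 1. *)
Lemma nsol_hensel n (a b y0 : 'I_n.+1 -> int) (t : 'I_n.+1 -> nat) (s : nat) (j : 'I_n.+1) (p v : nat) : prime p ->
  (forall k, a k * p%:Z ^+ (2 * t k) = p%:Z ^+ s * b k) ->
  (p%:Z ^+ v.*2.+1 %| quad b y0)%Z -> (p%:Z ^+ v %| 2 * b j * y0 j)%Z -> ~~ (p%:Z ^+ v.+1 %| 2 * b j * y0 j)%Z ->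
  exists kap, forall E, ((p ^ E) ^ n <= p ^ (kap * n) * nsol a (p ^ E))%N.
Proof.
move=> pp hab h0 hv nv; pose tau := \max_k t k; exists (v.*2.+1 + tau)%N => E.
have p0 : (0 < p)%N by exact: prime_gt0.
have pE0 : (0 < p ^ E)%N by rewrite expn_gt0 p0.
(* For small E the zero vector is enough; the constant p^(kap n) covers the rest. *)
have [hE|hE] := leqP E (v.*2.+1 + tau).
  apply: (@leq_trans (p ^ ((v.*2.+1 + tau) * n) * 1)%N).
    by rewrite muln1 -expnM leq_pexp2l // leq_mul2r hE orbT.
  rewrite leq_mul2l; apply/orP; right; apply/card_gt0P; exists [ffun=> Ordinal pE0].
  by rewrite inE /quad big1 ?dvdz0 // => k _; rewrite ffunE expr2 !mulr0.
set w := v.*2.+1 in h0 hE *; pose E' := (E - (w + tau))%N.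
pose T := {ffun 'I_n -> 'I_(p ^ E')}.
(* All coordinates but j run freely through a residue class modulo p^w. The exponent E' leaves room
   for p^w and the scalings p^(t k), so that different c stay different modulo p^E. *)
pose z0 (c : T) (k : 'I_n.+1) : int := if unlift j k is Some k' then y0 k + p%:Z ^+ w * (c k')%:Z else y0 k.
have hz0 c k : (p%:Z ^+ w %| z0 c k - y0 k)%Z.
  by rewrite /z0; case: unliftP => [k' _|_]; rewrite ?subrr ?dvdz0 // addrAC subrr add0r dvdz_mulr.
have hx c : exists x : int, (p%:Z ^+ (w + (E - w)) %| quad b (upd (z0 c) j x))%Z.
  by have [x [_ hx]] := hensel_lift (E - w)%N pp h0 hv nv (hz0 c); exists x.
have [X hX] := boolp.choice hx.
pose F (c : T) (k : 'I_n.+1) : int := p%:Z ^+ t k * upd (z0 c) j (X c) k.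
have cT : #|{: T}| = ((p ^ E') ^ n)%N by rewrite card_ffun !card_ord.
have : (#|{: T}| <= nsol a (p ^ E))%N.
  apply: (nsol_ge (F := F)) => // [c|c c' hcc].
    have -> : quad a (F c) = p%:Z ^+ s * quad b (upd (z0 c) j (X c)).
      rewrite /quad mulr_sumr; apply: eq_bigr => k _; by rewrite /F exprMn -exprM [(t k * 2)%N]mulnC [LHS]mulrA hab -[LHS]mulrA.
    rewrite PoszX; apply: dvdz_mull; apply: dvdz_trans (hX c); apply: dvdz_exp2l.
    by move: hE; clear; lia.
  apply/ffunP => k'; have := hcc (lift j k'); rewrite /F /upd /z0 liftK eq_sym (negbTE (neq_lift j k')).
  set k := lift j k'; have -> : p%:Z ^+ t k * (y0 k + p%:Z ^+ w * (c k')%:Z) - p%:Z ^+ t k * (y0 k + p%:Z ^+ w * (c' k')%:Z) =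
     p%:Z ^+ (t k + w) * ((c k')%:Z - (c' k')%:Z) by rewrite exprD; ring.
  have tk : (t k <= tau)%N by exact: (leq_bigmax k).
  have -> : (p ^ E)%N%:Z = p%:Z ^+ (t k + w) * p%:Z ^+ (E - (t k + w)).
    by rewrite PoszX -exprD; congr (_ ^+ _); move: tk hE; clear; lia.
  rewrite dvdz_mul2l; last by rewrite expf_neq0 // -lt0n.
  move=> hd; have {hd} hd : ((p ^ E')%N%:Z %| (c k')%:Z - (c' k')%:Z)%Z.
    by apply: dvdz_trans hd; rewrite PoszX; apply: dvdz_exp2l; rewrite /E'; move: tk; clear; lia.
  have h00 : (c k')%:Z - (c' k')%:Z = 0.
    by apply: (dvdz_small hd); have := ltn_ord (c k'); have := ltn_ord (c' k'); clear; lia.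
  by apply: val_inj => /=; apply/eqP; rewrite -eqz_nat -subr_eq0; apply/eqP.
rewrite cT => hc; apply: (@leq_trans (p ^ ((w + tau) * n) * (p ^ E') ^ n)%N); last by rewrite leq_mul2l hc orbT.
by rewrite -!expnM -expnD -mulnDl; apply: eq_leq; congr (_ ^ (_ * _))%N; rewrite /E'; move: hE; clear; lia.
Qed.

(** Of five parities three agree. Applied to the p-adic valuations of five coefficients, it provides
    three that can be made units at the same time. *)
Lemma odd_majority (T : eqType) (f : pred T) (l : seq T) : uniq l -> size l = 5%N ->
  exists x1 x2 x3 x4 x5 : T, [/\ uniq [:: x1; x2; x3; x4; x5], f x1 = f x2, f x1 = f x3 & {subset [:: x1; x2; x3; x4; x5] <= l}].
Proof.
move=> ul sl; have main (g : pred T) : (3 <= count g l)%N -> exists x1 x2 x3 x4 x5 : T,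
    [/\ uniq [:: x1; x2; x3; x4; x5], g x1, g x2 & g x3 /\ {subset [:: x1; x2; x3; x4; x5] <= l}].
  move=> cg; pose r := filter g l ++ filter (predC g) l.
  have pr : perm_eq r l by apply/permPl; exact: perm_filterC.
  have ur : uniq r by rewrite (perm_uniq pr).
  have sr : size r = 5%N by rewrite (perm_size pr).
  have gr k : (k < 3)%N -> forall x0, g (nth x0 r k).
    move=> k3 x0; have kf : (k < size (filter g l))%N by rewrite size_filter (leq_trans k3).
    rewrite nth_cat kf; have := mem_nth x0 kf; by rewrite mem_filter => /andP[].
  move: ur sr gr (perm_mem pr); case: r {pr} => [|x1 [|x2 [|x3 [|x4 [|x5 [|]]]]]] // ur _ gr pm.
  exists x1, x2, x3, x4, x5; split=> //; [exact: (gr 0%N isT x1)|exact: (gr 1%N isT x1)|split; first exact: (gr 2%N isT x1)].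
  by move=> x; rewrite pm.
have [h|h] := leqP 3 (count f l).
  by have [x1 [x2 [x3 [x4 [x5 [u g1 g2 [g3 s]]]]]]] := main _ h; exists x1, x2, x3, x4, x5; rewrite g1 g2 g3.
have h' : (3 <= count (predC f) l)%N by have := count_predC f l; rewrite sl; move: h; clear; lia.
have [x1 [x2 [x3 [x4 [x5 [u /= /negbTE g1 /negbTE g2 [/negbTE g3 s]]]]]]] := main _ h'.
by exists x1, x2, x3, x4, x5; rewrite g1 g2 g3.
Qed.

(** One of the variables with odd coefficient must equal 1: then 2 divides the derivative exactly
    once, and 8 = 2^(2 + 1) is the modulus from which Hensel's lemma starts. *)
Definition mod8_solvable (r1 r2 r3 r4 r5 : nat) : bool :=
  (has (fun y1 => has (fun y2 => has (fun y3 => has (fun y4 => has (fun y5 =>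
    (8 %| r1 * y1 ^ 2 + r2 * y2 ^ 2 + r3 * y3 ^ 2 + r4 * y4 ^ 2 + r5 * y5 ^ 2) &&
    [|| y1 == 1, y2 == 1 | y3 == 1]) (iota 0 3)) (iota 0 3)) (iota 0 3)) (iota 0 3)) (iota 0 3))%N.

Lemma mod8_solvableT :
  all (fun r1 => all (fun r2 => all (fun r3 => all (fun r4 => all (fun r5 => mod8_solvable r1 r2 r3 r4 r5)
    [:: 1; 3; 5; 7; 2; 6]) [:: 1; 3; 5; 7; 2; 6]) [:: 1; 3; 5; 7]) [:: 1; 3; 5; 7]) [:: 1; 3; 5; 7]%N.
Proof. by vm_compute. Qed.

Lemma two_adic_quinary (b1 b2 b3 b4 b5 : int) : ~~ (2 %| b1)%Z -> ~~ (2 %| b2)%Z -> ~~ (2 %| b3)%Z ->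
  ~~ (4 %| b4)%Z -> ~~ (4 %| b5)%Z -> exists y1 y2 y3 y4 y5 : int,
  (8 %| b1 * y1 ^+ 2 + b2 * y2 ^+ 2 + b3 * y3 ^+ 2 + b4 * y4 ^+ 2 + b5 * y5 ^+ 2)%Z /\ [\/ y1 = 1, y2 = 1 | y3 = 1].
Proof.
move=> h1 h2 h3 h4 h5; pose r (b : int) : nat := `|(b %% 8)%Z|%N.
have rE b : exists q : int, b = q * 8 + (r b)%:Z.
  exists (b %/ 8)%Z; rewrite {1}(divz_eq b 8) /r abszE ger0_norm // modz_ge0 //.
have r8 b : (r b < 8)%N by rewrite -ltz_nat /r abszE ger0_norm ?modz_ge0 // ltz_pmod.
have ru b : ~~ (2 %| b)%Z -> r b \in [:: 1; 3; 5; 7]%N.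
  have [q {1}->] := rE b; rewrite rpredDl; last by rewrite (_ : 8 = 4 * 2) // mulrA dvdz_mull.
  by rewrite dvdzE /= dvdn2 negbK; move: (r b) (r8 b); do 8 (case=> //).
have rv b : ~~ (4 %| b)%Z -> r b \in [:: 1; 3; 5; 7; 2; 6]%N.
  have [q {1}->] := rE b; rewrite rpredDl; last by rewrite (_ : 8 = 2 * 4) // mulrA dvdz_mull.
  by rewrite dvdzE /=; move: (r b) (r8 b); do 8 (case=> //).
have := mod8_solvableT => /allP/(_ _ (ru _ h1))/allP/(_ _ (ru _ h2))/allP/(_ _ (ru _ h3))/allP/(_ _ (rv _ h4))/allP/(_ _ (rv _ h5)).
move=> /hasP[y1 _ /hasP[y2 _ /hasP[y3 _ /hasP[y4 _ /hasP[y5 _ /andP[h8 hy]]]]]].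
exists y1%:Z, y2%:Z, y3%:Z, y4%:Z, y5%:Z; split; last first.
  by case/or3P: hy => /eqP ->; [constructor 1|constructor 2|constructor 3].
have [q1 e1] := rE b1; have [q2 e2] := rE b2; have [q3 e3] := rE b3; have [q4 e4] := rE b4; have [q5 e5] := rE b5.
have -> : b1 * y1%:Z ^+ 2 + b2 * y2%:Z ^+ 2 + b3 * y3%:Z ^+ 2 + b4 * y4%:Z ^+ 2 + b5 * y5%:Z ^+ 2 =
   (q1 * y1%:Z ^+ 2 + q2 * y2%:Z ^+ 2 + q3 * y3%:Z ^+ 2 + q4 * y4%:Z ^+ 2 + q5 * y5%:Z ^+ 2) * 8 +
   (r b1 * y1 ^ 2 + r b2 * y2 ^ 2 + r b3 * y3 ^ 2 + r b4 * y4 ^ 2 + r b5 * y5 ^ 2)%N%:Z.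
  rewrite {1}e1 {1}e2 {1}e3 {1}e4 {1}e5 !PoszD !PoszM ?PoszX.
  move: ((r b1)%:Z) ((r b2)%:Z) ((r b3)%:Z) ((r b4)%:Z) ((r b5)%:Z) (y1%:Z) (y2%:Z) (y3%:Z) (y4%:Z) (y5%:Z); clear => *; ring.
by rewrite rpredD ?dvdz_mull.
Qed.

(** Scaling the variables by powers of p leaves coefficients that are units or p times units, three
    of five chosen ones being units. For odd p these three have a nonzero common zero modulo p, and
    the derivative is a unit; for p = 2 the table modulo 8 is used, with the derivative divisible by
    2 exactly once. *)
Lemma local_solution n (a : 'I_n.+1 -> int) (p : nat) : (5 <= n.+1)%N -> prime p -> (forall k, a k != 0) ->
  exists kap, forall E, ((p ^ E) ^ n <= p ^ (kap * n) * nsol a (p ^ E))%N.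
Proof.
move=> n5 pp ha; have p0 : (0 < p)%N by exact: prime_gt0.
have [u hu] : exists u : 'I_n.+1 -> int, forall k, ~~ (p %| u k)%Z /\ a k = u k * p%:Z ^+ logn p `|a k|.
  suff h k : exists u, ~~ (p %| u)%Z /\ a k = u * p%:Z ^+ logn p `|a k|.
    by have [u hu] := boolp.choice h; exists u.
  have ak0 : (0 < `|a k|)%N by rewrite absz_gt0.
  have pa : (p%:Z ^+ logn p `|a k| %| a k)%Z by rewrite dvdzE abszX /= pfactor_dvdnn.
  have [u uE] := dvdzP pa; exists u; split=> //; apply/negP => /dvdzP[w wE].
  have : (p%:Z ^+ (logn p `|a k|).+1 %| a k)%Z.
    by rewrite [X in (_ %| X)%Z]uE wE -mulrA -exprS dvdz_mull.
  by rewrite dvdzE abszX /= pfactor_dvdn // ltnn.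
pose v k := logn p `|a k|.
pose l := take 5 (enum 'I_n.+1).
have ul : uniq l by rewrite take_uniq // enum_uniq.
have sl : size l = 5%N by rewrite size_take_min -cardE card_ord; apply/minn_idPl.
have [x1 [x2 [x3 [x4 [x5 [ux o2 o3 _]]]]]] := odd_majority (fun k => odd (v k)) ul sl.
(* At least every valuation, and of the parity of the majority, so that those coefficients become
   units. *)
pose s := (2 * (\sum_k v k) + odd (v x1))%N.
have vs k : (v k <= s)%N by rewrite /s (bigD1 k) //=; clear; lia.
pose t k := uphalf (s - v k).
pose b k : int := u k * p%:Z ^+ odd (s - v k).
have hab k : a k * p%:Z ^+ (2 * t k) = p%:Z ^+ s * b k.
  rewrite (proj2 (hu k)) /b -/(v k) mulrCA -mulrA -!exprD; congr (_ * _ ^+ _).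
  have := vs k; rewrite /t uphalf_half; have := odd_double_half (s - v k); rewrite -muln2; clear; lia.
have so k : odd (v k) = odd (v x1) -> b k = u k.
  move=> h; rewrite /b; have -> : odd (s - v k) = false; last by rewrite expr0 mulr1.
  by rewrite oddB // /s oddD oddM /= h oddb addbb.
have b1 : b x1 = u x1 by exact: so.
have b2 : b x2 = u x2 by exact: so.
have b3 : b x3 = u x3 by exact: so.
pose L := [:: x1; x2; x3; x4; x5].
have qE (y : 'I_n.+1 -> int) : (forall k, k \notin L -> y k = 0) ->
   quad b y = b x1 * y x1 ^+ 2 + b x2 * y x2 ^+ 2 + b x3 * y x3 ^+ 2 + b x4 * y x4 ^+ 2 + b x5 * y x5 ^+ 2.
  move=> y0; rewrite /quad (bigID (mem L)) /= [X in _ + X]big1 ?addr0 => [|k hk]; last by rewrite y0 // expr2 !mulr0.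
  by rewrite -(big_uniq _ ux) /= !big_cons big_nil addr0 !addrA.
have main (ys : seq int) : size ys = 5%N -> exists y : 'I_n.+1 -> int, (forall k, k \notin L -> y k = 0) /\
   [/\ y x1 = ys`_0, y x2 = ys`_1, y x3 = ys`_2, y x4 = ys`_3 & y x5 = ys`_4].
  move=> sy; exists (fun k => nth 0 ys (index k L)); split=> [k hk|].
    by rewrite nth_default // sy -[5%N]/(size L) leqNgt index_mem.
  have ih i : (i < 5)%N -> index (nth x1 L i) L = i by move=> i5; rewrite index_uniq.
  by split; rewrite -?[in LHS](ih 0%N isT) ?(ih 0%N isT) ?(ih 1%N isT) ?(ih 2%N isT) ?(ih 3%N isT) ?(ih 4%N isT).
have uodd k (y : int) : (2 < p)%N -> ~~ (p %| y)%Z -> ~~ (p%:Z ^+ 1 %| 2 * u k * y)%Z.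
  move=> p2 py; rewrite expr1 dvdzE !abszM !Euclid_dvdM //= !negb_or py (proj1 (hu k)) !andbT.
  by apply/negP => h; have := dvdn_leq (isT : (0 < 2)%N) h; rewrite leqNgt p2.
have [p2|p2] := ltnP 2 p.
  pose a3 (k : 'I_3) : int := u (nth x1 L k).
  have /card_gt1P [z [z' [zi z'i zz]]] : (1 < nsol a3 p)%N.
    by apply: nsol3_prime => // k; have := proj1 (hu (nth x1 L k)).
  have [w wi [k wk]] : exists2 w : {ffun 'I_3 -> 'I_p}, (p %| quad a3 (fun k => (w k)%:Z))%Z & exists k, (0 < w k)%N.
    have nz (w : {ffun 'I_3 -> 'I_p}) : (exists k, (0 < w k)%N) \/ w = [ffun=> Ordinal p0].
      case: (boolP [exists k, (0 < w k)%N]) => [/existsP h|]; [by left|rewrite negb_exists => /forallP h; right].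
      by apply/ffunP => k; rewrite ffunE; apply: val_inj; have := h k; rewrite -leqNgt leqn0 => /eqP.
    rewrite !inE in zi z'i; have [h|h] := nz z; first by exists z.
    have [h'|h'] := nz z'; first by exists z'.
    by move: zz; rewrite h h' eqxx.
  have [y [y0 [yx1 yx2 yx3 yx4 yx5]]] := main [:: (w ord0)%:Z; (w (lift ord0 ord0))%:Z; (w (lift ord0 (lift ord0 ord0)))%:Z; 0; 0] erefl.
  have yk : y (nth x1 L k) = w k /\ b (nth x1 L k) = u (nth x1 L k).
    case: k wk => -[|[|[|//]]] i wk /=; (split; last by []);
      [rewrite yx1|rewrite yx2|rewrite yx3] => /=; congr (Posz (nat_of_ord (w _))); exact: val_inj.
  apply: (nsol_hensel (v := 0) (j := nth x1 L k) (y0 := y) pp hab).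
  - rewrite double0 expr1 qE // yx1 yx2 yx3 yx4 yx5 b1 b2 b3 /= expr2 !mulr0 !addr0.
    by move: wi; rewrite /quad !big_ord_recl big_ord0 addr0 addrA /a3 /=.
  - by rewrite expr0 dvd1z.
  rewrite (proj2 yk); apply: uodd => //; rewrite (proj1 yk) dvdzE /=.
  by apply/negP => /(dvdn_leq wk); rewrite leqNgt ltn_ord.
have p2E : p = 2%N by move: p2 (prime_gt1 pp); clear; lia.
have u2 k : ~~ (2 %| u k)%Z by have := proj1 (hu k); rewrite p2E.
have b4 k : ~~ (4 %| b k)%Z.
  rewrite /b p2E; apply/negP; case: (odd _) => h; move/negP: (u2 k); apply.
    by move: h; rewrite expr1 (_ : 4 = 2 * 2) // dvdz_mul2r.
  by move: h; rewrite expr0 mulr1; apply: dvdz_trans.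
have [||||| y1 [y2 [y3 [y4 [y5 [h8 hy]]]]]] := @two_adic_quinary (b x1) (b x2) (b x3) (b x4) (b x5); rewrite ?b1 ?b2 ?b3 //.
have [y [y0 [yx1 yx2 yx3 yx4 yx5]]] := main [:: y1; y2; y3; y4; y5] erefl.
have fin j : b j = u j -> y j = 1 -> exists kap, forall E, ((p ^ E) ^ n <= p ^ (kap * n) * nsol a (p ^ E))%N.
  move=> bj yj; apply: (nsol_hensel (v := 1) (j := j) (y0 := y) pp hab).
  - by rewrite qE // yx1 yx2 yx3 yx4 yx5 p2E.
  - by rewrite p2E expr1 -mulrA dvdz_mulr.
  rewrite yj bj mulr1 p2E (_ : 2%N%:Z ^+ 2 = 2 * 2) // dvdz_mul2l //; exact: u2.
case: hy => hy; [apply: (fin x1)|apply: (fin x2)|apply: (fin x3)] => //; [rewrite yx1|rewrite yx2|rewrite yx3]; exact: hy.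
Qed.

Lemma nsol_lower n (a : 'I_n.+1 -> int) : (5 <= n.+1)%N -> (forall k, a k != 0) ->
  exists2 c : R, 0 < c & forall W : nat, (0 < W)%N -> c * W%:R ^+ n <= (nsol a W)%:R.
Proof.
move=> n5 ha.
have main B : exists2 c : R, 0 < c & forall W : nat, (0 < W)%N -> (forall p, prime p -> (p %| W)%N -> (17 + \sum_k `|a k| < p + B)%N) ->
    c * W%:R ^+ n <= (nsol a W)%:R.
  elim: B => [|B [c c0 IH]].
    exists (1 / 2) => [|W W0 hW]; first by lra.
    suff : W%:R ^+ n <= 2 * (nsol a W)%:R :> R by move: (W%:R ^+ n : R) ((nsol a W)%:R : R) => x y; clear; lra.
    apply: nsol_good => // p pp pW; have := hW p pp pW; rewrite addn0 => hp; split; first by move: hp; clear; lia.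
    move=> k; apply/negP => pa; have : (p <= `|a k|)%N by apply: dvdn_leq => //; rewrite absz_gt0.
    by move: hp; rewrite (bigD1 k) //=; clear; lia.
  have [q qE] : exists q, q = (17 + (\sum_k `|a k|) - B)%N by eexists.
  case: (boolP (prime q)) => [pq|npq]; last first.
    exists c => // W W0 hW; apply: IH => // p pp pW; have := hW p pp pW.
    have : p != q by apply: contra npq => /eqP <-.
    by rewrite qE; move/eqP; clear; lia.
  have [kap hk] := local_solution n5 pq ha.
  have qR : (0 : R) < q%:R by rewrite ltr0n prime_gt0.
  have qk0 : 0 < q%:R ^+ (kap * n) :> R by rewrite exprn_gt0.
  exists (c / q%:R ^+ (kap * n)) => [|W W0 hW]; first by rewrite divr_gt0.
  have WE := partnC q W0; set W1 := (W`_q)%N in WE; set W2 := (W`_q^')%N in WE.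
  have W10 : (0 < W1)%N by exact: part_gt0.
  have W20 : (0 < W2)%N by exact: part_gt0.
  have co : coprime W1 W2 by exact: coprime_partC.
  have [E W1E] : exists E, W1 = (q ^ E)%N by exists (logn q W); rewrite /W1 p_part.
  have h2 : c * W2%:R ^+ n <= (nsol a W2)%:R.
    apply: IH => // p pp pW2; have := hW p pp (dvdn_trans pW2 (dvdn_part _ _)).
    have : p != q.
      apply: contraTneq pW2 => ->; rewrite -prime_coprime // coprime_sym (pnat_coprime (part_pnat _ _)) //.
      by rewrite pnatNK pnat_id.
    by rewrite qE; move/eqP; clear; lia.
  have h1 : W1%:R ^+ n <= q%:R ^+ (kap * n) * (nsol a W1)%:R :> R.
    by rewrite W1E -natrX -[q%:R ^+ _]natrX -natrM ler_nat hk.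
  have h3 := nsol_mul a W10 W20 co; rewrite WE in h3.
  apply: (@le_trans _ _ ((nsol a W1)%:R * (nsol a W2)%:R)); last by rewrite -natrM ler_nat.
  rewrite -WE natrM exprMn mulrAC ler_pdivrMr // mulrCA.
  rewrite [leRHS](_ : _ = (q%:R ^+ (kap * n) * (nsol a W1)%:R) * (nsol a W2)%:R); last by ring.
  by apply: ler_pM; rewrite ?exprn_ge0 ?mulr_ge0 ?exprn_ge0 // ltW.
have [c c0 hc] := main (18 + \sum_k `|a k|)%N; exists c => // W W0; apply: hc => // p pp _.
by have := prime_gt0 pp; clear; lia.
Qed.

(** * Lower bound for the number of solutions *)

Section Diagonal.
Variable lam : nat -> int.
Let Lam (k : nat) : int := \sum_(i < k.+1) lam i.
(** Gram-Schmidt with denominators cleared: lam_{k+1} (e_0 + ... + e_k) - Lam_k e_{k+1}, whose value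
    under the form is [dcoef k]. *)
Definition dvec (k i : nat) : int := if (i <= k)%N then lam k.+1 else if i == k.+1 then - Lam k else 0.
Definition dcoef (k : nat) : int := lam k.+1 * Lam k * Lam k.+1.
Definition dcomb (K : nat) (z : nat -> int) (i : nat) : int := \sum_(k < K) z k * dvec k i.

Lemma sum_supp (V : nmodType) (F : nat -> V) (K s : nat) : (K <= s)%N -> (forall i, (K <= i)%N -> F i = 0) ->
  \sum_(i < s) F i = \sum_(i < K) F i.
Proof.
move=> Ks h; rewrite -(subnKC Ks) big_split_ord /= [X in _ + X]big1 ?addr0 // => i _.
by rewrite h // leq_addr.
Qed.

(* The vectors [dvec k] are orthogonal for the form [sum lam x^2] and lie in the hyperplane [sum lam x = 0]. *)
Lemma dcomb_quad (K s : nat) (z : nat -> int) : (K.+1 < s)%N ->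
  [/\ forall i, (K < i)%N -> dcomb K z i = 0, \sum_(i < s) lam i * dcomb K z i = 0 &
      \sum_(i < s) lam i * dcomb K z i ^+ 2 = \sum_(k < K) dcoef k * z k ^+ 2].
Proof.
elim: K => [|K IH] Ks.
  by split=> [i _||]; rewrite /dcomb ?big_ord0 // big1 // => i _; rewrite big_ord0 ?expr2 ?mulr0.
have [s0 s1 s2] := IH (ltnW Ks).
have S i : dcomb K.+1 z i = dcomb K z i + z K * dvec K i by rewrite /dcomb big_ord_recr.
have v0 i : (K.+1 < i)%N -> dvec K i = 0.
  by move=> h; rewrite /dvec leqNgt (ltnW h) /= gtn_eqF.
have l1 : \sum_(i < s) lam i * dvec K i = 0.
  rewrite (sum_supp (F := fun i => lam i * dvec K i) (ltnW Ks)) => [|i h]; last by rewrite v0 ?mulr0.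
  rewrite big_ord_recr /= {2}/dvec ltnn eqxx (eq_bigr (fun i : 'I_K.+1 => lam K.+1 * lam i)) => [|i _].
    by rewrite -mulr_sumr mulrN subrr.
  by rewrite /dvec -ltnS ltn_ord mulrC.
have l2 : \sum_(i < s) lam i * dvec K i ^+ 2 = dcoef K.
  rewrite (sum_supp (F := fun i => lam i * dvec K i ^+ 2) (ltnW Ks)) => [|i h]; last by rewrite v0 // expr2 !mulr0.
  rewrite big_ord_recr /= {2}/dvec ltnn eqxx (eq_bigr (fun i : 'I_K.+1 => lam K.+1 ^+ 2 * lam i)) => [|i _].
    have LE : Lam K.+1 = Lam K + lam K.+1 by rewrite /Lam big_ord_recr.
    by rewrite -mulr_sumr -/(Lam K) /dcoef -/(Lam K) -/(Lam K.+1) LE; ring.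
  by rewrite /dvec -ltnS ltn_ord mulrC.
have l3 : \sum_(i < s) lam i * dcomb K z i * dvec K i = 0.
  rewrite (sum_supp (F := fun i => lam i * dcomb K z i * dvec K i) (ltnW (ltnW Ks))) => [|i h]; last by rewrite s0 // mulr0 mul0r.
  rewrite (eq_bigr (fun i : 'I_K.+1 => lam K.+1 * (lam i * dcomb K z i))) => [|i _]; last by rewrite /dvec -ltnS ltn_ord mulrC.
  rewrite -mulr_sumr; move: s1; rewrite (sum_supp (F := fun i => lam i * dcomb K z i) (ltnW (ltnW Ks))) => [->|i h]; first by rewrite mulr0.
  by rewrite s0 // mulr0.
split=> [i h||]; first by rewrite S s0 ?v0 ?mulr0 ?addr0 // ltnW.
  under eq_bigr => i _ do rewrite S mulrDr mulrCA; by rewrite big_split /= s1 -mulr_sumr l1 mulr0 addr0.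
rewrite (eq_bigr (fun i : 'I_s => lam i * dcomb K z i ^+ 2 + (2 * z K * (lam i * dcomb K z i * dvec K i) + z K ^+ 2 * (lam i * dvec K i ^+ 2)))) => [|i _].
  by rewrite !big_split /= -!mulr_sumr s2 l2 l3 mulr0 add0r big_ord_recr /= mulrC.
rewrite S; ring.
Qed.

(** Coordinates are read off from values of the form: raising the k-th coordinate by 1 changes the
    diagonal form by [dcoef k] times 2 z_k + 1. *)
Lemma dcomb_inj (K s : nat) (z z' : nat -> int) : (K.+1 < s)%N -> (forall k, (k < K)%N -> dcoef k != 0) ->
  (forall i, (i < s)%N -> dcomb K z i = dcomb K z' i) -> forall k, (k < K)%N -> z k = z' k.
Proof.
move=> Ks nz hz k kK.
have add u v i : dcomb K (fun k => u k + v k) i = dcomb K u i + dcomb K v i.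
  by rewrite /dcomb -big_split; apply: eq_bigr => j _; rewrite mulrDl.
pose d j : int := (j == k)%:Z.
have h : \sum_(i < s) lam i * dcomb K (fun j => z j + d j) i ^+ 2 = \sum_(i < s) lam i * dcomb K (fun j => z' j + d j) i ^+ 2.
  by apply: eq_bigr => i _; rewrite !add hz.
have h' : \sum_(i < s) lam i * dcomb K z i ^+ 2 = \sum_(i < s) lam i * dcomb K z' i ^+ 2.
  by apply: eq_bigr => i _; rewrite hz.
have [_ _ q1] := dcomb_quad (fun j => z j + d j) Ks; have [_ _ q2] := dcomb_quad (fun j => z' j + d j) Ks.
have [_ _ q3] := dcomb_quad z Ks; have [_ _ q4] := dcomb_quad z' Ks.
have E (u : nat -> int) : \sum_(j < K) dcoef j * (u j + d j) ^+ 2 = \sum_(j < K) dcoef j * u j ^+ 2 + dcoef k * (2 * u k + 1).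
  rewrite (bigD1 (Ordinal kK)) //= [in RHS](bigD1 (Ordinal kK)) //= /d eqxx.
  rewrite (eq_bigr (fun j : 'I_K => dcoef j * u j ^+ 2)) => [|j]; first by rewrite /=; ring.
  by rewrite -val_eqE /= => /negbTE ->; rewrite addr0.
move: h; rewrite q1 q2 !E -q3 -q4 h' => /addrI /(mulfI (nz k kK)); clear; lia.
Qed.
End Diagonal.

(** y0 is the least integer for which a0 (r0 + W y0)^2 reaches Y, positive because Y >= A W^2. The
    predecessor still lies below Y, so the overshoot at the next U places is at most an increment of
    the square over W U. *)
Lemma window_exists (a0 : int) (r0 W L U A : nat) (Y : int) : (0 < W)%N -> (0 < A)%N -> 0 < a0 -> a0 <= A%:Z -> (r0 < W)%N ->
  (U <= L)%N -> A%:Z * W%:Z ^+ 2 <= Y -> Y <= 5 * A%:Z * (W * L)%N%:Z ^+ 2 ->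
  exists y0 : nat, forall u, (u < U)%N ->
    [/\ (r0 + W * (y0 + u) <= 4 * A * (W * L))%N, 0 <= a0 * (r0 + W * (y0 + u))%N%:Z ^+ 2 - Y &
     a0 * (r0 + W * (y0 + u))%N%:Z ^+ 2 - Y <= (7 * A ^ 2 * W ^ 2 * L * U)%N%:Z].
Proof.
move=> W0 A0 a00 aA rW UL Y1 Y2.
pose P y := Y <= a0 * (r0 + W * y)%N%:Z ^+ 2.
have exP : exists y, P y.
  exists `|Y|%N; rewrite /P; have : Y <= (r0 + W * `|Y|)%N%:Z.
    have : (`|Y| <= W * `|Y|)%N by rewrite leq_pmull.
    by move: (W * `|Y|)%N => z; clear; lia.
  by move: (r0 + W * _)%N => z hz; rewrite expr2; move: a00 hz; clear; nia.
case: (ex_minnP exP) => y0 Py0 miny; exists y0 => u uU.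
have y00 : (0 < y0)%N.
  rewrite lt0n; apply/eqP => y00; move: Py0; rewrite y00 /P muln0 addn0 => h.
  have h1 : a0 * r0%:Z ^+ 2 < A%:Z * W%:Z ^+ 2.
    apply: (@le_lt_trans _ _ (A%:Z * r0%:Z ^+ 2)); first by rewrite ler_wpM2r // sqr_ge0.
    have h2 : r0%:Z ^+ 2 < W%:Z ^+ 2 by rewrite ltrXn2r // ltz_nat.
    by rewrite ltr_pM2l.
  by have := lt_le_trans h1 (le_trans Y1 h); rewrite ltxx.
pose q := (r0 + W * y0.-1)%N.
have hq : a0 * q%:Z ^+ 2 < Y.
  rewrite ltNge; apply/negP => /miny; by move: y00; clear; lia.
have qL : (q <= 3 * A * (W * L))%N.
  rewrite leqNgt; apply/negP => h; have : (3 * A * (W * L))%N%:Z ^+ 2 < q%:Z ^+ 2.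
    by rewrite ltrXn2r // ltz_nat.
  have : q%:Z ^+ 2 <= a0 * q%:Z ^+ 2 by rewrite ler_peMl ?sqr_ge0.
  have -> : (3 * A * (W * L))%N%:Z ^+ 2 = 9 * A%:Z * (A%:Z * (W * L)%N%:Z ^+ 2) by rewrite !PoszM; ring.
  have : 1 * (A%:Z * (W * L)%N%:Z ^+ 2) <= A%:Z * (A%:Z * (W * L)%N%:Z ^+ 2).
    by rewrite ler_wpM2r // mulr_ge0 ?sqr_ge0.
  move: hq Y2; rewrite -(mulrA 9) -(mulrA 5); set X := A%:Z * _ ^+ 2.
  have X0 : 0 <= X by rewrite mulr_ge0 ?sqr_ge0.
  by move: X0; move: X (A%:Z * X) (a0 * q%:Z ^+ 2) (q%:Z ^+ 2) => X AX x3 x4; clear; lia.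
have e : (r0 + W * (y0 + u) = q + W * u.+1)%N.
  by rewrite /q -{1}(prednK y00); ring.
have uL : (u.+1 <= L)%N by exact: leq_trans UL.
rewrite e; split.
- rewrite (_ : 4 * A * (W * L) = 3 * A * (W * L) + A * (W * L))%N; last by ring.
  rewrite leq_add //; apply: (@leq_trans (W * L)%N); first by rewrite leq_mul2l uL orbT.
  by rewrite leq_pmull.
- rewrite subr_ge0; apply: (le_trans Py0); rewrite ler_pM2l // lerXn2r ?nnegrE // lez_nat -e leq_add2l leq_mul2l.
  by rewrite leq_addr orbT.
apply: (@le_trans _ _ (a0 * (q + W * u.+1)%N%:Z ^+ 2 - a0 * q%:Z ^+ 2)); first by rewrite lerD2l lerN2 ltW.
rewrite -mulrBr; have -> : (q + W * u.+1)%N%:Z ^+ 2 - q%:Z ^+ 2 = (W * u.+1 * (2 * q + W * u.+1))%N%:Z.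
  by rewrite !(PoszD, PoszM); ring.
apply: (@le_trans _ _ (A%:Z * (W * u.+1 * (2 * q + W * u.+1))%N%:Z)); first by rewrite ler_wpM2r.
rewrite -PoszM lez_nat.
apply: (@leq_trans (A * (W * U * (7 * A * (W * L))))%N); last by apply: eq_leq; ring.
rewrite leq_mul2l; apply/orP; right; apply: leq_mul; first by rewrite leq_mul2l uU orbT.
rewrite (_ : 7 * A * (W * L) = 2 * (3 * A * (W * L)) + A * (W * L))%N; last by ring.
rewrite leq_add //; first by rewrite leq_mul2l qL.
apply: (@leq_trans (W * L)%N); first by rewrite leq_mul2l uL orbT.
by rewrite leq_pmull.
Qed.

Lemma ord_mod_inj (W : nat) (x y : 'I_W) (p q : nat) : (x + W * p = y + W * q)%N -> x = y.
Proof.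
move=> h; apply: val_inj; have := congr1 (modn^~ W) h.
by rewrite /= ![(W * _)%N]mulnC ![(_ + _ * W)%N]addnC !modnMDl !modn_small.
Qed.

Section SolutionCount.
Variables (lam : nat -> int) (n : nat).
Let m := n.+1.
Let s := m.+2.
Hypothesis nz : forall k, (k < m)%N -> dcoef lam k != 0.
Hypothesis pos0 : 0 < dcoef lam 0.
Hypothesis negn : dcoef lam n < 0.
Let a (k : 'I_m) : int := dcoef lam k.
Let A := (\sum_k `|a k|)%N.
Let D := (\sum_(i < s) \sum_(k < m) `|dvec lam k i|)%N.

Lemma sc_n0 : (0 < n)%N.
Proof. by case: n negn => // h; have := lt_trans h pos0; rewrite ltxx. Qed.

Lemma sc_a_le k : `|a k| <= A%:Z.
Proof. by rewrite -abszE lez_nat /A (bigD1 k) //= leq_addr. Qed.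

Lemma sc_A0 : (0 < A)%N.
Proof. by rewrite -ltz_nat; apply: lt_le_trans (sc_a_le ord0); rewrite normr_gt0 nz. Qed.

Variables (W L L' U X H : nat).
Hypotheses (W0 : (0 < W)%N) (UL : (U <= L)%N) (L'0 : (0 < L')%N) (hL' : (2 * A * L' <= L)%N) (hH : (7 * A ^ 2 * W ^ 2 * L * U <= H)%N).

Let R0 := {r : {ffun 'I_m -> 'I_W} | (W%:Z %| quad a (fun k => (r k)%:Z))%Z}.
Let T := (R0 * {ffun 'I_n -> 'I_L'})%type.

(* All coordinates but the one of index 0 are free; the last one is taken of size about [W L] to make the form negative. *)
Let zrest (t : T) (k : 'I_m) : nat :=
  if unlift ord0 k is Some k' then (val t.1 k + W * (t.2 k' + (if k == ord_max then L else 0)))%N else 0%N.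

Let Yof (t : T) : int := - \sum_(k | k != ord0) a k * (zrest t k)%:Z ^+ 2.

Lemma sc_zrest_le (t : T) k : k != ord0 -> k != ord_max -> (zrest t k <= W * L')%N.
Proof.
move=> k0 km; rewrite /zrest; case: unliftP => [k' _|h]; last by rewrite h eqxx in k0.
rewrite (negbTE km) addn0; apply: (@leq_trans (W + W * t.2 k')%N); first by rewrite leq_add2r ltnW.
by rewrite -mulnS leq_mul2l ltn_ord orbT.
Qed.

Lemma sc_zmax_ge (t : T) : (W * L <= zrest t ord_max <= 2 * (W * L))%N.
Proof.
rewrite /zrest; case: unliftP => [k' _|h]; last first.
  by have := congr1 val h; move: sc_n0 => /=; case: (n).
rewrite eqxx; apply/andP; split.
  by rewrite mulnDr addnA leq_addl.
apply: (@leq_trans (W + W * (t.2 k' + L))%N); first by rewrite leq_add2r ltnW.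
rewrite -mulnS mulnCA leq_mul2l; apply/orP; right; rewrite mul2n -addnn -addSn leq_add2r.
apply: (leq_trans (ltn_ord _)); apply: leq_trans hL'; by rewrite leq_pmull // muln_gt0 sc_A0.
Qed.

Lemma sc_mid_sum (t : T) : `|\sum_(k | (k != ord0) && (k != ord_max)) a k * (zrest t k)%:Z ^+ 2| * (4 * A%:Z) <= (W * L)%N%:Z ^+ 2.
Proof.
apply: (@le_trans _ _ ((A%:Z * (W * L')%N%:Z ^+ 2) * (4 * A%:Z))).
  rewrite ler_wpM2r //; apply: (le_trans (ler_norm_sum _ _ _)).
  apply: (@le_trans _ _ (\sum_(k | (k != ord0) && (k != ord_max)) `|a k| * (W * L')%N%:Z ^+ 2)).
    apply: ler_sum => k /andP[k0 km]; rewrite normrM ler_wpM2l // normrX lerXn2r ?nnegrE //.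
    by rewrite -abszE lez_nat /= sc_zrest_le.
  rewrite -mulr_suml ler_wpM2r ?sqr_ge0 // (_ : A%:Z = \sum_k `|a k|); last first.
    by rewrite /A; elim/big_rec2: _ => // k x y _ <-; rewrite PoszD abszE.
  rewrite [leRHS](bigID (fun k : 'I_m => (k != ord0) && (k != ord_max))) /=.
  rewrite -[leLHS]addr0 lerD //.
  by apply: sumr_ge0.
have -> : A%:Z * (W * L')%N%:Z ^+ 2 * (4 * A%:Z) = (W * (2 * A * L'))%N%:Z ^+ 2 by rewrite !PoszM; ring.
by rewrite lerXn2r ?nnegrE // lez_nat leq_mul2l hL' orbT.
Qed.

(** The last coefficient is negative and its coordinate dominates, since L' is small against L: what
    the coordinate of index 0 has to compensate is positive and of order (W L)^2. *)
Lemma sc_Y_bounds (t : T) : (2 * A <= L)%N -> A%:Z * W%:Z ^+ 2 <= Yof t /\ Yof t <= 5 * A%:Z * (W * L)%N%:Z ^+ 2.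
Proof.
move=> AL; have om : (ord_max : 'I_m) != ord0 by rewrite -val_eqE /= -lt0n; exact: sc_n0.
have E : Yof t = - a ord_max * (zrest t ord_max)%:Z ^+ 2 - \sum_(k | (k != ord0) && (k != ord_max)) a k * (zrest t k)%:Z ^+ 2.
  by rewrite /Yof (bigD1 ord_max) //= opprD mulNr.
have := sc_mid_sum t; rewrite E; move: (\sum_(k | _) _) => S hS.
have /andP[z1 z2] := sc_zmax_ge t; move: (zrest t ord_max) z1 z2 => z z1 z2.
have an : 1 <= - a ord_max by rewrite /a /=; move: negn; clear; lia.
have aA : - a ord_max <= A%:Z by apply: le_trans (sc_a_le ord_max); rewrite -normrN ler_norm.
have A1 : 1 <= A%:Z by rewrite lez_nat; exact: sc_A0.
have q1 : (W * L)%N%:Z ^+ 2 <= z%:Z ^+ 2 by rewrite lerXn2r ?nnegrE // lez_nat.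
have q2 : z%:Z ^+ 2 <= 4 * (W * L)%N%:Z ^+ 2.
  have -> : 4 * (W * L)%N%:Z ^+ 2 = (2 * (W * L))%N%:Z ^+ 2 by rewrite !PoszM; ring.
  by rewrite lerXn2r ?nnegrE // lez_nat.
have q3 : 4 * (A%:Z * W%:Z ^+ 2) <= 2 * (W * L)%N%:Z ^+ 2.
  have : (2 * A * W ^ 2 <= W ^ 2 * (L * L))%N.
    by rewrite mulnC leq_mul2l; apply/orP; right; apply: (leq_trans AL); rewrite leq_pmulr //; apply: leq_trans AL; rewrite muln_gt0 sc_A0.
  by rewrite -lez_nat !PoszM; lia.
have p1 : z%:Z ^+ 2 <= - a ord_max * z%:Z ^+ 2 by rewrite ler_peMl ?sqr_ge0.
have p2 : - a ord_max * z%:Z ^+ 2 <= A%:Z * (4 * (W * L)%N%:Z ^+ 2) by apply: ler_pM => //; move: an; clear; lia.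
have s1 : `|S| * 4 <= (W * L)%N%:Z ^+ 2.
  by apply: le_trans hS; rewrite ler_wpM2l // ler_peMr.
have q0 : (W * L)%N%:Z ^+ 2 <= A%:Z * (W * L)%N%:Z ^+ 2 by rewrite ler_peMl ?sqr_ge0.
move: p1 p2 s1 q0 q1 q3; rewrite -(mulrA 5) (mulrCA _ 4).
set v1 := - a ord_max * _; set v2 := A%:Z * W%:Z ^+ 2; set v4 := (W * L)%N%:Z ^+ 2; set v3 := A%:Z * v4; set v5 := z%:Z ^+ 2.
by clearbody v1 v2 v3 v4 v5; clear; lia.
Qed.

Hypothesis lam0 : \sum_(i < s) lam i = 0.
Hypothesis AL : (2 * A <= L)%N.
Variable N : nat.
Let X0 := (4 * A * (W * L) * D)%N.
Hypothesis hN : (2 * X0 + X <= N)%N.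
Hypothesis X1 : (0 < X)%N.

Definition near_solutions : nat := #|[pred v : {ffun 'I_s -> 'I_N} |
  [&& \sum_(i < s) lam i * (v i)%:Z == 0, (W%:Z %| \sum_(i < s) lam i * (v i)%:Z ^+ 2)%Z & `|\sum_(i < s) lam i * (v i)%:Z ^+ 2| <= H%:Z]]|.

(** The free parameters are a solution modulo W, blocks of length L' in the n coordinates other than
    0, a window of length U for coordinate 0, and X translations. A translation changes neither
    form, because the lam i sum to 0 and the linear form vanishes. *)
Lemma sc_count : (nsol a W * L' ^ n * U * X <= near_solutions)%N.
Proof.
have N0 : (0 < N)%N by apply: leq_trans hN; rewrite addn_gt0 X1 orbT.
have [y0 hy0] : exists y0 : T -> nat, forall (t : T) u, (u < U)%N ->
    [/\ (val t.1 ord0 + W * (y0 t + u) <= 4 * A * (W * L))%N, 0 <= a ord0 * (val t.1 ord0 + W * (y0 t + u))%N%:Z ^+ 2 - Yof t &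
     a ord0 * (val t.1 ord0 + W * (y0 t + u))%N%:Z ^+ 2 - Yof t <= (7 * A ^ 2 * W ^ 2 * L * U)%N%:Z].
  suff h (t : T) : exists y0, forall u, (u < U)%N ->
    [/\ (val t.1 ord0 + W * (y0 + u) <= 4 * A * (W * L))%N, 0 <= a ord0 * (val t.1 ord0 + W * (y0 + u))%N%:Z ^+ 2 - Yof t &
     a ord0 * (val t.1 ord0 + W * (y0 + u))%N%:Z ^+ 2 - Yof t <= (7 * A ^ 2 * W ^ 2 * L * U)%N%:Z].
    by have [y0 hy0] := boolp.choice h; exists y0.
  have [Y1 Y2] := sc_Y_bounds t AL.
  apply: window_exists => //; first exact: sc_A0.
  by apply: le_trans (sc_a_le ord0); rewrite ler_norm.
pose T' := (T * 'I_U * 'I_X)%type.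
pose zz (t : T') (k : nat) : int := if k == 0%N then (val t.1.1.1 ord0 + W * (y0 t.1.1 + t.1.2))%N%:Z else (zrest t.1.1 (inord k))%:Z.
(* The shift by X0 makes all entries nonnegative; t.2 is the translation parameter. *)
pose v (t : T') (i : nat) : int := (X0 + t.2)%N%:Z + dcomb lam m (zz t) i.
have zz_ge0 t k : 0 <= zz t k by rewrite /zz; case: ifP.
have L'L : (L' <= L)%N by apply: leq_trans hL'; rewrite leq_pmull // muln_gt0 sc_A0.
have zzr t (k : 'I_m) : k != ord0 -> zz t k = (zrest t.1.1 k)%:Z.
  by rewrite -val_eqE /= => /negbTE k0; rewrite /zz k0 inord_val.
have zz_le t (k : 'I_m) : zz t k <= (4 * A * (W * L))%N%:Z.
  have [->|k0] := eqVneq k ord0; first by rewrite /zz /= lez_nat; have [h _ _] := hy0 t.1.1 t.1.2 (ltn_ord _).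
  rewrite zzr // lez_nat; apply: (@leq_trans (2 * (W * L))%N); last first.
    by rewrite leq_mul2r; apply/orP; right; apply: leq_trans (_ : 4 * 1 <= _)%N; rewrite ?leq_mul2l ?sc_A0.
  have [->|km] := eqVneq k ord_max; first by have /andP[] := sc_zmax_ge t.1.1.
  by apply: (leq_trans (sc_zrest_le t.1.1 k0 km)); rewrite mulnCA leq_mul2l mul2n -addnn (leq_trans L'L) ?leq_addl ?orbT.
have comb_le t i : (i < s)%N -> `|dcomb lam m (zz t) i| <= X0%:Z.
  move=> si; apply: (le_trans (ler_norm_sum _ _ _)).
  apply: (@le_trans _ _ (\sum_(k < m) (4 * A * (W * L))%N%:Z * `|dvec lam k i|)).
    by apply: ler_sum => k _; rewrite normrM (ger0_norm (zz_ge0 t k)) ler_wpM2r.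
  rewrite -mulr_sumr /X0 (PoszM (4 * A * (W * L))) ler_wpM2l // (_ : \sum_(k < m) `|dvec lam k i| = (\sum_(k < m) `|dvec lam k i|)%N%:Z); last first.
    by elim/big_rec2: _ => // k x y _ ->; rewrite PoszD abszE.
  by rewrite lez_nat /D (bigD1 (Ordinal si)) //= leq_addr.
have v_range t i : (i < s)%N -> 0 <= v t i < N%:Z.
  move=> si; have := comb_le t i si; rewrite /v; have := ltn_ord t.2; move: hN; move: (dcomb _ _ _ _) (nat_of_ord t.2) => x y; clear; lia.
pose F (t : T') : {ffun 'I_s -> 'I_N} := [ffun i : 'I_s => Ordinal (zord_subproof (v t i) N0)].
have FE t i : (F t i)%:Z = v t i.
  have N00 : N%:Z != 0 by rewrite eqz_nat -lt0n.
  by rewrite ffunE /= modz_small ?v_range // abszE ger0_norm //; have /andP[] := v_range t i (ltn_ord i).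
have q0 t : \sum_(k < m) dcoef lam k * zz t k ^+ 2 = a ord0 * zz t 0 ^+ 2 - Yof t.1.1.
  rewrite (bigD1 ord0) //= /Yof opprK; congr (_ + _); apply: eq_bigr => k k0; by rewrite zzr.
have sum2 t : \sum_(i < s) lam i * v t i ^+ 2 = \sum_(k < m) dcoef lam k * zz t k ^+ 2.
  have [_ c1 c2] := dcomb_quad lam (zz t) (leqnn s).
  rewrite -c2 (eq_bigr (fun i : 'I_s => lam i * dcomb lam m (zz t) i ^+ 2 + (2 * (X0 + t.2)%N%:Z * (lam i * dcomb lam m (zz t) i) + (X0 + t.2)%N%:Z ^+ 2 * lam i))) => [|i _].
    by rewrite !big_split /= -!mulr_sumr c1 lam0 !mulr0 !addr0.
  by rewrite /v; ring.
have injF : injective F.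
  move=> t t' /ffunP h; have hv i : (i < s)%N -> v t i = v t' i.
    by move=> si; have := h (Ordinal si); move=> /(congr1 (fun x : 'I_N => x%:Z)); rewrite !FE.
  have [c0 _ _] := dcomb_quad lam (zz t) (leqnn s); have [c0' _ _] := dcomb_quad lam (zz t') (leqnn s).
  (* [dcomb] vanishes at the last index, so the last entry reveals the translation. *)
  have hx : t.2 = t'.2.
    have := hv m.+1 (ltnSn _); rewrite /v c0 // c0' // => h1; apply: val_inj => /=; move: h1; clear; lia.
  have hd i : (i < s)%N -> dcomb lam m (zz t) i = dcomb lam m (zz t') i.
    by move=> si; have := hv i si; rewrite /v hx => /addrI.
  have hz := dcomb_inj (leqnn s) nz hd.
  have hr (k : 'I_m) : val t.1.1.1 k = val t'.1.1.1 k /\ (forall k', k = lift ord0 k' -> t.1.1.2 k' = t'.1.1.2 k').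
    have := hz k (ltn_ord k); case: (unliftP ord0 k) => [k' kE|->].
      have k0 : k != ord0 by rewrite kE eq_sym neq_lift.
      rewrite !zzr // => /eqP; rewrite eqz_nat /zrest {1 4}kE liftK => /eqP h1.
      have hk : val t.1.1.1 k = val t'.1.1.1 k.
        exact: ord_mod_inj h1.
      split=> // k'' kE'; have <- : k' = k'' by apply: (@lift_inj _ ord0); rewrite -kE -kE'.
      move: h1; rewrite hk => /addnI /eqP; rewrite eqn_pmul2l // eqn_add2r => /eqP h1; exact: val_inj.
    rewrite /zz /= => /eqP; rewrite eqz_nat => /eqP h1; split=> [|k' h2]; last by have := neq_lift ord0 k'; rewrite -h2 eqxx.
    exact: ord_mod_inj h1.
  have h11 : t.1.1 = t'.1.1.
    rewrite (surjective_pairing t.1.1) (surjective_pairing t'.1.1); congr (_, _).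
      by apply: val_inj; apply/ffunP => k; have [] := hr k.
    by apply/ffunP => k'; have [_ h2] := hr (lift ord0 k'); apply: h2.
  have h12 : t.1.2 = t'.1.2.
    have := hz 0%N (ltn0Sn _); rewrite /zz /= h11 => /eqP; rewrite eqz_nat eqn_add2l eqn_pmul2l // eqn_add2l => /eqP h1; exact: val_inj.
  by move: h11 h12 hx; case: (t) => [[? ?] ?]; case: (t') => [[? ?] ?] /= -> -> ->.
have cT : #|{: T'}| = (nsol a W * L' ^ n * U * X)%N.
  by rewrite !card_prod card_sig card_ffun !card_ord.
rewrite -cT -(card_imset _ injF); apply/subset_leq_card/subsetP => w /imsetP[t _ ->].
rewrite inE; have -> : \sum_(i < s) lam i * (F t i)%:Z = 0.
  under eq_bigr => i _ do rewrite FE /v mulrDr.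
  have [_ c1 _] := dcomb_quad lam (zz t) (leqnn s); by rewrite big_split /= -mulr_suml lam0 mul0r add0r c1.
have -> : \sum_(i < s) lam i * (F t i)%:Z ^+ 2 = \sum_(k < m) dcoef lam k * zz t k ^+ 2.
  by rewrite -sum2; apply: eq_bigr => i _; rewrite FE.
rewrite eqxx /=; apply/andP; split.
  rewrite -/(quad a (fun k : 'I_m => zz t k)) (quad_dvd a (z' := fun k => (val t.1.1.1 k)%:Z)); first exact: valP t.1.1.1.
  move=> k; have [->|k0] := eqVneq k ord0; first by rewrite /zz /= PoszD addrAC subrr add0r PoszM dvdz_mulr.
  rewrite zzr // /zrest; case: unliftP => [k' _|h]; last by rewrite h eqxx in k0.
  by rewrite PoszD addrAC subrr add0r PoszM dvdz_mulr.
rewrite q0; have [_ h1 h2] := hy0 t.1.1 t.1.2 (ltn_ord _).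
by rewrite /zz /= ger0_norm //; apply: (le_trans h2); rewrite lez_nat.
Qed.
End SolutionCount.

Lemma leq_double_divn (x d : nat) : (0 < d)%N -> (d <= x)%N -> (x <= 2 * d * (x %/ d))%N.
Proof.
move=> d0 dx; have q1 : (0 < x %/ d)%N by rewrite divn_gt0.
have := ltn_ceil x d0; have : (d <= x %/ d * d)%N by rewrite leq_pmull.
rewrite mulSn -mulnA [(d * _)%N]mulnC; move: (x %/ d * d)%N => z; clear; lia.
Qed.

(** The choice L about N / W, L' about L, U about H / (W^2 L) and X about N, together with W^n
    residue solutions up to a constant, gives N^n H / W. The conditions on H say that U is at least
    1 and at most L. *)
Lemma near_count (lam : nat -> int) (n : nat) : (4 <= n)%N -> (forall k, (k < n.+1)%N -> dcoef lam k != 0) ->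
  0 < dcoef lam 0 -> dcoef lam n < 0 -> \sum_(i < n.+3) lam i = 0 ->
  exists (C : nat) (c : R), [/\ (0 < C)%N, 0 < c & forall W N H : nat, (0 < W)%N -> (C * W <= N)%N ->
    (C * H <= N ^ 2)%N -> (C * (W * N) <= H)%N -> c * N%:R ^+ n * H%:R <= W%:R * (near_solutions lam n W H N)%:R].
Proof.
move=> n4 nz p0 nn s0.
pose a (k : 'I_n.+1) : int := dcoef lam k.
have [c0 c00 hc0] : exists2 c : R, 0 < c & forall W : nat, (0 < W)%N -> c * W%:R ^+ n <= (nsol a W)%:R.
  by apply: nsol_lower => // k; apply: nz.
have [A AE] : exists A, A = (\sum_k `|a k|)%N by eexists.
have [D0 DE] : exists D, D = (\sum_(i < n.+3) \sum_(k < n.+1) `|dvec lam k i|)%N by eexists.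
have A0 : (0 < A)%N by rewrite AE (bigD1 ord0) //= addn_gt0 absz_gt0 nz.
have [B BE] : exists B, B = (16 * A * D0.+1)%N by eexists.
have B0 : (0 < B)%N by rewrite BE muln_gt0 muln_gt0 A0.
have [n' nE] : exists n', n = n'.+1 by exists n.-1; move: n4; clear; lia.
have [K KE] : exists K, K = ((4 * A) ^ n * (28 * A ^ 2) * (2 * B) ^ n')%N by eexists.
have K0 : (0 < K)%N.
  have A4 : (0 < 4 * A)%N by rewrite muln_gt0 A0.
  have B2 : (0 < 2 * B)%N by rewrite muln_gt0 B0.
  by rewrite KE muln_gt0 expn_gt0 B2 muln_gt0 expn_gt0 A4 muln_gt0 expn_gt0 A0.
have [C CE] : exists C, C = (4 * A * B + 7 * A ^ 2 + 4 * B ^ 2)%N by eexists.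
have C1 : (4 * A * B <= C)%N by rewrite CE -addnA leq_addr.
have C2 : (7 * A ^ 2 <= C)%N by rewrite CE -addnA addnCA leq_addr.
have C3 : (4 * B ^ 2 <= C)%N by rewrite CE leq_addl.
exists C, (c0 / K%:R); split.
- by apply: leq_trans C1; rewrite muln_gt0 B0 muln_gt0 A0.
- by rewrite divr_gt0 // ltr0n.
move=> W N H W0 CW CH WH.
have BW : (0 < B * W)%N by rewrite muln_gt0 B0.
have [L LE] : exists L, L = (N %/ (B * W))%N by eexists.
have [L' L'E] : exists L', L' = (L %/ (2 * A))%N by eexists.
have [E EE] : exists E, E = (7 * A ^ 2 * W ^ 2 * L)%N by eexists.
have [U UE] : exists U, U = (H %/ E)%N by eexists.
have NBW : (4 * A * (B * W) <= N)%N by apply: leq_trans CW; rewrite mulnA leq_mul2r C1 orbT.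
have L4A : (4 * A <= L)%N by rewrite LE leq_divRL.
have L0 : (0 < L)%N by apply: leq_trans L4A; rewrite muln_gt0 A0.
have A20 : (0 < 2 * A)%N by rewrite muln_gt0 A0.
have AL : (2 * A <= L)%N by apply: leq_trans L4A; rewrite leq_mul2r orbT.
have L'0 : (0 < L')%N by rewrite L'E divn_gt0.
have hL' : (2 * A * L' <= L)%N by rewrite L'E mulnC leq_divM.
have E0 : (0 < E)%N by rewrite EE muln_gt0 L0 muln_gt0 expn_gt0 W0 muln_gt0 expn_gt0 A0.
have NL : (N <= 2 * (B * W) * L)%N.
  by rewrite LE; apply: leq_double_divn => //; apply: leq_trans NBW; rewrite leq_pmull // muln_gt0 A0.
have LN : (L * (B * W) <= N)%N by rewrite LE; exact: leq_divM.
have WLN : (W * L <= N)%N by apply: leq_trans LN; rewrite mulnC leq_mul2l leq_pmull ?orbT.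
have EH : (E <= H)%N.
  apply: leq_trans WH; rewrite EE; apply: (@leq_trans (C * (W * (W * L)))%N); last by rewrite leq_mul2l leq_mul2l WLN !orbT.
  rewrite (_ : 7 * A ^ 2 * W ^ 2 * L = 7 * A ^ 2 * (W * (W * L)))%N; last by ring.
  by rewrite leq_mul2r C2 orbT.
have U0 : (0 < U)%N by rewrite UE divn_gt0.
have hU : (7 * A ^ 2 * W ^ 2 * L * U <= H)%N by rewrite -EE UE mulnC leq_divM.
have UL : (U <= L)%N.
  have HWL : (H <= (W * L) ^ 2)%N.
    have b2 : (0 < 4 * B ^ 2)%N by rewrite muln_gt0 expn_gt0 B0.
    rewrite -(leq_pmul2l b2); apply: leq_trans (leq_trans CH _); first by rewrite leq_mul2r C3 orbT.
    apply: (@leq_trans ((2 * (B * W) * L) ^ 2)%N); first by rewrite leq_sqr.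
    by apply: eq_leq; ring.
  rewrite UE -ltnS ltn_divLR //; apply: (leq_ltn_trans HWL); apply: (@leq_trans (L * E).+1); last first.
    by rewrite mulSn addnC -[X in (X <= _)%N]addn1 leq_add2l.
  rewrite ltnS EE (_ : L * (7 * A ^ 2 * W ^ 2 * L) = 7 * A ^ 2 * (W * L) ^ 2)%N; last by ring.
  by rewrite leq_pmull // muln_gt0 expn_gt0 A0.
have [X0 X0E] : exists X0, X0 = (4 * A * (W * L) * D0)%N by eexists.
have BD : (4 * X0 <= N)%N.
  apply: leq_trans LN; rewrite BE X0E (_ : L * (16 * A * D0.+1 * W) = 4 * (4 * A * (W * L) * D0.+1))%N; last by ring.
  by rewrite leq_mul2l leq_mul2l leqnSn !orbT.
have N0 : (0 < N)%N by apply: leq_trans LN; rewrite muln_gt0 L0.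
have [X XE] : exists X, X = (N - 2 * X0)%N by eexists.
have X00 : (0 < X)%N by move: BD N0; rewrite XE; clear; lia.
have NX : (N <= 2 * X)%N by move: BD; rewrite XE; clear; lia.
have hN : (2 * X0 + X <= N)%N by move: BD; rewrite XE; clear; lia.
rewrite X0E DE AE in hN; rewrite AE in hL' hU AL.
have main := sc_count nz p0 nn W0 UL L'0 hL' hU s0 AL hN X00.
rewrite -AE in hL' hU AL.
have h1 := hc0 W W0.
have LL' : (L <= 4 * A * L')%N by have := leq_double_divn A20 AL; rewrite mulnA -L'E.
have HU : (H <= 2 * E * U)%N by rewrite UE; exact: leq_double_divn.
have comb : (N ^ n * H <= K * (W * (W ^ n * L' ^ n * U * X)))%N.
  apply: (@leq_trans ((2 * B) ^ n' * (28 * A ^ 2) * (W * (W * L) ^ n * U * X))%N).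
    apply: (@leq_trans ((2 * (B * W) * L) ^ n' * (2 * X) * (2 * E * U))%N).
      by apply: leq_mul => //; rewrite nE expnSr; apply: leq_mul => //; rewrite leq_exp2r // ; move: n4 nE; clear; lia.
    rewrite EE nE (_ : (W * L) ^ n'.+1 = (W * L) ^ n' * (W * L))%N; last by rewrite expnSr.
    rewrite (_ : 2 * (B * W) * L = 2 * B * (W * L))%N; last by ring.
    by rewrite expnMn; move: ((2 * B) ^ n')%N ((W * L) ^ n')%N => z1 z2; apply: eq_leq; ring.
  have h3 : ((W * L) ^ n <= (4 * A) ^ n * (W ^ n * L' ^ n))%N.
    rewrite -!expnMn leq_exp2r; last by rewrite nE.
    by rewrite mulnCA leq_mul2l LL' orbT.
  rewrite KE; apply: (@leq_trans ((2 * B) ^ n' * (28 * A ^ 2) * (W * ((4 * A) ^ n * (W ^ n * L' ^ n)) * U * X))%N).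
    by rewrite leq_mul2l !leq_mul2r leq_mul2l h3 !orbT.
  by move: ((2 * B) ^ n')%N ((4 * A) ^ n)%N (W ^ n)%N (L' ^ n)%N => z1 z2 z3 z4; apply: eq_leq; ring.
have h2 : c0 * W%:R ^+ n * (L' ^ n * U * X)%N%:R <= (near_solutions lam n W H N)%:R.
  apply: (@le_trans _ _ ((nsol a W)%:R * (L' ^ n * U * X)%N%:R)); first by rewrite ler_wpM2r.
  by rewrite -natrM ler_nat !mulnA.
have WR : (0 : R) < W%:R by rewrite ltr0n.
apply: (le_trans _ (ler_wpM2l (ltW WR) h2)).
have KR : (0 : R) < K%:R by rewrite ltr0n.
rewrite -mulrA mulrAC ler_pdivrMr //.
have : (N ^ n * H)%N%:R <= (K * (W * (W ^ n * L' ^ n * U * X)))%N%:R :> R by rewrite ler_nat.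
move=> h; have := ler_wpM2l (ltW c00) h; rewrite [in leLHS]natrM natrX => h'; apply: (le_trans h'); apply: eq_ler.
rewrite (natrM _ K) (natrM _ W) -!mulnA (natrM _ (W ^ n)) natrX; ring.
Qed.

(** * Counting solutions on the grid and through the kernel *)

Lemma pair_grid (V : nmodType) (P1 P2 : nat) (F : nat -> nat -> V) :
  \sum_(p : 'I_P1 * 'I_P2) F p.1 p.2 = \sum_(a < P1) \sum_(b < P2) F a b.
Proof. by rewrite [RHS]pair_big. Qed.

Section Forms.
Variables (lam : nat -> int) (s N : nat).
Definition lform (v : {ffun 'I_s -> 'I_N}) : int := \sum_(i < s) lam i * (v i)%:Z.
Definition qform (v : {ffun 'I_s -> 'I_N}) : int := \sum_(i < s) lam i * (v i)%:Z ^+ 2.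

Lemma prod_fsum (g : nat -> nat -> R[i]) (P1 P2 a b : nat) :
  \prod_(i < s) fsum N (g i) P1 P2 (lam i * a%:Z) (lam i * b%:Z) =
  \sum_(v : {ffun 'I_s -> 'I_N}) (\prod_(i < s) g i (v i)) * e ((lform v)%:~R * a%:R / P1%:R + (qform v)%:~R * b%:R / P2%:R).
Proof.
rewrite /fsum bigA_distr_bigA; apply: eq_bigr => v _; rewrite big_split /=; congr (_ * _).
rewrite -e_sum big_split /= /lform /qform !rmorph_sum !mulr_suml; congr (e (_ + _)); apply: eq_bigr => i _; rewrite ?rmorphM ?rmorphXn /=; ring.
Qed.

Lemma lform_le v : (`|lform v| <= (\sum_(i < s) `|lam i|%N) * N)%N.
Proof.
have h : `|lform v| <= ((\sum_(i < s) `|lam i|%N) * N)%N%:Z.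
  apply: (le_trans (ler_norm_sum _ _ _)); rewrite big_distrl /= (big_morph Posz PoszD (erefl _)).
  apply: ler_sum => i _; rewrite normrM PoszM abszE ler_wpM2l // ger0_norm // lez_nat ltnW //.
by rewrite -lez_nat abszE.
Qed.

Lemma qform_le v : (`|qform v| <= (\sum_(i < s) `|lam i|%N) * N ^ 2)%N.
Proof.
have h : `|qform v| <= ((\sum_(i < s) `|lam i|%N) * N ^ 2)%N%:Z.
  apply: (le_trans (ler_norm_sum _ _ _)); rewrite big_distrl /= (big_morph Posz PoszD (erefl _)).
  apply: ler_sum => i _; rewrite normrM PoszM abszE ler_wpM2l // normrX ger0_norm // -PoszX lez_nat leq_sqr ltnW //.
by rewrite -lez_nat abszE.
Qed.

Lemma count_fsum (g : nat -> nat -> R[i]) (P1 P2 : nat) :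
  ((\sum_(i < s) `|lam i|%N) * N < P1)%N -> ((\sum_(i < s) `|lam i|%N) * N ^ 2 < P2)%N ->
  \sum_(p : 'I_P1 * 'I_P2) \prod_(i < s) fsum N (g i) P1 P2 (lam i * p.1%:Z) (lam i * p.2%:Z) =
  (P1 * P2)%:R * \sum_(v | (lform v == 0) && (qform v == 0)) \prod_(i < s) g i (v i).
Proof.
move=> h1 h2; have p1 : (0 < P1)%N by apply: leq_ltn_trans h1.
have p2 : (0 < P2)%N by apply: leq_ltn_trans h2.
rewrite (@pair_grid _ P1 P2 (fun a b => \prod_(i < s) fsum N (g i) P1 P2 (lam i * a%:Z) (lam i * b%:Z))) /=.
under eq_bigr => a _ do under eq_bigr => b _ do rewrite prod_fsum.
rewrite exchange_big3 mulr_sumr [RHS]big_mkcond; apply: eq_bigr => v _ /=.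
transitivity (\prod_(i < s) g i (v i) * \sum_(a < P1) \sum_(b < P2) e ((lform v)%:~R * a%:R / P1%:R + (qform v)%:~R * b%:R / P2%:R)).
  by rewrite mulr_sumr; apply: eq_bigr => a _; rewrite mulr_sumr.
rewrite grid_orth //.
have -> : (P1%:Z %| lform v)%Z = (lform v == 0).
  apply/idP/eqP => [d|->]; last exact: dvdz0.
  by apply: (dvdz_small d); apply: leq_ltn_trans (lform_le v) h1.
have -> : (P2%:Z %| qform v)%Z = (qform v == 0).
  apply/idP/eqP => [d|->]; last exact: dvdz0.
  by apply: (dvdz_small d); apply: leq_ltn_trans (qform_le v) h2.
by case: ifP => _; rewrite ?mulr0 // mulrC.
Qed.

(** What orthogonality selects once the kernel is expanded: the two indices below M are those of its
    double sum. *)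
Definition shifted_solutions (P1 P2 W M : nat) (x : {ffun 'I_s -> 'I_N} * ('I_M * 'I_M)) : bool :=
  (P1%:Z %| lform x.1)%Z && (P2%:Z %| qform x.1 + W%:Z * (x.2.1%:Z - x.2.2%:Z))%Z.

(* The kernel is 1 at every rational b / W and thickens the equation of degree two to a congruence and a bound. *)
Lemma kernel_count (P1 P2 W M : nat) : (0 < P1)%N -> (0 < P2)%N ->
  \sum_(p : 'I_P1 * 'I_P2) (\prod_(i < s) fsum N (fun=> 1) P1 P2 (lam i * p.1%:Z) (lam i * p.2%:Z)) *
     (fejer M (W%:R * (p.2%:R / P2%:R)))%:C =
  (M%:R ^- 2 * (P1 * P2)%:R * #|[pred x | shifted_solutions P1 P2 W (M := M) x]|%:R)%:C.
Proof.
move=> p1 p2.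
rewrite (@pair_grid _ P1 P2 (fun a b : nat => (\prod_(i < s) fsum N (fun=> 1) P1 P2 (lam i * a%:Z) (lam i * b%:Z)) * (fejer M (W%:R * (b%:R / P2%:R)))%:C)) /=.
have term (a b : nat) : (\prod_(i < s) fsum N (fun=> 1) P1 P2 (lam i * a%:Z) (lam i * b%:Z)) * (fejer M (W%:R * (b%:R / P2%:R)))%:C =
   \sum_(x : {ffun 'I_s -> 'I_N} * ('I_M * 'I_M)) (M%:R ^- 2)%:C *
     e ((lform x.1)%:~R * a%:R / P1%:R + (qform x.1 + W%:Z * (x.2.1%:Z - x.2.2%:Z))%:~R * b%:R / P2%:R).
  rewrite (prod_fsum (fun _ _ => 1)) fejer_expand mulrCA mulr_suml -mulr_sumr; congr (_ * _).
  rewrite -(pair_big xpredT xpredT (fun (v : {ffun 'I_s -> 'I_N}) (y : 'I_M * 'I_M) => e ((lform v)%:~R * a%:R / P1%:R + (qform v + W%:Z * (y.1%:Z - y.2%:Z))%:~R * b%:R / P2%:R))) /=.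
  apply: eq_bigr => v _; rewrite big1 ?mul1r // mulr_sumr.
  rewrite (@pair_grid _ M M (fun (j k : nat) => e ((lform v)%:~R * a%:R / P1%:R + (qform v + W%:Z * (j%:Z - k%:Z))%:~R * b%:R / P2%:R))) /=.
  apply: eq_bigr => j _; rewrite mulr_sumr; apply: eq_bigr => k _; rewrite -eD; congr e.
  by rewrite intrD intrM intrB; ring.
under eq_bigr => a _ do under eq_bigr => b _ do rewrite term.
rewrite exchange_big3 -mulrA realCM realCM !real_natC -sum1_card natr_sum mulr_sumr mulr_sumr [RHS]big_mkcond /=.
apply: eq_bigr => x _ /=.
transitivity ((M%:R ^- 2)%:C * \sum_(a < P1) \sum_(b < P2) e ((lform x.1)%:~R * a%:R / P1%:R + (qform x.1 + W%:Z * (x.2.1%:Z - x.2.2%:Z))%:~R * b%:R / P2%:R)).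
  by rewrite mulr_sumr; apply: eq_bigr => a _; rewrite mulr_sumr.
rewrite grid_orth // inE /shifted_solutions.
by case: ifP => _; rewrite ?mulr0 // mulr1.
Qed.
End Forms.

(** A near solution with quadratic form W z, |z| <= M1, is met by M1 pairs of indices below 2 M1
    with difference matching z. *)
Lemma shifted_solutions_ge (lam : nat -> int) (n N P1 P2 W M1 : nat) :
  (M1 * near_solutions lam n W (W * M1) N <= #|[pred x | @shifted_solutions lam n.+3 N P1 P2 W (2 * M1) x]|)%N.
Proof.
rewrite (card_pair (fun v y => @shifted_solutions lam n.+3 N P1 P2 W (2 * M1) (v, y))) /near_solutions.
rewrite -sum1_card big_distrr /= big_mkcond /=; apply: leq_sum => v _; case: ifP => // /and3P[/eqP L0 /dvdzP[z' Qz] QH].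
have [z zE] : exists z : int, z = z' by eexists.
rewrite -zE in Qz.
rewrite muln1 -[X in (X <= _)%N](card_ord M1).
have [W0|W0] := posnP W.
  have f_lt (t : 'I_M1) : (t < 2 * M1)%N by apply: leq_trans (ltn_ord t) _; rewrite leq_pmull.
  pose f (t : 'I_M1) := (Ordinal (f_lt t), Ordinal (f_lt t)).
  have fi : injective f by move=> t u [h]; apply: val_inj.
  rewrite -(card_codom fi); apply: subset_leq_card; apply/subsetP => y /codomP[t ->].
  by rewrite unfold_in /shifted_solutions /= /lform /qform L0 Qz W0 !(mulr0, mul0r) addr0 !dvdz0.
have zM : (`|z| <= M1)%N.
  move: QH; rewrite Qz normrM [W%:Z]lock -lock PoszM [W%:Z * _]mulrC.
  by rewrite [`|W%:Z|]ger0_norm // ler_pM2r ?ltz_nat // -abszE lez_nat.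
have f_lt (t : 'I_M1) : (t + (if (0 <= z)%R then 0 else `|z|%N) < 2 * M1)%N by move: (ltn_ord t) zM; case: ifP; clear; lia.
have g_lt (t : 'I_M1) : (t + (if (0 <= z)%R then `|z|%N else 0%N) < 2 * M1)%N by move: (ltn_ord t) zM; case: ifP; clear; lia.
pose f (t : 'I_M1) := (Ordinal (f_lt t), Ordinal (g_lt t)).
have fi : injective f by move=> t u [h _]; apply: val_inj => /=; move: h; clear; lia.
rewrite -(card_codom fi); apply: subset_leq_card; apply/subsetP => y /codomP[t ->].
rewrite unfold_in /shifted_solutions /= /lform /qform L0 Qz dvdz0 /= [z * _]mulrC -mulrDr.
by rewrite (_ : z + _ = 0) ?mulr0 ?dvdz0 //; case: ifP; clear; lia.
Qed.

(** If x i0 is at most ka times the largest factor, the product is at most ka times the s-th power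
    of that factor; otherwise all factors are at most x i0 / ka. *)
Lemma prod_le_split (s : nat) (x : 'I_s -> R) (i0 : 'I_s) (ka : R) : (forall i, 0 <= x i) -> 0 < ka -> ka <= 1 ->
  \prod_i x i <= ka ^- s * x i0 ^+ s + ka * \sum_i x i ^+ s.
Proof.
move=> x0 k0 k1; have [m _ hm] := @arg_maxP _ R _ i0 xpredT x isT.
have hp : \prod_i x i <= x i0 * x m ^+ s.-1.
  rewrite (bigD1 i0) //=; apply: ler_wpM2l => //; rewrite (_ : s.-1 = #|[pred i | i != i0]|).
    by rewrite -prodr_const; apply: ler_prod => i _; rewrite x0; exact: hm.
  by have := cardC1 i0; rewrite card_ord => <-; apply: eq_card => i; rewrite !inE.
have sE : s = s.-1.+1 by rewrite prednK // (leq_ltn_trans _ (ltn_ord i0)).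
have S0 : x m ^+ s <= \sum_i x i ^+ s.
  by rewrite (bigD1 m) //= lerDl sumr_ge0 // => i _; rewrite exprn_ge0.
have T0 : 0 <= ka ^- s * x i0 ^+ s by rewrite mulr_ge0 ?invr_ge0 ?exprn_ge0 // ltW.
have [h|h] := lerP (x i0) (ka * x m).
  apply: (le_trans hp); apply: (@le_trans _ _ (ka * x m ^+ s)).
    by rewrite [in leRHS]sE exprS mulrA ler_wpM2r // exprn_ge0.
  by rewrite -[leLHS]add0r lerD // ler_wpM2l // ltW.
apply: (le_trans hp); apply: (@le_trans _ _ (ka ^- s * x i0 ^+ s)); last first.
  by rewrite lerDl; apply: mulr_ge0; [exact: ltW|apply: sumr_ge0 => i _; exact: exprn_ge0].
have h2 : x m <= ka^-1 * x i0 by rewrite mulrC ler_pdivlMr // mulrC ltW.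
have h3 : x m ^+ s.-1 <= (ka^-1 * x i0) ^+ s.-1 by rewrite lerXn2r // nnegrE // mulr_ge0 // invr_ge0 ltW.
apply: (@le_trans _ _ (x i0 * (ka^-1 * x i0) ^+ s.-1)); first by rewrite ler_wpM2l.
rewrite exprMn mulrCA -exprS -sE; apply: ler_wpM2r; first by rewrite exprn_ge0.
rewrite exprVn lef_pV2 ?posrE; first by apply: ler_wiXn2l; rewrite ?(ltW k0) ?leq_pred.
  by apply: exprn_gt0.
by apply: exprn_gt0.
Qed.

Lemma fsum_addmul N g P1 P2 (a b k l : int) : (0 < P1)%N -> (0 < P2)%N ->
  fsum N g P1 P2 (a + k * P1%:Z) (b + l * P2%:Z) = fsum N g P1 P2 a b.
Proof.
move=> p1 p2; apply: eq_bigr => n _; congr (_ * _).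
have P1R : (P1%:R : R) != 0 by rewrite pnatr_eq0 -lt0n.
have P2R : (P2%:R : R) != 0 by rewrite pnatr_eq0 -lt0n.
rewrite -[RHS](e_addint _ (k * n%:Z + l * n%:Z ^+ 2)); congr e.
rewrite !expr2 !intrD !intrM; field; by rewrite P1R P2R.
Qed.

Lemma sum_dilate (V : nmodType) (l : int) (P1 P2 N : nat) g (G : R[i] -> V) : (0 < P1)%N -> (0 < P2)%N ->
  coprime P1 `|l| -> coprime P2 `|l| ->
  \sum_(p : 'I_P1 * 'I_P2) G (fsum N g P1 P2 (l * p.1%:Z) (l * p.2%:Z)) =
  \sum_(p : 'I_P1 * 'I_P2) G (fsum N g P1 P2 p.1 p.2).
Proof.
move=> p1 p2 c1 c2.
have lt P (a : 'I_P) : (0 < P)%N -> (`|(l * a%:Z %% P)%Z| < P)%N.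
  by move=> P0; rewrite -ltz_nat gez0_abs ?modz_ge0 ?ltz_pmod // -lt0n.
have inj P (a b : 'I_P) : (0 < P)%N -> coprime P `|l| -> `|(l * a%:Z %% P)%Z|%N = `|(l * b%:Z %% P)%Z|%N -> a = b.
  move=> P0 cP h; have h1 : (l * a%:Z %% P)%Z = (l * b%:Z %% P)%Z.
    by rewrite -[LHS]gez0_abs ?modz_ge0 -?lt0n // h gez0_abs ?modz_ge0 -?lt0n.
  have : (P%:Z %| l * (a%:Z - b%:Z))%Z.
    by rewrite mulrBr -eqz_mod_dvd; apply/eqP.
  rewrite Gauss_dvdzr ?coprimezE // => d; have := dvdz_small d => h2; apply: val_inj => /=.
  by move: h2 (ltn_ord a) (ltn_ord b); clear; lia.
pose f (p : 'I_P1 * 'I_P2) := (Ordinal (lt P1 p.1 p1), Ordinal (lt P2 p.2 p2)).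
have fi : injective f.
  by move=> [a b] [a' b'] [/(inj _ _ _ p1 c1) -> /(inj _ _ _ p2 c2) ->].
rewrite [RHS](reindex_inj fi); apply: eq_bigr => p _; congr G; rewrite /f /=.
rewrite !gez0_abs ?modz_ge0 -?lt0n // {1}(divz_eq (l * p.1%:Z) P1) {1}(divz_eq (l * p.2%:Z) P2).
by rewrite [_ + (l * p.1%:Z %% _)%Z]addrC [_ + (l * p.2%:Z %% _)%Z]addrC fsum_addmul.
Qed.

Definition adapted (lam : nat -> int) (s N P1 P2 : nat) :=
  [/\ ((\sum_(i < s) `|lam i|%N) * N < P1)%N, ((\sum_(i < s) `|lam i|%N) * N ^ 2 < P2)%N &
   forall i : 'I_s, coprime P1 `|lam i| && coprime P2 `|lam i|].

Lemma ratio_small (eps : R) : 0 < eps -> exists i, ratio ^+ i <= eps.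
Proof.
move=> e0; have [b96 b112 _] := grow_bounds.
have h i : ratio ^+ i * (1 + i%:R / 8) <= 1.
  elim: i => [|i IH]; first by rewrite expr0 mul0r addr0 mulr1.
  rewrite exprSr; have r0 : 0 <= ratio ^+ i.
    by apply: exprn_ge0; rewrite /ratio divr_ge0 //; move: b96; clear; lra.
  have r8 : ratio <= 7 / 8 by rewrite /ratio; move: b112; clear; lra.
  have i0 : (0 : R) <= i%:R by [].
  apply: le_trans IH; rewrite -mulrA ler_wpM2l // -natr1.
  apply: (@le_trans _ _ (7 / 8 * (1 + (i%:R + 1) / 8))); first by rewrite ler_wpM2r //; move: i0; clear; lra.
  by move: i0; clear; lra.
have [i /andP[hi _]] := nat_ceil (ltW (divr_gt0 (ltr0Sn _ 7) e0)).
exists i; rewrite -[leRHS]mulr1; apply: le_trans (ler_wpM2l (ltW e0) (h i)); rewrite mulrCA ler_peMr //.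
  by apply: exprn_ge0; rewrite /ratio divr_ge0 //; move: b96; clear; lra.
move: hi; rewrite ler_pdivrMr // [i%:R * _]mulrC => hi.
by move: hi e0; clear; set u := eps * i%:R => h e0; rewrite mulrDr mulr1 mulrA -/u; lra.
Qed.

Lemma fejer_dst M x : (0 < M)%N -> 1 - fejer M x <= 16 * (M%:R * dst x).
Proof.
by move=> M0; rewrite /dst -{1}[x](subrK (nint x)%:~R) fejer_addint; exact: fejer_center.
Qed.

Lemma dst_dvdn (r m : nat) (x : R) : (r %| m)%N -> dst (m%:R * x) <= m%:R * dst (r%:R * x).
Proof.
move=> rm; have [->|m0] := posnP m; first by rewrite !mul0r -[0]/((0 : int)%:~R) dst_int.
rewrite -{1}(divnK rm) natrM -mulrA; apply: (le_trans (dst_muln _ _)).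
by rewrite ler_wpM2r ?dst_ge0 // ler_nat leq_div.
Qed.

(** A large sum forces a multiplier r <= Q that brings l b / P2 within O(N^(-2)) of an integer after
    multiplication. W = |l| Q! serves every such r at once, and a kernel of length at most N^2 / K
    does not notice an error of order W / N^2. *)
Lemma kernel_major (eta : R) (l : int) (sig : R) : 0 < eta -> eta <= 1 -> l != 0 -> 0 < sig ->
  exists W K : nat, [/\ (0 < W)%N, (0 < K)%N & forall N P1 P2 M1 (a b : int), (K <= N)%N -> (0 < M1)%N -> (M1 * K <= N ^ 2)%N ->
    eta * N%:R <= cn (fsum N (fun=> 1) P1 P2 (l * a) (l * b)) ->
    1 - fejer (2 * M1) (W%:R * (b%:~R / P2%:R)) <= sig].
Proof.
move=> e0 e1 l0 s0; have [C C1 hC] := weyl_inverse.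
have C0 : 0 < C by exact: lt_le_trans C1.
have [Q /andP[hQ _]] := nat_ceil (ltW (divr_gt0 C0 (exprn_gt0 2 e0))).
have [W WE] : exists W, W = (`|l| * Q`!)%N by eexists.
have W0 : (0 < W)%N by rewrite WE muln_gt0 fact_gt0 absz_gt0 l0.
have e4 : 0 < eta ^+ 4 by apply: exprn_gt0.
have [K /andP[hK _]] := @nat_ceil (32 * (W%:R * C) / (sig * eta ^+ 4) + C / eta ^+ 4 + 1) (addr_ge0 (addr_ge0 (divr_ge0 (mulr_ge0 (ler0n _ 32) (mulr_ge0 (ler0n _ W) (ltW C0))) (mulr_ge0 (ltW s0) (ltW e4))) (divr_ge0 (ltW C0) (ltW e4))) ler01).
have u0 : 0 <= 32 * (W%:R * C) / (sig * eta ^+ 4).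
  apply: divr_ge0; last by apply: mulr_ge0; exact: ltW.
  by apply: mulr_ge0 => //; apply: mulr_ge0 => //; exact: ltW.
have v0 : 0 <= C / eta ^+ 4 by rewrite divr_ge0 // ltW.
have K1 : (1 : R) <= K%:R by apply: le_trans hK; rewrite lerDr addr_ge0.
have K2 : C / eta ^+ 4 <= K%:R by apply: le_trans hK; move: u0; set u := _ / (sig * _); set v := C / _; clear; lra.
have K3 : 32 * (W%:R * C) / (sig * eta ^+ 4) <= K%:R by apply: le_trans hK; move: v0; set u := _ / (sig * _); set v := C / _; clear; lra.
have K0 : (0 < K)%N by move: K1; rewrite ler1n.
exists W, K; split => // N P1 P2 M1 a b KN M10 MK hF.
have N0 : (0 < N)%N by exact: leq_trans KN.
have NR : (0 : R) < N%:R by rewrite ltr0n.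
have hq : eta * N%:R <= cn (qsum N ((l * a)%:~R / P1%:R) ((l * b)%:~R / P2%:R)).
  by move: hF; rewrite /fsum /qsum; under eq_bigr => n _ do rewrite mul1r.
have [|r [r0 hr hd]] := hC _ _ _ _ e0 e1 _ hq.
  have h : C <= K%:R * eta ^+ 4 by rewrite -ler_pdivrMr.
  by apply: (le_trans h); rewrite mulrC ler_wpM2l ?(ltW e4) // ler_nat.
have rQ : (r <= Q)%N.
  by rewrite -(ler_nat R); apply: le_trans hQ; rewrite ler_pdivlMr // exprn_gt0.
have rF : (r %| Q`!)%N by apply: dvdn_fact; rewrite r0 rQ.
apply: (le_trans (fejer_dst _ _)); first by rewrite muln_gt0.
have hdW : dst (W%:R * (b%:~R / P2%:R)) <= W%:R * dst (r%:R * ((l * b)%:~R / P2%:R)).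
  have -> : dst (W%:R * (b%:~R / P2%:R)) = dst (Q`!%:R * ((l * b)%:~R / P2%:R)).
    rewrite WE natrM intrM; have [l1|l1] := leP 0 l.
      have -> : l%:~R = `|l|%N%:R :> R by rewrite -{1}(gez0_abs l1).
      by congr dst; ring.
    have -> : l%:~R = - `|l|%N%:R :> R by rewrite -[l]opprK -(ltz0_abs l1) rmorphN abszN abszE.
    by rewrite -[RHS]dstN; congr dst; ring.
  apply: (le_trans (dst_dvdn _ rF)); rewrite ler_wpM2r ?dst_ge0 // ler_nat WE leq_pmull // absz_gt0; exact: l0.
have N2 : 0 < eta ^+ 4 * N%:R ^+ 2 by apply: mulr_gt0 => //; exact: exprn_gt0.
have hd2 : dst (W%:R * (b%:~R / P2%:R)) <= W%:R * (C / (eta ^+ 4 * N%:R ^+ 2)) by apply: (le_trans hdW); apply: ler_wpM2l => //; rewrite ler_pdivlMr.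
have M1R : (0 : R) < (2 * M1)%N%:R by rewrite ltr0n muln_gt0.
apply: (@le_trans _ _ (16 * ((2 * M1)%N%:R * (W%:R * (C / (eta ^+ 4 * N%:R ^+ 2)))))).
  by rewrite ler_wpM2l // ler_wpM2l // ltW.
have MN : M1%:R * K%:R <= N%:R ^+ 2 :> R by rewrite -natrM -natrX ler_nat.
have h5 : 32 * (W%:R * C) <= K%:R * (sig * eta ^+ 4) by rewrite -ler_pdivrMr // mulr_gt0.
rewrite natrM (_ : 16 * _ = 32 * (W%:R * C) * M1%:R / (eta ^+ 4 * N%:R ^+ 2)); last by rewrite !mulrA; congr (_ / _); ring.
rewrite ler_pdivrMr; last exact: N2.
apply: (@le_trans _ _ (K%:R * (sig * eta ^+ 4) * M1%:R)); first by rewrite ler_wpM2r.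
rewrite (_ : K%:R * _ * _ = sig * (eta ^+ 4 * (M1%:R * K%:R))); last by ring.
by rewrite ler_wpM2l ?(ltW s0) // ler_wpM2l // ltW.
Qed.

Definition nsolutions (lam : nat -> int) (s N : nat) : nat :=
  #|[pred v : {ffun 'I_s -> 'I_N} | (lform lam v == 0) && (qform lam v == 0)]|.

(** The kernel-weighted sum is bounded below by counting near solutions. Its difference from the
    true count carries the weight 1 - D: small by [kernel_major] where one chosen factor is large,
    while elsewhere [prod_le_split] and [tail_bound] apply to that factor. *)
Lemma nsolutions_ge (lam : nat -> int) (n : nat) (Lam : R) : (4 <= n)%N -> (forall i, (i < n.+3)%N -> lam i != 0) ->
  (forall k, (k < n.+1)%N -> dcoef lam k != 0) -> 0 < dcoef lam 0 -> dcoef lam n < 0 -> \sum_(i < n.+3) lam i = 0 -> 1 <= Lam ->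
  exists N0 : nat, exists2 c : R, 0 < c & forall N P1 P2, (N0 <= N)%N -> grid_ok Lam N P1 P2 -> adapted lam n.+3 N P1 P2 ->
    c * N%:R ^+ n.+3 <= (P1 * P2)%:R * (nsolutions lam n.+3 N)%:R.
Proof.
move=> n4 lnz dnz d0 dn lsum L1.
have [C1 [c0 [C10 c00 hnear]]] := near_count n4 dnz d0 dn lsum.
have [C2 C21 htail] := tail_bound L1.
have [C3 C31 hfull] := full_moment_bound L1.
have [s sE] : exists s, s = n.+3 by eexists.
have s0 : (0 < s)%N by rewrite sE.
have sR : (0 : R) < s%:R by rewrite ltr0n.
have C30 : 0 < C3 by exact: lt_le_trans C31.
have C20 : 0 < C2 by exact: lt_le_trans C21.
(* Makes the loss ka s C3 from the full moments at most c0 / 64, the factor 1 + c0 ensuring ka <= 1.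
   The level i is then chosen after ka so that the tail of the chosen factor loses no more. *)
have [ka kE] : exists ka : R, ka = c0 / (64 * (1 + c0) * (s%:R * C3)) by eexists.
have sC1 : 1 <= s%:R * C3 by rewrite mulr_ege1 // ler1n.
have ka0 : 0 < ka.
  by rewrite kE divr_gt0 // mulr_gt0 ?mulr_gt0 // addr_gt0.
have kas : ka * (s%:R * C3) <= c0 / 64.
  rewrite kE; move: (s%:R * C3) sC1 => t t1; have t0 : t != 0 by rewrite gt_eqF // (lt_le_trans ltr01).
  have d1 : 1 + c0 != 0 by rewrite gt_eqF // addr_gt0.
  rewrite (_ : c0 / _ * t = c0 / 64 / (1 + c0)); last by field; rewrite t0 d1.
  rewrite ler_pdivrMr ?addr_gt0 // ler_peMr ?lerDl ?(ltW c00) //.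
  by rewrite divr_ge0 // ltW.
have ka1 : ka <= 1.
  rewrite kE ler_pdivrMr ?mulr_gt0 ?addr_gt0 // mul1r; apply: (@le_trans _ _ (64 * (1 + c0) * 1)); first by move: c00; clear; lra.
  by rewrite ler_wpM2l // mulr_ge0 // addr_ge0 // ltW.
have kas0 : 0 < ka ^- s by rewrite invr_gt0; apply: exprn_gt0.
have [i hi] := ratio_small (divr_gt0 c00 (mulr_gt0 (ltr0Sn R 63) (mulr_gt0 kas0 C20))).
have e0 : (0 : R) < 2 ^- i by rewrite invr_gt0; apply: exprn_gt0.
have e1 : (2 ^- i : R) <= 1 by rewrite invf_le1 ?exprn_gt0 //; apply: exprn_ege1; rewrite ler1n.
have [W [K0 [W0 K00 hker]]] := kernel_major e0 e1 (lnz 0%N isT) ka0.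
have [N1 /andP[hN1 _]] := @nat_ceil (C2 * 2 ^+ (60 * i)) (mulr_ge0 (ltW C20) (exprn_ge0 _ (ler0n _ 2))).
have [K KE] : exists K, K = (C1 * W * K0)%N by eexists.
have KK : (0 < K)%N by rewrite KE muln_gt0 K00 muln_gt0 C10 W0.
exists (N1 + 2 * C1 * K + C1 * W)%N; exists (c0 / 2); first by rewrite divr_gt0.
rewrite -sE => N P1 P2 hN ok [a1 a2 acop].
have [N0 P1N P2N PL] := ok.
have NR : (0 : R) < N%:R by rewrite ltr0n.
have p1 : (0 < P1)%N by apply: leq_trans P1N; rewrite muln_gt0.
have p2 : (0 < P2)%N by apply: leq_trans P2N; rewrite muln_gt0 expn_gt0 N0.
have hN2 : (2 * C1 * K <= N)%N by apply: leq_trans hN; rewrite addnAC leq_addl.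
have [M1 M1E] : exists M1, M1 = (N ^ 2 %/ K)%N by eexists.
have MN : (C1 * N <= M1)%N.
  rewrite M1E leq_divRL // mulnAC expnS expn1; apply: leq_mul => //; apply: leq_trans hN2; rewrite leq_mul2r leq_pmull ?orbT //.
have M10 : (0 < M1)%N by apply: leq_trans MN; rewrite muln_gt0 C10.
have MK : (M1 * K <= N ^ 2)%N by rewrite M1E leq_divM.
have near := hnear W N (W * M1)%N W0.
have {}near : c0 * N%:R ^+ n * (W * M1)%N%:R <= W%:R * (near_solutions lam n W (W * M1) N)%:R.
  apply: near; first by apply: leq_trans hN; rewrite leq_addl.
    apply: leq_trans MK; rewrite KE (_ : M1 * _ = C1 * (W * M1) * K0)%N; last by ring.
    by rewrite leq_pmulr.
  by rewrite mulnCA leq_mul2l MN orbT.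
have {}near : c0 * N%:R ^+ n * M1%:R <= (near_solutions lam n W (W * M1) N)%:R.
  have WR : (0 : R) < W%:R by rewrite ltr0n.
  by rewrite -(ler_pM2l WR); apply: le_trans near; rewrite natrM; apply: eq_ler; ring.
have shift := shifted_solutions_ge lam n N P1 P2 W M1.
rewrite -(ler_nat R) natrM -sE in shift.
pose x (j : 'I_s) (p : 'I_P1 * 'I_P2) : R := cn (fsum N (fun=> 1) P1 P2 (lam j * p.1%:Z) (lam j * p.2%:Z)) / N%:R.
pose D (p : 'I_P1 * 'I_P2) := fejer (2 * M1) (W%:R * (p.2%:R / P2%:R)).
have kc := @kernel_count lam s N P1 P2 W (2 * M1) p1 p2.
have cnt := @count_fsum lam s N (fun _ _ => 1) P1 P2 a1 a2.
have cn1 n0 : (n0 < N)%N -> cn (1 : R[i]) <= 1 by rewrite cn1.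
have x0 j p : 0 <= x j p by rewrite divr_ge0 ?cn_ge0.
have x1 j p : x j p <= 1 by rewrite ler_pdivrMr // mul1r fsum_le.
have dil (j : 'I_s) (G : R[i] -> R) : \sum_(p : 'I_P1 * 'I_P2) G (fsum N (fun=> 1) P1 P2 (lam j * p.1%:Z) (lam j * p.2%:Z)) =
    \sum_(p : 'I_P1 * 'I_P2) G (fsum N (fun=> 1) P1 P2 p.1 p.2).
  by have /andP[co1 co2] := acop j; exact: sum_dilate.
have xs j : \sum_p x j p ^+ s <= C3.
  rewrite (dil j (fun z => (cn z / N%:R) ^+ s)).
  under eq_bigr => p _ do rewrite expr_div_n.
  by rewrite -mulr_suml ler_pdivrMr ?exprn_gt0 //; apply: hfull => //; rewrite sE; move: n4; clear; lia.
have j0 : 'I_s by exact: Ordinal s0.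
have [i0 i00] : exists i0 : 'I_s, i0 = 0%N :> nat by exists (Ordinal s0).
have xt : \sum_(p | x i0 p * 2 ^+ i <= 1) x i0 p ^+ s <= c0 / 64 * ka ^+ s.
  apply: (@le_trans _ _ (C2 * ratio ^+ i)); last first.
    move: hi; rewrite ler_pdivlMr; last by rewrite mulr_gt0 // mulr_gt0.
    have kp : 0 < ka ^+ s by apply: exprn_gt0.
    move: (ratio ^+ i : R) (ka ^+ s : R) kp => t u u0 h; have := ler_wpM2r (ltW u0) h.
    rewrite (_ : t * (64 * (u^-1 * C2)) * u = 64 * (C2 * t)); last by field; rewrite gt_eqF.
    by clear; set v := C2 * t; set w := c0 * u; rewrite (_ : c0 / 64 * u = w / 64); [lra|rewrite /w; ring].
  rewrite big_mkcond (dil i0 (fun z => if cn z / N%:R * 2 ^+ i <= 1 then (cn z / N%:R) ^+ s else 0)) -big_mkcond /=.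
  have h2N : C2 * 2 ^+ (60 * i) <= N%:R :> R.
    by apply: (le_trans hN1); rewrite ler_nat; apply: leq_trans hN; rewrite -addnA leq_addr.
  have := htail N P1 P2 i (fun=> 1) ok cn1 h2N => h; apply: le_trans h.
  rewrite (eq_bigl (fun p : 'I_P1 * 'I_P2 => cn (fsum N (fun=> 1) P1 P2 p.1 p.2) * 2 ^+ i <= N%:R)); last first.
    by move=> p; rewrite mulrAC ler_pdivrMr // mul1r.
  apply: ler_sum => p _; apply: ler_wiXn2l; rewrite ?divr_ge0 ?cn_ge0 //.
    by rewrite ler_pdivrMr // mul1r fsum_le.
  by rewrite sE; move: n4; clear; lia.
have D1 p : 0 <= 1 - D p by rewrite subr_ge0 fejer_le1.
have D2 p : 1 - D p <= 1 by rewrite gerBl fejer_ge0.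
have Dk p : 1 < x i0 p * 2 ^+ i -> 1 - D p <= ka.
  move=> h; apply: (hker N P1 P2 M1 p.1%:Z p.2%:Z) => //.
    apply: leq_trans hN2; rewrite KE mulnA leq_pmull // !muln_gt0 W0 C10 //.
    by apply: leq_trans MK; rewrite leq_mul2l KE leq_pmull ?orbT // muln_gt0 C10.
  move: h; rewrite /x i00 mulrAC ltr_pdivlMr // mul1r => h; rewrite mulrC ler_pdivrMr ?exprn_gt0 // ltW //.
have pt p : \prod_j x j p * (1 - D p) <= (if x i0 p * 2 ^+ i <= 1 then ka ^- s * x i0 p ^+ s else 0) + 3 * ka * \sum_j x j p ^+ s.
  have S0 : 0 <= \sum_j x j p ^+ s by apply: sumr_ge0 => j _; exact: exprn_ge0.
  have S1 : x i0 p ^+ s <= \sum_j x j p ^+ s.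
    by rewrite (bigD1 i0) //= lerDl sumr_ge0 // => j _; rewrite exprn_ge0.
  have pr0 : 0 <= \prod_j x j p by apply: prodr_ge0.
  case: (lerP (x i0 p * 2 ^+ i) 1) => h.
    apply: (@le_trans _ _ (\prod_j x j p)); first by rewrite ler_piMr.
    apply: (le_trans (prod_le_split i0 (fun j => x0 j p) ka0 ka1)); rewrite lerD2l ler_wpM2r //.
    by move: ka0; clear; lra.
  rewrite add0r; have h1 := prod_le_split i0 (fun j => x0 j p) ltr01 (lexx 1).
  rewrite expr1n invr1 !mul1r in h1.
  apply: (@le_trans _ _ ((2 * \sum_j x j p ^+ s) * ka)).
    apply: ler_pM => //; last exact: Dk.
    by apply: (le_trans h1); rewrite mulr_natl mulr2n lerD2r.
  rewrite mulrAC ler_wpM2r // ler_wpM2r ?(ltW ka0) // ler_nat //.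
have err : \sum_p \prod_j x j p * (1 - D p) <= c0 / 16.
  apply: (le_trans (ler_sum _ (fun p _ => pt p))); rewrite big_split /= -big_mkcond -!mulr_sumr exchange_big /=.
  have e1' : ka ^- s * \sum_(p | x i0 p * 2 ^+ i <= 1) x i0 p ^+ s <= c0 / 64.
    by rewrite mulrC ler_pdivrMr //; apply: exprn_gt0.
  have e2 : 3 * ka * \sum_j \sum_p x j p ^+ s <= 3 * (c0 / 64).
    rewrite -mulrA ler_wpM2l //; apply: le_trans kas; rewrite ler_wpM2l ?(ltW ka0) // -sum_const_ord.
    by apply: ler_sum => j _; exact: xs.
  apply: (le_trans (lerD e1' e2)); move: c00; clear; lra.
have diff : (2 * M1)%N%:R ^- 2 * (P1 * P2)%:R * #|[pred x0 | @shifted_solutions lam s N P1 P2 W (2 * M1) x0]|%:R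
   - (P1 * P2)%:R * (nsolutions lam s N)%:R <= N%:R ^+ s * \sum_p \prod_j x j p * (1 - D p).
  have -> : \sum_p \prod_j x j p * (1 - D p) = N%:R ^- s * \sum_(p : 'I_P1 * 'I_P2) (\prod_(j < s) cn (fsum N (fun=> 1) P1 P2 (lam j * p.1%:Z) (lam j * p.2%:Z))) * (1 - D p).
    rewrite mulr_sumr; apply: eq_bigr => p _; rewrite mulrA; congr (_ * _).
    by rewrite /x prodf_div prodr_const card_ord mulrC.
  rewrite mulrA divff ?mul1r; last by rewrite gt_eqF //; apply: exprn_gt0.
  set S2 := _ * _ * _; set S1 := _ * _; apply: (le_trans (ler_norm _)).
  have -> : `|S2 - S1| = cn (\sum_(p : 'I_P1 * 'I_P2) (\prod_(j < s) fsum N (fun=> 1) P1 P2 (lam j * p.1%:Z) (lam j * p.2%:Z)) * ((D p)%:C - 1)).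
    rewrite -cn_real; congr cn.
    transitivity (\sum_(p : 'I_P1 * 'I_P2) (\prod_(j < s) fsum N (fun=> 1) P1 P2 (lam j * p.1%:Z) (lam j * p.2%:Z)) * (D p)%:C -
        \sum_(p : 'I_P1 * 'I_P2) \prod_(j < s) fsum N (fun=> 1) P1 P2 (lam j * p.1%:Z) (lam j * p.2%:Z)).
      rewrite cnt kc; apply: etrans (rmorphB _ _ _) _; congr (_ - _).
      rewrite /S1; apply: etrans (realCM _ _) _; rewrite !real_natC; congr (_ * _).
      by rewrite /nsolutions -sum1_card natr_sum; apply: eq_bigr => v _; rewrite big1.
    by rewrite -sumrB; apply: eq_bigr => p _; rewrite mulrBr mulr1.
  apply: (le_trans (cn_sum _ _ _)); apply: ler_sum => p _; rewrite cnM cn_prod ler_wpM2l //.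
    by apply: prodr_ge0 => j _; exact: cn_ge0.
  by rewrite -[1](rmorph1 (real_complex R)) -rmorphB cn_real distrC ger0_norm.
(* 9 = 36 / 4: the grid has at least 36 N^3 points, and the kernel of length 2 M1 is normalised by 4
   M1^2. *)
have low : 9 * c0 * N%:R ^+ s <= (2 * M1)%N%:R ^- 2 * (P1 * P2)%:R * #|[pred x0 | @shifted_solutions lam s N P1 P2 W (2 * M1) x0]|%:R.
  have M1R : (0 : R) < M1%:R by rewrite ltr0n.
  have h1 : M1%:R * (c0 * N%:R ^+ n * M1%:R) <= #|[pred x0 | @shifted_solutions lam s N P1 P2 W (2 * M1) x0]|%:R :> R.
    by apply: le_trans shift; rewrite ler_wpM2l.
  have PP : 36 * N%:R ^+ 3 <= (P1 * P2)%:R :> R.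
    rewrite -natrX -natrM ler_nat (_ : 36 * N ^ 3 = 6 * N * (6 * N ^ 2))%N; last by ring.
    exact: leq_mul.
  have h2 := ler_pM (mulr_ge0 (ler0n _ _) (exprn_ge0 _ (ltW NR))) (mulr_ge0 (ltW M1R) (mulr_ge0 (mulr_ge0 (ltW c00) (exprn_ge0 _ (ltW NR))) (ltW M1R))) PP h1.
  rewrite -[leRHS]mulrA [leRHS]mulrC ler_pdivlMr; last by apply: exprn_gt0; rewrite ltr0n muln_gt0.
  apply: le_trans h2; rewrite sE natrM; apply: eq_ler; rewrite -[n.+3]addn3 exprD.
  move: (N%:R ^+ n) (N%:R ^+ 3) => u v; ring.
have NS0 : 0 < N%:R ^+ s :> R by apply: exprn_gt0.
move: low diff err NS0 c00.
set S2 := _ ^- 2 * _ * _; set T1 := _ * (nsolutions _ _ _)%:R; set E1 := \sum_p _; set NS := N%:R ^+ s; move: S2 T1 E1 NS.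
clear; move=> S2 T1 E1 NS low diff err NS0 c00.
have := ler_wpM2l (ltW NS0) err; have := mulr_gt0 c00 NS0; move: low diff.
rewrite (_ : 9 * c0 * NS = 9 * (c0 * NS)); last by ring.
rewrite (_ : NS * (c0 / 16) = c0 * NS / 16); last by ring.
rewrite (_ : c0 / 2 * NS = c0 * NS / 2); last by ring.
move: (c0 * NS : R) (NS * E1 : R) => u v; clear; lra.
Qed.

(** * Sets without non-trivial solutions *)

Lemma nat_sqrt_ceil (N : nat) : (0 < N)%N -> exists T, [/\ (0 < T)%N, (N <= T ^ 2)%N & (T ^ 2 <= 4 * N)%N].
Proof.
move=> N0; have ex : exists T, (N <= T ^ 2)%N.
  by exists N; rewrite expnS expn1 leq_pmulr.
case: (ex_minnP ex) => T hT minT; exists T.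
have T0 : (0 < T)%N by case: T hT {minT} => //; rewrite leqNgt N0.
split=> //; case: T T0 hT minT => // t _ _ minT.
have : ~~ (N <= t ^ 2)%N by apply/negP => /minT; rewrite ltnn.
rewrite -ltnNge => ht; have [->|t0] := posnP t; first by rewrite exp1n muln_gt0.
apply: (@leq_trans (4 * t ^ 2)%N); last by rewrite leq_mul2l ltnW.
by move: t0; rewrite !expnS !expn0; clear; nia.
Qed.

(** For x in units of N, x^5 <= T x^6 + T^(-5) with T about sqrt N: the sixth moment and the number
    of grid points give about sqrt N each, and the divisor loss is at most N^(1/4). Any exponent
    below 1 would do. *)
Lemma fifth_moment (Lam : R) : 1 <= Lam -> exists2 C : R, 1 <= C & forall (N P1 P2 : nat) (g : nat -> R[i]),
  grid_ok Lam N P1 P2 -> (forall n, (n < N)%N -> cn (g n) <= 1) ->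
  (\sum_(p : 'I_P1 * 'I_P2) (cn (fsum N g P1 P2 p.1 p.2) / N%:R) ^+ 5) ^+ 4 <= C * N%:R ^+ 3.
Proof.
move=> L1; have [C0 C01 hJ] := @J3_bound 4 isT.
have L0 : 0 < Lam by exact: lt_le_trans L1.
exists (Lam ^+ 4 * (8 * (256 * C0 + 1))).
  by rewrite mulr_ege1 ?exprn_ege1 //; move: C01; clear; lra.
move=> N P1 P2 g [N0 P1N P2N PL] g1; have NR : (0 : R) < N%:R by rewrite ltr0n.
have [T [T0 TN NT]] := nat_sqrt_ceil N0.
have TR : (0 : R) < T%:R by rewrite ltr0n.
have T2 : N%:R <= T%:R ^+ 2 :> R by rewrite -natrX ler_nat.
have T4 : T%:R ^+ 2 <= 4 * N%:R :> R by rewrite -natrX -natrM ler_nat.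
pose x (p : 'I_P1 * 'I_P2) : R := cn (fsum N g P1 P2 p.1 p.2) / N%:R.
have x0 p : 0 <= x p by rewrite divr_ge0 ?cn_ge0.
have [J JE] : exists J : R, J = (J3 N)%:R / N%:R ^+ 3 by eexists.
have J0 : 0 <= J by rewrite JE divr_ge0 // exprn_ge0.
have hJ4 : J ^+ 4 <= C0 * N%:R by rewrite JE; exact: hJ.
have s6 : \sum_p x p ^+ 6 <= Lam * J.
  have h := @sixth_moment N g P1 P2 g1 (leq_trans (leq_mul (isT : (3 <= 6)%N) (leqnn N)) P1N) (leq_trans (leq_mul (isT : (3 <= 6)%N) (leqnn (N ^ 2))) P2N) N0.
  rewrite -(pair_grid P1 P2 (fun a b => cn (fsum N g P1 P2 a b) ^+ 6)) in h.
  rewrite /x; under eq_bigr => p _ do rewrite expr_div_n.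
  rewrite -mulr_suml ler_pdivrMr; last by apply: exprn_gt0.
  apply: (le_trans h); rewrite JE.
  have N3 : 0 < N%:R ^+ 3 :> R by apply: exprn_gt0.
  rewrite (_ : Lam * _ * _ = Lam * N%:R ^+ 3 * (J3 N)%:R); first by rewrite ler_wpM2r.
  by move: (J3 N)%:R => t; field; rewrite gt_eqF.
have pt p : x p ^+ 5 <= T%:R * x p ^+ 6 + T%:R ^- 5.
  have T5 : 0 <= T%:R ^- 5 :> R by rewrite invr_ge0 exprn_ge0.
  have [h|h] := lerP 1 (T%:R * x p).
    rewrite [x p ^+ 6]exprS mulrA -[leLHS]addr0 lerD // ler_peMl // exprn_ge0 //.
  rewrite -[leLHS]add0r; apply: lerD; first by apply: mulr_ge0 => //; apply: exprn_ge0.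
  by rewrite -exprVn lerXn2r ?nnegrE ?invr_ge0 // -div1r ler_pdivlMr // mulrC ltW.
have sum5 : \sum_p x p ^+ 5 <= Lam * (N%:R / T%:R) * (4 * J + 1).
  apply: (le_trans (ler_sum _ (fun p _ => pt p))); rewrite big_split /= -mulr_sumr sumr_const card_prod !card_ord -[X in _ + X]mulr_natr.
  rewrite mulrDr mulr1 [Lam * _ * (4 * J)]mulrC; apply: lerD.
    apply: (@le_trans _ _ (T%:R * (Lam * J))); first by rewrite ler_wpM2l.
    rewrite (_ : 4 * J * _ = (4 * N%:R / T%:R) * (Lam * J)); last by ring.
    by rewrite ler_wpM2r ?mulr_ge0 ?(ltW L0) // ler_pdivlMr // -expr2.
  rewrite mulrC ler_pdivrMr; last by apply: exprn_gt0.
  apply: (le_trans PL); rewrite (_ : _ * T%:R ^+ 5 = Lam * (N%:R * (T%:R ^+ 2 * T%:R ^+ 2))); last first.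
    by field; rewrite gt_eqF.
  by rewrite ler_wpM2l ?(ltW L0) // exprS ler_wpM2l // expr2 ler_pM.
have S0 : 0 <= \sum_p x p ^+ 5 by apply: sumr_ge0 => p _; exact: exprn_ge0.
have NT0 : 0 <= N%:R / T%:R :> R by rewrite divr_ge0.
apply: (@le_trans _ _ ((Lam * (N%:R / T%:R) * (4 * J + 1)) ^+ 4)).
  by rewrite lerXn2r // nnegrE (le_trans S0).
rewrite (exprMn 4 (Lam * (N%:R / T%:R))) (exprMn 4 Lam).
have h1 : (N%:R / T%:R) ^+ 4 <= N%:R ^+ 2 :> R.
  rewrite expr_div_n ler_pdivrMr; last by apply: exprn_gt0.
  rewrite -[4%N]/((2 + 2)%N) !exprD; apply: ler_wpM2l; first exact: sqr_ge0.
  by rewrite expr2 ler_pM.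
have h2 : (4 * J + 1) ^+ 4 <= 8 * (256 * C0 + 1) * N%:R.
  apply: (@le_trans _ _ (8 * (256 * J ^+ 4 + 1))).
    move: J0; clear; move=> J0; rewrite -subr_ge0.
    have -> : 8 * (256 * J ^+ 4 + 1) - (4 * J + 1) ^+ 4 = (4 * J - 1) ^+ 2 * (7 * (4 * J) ^+ 2 + 10 * (4 * J) + 7) by ring.
    by rewrite mulr_ge0 ?sqr_ge0 // !addr_ge0 ?mulr_ge0.
  have N1 : 1 <= N%:R :> R by rewrite ler1n.
  move: hJ4 N1; move: (J ^+ 4 : R) (N%:R : R) => t u; clear => h u1.
  by rewrite (_ : 8 * (256 * C0 + 1) * u = 8 * (256 * (C0 * u) + u)); [move: h u1; set w := C0 * u; clear; lra|ring].
rewrite (_ : _ * N%:R ^+ 3 = Lam ^+ 4 * N%:R ^+ 2 * (8 * (256 * C0 + 1) * N%:R)); last by ring.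
apply: ler_pM => //; first by apply: mulr_ge0; apply: exprn_ge0 => //; exact: ltW.
  by rewrite exprn_ge0 // addr_ge0 // mulr_ge0.
by rewrite ler_wpM2l // exprn_ge0 // ltW.
Qed.

Definition degenerate (lam : nat -> int) (s N : nat) : nat :=
  #|[pred v : {ffun 'I_s -> 'I_N} | (lform lam v == 0) && (qform lam v == 0) && ~~ injectiveb v]|.

Lemma prod_others_le (s : nat) (x : 'I_s -> R) (i j : 'I_s) : (7 <= s)%N -> i != j -> (forall k, 0 <= x k <= 1) ->
  \prod_(k | (k != i) && (k != j)) x k <= \sum_k x k ^+ 5.
Proof.
move=> s7 ij hx; have x0 k : 0 <= x k by case/andP: (hx k).
have card2 : #|[pred k | (k != i) && (k != j)]| = s.-2.
  have := cardC [set i; j]; rewrite card_ord cards2 ij => h.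
  have -> : #|[pred k | (k != i) && (k != j)]| = #|[predC [set i; j]]|.
    by apply: eq_card => k; rewrite !inE negb_or.
  by move: h; clear; lia.
have [k0 hk0] : exists k0, (k0 != i) && (k0 != j).
  by apply/existsP; rewrite -[X in is_true X]negbK; apply/negP => /existsPn h; move: card2; rewrite eq_card0 => [|k]; [move: s7; clear; lia|rewrite !inE; exact/negbTE].
have [m hm1 hm] := @arg_maxP _ R _ k0 (fun k => (k != i) && (k != j)) x hk0.
apply: (@le_trans _ _ (x m ^+ s.-2)).
  by rewrite -card2 -prodr_const; apply: ler_prod => k hk; rewrite x0; exact: hm.
apply: (@le_trans _ _ (x m ^+ 5)).
  by apply: ler_wiXn2l; rewrite ?x0 //; [case/andP: (hx m)|move: s7; clear; lia].
by rewrite (bigD1 m) //= lerDl sumr_ge0 // => k _; rewrite exprn_ge0.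
Qed.

(** For fixed i, j and common value t the factors i and j are single exponentials of modulus 1, and
    the remaining s - 2 >= 5 factors are bounded through the fifth moment. Summation over t leaves
    N^(s - 1) times N^(3/4), smaller than the expected order by N^(1/4). *)
Lemma degenerate_le (lam : nat -> int) (s : nat) (Lam : R) : (7 <= s)%N -> 1 <= Lam ->
  exists2 C : R, 1 <= C & forall N P1 P2, grid_ok Lam N P1 P2 -> adapted lam s N P1 P2 ->
    ((P1 * P2)%:R * (degenerate lam s N)%:R / N%:R ^+ s) ^+ 4 * N%:R <= C.
Proof.
move=> s7 L1; have [C C1 hC] := fifth_moment L1.
have s1 : (1 : R) <= (s * s * s)%N%:R by rewrite ler1n !muln_gt0; move: s7; case: (s).
exists ((s * s * s)%N%:R ^+ 4 * C); first by rewrite mulr_ege1 // exprn_ege1.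
move=> N P1 P2 ok [a1 a2 acop]; have [N0 P1N P2N PL] := ok.
have NR : (0 : R) < N%:R by rewrite ltr0n.
have p1 : (0 < P1)%N by apply: leq_trans P1N; rewrite muln_gt0.
have p2 : (0 < P2)%N by apply: leq_trans P2N; rewrite muln_gt0 expn_gt0 N0.
have [E EE] : exists E : R, E = \sum_(p : 'I_P1 * 'I_P2) (cn (fsum N (fun=> 1) P1 P2 p.1 p.2) / N%:R) ^+ 5 by eexists.
have hE := hC N P1 P2 (fun=> 1) ok (fun n _ => eq_ler cn1); rewrite -EE in hE.
have E0 : 0 <= E by rewrite EE sumr_ge0 // => p _; rewrite exprn_ge0 // divr_ge0 ?cn_ge0.
pose x (k : 'I_s) (p : 'I_P1 * 'I_P2) : R := cn (fsum N (fun=> 1) P1 P2 (lam k * p.1%:Z) (lam k * p.2%:Z)) / N%:R.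
have hx p k : 0 <= x k p <= 1.
  rewrite divr_ge0 ?cn_ge0 //= ler_pdivrMr // mul1r fsum_le // => n _.
  by rewrite cn1.
have x5 k : \sum_p x k p ^+ 5 = E.
  have /andP[co1 co2] := acop k.
  by rewrite /x (@sum_dilate _ (lam k) P1 P2 N (fun=> 1) (fun z => (cn z / N%:R) ^+ 5)) // EE.
have one (i j : 'I_s) (t : 'I_N) : i != j ->
   (P1 * P2)%:R * #|[pred v : {ffun 'I_s -> 'I_N} | (lform lam v == 0) && (qform lam v == 0) && ((v i == t) && (v j == t))]|%:R <= s%:R * (N%:R ^+ s.-2 * E).
  (* These weights pin the coordinates i and j to the value t and leave the others free. *)
  move=> ij; pose g (k n : nat) : R[i] := if ((k == i) || (k == j)) && (n != t) then 0 else 1.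
  have cnt := @count_fsum lam s N g P1 P2 a1 a2.
  have hv : \sum_(v : {ffun 'I_s -> 'I_N} | (lform lam v == 0) && (qform lam v == 0)) \prod_(k < s) g k (v k) =
     (#|[pred v : {ffun 'I_s -> 'I_N} | (lform lam v == 0) && (qform lam v == 0) && ((v i == t) && (v j == t))]|%:R : R[i]).
    rewrite -sum1_card natr_sum [LHS]big_mkcond [RHS]big_mkcond; apply: eq_bigr => v _; rewrite inE.
    case: (_ && _) => //=; case: ifP => [/andP[/eqP vi /eqP vj]|hn].
      apply: big1 => k _; rewrite /g; case: ifP => // /andP[/orP[] /eqP/val_inj ->]; by rewrite ?vi ?vj eqxx.
    have [k hk] : exists k : 'I_s, ((k == i :> nat) || (k == j :> nat)) && (v k != t :> nat).
      move/negbT: hn; rewrite negb_and => /orP[] h; [exists i|exists j]; rewrite eqxx ?orbT /=; exact: h.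
    by rewrite (bigD1 k) //= /g hk mul0r.
  rewrite hv in cnt; rewrite -[leLHS]ger0_norm ?mulr_ge0 // -cn_real realCM !real_natC -cnt.
  apply: (le_trans (cn_sum _ _ _)).
  have -> : s%:R * (N%:R ^+ s.-2 * E) = \sum_(p : 'I_P1 * 'I_P2) N%:R ^+ s.-2 * \sum_k x k p ^+ 5.
    rewrite -mulr_sumr exchange_big /= (eq_bigr (fun=> E)) => [|k _]; last exact: x5.
    by rewrite sum_const_ord mulrCA.
  apply: ler_sum => p _; rewrite cn_prod (bigD1 i) // (bigD1 j) /=; last by rewrite eq_sym.
  have g1 k : k = i \/ k = j -> cn (fsum N (g k) P1 P2 (lam k * p.1%:Z) (lam k * p.2%:Z)) <= 1.
    move=> hk; rewrite /fsum (bigD1 t) //= big1 => [|n nt].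
      rewrite addr0 cnM cn_e mulr1 /g eqxx andbF cn1 //.
    have kij : (k == i :> nat) || (k == j :> nat) by case: hk => ->; rewrite eqxx ?orbT.
    have nt' : n != t :> nat by exact: nt.
    by rewrite /g kij nt' mul0r.
  have gk k : cn (fsum N (g k) P1 P2 (lam k * p.1%:Z) (lam k * p.2%:Z)) >= 0 by exact: cn_ge0.
  have pr : \prod_(k < s | (k != i) && (k != j)) cn (fsum N (g k) P1 P2 (lam k * p.1%:Z) (lam k * p.2%:Z)) <= N%:R ^+ s.-2 * \sum_k x k p ^+ 5.
    have card2 : #|[pred k : 'I_s | (k != i) && (k != j)]| = s.-2.
      have := cardC [set i; j]; rewrite card_ord cards2 ij => h.
      have -> : #|[pred k | (k != i) && (k != j)]| = #|[predC [set i; j]]|.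
        by apply: eq_card => k; rewrite !inE negb_or.
      by move: h; clear; lia.
    apply: le_trans (ler_wpM2l (exprn_ge0 _ (ltW NR)) (prod_others_le s7 ij (hx p))).
    rewrite -card2 -prodr_const -big_split /=; apply: ler_prod => k /andP[ki kj]; rewrite gk /=.
    rewrite /x [leRHS]mulrC divfK ?gt_eqF // /fsum; apply: eq_ler; congr cn; apply: eq_bigr => n _.
    by rewrite /g !(inj_eq val_inj) (negbTE ki) (negbTE kj).
  apply: le_trans pr; rewrite mulrA ler_piMl //.
    by apply: prodr_ge0 => k _.
  by rewrite mulr_ile1 ?gk //; apply: g1; [left|right].
have all : (P1 * P2)%:R * (degenerate lam s N)%:R <= (s * s * s)%N%:R * (N%:R ^+ s.-1 * E).
  have cover : ((degenerate lam s N) <= \sum_(i < s) \sum_(j < s) \sum_(t < N)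
      (if i != j then #|[pred v : {ffun 'I_s -> 'I_N} | (lform lam v == 0%R) && (qform lam v == 0%R) && ((v i == t) && (v j == t))]| else 0))%N.
    rewrite /degenerate -sum1_card big_mkcond /=.
    have -> : (\sum_(i < s) \sum_(j < s) \sum_(t < N)
      (if i != j then #|[pred v : {ffun 'I_s -> 'I_N} | (lform lam v == 0%R) && (qform lam v == 0%R) && ((v i == t) && (v j == t))]| else 0) =
       \sum_(v : {ffun 'I_s -> 'I_N}) \sum_(i < s) \sum_(j < s) \sum_(t < N) (if (i != j) && ((lform lam v == 0%R) && (qform lam v == 0%R) && ((v i == t) && (v j == t))) then 1 else 0))%N.
      rewrite [RHS]exchange_big; apply: eq_bigr => i _; rewrite [RHS]exchange_big; apply: eq_bigr => j _.
      rewrite [RHS]exchange_big; apply: eq_bigr => t _; case: (i != j) => /=; last by rewrite big1.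
      by rewrite -sum1_card big_mkcond.
    apply: leq_sum => v _; case: ifP => //; rewrite inE => /andP[hv /injectivePn[i [j ij vij]]].
    rewrite (bigD1 i) //= (bigD1 j) //= (bigD1 (v i)) //= ij hv vij eqxx /=.
    by rewrite -!addnA leq_addr.
  have PP0 : (0 : R) <= (P1 * P2)%:R by [].
  apply: (@le_trans _ _ (\sum_(i < s) \sum_(j < s) \sum_(t < N) s%:R * (N%:R ^+ s.-2 * E))); last first.
    rewrite !sum_const_ord !natrM (_ : s.-1 = s.-2.+1) ?exprS; last by move: s7; clear; lia.
    by apply: eq_ler; ring.
  apply: (@le_trans _ _ ((P1 * P2)%:R * (\sum_(i < s) \sum_(j < s) \sum_(t < N)
      (if i != j then #|[pred v : {ffun 'I_s -> 'I_N} | (lform lam v == 0%R) && (qform lam v == 0%R) && ((v i == t) && (v j == t))]| else 0))%N%:R)).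
    by rewrite ler_wpM2l // ler_nat.
  rewrite natr_sum mulr_sumr; apply: ler_sum => i _; rewrite natr_sum mulr_sumr; apply: ler_sum => j _.
  rewrite natr_sum mulr_sumr; apply: ler_sum => t _; case: ifP => ij; first exact: one.
  by rewrite mulr0 mulr_ge0 // mulr_ge0 // exprn_ge0.
have NS : 0 < N%:R ^+ s :> R by apply: exprn_gt0.
have bnd : (P1 * P2)%:R * (degenerate lam s N)%:R / N%:R ^+ s <= (s * s * s)%N%:R * (E / N%:R).
  rewrite ler_pdivrMr //; apply: (le_trans all).
  rewrite (_ : s = s.-1.+1) /=; last by move: s7; clear; lia.
  by rewrite [N%:R ^+ _.+1]exprS; move: (_ %:R : R) (N%:R ^+ s.-1 : R) => u w; apply: eq_ler; field; rewrite gt_eqF.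
have q0 : 0 <= (P1 * P2)%:R * (degenerate lam s N)%:R / N%:R ^+ s :> R.
  by rewrite divr_ge0 ?mulr_ge0 // ltW.
apply: (@le_trans _ _ (((s * s * s)%N%:R * (E / N%:R)) ^+ 4 * N%:R)).
  by rewrite ler_wpM2r // lerXn2r // nnegrE (le_trans q0).
rewrite exprMn -mulrA ler_wpM2l ?exprn_ge0 // expr_div_n -mulrA.
have -> : N%:R ^- 4 * N%:R = N%:R ^- 3 :> R by field; rewrite gt_eqF.
by rewrite ler_pdivrMr //; apply: exprn_gt0.
Qed.

(** The difference expands over nonempty sets J of indices carrying w. Each such product has a
    factor w i0, to which [prod_le_split] gives the distinguished role; there are at most 2^s
    sets. *)
Lemma product_difference (s : nat) (u w : 'I_s -> R[i]) (ka : R) : 0 < ka -> ka <= 1 ->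
  cn (\prod_i (u i + w i) - \prod_i u i) <=
  2 ^+ s * (2 * ka ^- s * \sum_i cn (w i) ^+ s + ka * \sum_i cn (u i) ^+ s).
Proof.
move=> k0 k1; have ks : 1 <= ka ^- s.
  by rewrite invf_ge1; [apply: exprn_ile1 => //; exact: ltW|apply: exprn_gt0].
have X0 (v : 'I_s -> R[i]) : 0 <= \sum_i cn (v i) ^+ s by apply: sumr_ge0 => i _; rewrite exprn_ge0 ?cn_ge0.
under eq_bigr => i _ do rewrite addrC.
rewrite bigA_distr (bigD1 set0) ?inE //= [X in X + _ - _](_ : _ = \prod_i u i); last first.
  by apply: eq_bigr => i _; rewrite inE.
rewrite [X in cn (X - _)]addrC addrK; apply: (le_trans (cn_sum _ _ _)).
set bd := 2 * _ * _ + _; have bd0 : 0 <= bd.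
  by rewrite addr_ge0 // mulr_ge0 ?(ltW k0) // mulr_ge0 // (le_trans ler01).
have h (J : {set 'I_s}) : J != set0 -> cn (\prod_i (if i \in J then w i else u i)) <= bd.
  move=> /set0Pn[i0 i0J]; rewrite cn_prod.
  apply: (le_trans (@prod_le_split s (fun i => cn (if i \in J then w i else u i)) i0 ka (fun i => cn_ge0 _) k0 k1)).
  rewrite i0J; have h1 : cn (w i0) ^+ s <= \sum_i cn (w i) ^+ s.
    by rewrite (bigD1 i0) //= lerDl sumr_ge0 // => i _; rewrite exprn_ge0 ?cn_ge0.
  have h2 : \sum_i cn (if i \in J then w i else u i) ^+ s <= \sum_i cn (w i) ^+ s + \sum_i cn (u i) ^+ s.
    rewrite -big_split /=; apply: ler_sum => i _; case: ifP => _; first by rewrite lerDl exprn_ge0 ?cn_ge0.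
    by rewrite lerDr exprn_ge0 ?cn_ge0.
  have h3 := ler_wpM2l (le_trans ler01 ks) h1; have h4 := ler_wpM2l (ltW k0) h2.
  have h5 : ka * \sum_i cn (w i) ^+ s <= ka ^- s * \sum_i cn (w i) ^+ s by rewrite ler_wpM2r // (le_trans k1).
  move: h3 h4 h5; rewrite /bd mulrDr -[2 * _ * _]mulrA.
  move: (ka ^- s * cn (w i0) ^+ s : R) (ka ^- s * \sum_i cn (w i) ^+ s : R) (ka * \sum_i cn (w i) ^+ s : R) (ka * \sum_i cn (u i) ^+ s : R) (ka * \sum_i cn (if i \in J then w i else u i) ^+ s : R).
  clear; move=> *; lra.
apply: (@le_trans _ _ (\sum_(J : {set 'I_s}) bd)).
  rewrite [leLHS]big_mkcond /=; apply: ler_sum => J _; case: ifP => // hJ; exact: h.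
rewrite sumr_const (_ : #|{set 'I_s}| = 2 ^ s)%N; last by rewrite -cardsT -powersetT card_powerset cardsT card_ord.
by rewrite -[leLHS]mulr_natl natrX.
Qed.

Definition sol_free (lam : nat -> int) (s : nat) (A : pred nat) (N : nat) : Prop :=
  forall v : {ffun 'I_s -> 'I_N}, lform lam v = 0 -> qform lam v = 0 -> (forall i, A (v i)) -> ~ injective v.

Lemma cn_balanced_le1 A N n : cn (balanced A N n) <= 1.
Proof.
rewrite /balanced cn_real ler_norml; have := dens_ge0 A N; have := dens_le1 A N.
by rewrite /indic; case: (A n) => h1 h2; apply/andP; split; move: h1 h2; clear; lra.
Qed.

(** Here u belongs to the constant density and w to the balanced function. The products of u + w
    count solutions in A, hence only degenerate ones, while those of u give at least c (de N)^s. In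
    the difference the u terms are absorbed by the full moment bound with ka small, and the w terms
    must be large. *)
Lemma balanced_large (lam : nat -> int) (n : nat) (Lam : R) : (4 <= n)%N -> (forall i, (i < n.+3)%N -> lam i != 0) ->
  (forall k, (k < n.+1)%N -> dcoef lam k != 0) -> 0 < dcoef lam 0 -> dcoef lam n < 0 -> \sum_(i < n.+3) lam i = 0 -> 1 <= Lam ->
  exists C : R, exists2 c : R, 0 < c & forall N P1 P2 A, grid_ok Lam N P1 P2 -> adapted lam n.+3 N P1 P2 ->
    sol_free lam n.+3 A N -> 0 < dens A N -> C <= dens A N ^+ (4 * n.+3) * N%:R ->
    c * (dens A N * N%:R) ^+ n.+3 <= \sum_(p : 'I_P1 * 'I_P2) cn (fsum N (balanced A N) P1 P2 p.1 p.2) ^+ n.+3.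
Proof.
move=> n4 lnz dnz d0 dn lsum L1.
have [N1 [c c0 hns]] := nsolutions_ge n4 lnz dnz d0 dn lsum L1.
have [s sE] : exists s, s = n.+3 by eexists.
have s7 : (7 <= s)%N by rewrite sE; move: n4; clear; lia.
rewrite -sE in hns *.
have [C1 C11 hdeg] := degenerate_le lam s7 L1.
have [C3 C31 hfull] := full_moment_bound L1.
have sR : (1 : R) <= s%:R by rewrite ler1n; move: s7; clear; lia.
have C30 : 0 < C3 by exact: lt_le_trans C31.
have sC1 : 1 <= 2 ^+ s * (s%:R * C3) :> R by rewrite mulr_ege1 ?mulr_ege1 //; apply: exprn_ege1; rewrite ler1n.
have [ka kE] : exists ka : R, ka = c / (4 * (1 + c)) / (2 ^+ s * (s%:R * C3)) by eexists.
have tt0 : 0 < 2 ^+ s * (s%:R * C3) :> R by exact: lt_le_trans sC1.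
have r0 : 0 < c / (4 * (1 + c)) by rewrite divr_gt0 // mulr_gt0 // addr_gt0.
have ka0 : 0 < ka by rewrite kE divr_gt0.
have r1 : c / (4 * (1 + c)) <= 1.
  by rewrite ler_pdivrMr ?mul1r; [move: c0; clear; lra|rewrite mulr_gt0 // addr_gt0].
have ka1 : ka <= 1.
  by rewrite kE ler_pdivrMr // mul1r (le_trans r1).
have kas : 2 ^+ s * (ka * (s%:R * C3)) <= c / 4.
  rewrite kE mulrCA divfK; last by rewrite gt_eqF.
  rewrite ler_pdivrMr; last by rewrite mulr_gt0 // addr_gt0.
  rewrite -subr_ge0 (_ : _ - c = c * c); last by field.
  by rewrite mulr_ge0 // ltW.
have ks0 : 0 < ka ^- s by rewrite invr_gt0; apply: exprn_gt0.
have c40 : 0 < (c / 4) ^+ 4 by apply: exprn_gt0; rewrite divr_gt0.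
(* The second summand keeps the degenerate solutions below a quarter of the main term, which is why
   de^(4 s) N has to be large. *)
exists (N1%:R + (C1 + 1) / (c / 4) ^+ 4), (c / 2 / (2 ^+ s * (2 * ka ^- s * s%:R))).
  have sR0 : (0 : R) < s%:R by exact: lt_le_trans sR.
  by rewrite divr_gt0 ?divr_gt0 // mulr_gt0 ?exprn_gt0 // mulr_gt0 // mulr_gt0.
move=> N P1 P2 A ok ad free de0 hN.
have [N0 P1N P2N PL] := ok; have [a1 a2 acop] := ad.
have NR : (0 : R) < N%:R by rewrite ltr0n.
have p1 : (0 < P1)%N by apply: leq_trans P1N; rewrite muln_gt0.
have p2 : (0 < P2)%N by apply: leq_trans P2N; rewrite muln_gt0 expn_gt0 N0.
have [de deE] : exists de, de = dens A N by eexists.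
rewrite -deE in de0 hN *.
have de1 : de <= 1 by rewrite deE dens_le1.
have C40 : 0 <= (C1 + 1) / (c / 4) ^+ 4 by rewrite divr_ge0 ?(ltW c40) // addr_ge0 // (le_trans ler01).
have hN1 : (N1 <= N)%N.
  rewrite -(ler_nat R); apply: (@le_trans _ _ (de ^+ (4 * s) * N%:R)); first by apply: le_trans hN; rewrite lerDl.
  by rewrite ler_piMl // exprn_ile1 // ltW.
have main := hns N P1 P2 hN1 ok ad.
have deg := hdeg N P1 P2 ok ad.
have ds0 : 0 < de ^+ s by apply: exprn_gt0.
have NS : 0 < N%:R ^+ s :> R by apply: exprn_gt0.
have deg2 : (P1 * P2)%:R * (degenerate lam s N)%:R <= c / 4 * (de ^+ s * N%:R ^+ s).
  rewrite mulrA -ler_pdivrMr // leNgt; apply/negP => hlt.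
  have h4 : (c / 4 * de ^+ s) ^+ 4 * N%:R <= C1.
    apply: le_trans deg; rewrite ler_wpM2r // lerXn2r ?nnegrE ?(ltW hlt) //; first by rewrite mulr_ge0 ?(ltW ds0) // divr_ge0 // ltW.
    by rewrite (le_trans _ (ltW hlt)) // mulr_ge0 ?(ltW ds0) // divr_ge0 // ltW.
  have : (C1 + 1) / (c / 4) ^+ 4 <= de ^+ (4 * s) * N%:R by apply: le_trans hN; rewrite lerDr.
  rewrite ler_pdivrMr // mulnC exprM => h5.
  move: h4; rewrite exprMn (_ : _ * N%:R = (de ^+ s) ^+ 4 * N%:R * (c / 4) ^+ 4); last by ring.
  by move=> h4; have := le_trans h5 h4; clear; lra.
pose u (i : 'I_s) (p : 'I_P1 * 'I_P2) : R[i] := fsum N (fun=> de%:C) P1 P2 (lam i * p.1%:Z) (lam i * p.2%:Z).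
pose w (i : 'I_s) (p : 'I_P1 * 'I_P2) : R[i] := fsum N (balanced A N) P1 P2 (lam i * p.1%:Z) (lam i * p.2%:Z).
have uw i p : u i p + w i p = fsum N (fun n => (indic A n)%:C) P1 P2 (lam i * p.1%:Z) (lam i * p.2%:Z).
  rewrite /u /w /fsum -big_split /=; apply: eq_bigr => m _; rewrite -mulrDl; congr (_ * _).
  by rewrite /balanced -deE -rmorphD /= addrC subrK.
have cuw := @count_fsum lam s N (fun _ n => (indic A n)%:C) P1 P2 a1 a2.
have cu := @count_fsum lam s N (fun _ _ => de%:C) P1 P2 a1 a2.
have Suw : cn (\sum_p \prod_i (u i p + w i p)) <= c / 4 * (de ^+ s * N%:R ^+ s).
  under eq_bigr => p _ do under eq_bigr => i _ do rewrite uw.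
  rewrite cuw cnM cn_nat; apply: le_trans deg2; rewrite ler_wpM2l //; apply: (le_trans (cn_sum _ _ _)).
  rewrite /degenerate -sum1_card natr_sum [leLHS]big_mkcond [leRHS]big_mkcond; apply: ler_sum => v _; rewrite inE.
  case: ifP => [/andP[/eqP hl /eqP hq]|_] //=.
  have [/injectiveP inj|ninj] /= := boolP (injectiveb v).
    have [/forallP al|/forallPn[i nai]] := boolP [forall i, A (v i)]; first by have := free v hl hq al inj.
    by rewrite (bigD1 i) //= /indic (negbTE nai) mul0r cn0.
  rewrite cn_prod; apply: prodr_ile1 => i _; apply/andP; split; first exact: cn_ge0.
  by rewrite cn_real /indic; case: ifP => _; rewrite ?normr1 ?normr0 ?ler01.
have Su : de ^+ s * (c * N%:R ^+ s) <= cn (\sum_p \prod_i u i p).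
  rewrite cu cnM cn_nat; apply: (le_trans (ler_wpM2l (ltW ds0) main)); rewrite mulrCA ler_wpM2l //.
  rewrite (eq_bigr (fun=> (de ^+ s)%:C)) => [|v _]; last by rewrite prodr_const card_ord rmorphXn.
  have -> : \sum_(v : {ffun 'I_s -> 'I_N} | (lform lam v == 0) && (qform lam v == 0)) (de ^+ s)%:C = (de ^+ s)%:C * (nsolutions lam s N)%:R.
    by rewrite /nsolutions -sum1_card natr_sum mulr_sumr; apply: eq_big => v; rewrite ?inE ?mulr1.
  by rewrite cnM cn_nat cn_real ger0_norm // ltW.
have dil g (i : 'I_s) (G : R[i] -> R) : \sum_(p : 'I_P1 * 'I_P2) G (fsum N g P1 P2 (lam i * p.1%:Z) (lam i * p.2%:Z)) =
    \sum_(p : 'I_P1 * 'I_P2) G (fsum N g P1 P2 p.1 p.2).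
  by have /andP[co1 co2] := acop i; exact: sum_dilate.
have [E EE] : exists E : R, E = \sum_(p : 'I_P1 * 'I_P2) cn (fsum N (balanced A N) P1 P2 p.1 p.2) ^+ s by eexists.
have Sw i : \sum_p cn (w i p) ^+ s = E by rewrite EE /w (dil _ i (fun z => cn z ^+ s)).
have Su2 i : \sum_p cn (u i p) ^+ s <= C3 * (de ^+ s * N%:R ^+ s).
  rewrite /u (dil _ i (fun z => cn z ^+ s)).
  have ud (p : 'I_P1 * 'I_P2) : cn (fsum N (fun=> de%:C) P1 P2 p.1 p.2) ^+ s = de ^+ s * cn (fsum N (fun=> 1) P1 P2 p.1 p.2) ^+ s.
    rewrite -exprMn; congr (_ ^+ _); rewrite -{2}(ger0_norm (ltW de0)) -cn_real -cnM; congr cn.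
    by rewrite /fsum mulr_sumr; apply: eq_bigr => m _; rewrite mul1r.
  under eq_bigr => p _ do rewrite ud.
  rewrite -mulr_sumr mulrCA ler_wpM2l ?(ltW ds0) //; apply: hfull => // m _; by rewrite cn1.
have diff : cn (\sum_p \prod_i u i p) <= cn (\sum_p \prod_i (u i p + w i p)) +
   2 ^+ s * (2 * ka ^- s * (s%:R * E) + ka * (s%:R * (C3 * (de ^+ s * N%:R ^+ s)))).
  have -> : \sum_p \prod_i u i p = \sum_p \prod_i (u i p + w i p) - \sum_p (\prod_i (u i p + w i p) - \prod_i u i p).
    by rewrite sumrB opprB addrC subrK.
  apply: (le_trans (cnB _ _)); rewrite lerD2l; apply: (le_trans (cn_sum _ _ _)).
  apply: (le_trans (ler_sum _ (fun p _ => product_difference (fun i => u i p) (fun i => w i p) ka0 ka1))).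
  rewrite -mulr_sumr ler_wpM2l ?exprn_ge0 // big_split /= -!mulr_sumr; apply: lerD.
    rewrite ler_wpM2l ?mulr_ge0 ?(ltW ks0) // exchange_big /= -sum_const_ord; apply: ler_sum => i _.
    by rewrite Sw.
  rewrite ler_wpM2l ?(ltW ka0) // exchange_big /= -sum_const_ord; apply: ler_sum => i _; exact: Su2.
rewrite -EE exprMn.
have X0 : 0 < de ^+ s * N%:R ^+ s by rewrite mulr_gt0.
have T0 : 0 < 2 ^+ s * (2 * ka ^- s * s%:R) :> R.
  by rewrite mulr_gt0 ?exprn_gt0 // mulr_gt0 ?mulr_gt0 // (lt_le_trans ltr01).
rewrite [leLHS]mulrAC ler_pdivrMr //.
have kas2 := ler_wpM2r (ltW X0) kas.
move: Su Suw diff kas2.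
have -> : 2 ^+ s * (2 * ka ^- s * (s%:R * E) + ka * (s%:R * (C3 * (de ^+ s * N%:R ^+ s)))) =
  E * (2 ^+ s * (2 * ka ^- s * s%:R)) + 2 ^+ s * (ka * (s%:R * C3)) * (de ^+ s * N%:R ^+ s) by ring.
have -> : de ^+ s * (c * N%:R ^+ s) = c * (de ^+ s * N%:R ^+ s) by ring.
rewrite (_ : c / 4 * (de ^+ s * N%:R ^+ s) = c * (de ^+ s * N%:R ^+ s) / 4); last by field.
rewrite (_ : c / 2 * (de ^+ s * N%:R ^+ s) = c * (de ^+ s * N%:R ^+ s) / 2); last by field.
move: (c * (de ^+ s * N%:R ^+ s) : R) (E * _ : R) (2 ^+ s * (ka * (s%:R * C3)) * (de ^+ s * N%:R ^+ s) : R) (cn _ : R) (cn (\sum_p \prod_i u i p) : R).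
by clear => *; lra.
Qed.

(** K is a multiple of every lam i, so K N + 1 and K N^2 + 1 are coprime to all of them. *)
Lemma grid_exists (lam : nat -> int) (s : nat) : (forall i, (i < s)%N -> lam i != 0) ->
  exists2 Lam : R, 1 <= Lam & forall N, (0 < N)%N -> exists P1 P2, grid_ok Lam N P1 P2 /\ adapted lam s N P1 P2.
Proof.
move=> lnz; have [S SE] : exists S, S = (\sum_(i < s) `|lam i|)%N by eexists.
have [K KE] : exists K, K = (6 * S.+1 * \prod_(i < s) `|lam i|)%N by eexists.
have pr0 : (0 < \prod_(i < s) `|lam i|)%N by rewrite prodn_gt0 // => i; rewrite absz_gt0 lnz.
have K6 : (6 <= K)%N by rewrite KE -mulnA leq_pmulr // muln_gt0.
have KS : (S <= K)%N by apply: leq_trans (leqnSn S) _; rewrite KE -mulnA mulnCA leq_pmulr // muln_gt0 pr0.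
exists ((2 * K) ^ 2)%N%:R.
  by rewrite ler1n expn_gt0 muln_gt0 (leq_trans _ K6).
move=> N N0; exists (K * N).+1, (K * N ^ 2).+1; split.
  split => //; first by rewrite ltnW // ltnS leq_mul2r K6 orbT.
    by rewrite ltnW // ltnS leq_mul2r K6 orbT.
  have K0 : (0 < K)%N by exact: leq_trans K6.
  have le1 x : (0 < x)%N -> ((K * x).+1 <= 2 * K * x)%N.
    by move=> x0; rewrite -mulnA mul2n -addnn -addn1 leq_add2l muln_gt0 K0.
  rewrite -natrX -natrM ler_nat; apply: (@leq_trans (2 * K * N * (2 * K * N ^ 2))%N).
    by apply: leq_mul; apply: le1 => //; rewrite expn_gt0 N0.
  by apply: eq_leq; ring.
split; rewrite -?SE.
- by rewrite ltnS leq_mul2r KS orbT.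
- by rewrite ltnS leq_mul2r KS orbT.
move=> i; have dv x : coprime (K * x).+1 `|lam i|.
  have : (`|lam i| %| K * x)%N by rewrite KE (bigD1 i) //=; apply/dvdn_mulr/dvdn_mull/dvdn_mulr.
  by move=> /dvdnP[z ->]; rewrite -addn1 -coprime_modl modnMDl coprime_modl coprime1n.
by rewrite !dv.
Qed.

(** * Selecting a level and one step of the increment *)

Lemma ratio_bounds : 0 < ratio /\ ratio <= 7 / 8.
Proof.
have [b96 b112 _] := grow_bounds; rewrite /ratio; split; last by move: b112; clear; lra.
by rewrite divr_gt0 //; move: b96; clear; lra.
Qed.

Lemma ratio_sum (m : nat) : \sum_(j < m) ratio ^+ j <= 8.
Proof.
have [r0 r1] := ratio_bounds.
have h : \sum_(j < m) ratio ^+ j <= 8 * (1 - ratio ^+ m).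
  elim: m => [|m IH]; first by rewrite big_ord0 expr0 subrr mulr0.
  rewrite big_ord_recr /= exprSr; have t0 : 0 <= ratio ^+ m by apply: exprn_ge0; exact: ltW.
  move: IH (ler_wpM2l t0 r1); move: (ratio ^+ m : R) t0 (\sum_(j < m) _ : R) => t t0 S; move: r1; move: ratio => r r1 h1 h2.
  by move: h1 h2; set u := t * r; clear; lra.
apply: (le_trans h); have t0 : 0 <= ratio ^+ m by apply: exprn_ge0; exact: ltW.
by move: t0; clear; lra.
Qed.

(** If every level set were smaller than c [grow]^j, sorting the points by the least j with y >=
    2^(-j) would bound the sum by 2^s c times the sum of [ratio]^j. That sum is at most 8, and c =
    ka / 2^(s + 4) leaves only ka / 2. *)
Lemma level_select (T : finType) (y : T -> R) (s i : nat) (ka : R) : (7 <= s)%N -> (forall p, 0 <= y p <= 2) -> 0 < ka ->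
  ka <= \sum_(p | 1 <= y p * 2 ^+ i) y p ^+ s ->
  exists2 j, (j <= i)%N & ka / 2 ^+ (s + 4) * grow ^+ j <= #|[set p | 1 <= y p * 2 ^+ j]|%:R.
Proof.
move=> s7 y02 ka0 hsum; have [r0 r1] := ratio_bounds.
have [c cE] : exists c, c = ka / 2 ^+ (s + 4) by eexists.
rewrite -cE; case: (boolP [exists j : 'I_i.+1, c * grow ^+ j <= #|[set p | 1 <= y p * 2 ^+ j]|%:R]).
  by move=> /existsP[j hj]; exists j => //; rewrite -ltnS.
move=> /existsPn hno; exfalso.
have pt p : 1 <= y p * 2 ^+ i -> y p ^+ s <= \sum_(j < i.+1) (if 1 <= y p * 2 ^+ j then 2 ^+ s * 128 ^- j else 0).
  move=> hp; have ex : exists j, 1 <= y p * 2 ^+ j by exists i.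
  case: (ex_minnP ex) => j hj minj; have ji : (j < i.+1)%N by rewrite ltnS minj.
  have /andP[yp0 yp2] := y02 p.
  rewrite (bigD1 (Ordinal ji)) //= hj; apply: (@le_trans _ _ (2 ^+ s * 128 ^- j)); last first.
    by rewrite lerDl sumr_ge0 // => k _; case: ifP => // _; rewrite mulr_ge0 ?invr_ge0 ?exprn_ge0.
  have hy : y p <= 2 * 2 ^- j.
    case: j hj minj {ji} => [|j] _ minj; first by rewrite expr0 invr1 mulr1.
    have : ~~ (1 <= y p * 2 ^+ j) by apply/negP => /minj; rewrite ltnn.
    rewrite -ltNge => h; have p0 : (0 : R) < 2 ^+ j by apply: exprn_gt0.
    rewrite (_ : 2 * 2 ^- j.+1 = (2 ^+ j)^-1); last by rewrite exprS; field; rewrite gt_eqF.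
    by rewrite -div1r ler_pdivlMr // ltW.
  apply: (@le_trans _ _ ((2 * 2 ^- j) ^+ s)); first by rewrite lerXn2r // nnegrE (le_trans yp0).
  rewrite exprMn; apply: ler_wpM2l; first by apply: exprn_ge0.
  rewrite -exprVn -exprM mulnC exprM -exprVn; apply: lerXn2r; rewrite ?nnegrE ?exprn_ge0 ?invr_ge0 //.
  apply: (@le_trans _ _ (2^-1 ^+ 7)).
    by apply: ler_wiXn2l; rewrite ?invr_ge0 // invf_le1 // ler1n.
  by rewrite exprVn -natrX.
have : ka <= \sum_(j < i.+1) 2 ^+ s * 128 ^- j * #|[set p | 1 <= y p * 2 ^+ j]|%:R.
  apply: (le_trans hsum); apply: (@le_trans _ _ (\sum_p \sum_(j < i.+1) (if 1 <= y p * 2 ^+ j then 2 ^+ s * 128 ^- j else 0))).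
    rewrite [leLHS]big_mkcond /=; apply: ler_sum => p _; case: ifP => [|_]; first exact: pt.
    by apply: sumr_ge0 => j _; case: ifP => // _; rewrite mulr_ge0 ?invr_ge0 ?exprn_ge0.
  rewrite exchange_big /=; apply: ler_sum => j _; rewrite -big_mkcond /= -sum1_card natr_sum mulr_sumr.
  by apply: eq_ler; apply: eq_big => p; rewrite ?inE ?mulr1.
apply/negP; rewrite -ltNge; apply: (@le_lt_trans _ _ (\sum_(j < i.+1) 2 ^+ s * c * ratio ^+ j)).
  apply: ler_sum => j _; have := hno j; rewrite -ltNge => /ltW h.
  have -> : 2 ^+ s * c * ratio ^+ j = 2 ^+ s * 128 ^- j * (c * grow ^+ j).
    rewrite /ratio expr_div_n; move: (2 ^+ s : R) (grow ^+ j : R) (128 ^- j : R) => *; ring.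
  by rewrite ler_wpM2l // mulr_ge0 ?invr_ge0 ?exprn_ge0.
rewrite -mulr_sumr.
have p0 : (0 : R) < 2 ^+ s by apply: exprn_gt0.
have c0 : 0 <= 2 ^+ s * c by rewrite cE mulr_ge0 ?divr_ge0 ?exprn_ge0 // ltW.
apply: (le_lt_trans (ler_wpM2l c0 (ratio_sum _))).
rewrite cE exprD (_ : 2 ^+ s * (ka / (2 ^+ s * 2 ^+ 4)) * 8 = ka / 2).
  by move: ka0; clear; lra.
by move: (2 ^+ s : R) p0 => t t0; field; rewrite gt_eqF.
Qed.

(** Take the least such i. Since [ratio] <= 7/8, 2 [ratio]^6 <= 1, so 2^i is at most 2 q^6. *)
Lemma ratio_choice (q : R) : 1 <= q -> exists i, q * ratio ^+ i <= 1 /\ 2 ^+ i <= 2 * q ^+ 6.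
Proof.
move=> q1; have q0 : 0 < q by exact: lt_le_trans q1.
have [r0 r1] := ratio_bounds.
have ex : exists i, q * ratio ^+ i <= 1.
  have [i hi] : exists i, ratio ^+ i <= q^-1 by apply: ratio_small; rewrite invr_gt0.
  by exists i; rewrite mulrC -ler_pdivlMr // div1r.
case: (ex_minnP ex) => i hi mini; exists i; split => //.
have q6 : 1 <= q ^+ 6 by exact: exprn_ege1.
case: i hi mini => [|k] _ mini; first by rewrite expr0; move: q6; clear; lra.
have : ~~ (q * ratio ^+ k <= 1) by apply/negP => /mini; rewrite ltnn.
rewrite -ltNge => h; rewrite exprS ler_wpM2l //.
have p0 : (0 : R) <= 2 ^+ k by apply: exprn_ge0.
apply: (@le_trans _ _ (2 ^+ k * (q * ratio ^+ k) ^+ 6)).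
  by rewrite ler_peMr // exprn_ege1 // ltW.
rewrite exprMn mulrCA ler_piMr ?exprn_ge0 ?(ltW q0) // -exprM mulnC exprM -exprMn.
apply: exprn_ile1; first by apply: mulr_ge0 => //; apply: exprn_ge0; exact: ltW.
apply: (@le_trans _ _ (2 * (7 / 8) ^+ 6)).
  apply: ler_wpM2l => //; apply: lerXn2r => //; rewrite nnegrE; first exact: ltW.
  exact: le_trans (ltW r0) r1.
by clear; lra.
Qed.

Lemma fsum_balanced_le (A : pred nat) (N P1 P2 : nat) (a b : int) :
  cn (fsum N (balanced A N) P1 P2 a b) <= 2 * (dens A N * N%:R).
Proof.
apply: (le_trans (cn_sum _ _ _)); apply: (@le_trans _ _ (\sum_(n < N) (indic A n + dens A N))).
  apply: ler_sum => n _; rewrite cnM cn_e mulr1 cn_real; apply: (le_trans (ler_normB _ _)).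
  by rewrite !ger0_norm ?dens_ge0 // /indic; case: ifP.
by rewrite big_split /= dens_sum sum_const_ord; apply: eq_ler; ring.
Qed.

(** Frequencies below height N / 2^i, with 2^i of order de^(-6 s), carry at most half of the moment
    supplied by [balanced_large]. So some level j <= i is rich enough for [spectrum_increment]. The
    powers of de in the hypothesis come from this truncation. *)
Lemma density_increment (lam : nat -> int) (n : nat) : (4 <= n)%N -> (forall i, (i < n.+3)%N -> lam i != 0) ->
  (forall k, (k < n.+1)%N -> dcoef lam k != 0) -> 0 < dcoef lam 0 -> dcoef lam n < 0 -> \sum_(i < n.+3) lam i = 0 ->
  exists (E : nat) (C c : R), [/\ 1 <= C, 0 < c, c <= 1 & forall (N : nat) (A : pred nat), (0 < N)%N ->
    sol_free lam n.+3 A N -> 0 < dens A N -> C <= dens A N ^+ E * ln N%:R ->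
    exists j a d N' : nat, [/\ (0 < d)%N, (0 < N')%N, forall t, (t < N')%N -> (a + d * t < N)%N,
      ln N%:R <= C * 2 ^+ (21 * j) * ln N'%:R & dens A N * (1 + c * (101 / 100) ^+ j) <= dens (fun t => A (a + d * t)%N) N']].
Proof.
move=> n4 lnz dnz d0 dn lsum; have [Lam L1 hgrid] := grid_exists lnz.
have [Cb [c0 c00 hbal]] := balanced_large n4 lnz dnz d0 dn lsum L1.
have [C2 C21 htail] := tail_bound L1.
have [s sE] : exists s, s = n.+3 by eexists.
have s7 : (7 <= s)%N by rewrite sE; move: n4; clear; lia.
have C20 : 0 < C2 by exact: lt_le_trans C21.
rewrite -sE in hgrid hbal *.
have [c1 c1E] : exists c1, c1 = Num.min c0 1 by eexists.
have c10 : 0 < c1 by rewrite c1E lt_min c00 ltr01.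
have c11 : c1 <= 1 by rewrite c1E ge_min lexx orbT.
have c1c : c1 <= c0 by rewrite c1E ge_min lexx.
have [cl clE] : exists cl, cl = c1 / 2 / 2 ^+ (s + 4) by eexists.
have ps0 : (0 : R) < 2 ^+ (s + 4) by apply: exprn_gt0.
have ps1 : (1 : R) <= 2 ^+ (s + 4) by apply: exprn_ege1; rewrite ler1n.
have cl0 : 0 < cl by rewrite clE divr_gt0 // divr_gt0.
have cl1 : cl <= 1.
  by rewrite clE ler_pdivrMr // mul1r (le_trans _ ps1) //; move: c11; clear; lra.
have [Cs [c [Cs0 cc0 cc1 hspec]]] := spectrum_increment L1 cl0 cl1.
have [Q0 QE] : exists Q0, Q0 = 2 * C2 / c1 by eexists.
have Q1 : 1 <= Q0.
  by rewrite QE ler_pdivlMr // mul1r; move: c11 C21; clear; lra.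
have CsR : (1 : R) <= Cs%:R by rewrite ler1n.
have Q00 : 0 <= Q0 by exact: le_trans Q1.
have p360 : 0 <= C2 * (2 * Q0 ^+ 6) ^+ 60.
  by rewrite mulr_ge0 ?(ltW C20) // exprn_ge0 // mulr_ge0 // exprn_ge0.
have p216 : 0 <= Cs%:R * (2 * Q0 ^+ 6) ^+ 36.
  by rewrite mulr_ge0 // exprn_ge0 // mulr_ge0 // exprn_ge0.
have nC : 0 <= `|Cb| by exact: normr_ge0.
(* 360 s pays for 2^(60 i) in [tail_bound]; the 36th power in [spectrum_increment] needs 216 s +
   36. *)
exists (360 * s + 36)%N, (Cs%:R + (`|Cb| + (C2 * (2 * Q0 ^+ 6) ^+ 60 + Cs%:R * (2 * Q0 ^+ 6) ^+ 36))), c.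
split => //; first by apply: (le_trans CsR); rewrite lerDl !addr_ge0.
move=> N A N0 free de0 hC.
have [de deE] : exists de, de = dens A N by eexists.
rewrite -deE in de0 hC *; have de1 : de <= 1 by rewrite deE dens_le1.
have dd0 k : 0 <= de ^+ k by rewrite exprn_ge0 // ltW.
have dd1 k : de ^+ k <= 1 by rewrite exprn_ile1 // ltW.
have ln0 : 0 <= ln N%:R by apply: ln_ge0; rewrite ler1n.
have NR : (0 : R) < N%:R by rewrite ltr0n.
have lnN : ln N%:R <= N%:R by exact: ln_le_self.
have use x k : (k <= 360 * s + 36)%N -> 0 <= x -> x <= Cs%:R + (`|Cb| + (C2 * (2 * Q0 ^+ 6) ^+ 60 + Cs%:R * (2 * Q0 ^+ 6) ^+ 36)) -> x <= de ^+ k * ln N%:R.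
  move=> kE x0 hx; apply: (le_trans hx); apply: (le_trans hC); rewrite ler_wpM2r //.
  by apply: ler_wiXn2l => //; exact: ltW.
have u1 : Cb <= de ^+ (4 * s) * N%:R.
  apply: (le_trans (ler_norm Cb)); apply: (@le_trans _ _ (de ^+ (4 * s) * ln N%:R)); last by rewrite ler_wpM2l.
  apply: use => //; first by move: s7; clear; lia.
  by move: CsR p360 p216; clear; lra.
have u2 : C2 * (2 * Q0 ^+ 6) ^+ 60 <= de ^+ (360 * s) * N%:R.
  apply: (@le_trans _ _ (de ^+ (360 * s) * ln N%:R)); last by rewrite ler_wpM2l.
  apply: use => //; first by rewrite leq_addr.
  by move: CsR nC p216; clear; lra.
have u3 : Cs%:R * (2 * Q0 ^+ 6) ^+ 36 <= de ^+ (216 * s + 36) * ln N%:R.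
  apply: use => //; first by move: s7; clear; lia.
  by move: CsR nC p360; clear; lra.
have ds0 : 0 < de ^+ s by apply: exprn_gt0.
have [q qE] : exists q, q = Q0 / de ^+ s by eexists.
have q1 : 1 <= q by rewrite qE ler_pdivlMr // mul1r (le_trans (dd1 s)).
have [i [hi hi2]] := ratio_choice q1.
have [P1 [P2 [ok ad]]] := hgrid N N0.
have big := hbal N P1 P2 A ok ad free; rewrite -deE in big.
have {}big := big de0 u1.
have hi3 k : (2 ^+ i) ^+ k <= (2 * Q0 ^+ 6) ^+ k * (de ^+ (6 * k * s))^-1.
  apply: (@le_trans _ _ ((2 * q ^+ 6) ^+ k)).
    by rewrite lerXn2r // nnegrE ?mulr_ge0 ?exprn_ge0 // (le_trans _ q1).
  have -> : de ^+ (6 * k * s) = ((de ^+ s) ^+ 6) ^+ k.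
    by rewrite -!exprM; congr (_ ^+ _); ring.
  by rewrite qE expr_div_n mulrA expr_div_n.
have h60 : C2 * 2 ^+ (60 * i) <= N%:R.
  rewrite mulnC exprM; apply: (le_trans (ler_wpM2l (ltW C20) (hi3 60%N))).
  rewrite (_ : (6 * 60 * s = 360 * s)%N) //; move: u2 (exprn_gt0 (360 * s) de0).
  move: ((2 * Q0 ^+ 6) ^+ 60 : R) (de ^+ (360 * s) : R) => t u h u0.
  by rewrite mulrA ler_pdivrMr // [leRHS]mulrC.
pose F (p : 'I_P1 * 'I_P2) := cn (fsum N (balanced A N) P1 P2 p.1 p.2).
have F0 p : 0 <= F p by exact: cn_ge0.
have FN p : F p <= N%:R by apply: fsum_le => m _; exact: cn_balanced_le1.
have deN : 0 < de * N%:R by rewrite mulr_gt0.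
have ytail : \sum_(p | F p * 2 ^+ i <= N%:R) (F p / (de * N%:R)) ^+ s <= c1 / 2.
  apply: (@le_trans _ _ (\sum_(p | F p * 2 ^+ i <= N%:R) de ^- s * (F p / N%:R) ^+ 7)).
    apply: ler_sum => p _; rewrite invfM [_ * (_ / _)]mulrCA exprMn exprVn ler_wpM2l ?invr_ge0 //.
    by apply: ler_wiXn2l => //; rewrite ?divr_ge0 // ler_pdivrMr // mul1r.
  rewrite -mulr_sumr mulrC ler_pdivrMr //.
  apply: (le_trans (htail N P1 P2 i _ ok (fun m _ => cn_balanced_le1 A N m) h60)).
  move: hi; rewrite qE QE (_ : 2 * C2 / c1 / de ^+ s * ratio ^+ i = C2 * ratio ^+ i / (c1 / 2 * de ^+ s)).
    by rewrite ler_pdivrMr ?mul1r // mulr_gt0 // divr_gt0.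
  by move: (de ^+ s : R) (ratio ^+ i : R) ds0 => t u t0; field; rewrite !gt_eqF.
have ybig : c1 <= \sum_p (F p / (de * N%:R)) ^+ s.
  apply: (le_trans c1c); under eq_bigr => p _ do rewrite expr_div_n.
  by rewrite -mulr_suml ler_pdivlMr //; apply: exprn_gt0.
pose y p := F p / (de * N%:R).
have y02 p : 0 <= y p <= 2.
  by rewrite divr_ge0 ?(ltW deN) //= ler_pdivrMr // deE fsum_balanced_le.
have ysel : c1 / 2 <= \sum_(p | 1 <= y p * 2 ^+ i) y p ^+ s.
  have : c1 - c1 / 2 <= \sum_(p | ~~ (F p * 2 ^+ i <= N%:R)) y p ^+ s.
    by move: ybig ytail; rewrite (bigID (fun p => F p * 2 ^+ i <= N%:R)) /=; clear; lra.
  rewrite (_ : c1 - c1 / 2 = c1 / 2); last by field.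
  move=> h; apply: (le_trans h); rewrite [leLHS]big_mkcond [leRHS]big_mkcond /=; apply: ler_sum => p _.
  have yp : 0 <= y p ^+ s by apply: exprn_ge0; case/andP: (y02 p).
  case: ifP => [|_]; last by case: ifP.
  rewrite -ltNge => hp; rewrite (_ : 1 <= _ = true) // /y mulrAC ler_pdivlMr // mul1r (le_trans _ (ltW hp)) //.
  by rewrite ler_piMl.
have [j ji hj] := level_select s7 y02 (divr_gt0 c10 (ltr0Sn R 1)) ysel.
rewrite -clE in hj.
have [b96 _ _] := grow_bounds.
have gj1 : 1 <= grow ^+ j by apply: exprn_ege1; move: b96; clear; lra.
(* The level set is thinned to about [grow]^j points, because the price of the tiling grows with the
   number of phases. *)
have [S [SS Slow Sup]] : exists S : {set 'I_P1 * 'I_P2}, [/\ S \subset [set p | 1 <= y p * 2 ^+ j], cl * grow ^+ j <= #|S|%:R & #|S|%:R <= 2 * grow ^+ j].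
  have [h|h] := lerP (#|[set p | 1 <= y p * 2 ^+ j]|%:R) (2 * grow ^+ j).
    by exists [set p | 1 <= y p * 2 ^+ j].
  have [k /andP[k1 k2]] := @nat_ceil (grow ^+ j) (le_trans ler01 gj1).
  have kS : (k <= #|[set p | (1 <= y p * 2 ^+ j)%R]|)%N.
    by rewrite -(ler_nat R) (le_trans k2) // (le_trans _ (ltW h)) //; move: gj1; clear; lra.
  have [S SS Sk] := subset_of_card kS; exists S; split => //; rewrite Sk.
    by apply: le_trans k1; rewrite ler_piMl // (le_trans ler01).
  by move: k2 gj1; clear; lra.
have := hspec N P1 P2 j A S ok Slow Sup; rewrite -deE => /(_ de0) hs.
have [||a [d [N' [d00 N'0 hAP hln hde]]]] := hs.
- move=> p /(subsetP SS); rewrite inE /y mulrAC ler_pdivlMr // mul1r //.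
- apply: (@le_trans _ _ (Cs%:R * (2 ^+ i / de) ^+ 36)).
    rewrite ler_wpM2l // lerXn2r ?nnegrE ?divr_ge0 ?exprn_ge0 ?(ltW de0) //.
    by rewrite ler_pM2r ?invr_gt0 // ler_eXn2l // ltr1n.
  rewrite expr_div_n mulrA ler_pdivrMr ?exprn_gt0 //.
  apply: (le_trans (ler_wpM2l (ler0n R Cs) (hi3 36%N))).
  rewrite (_ : (6 * 36 * s = 216 * s)%N) //; move: u3 (exprn_gt0 (216 * s) de0); rewrite exprD.
  move: ((2 * Q0 ^+ 6) ^+ 36 : R) (de ^+ (216 * s) : R) (de ^+ 36 : R) (ln N%:R) => t u z l h u0.
  by rewrite mulrA ler_pdivrMr // (_ : l * z * u = u * z * l) //; ring.
exists j, a, d, N'; split => //.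
apply: (le_trans hln); rewrite ler_wpM2r ?ln_ge0 ?ler1n // ler_wpM2r ?exprn_ge0 // lerDl !addr_ge0 //.
Qed.

(** The system is invariant under n -> a + d n because the lam i sum to 0; d > 0 preserves
    distinctness. *)
Lemma sol_free_progression (lam : nat -> int) (s : nat) (A : pred nat) (N a d N' : nat) : \sum_(i < s) lam i = 0 ->
  (0 < d)%N -> (forall t, (t < N')%N -> (a + d * t < N)%N) -> sol_free lam s A N -> sol_free lam s (fun t => A (a + d * t)%N) N'.
Proof.
move=> l0 d0 hAP free v hl hq hA inj.
pose v' : {ffun 'I_s -> 'I_N} := [ffun i => Ordinal (hAP (v i) (ltn_ord (v i)))].
apply: (free v').
- have -> : lform lam v' = a%:Z * \sum_(i < s) lam i + d%:Z * lform lam v.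
    by rewrite /lform !mulr_sumr -big_split /=; apply: eq_bigr => i _; rewrite ffunE /= PoszD PoszM; ring.
  by rewrite l0 hl !mulr0 addr0.
- have -> : qform lam v' = a%:Z ^+ 2 * \sum_(i < s) lam i + 2 * a%:Z * d%:Z * lform lam v + d%:Z ^+ 2 * qform lam v.
    by rewrite /lform /qform !mulr_sumr -!big_split /=; apply: eq_bigr => i _; rewrite ffunE /= PoszD PoszM; ring.
  by rewrite l0 hl hq !mulr0 !addr0.
- by move=> i; rewrite ffunE; exact: hA.
- move=> i j; rewrite !ffunE => /(congr1 val) /= /addnI /eqP; rewrite eqn_pmul2l // => /eqP h.
  by apply: inj; apply: val_inj.
Qed.

Lemma exponent_exists (x y : R) : 0 < x -> exists B : nat, y <= (1 + x) ^+ B.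
Proof.
move=> x0; have [B /andP[hB _]] := @nat_ceil (`|y| / x) (divr_ge0 (normr_ge0 _) (ltW x0)).
exists B; apply: (le_trans (ler_norm y)).
have h : 1 + B%:R * x <= (1 + x) ^+ B.
  elim: B {hB} => [|B IH]; first by rewrite mul0r addr0 expr0.
  rewrite exprS; apply: le_trans (ler_wpM2l (addr_ge0 ler01 (ltW x0)) IH); rewrite -natr1.
  have b0 : 0 <= B%:R * x * x by rewrite !mulr_ge0 // ltW.
  rewrite (_ : (1 + x) * (1 + B%:R * x) = 1 + (B%:R + 1) * x + B%:R * x * x); last by ring.
  by rewrite lerDl.
by apply: le_trans h; move: hB; rewrite ler_pdivrMr // => hB; move: hB; clear; lra.
Qed.

(** Induction on the number k of increments still possible, measured by dens (1 + c)^k > 1. If de^B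
    ln N exceeded C, an increment would pass to a progression on which the same quantity has not
    decreased while k drops; at k = 0 the density would exceed 1. *)
Lemma sol_free_density (lam : nat -> int) (n : nat) : (4 <= n)%N -> (forall i, (i < n.+3)%N -> lam i != 0) ->
  (forall k, (k < n.+1)%N -> dcoef lam k != 0) -> 0 < dcoef lam 0 -> dcoef lam n < 0 -> \sum_(i < n.+3) lam i = 0 ->
  exists (B : nat) (C : R), forall (N : nat) (A : pred nat), (0 < N)%N -> sol_free lam n.+3 A N ->
    0 < dens A N -> dens A N ^+ B * ln N%:R <= C.
Proof.
move=> n4 lnz dnz d0 dn lsum.
have [E [C [c [C1 c0 c1 hinc]]]] := density_increment n4 lnz dnz d0 dn lsum.
have [B1 hB1] := exponent_exists C c0.
have [b hb] := exponent_exists c^-1 c0.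
have [a ha] := @exponent_exists (1 / 100) (2 ^+ 21) (divr_gt0 ltr01 (ltr0Sn _ 99)).
(* E secures the hypothesis of the increment and B1 absorbs C. For z = 1.01^j the rest uses (1 + c
   z)^(b+1) >= z and z^a >= 2^(21 j). *)
have [B BE] : exists B, B = (E + (B1 + b.+1 * a))%N by eexists.
have gE : 1 + 1 / 100 = 101 / 100 :> R by field.
rewrite gE in ha.
have g1 : 1 <= 101 / 100 :> R by clear; lra.
have grow_B j : C * 2 ^+ (21 * j) <= (1 + c * (101 / 100) ^+ j) ^+ B.
  have [z zE] : exists z : R, z = (101 / 100) ^+ j by eexists.
  have z1 : 1 <= z by rewrite zE; apply: exprn_ege1.
  rewrite -zE; have cz : 1 + c <= 1 + c * z by rewrite lerD2l ler_peMr // ltW.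
  have c1z : 1 <= 1 + c * z by apply: le_trans cz; rewrite lerDl ltW.
  have c00 : 0 <= 1 + c by rewrite addr_ge0 // ltW.
  have h1 : C <= (1 + c * z) ^+ B1.
    by apply: (le_trans hB1); rewrite lerXn2r // nnegrE (le_trans c00).
  have h2 : z <= (1 + c * z) ^+ b.+1.
    rewrite exprS; apply: (@le_trans _ _ (c * z * c^-1)); first by rewrite mulrAC divff ?mul1r ?gt_eqF.
    apply: ler_pM; rewrite ?invr_ge0 ?(ltW c0) //.
      by rewrite mulr_ge0 ?(ltW c0) // (le_trans ler01).
      by rewrite lerDr.
    by apply: (le_trans hb); rewrite lerXn2r // nnegrE (le_trans c00).
  have h3 : 2 ^+ (21 * j) <= (1 + c * z) ^+ (b.+1 * a).
    rewrite exprM [leRHS]exprM; apply: (@le_trans _ _ (z ^+ a)).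
      rewrite zE [leRHS](_ : _ = ((101 / 100) ^+ a) ^+ j); last by rewrite -!exprM mulnC.
      rewrite lerXn2r // nnegrE; first by rewrite exprn_ge0.
      by rewrite exprn_ge0 // (le_trans ler01).
    by rewrite lerXn2r // nnegrE ?exprn_ge0 // (le_trans ler01).
  rewrite BE (exprD _ E) (exprD _ B1); apply: (@le_trans _ _ ((1 + c * z) ^+ B1 * (1 + c * z) ^+ (b.+1 * a))).
    by apply: ler_pM => //; rewrite ?exprn_ge0 // (le_trans ler01).
  by rewrite ler_peMl ?mulr_ge0 ?exprn_ge0 ?exprn_ege1 // (le_trans ler01).
have key k : forall (N : nat) (A : pred nat), (0 < N)%N -> sol_free lam n.+3 A N -> 0 < dens A N ->
   1 < dens A N * (1 + c) ^+ k -> dens A N ^+ B * ln N%:R <= C.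
  elim: k => [|k IH] N A N0 free de0.
    by rewrite expr0 mulr1 => h; have := lt_le_trans h (dens_le1 A N); rewrite ltxx.
  move=> hk; rewrite leNgt; apply/negP => hlt.
  have ln0 : 0 <= ln N%:R by apply: ln_ge0; rewrite ler1n.
  have hE : C <= dens A N ^+ E * ln N%:R.
    apply: (le_trans (ltW hlt)); rewrite ler_wpM2r //; apply: ler_wiXn2l; rewrite ?dens_ge0 ?dens_le1 //.
    by rewrite BE leq_addr.
  have [j [x [d [N' [d00 N'0 hAP hln hde]]]]] := hinc N A N0 free de0 hE.
  have zj : 1 <= (101 / 100) ^+ j :> R by apply: exprn_ege1.
  have cz : 1 + c <= 1 + c * (101 / 100) ^+ j by rewrite lerD2l ler_peMr // ltW.
  have cz0 : 0 < 1 + c * (101 / 100) ^+ j by apply: lt_le_trans cz; rewrite addr_gt0.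
  have de'0 : 0 < dens (fun t => A (x + d * t)%N) N' by apply: lt_le_trans hde; rewrite mulr_gt0.
  have c1k : 0 <= (1 + c) ^+ k by rewrite exprn_ge0 // addr_ge0 // ltW.
  have := IH N' _ N'0 (sol_free_progression lsum d00 hAP free) de'0.
  have -> : 1 < dens (fun t => A (x + d * t)%N) N' * (1 + c) ^+ k.
    apply: (lt_le_trans hk); rewrite exprS mulrA ler_wpM2r //; apply: le_trans hde.
    by rewrite ler_wpM2l // ltW.
  move=> /(_ isT); apply/negP; rewrite -ltNge; apply: (lt_le_trans hlt).
  have ln0' : 0 <= ln N'%:R by apply: ln_ge0; rewrite ler1n.
  have dB : dens A N ^+ B * (C * 2 ^+ (21 * j)) <= dens (fun t => A (x + d * t)%N) N' ^+ B.
    apply: (@le_trans _ _ ((dens A N * (1 + c * (101 / 100) ^+ j)) ^+ B)).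
      by rewrite (exprMn B (dens A N) (1 + _)) ler_wpM2l ?exprn_ge0 ?dens_ge0.
    by rewrite lerXn2r // nnegrE ?dens_ge0 // mulr_ge0 ?dens_ge0 // ltW.
  apply: le_trans (ler_wpM2r ln0' dB); rewrite -mulrA ler_wpM2l // exprn_ge0 // dens_ge0 //.
exists B, C => N A N0 free de0; have [k hk] := exponent_exists (2 / dens A N) c0.
apply: (key k) => //; apply: (@lt_le_trans _ _ 2); first by rewrite ltr1n.
by move: hk; rewrite ler_pdivrMr // mulrC.
Qed.

(** With the positive coefficients in front, a partial sum is either a sum of positive terms or
    minus the sum of the remaining negative ones. *)
Lemma partial_sum_gt0 (lam : nat -> int) (s p : nat) : (0 < p)%N -> (forall i, (i < p)%N -> 0 < lam i) ->
  (forall i, (p <= i < s)%N -> lam i < 0) -> \sum_(i < s) lam i = 0 -> forall k, (k.+1 < s)%N -> 0 < \sum_(i < k.+1) lam i.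
Proof.
move=> p0 hp hn l0 k ks; have [kp|pk] := leqP k.+1 p.
  rewrite big_ord_recl; apply: ltr_wpDr; first by apply: sumr_ge0 => i _; apply/ltW/hp; exact: leq_trans (ltn_ord (lift ord0 i)) kp.
  exact: hp.
have [m mE] : exists m, s = (k.+1 + m.+1)%N by exists (s - k.+2)%N; move: ks; clear; lia.
move: l0; rewrite mE big_split_ord /= => /eqP; rewrite addr_eq0 => /eqP ->; rewrite -sumrN big_ord_recl /=.
have neg (j : 'I_m.+1) : 0 < - lam (k.+1 + j)%N.
  by rewrite oppr_gt0; apply: hn; rewrite mE ltn_add2l ltn_ord andbT; move: pk; clear; lia.
by apply: ltr_wpDr; [apply: sumr_ge0 => j _; exact: ltW (neg (lift ord0 j))|exact: (neg ord0)].
Qed.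

(** All partial sums being positive, [dcoef k] has the sign of lam (k + 1). Two positive
    coefficients make [dcoef 0] positive and two negative ones make the last [dcoef] negative, so
    the diagonal form is indefinite. *)
Lemma sol_free_density_sorted (lam : nat -> int) (s p : nat) : (7 <= s)%N -> (2 <= p)%N -> (p + 2 <= s)%N ->
  (forall i, (i < p)%N -> 0 < lam i) -> (forall i, (p <= i < s)%N -> lam i < 0) -> \sum_(i < s) lam i = 0 ->
  exists (B : nat) (C : R), forall (N : nat) (A : pred nat), (0 < N)%N -> sol_free lam s A N ->
    0 < dens A N -> dens A N ^+ B * ln N%:R <= C.
Proof.
move=> s7 p2 ps hp hn l0; have [n nE] : exists n, s = n.+3 by exists (s - 3)%N; move: s7; clear; lia.
have S0 := partial_sum_gt0 (ltnW p2) hp hn l0.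
have lnz i : (i < s)%N -> lam i != 0.
  by move=> i_s; case: (ltnP i p) => hi; [rewrite gt_eqF ?hp|rewrite lt_eqF // hn // hi].
rewrite nE; apply: sol_free_density.
- by move: s7; rewrite nE.
- by move=> i hi; apply: lnz; rewrite nE.
- move=> k hk; rewrite /dcoef !mulf_neq0 ?lnz ?gt_eqF ?S0 // nE; move: hk; clear; lia.
- rewrite /dcoef; apply: mulr_gt0; last by apply: S0; rewrite nE.
  by apply: mulr_gt0; [apply: hp|apply: S0; rewrite nE].
- rewrite /dcoef pmulr_llt0; last by apply: S0; rewrite nE; clear; lia.
  rewrite pmulr_llt0; last by apply: S0; rewrite nE; clear; lia.
  by apply: hn; move: ps; rewrite nE; clear; lia.
- by rewrite -nE.
Qed.

(** * Arbitrary order of the coefficients and the passage to lists *)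

Lemma sol_free_density_seq (l : seq int) : (7 <= size l)%N -> 0 \notin l -> \sum_(x <- l) x = 0 ->
  (2 <= count (fun x => 0 < x)%R l)%N -> (2 <= count (fun x => x < 0)%R l)%N ->
  exists (B : nat) (C : R), forall (N : nat) (A : pred nat), (0 < N)%N -> sol_free (nth 0 l) (size l) A N ->
    0 < dens A N -> dens A N ^+ B * ln N%:R <= C.
Proof.
move=> s7 l_nz l0 cp cn'.
pose l1 := [seq x <- l | 0 < x]; pose l2 := [seq x <- l | ~~ (0 < x)].
have pe : perm_eq (l1 ++ l2) (in_tuple l) by rewrite perm_filterC.
have /tuple_permP[q qE] := pe.
have sz : size (l1 ++ l2) = size l by exact: perm_size.
have nq (i : 'I_(size l)) : nth 0 (l1 ++ l2) i = nth 0 l (q i).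
  by rewrite qE -tnth_nth tnth_mktuple (tnth_nth 0).
have c1 : size l1 = count (fun x => 0 < x)%R l by rewrite size_filter.
have c2 : size l2 = count (fun x => x < 0)%R l.
  rewrite size_filter; apply: eq_in_count => x xl /=; rewrite -leNgt le_eqVlt.
  by case: eqP => // x0; move: l_nz; rewrite -x0 xl.
have sum0 : \sum_(i < size l) nth 0 (l1 ++ l2) i = 0.
  rewrite -sz; transitivity (\sum_(x <- l1 ++ l2) x); first by rewrite (big_nth 0) big_mkord.
  by rewrite (perm_big _ pe).
have [B [C hBC]] : exists (B : nat) (C : R), forall (N : nat) (A : pred nat), (0 < N)%N -> sol_free (nth 0 (l1 ++ l2)) (size l) A N ->
    0 < dens A N -> dens A N ^+ B * ln N%:R <= C.
  apply: (@sol_free_density_sorted _ _ (size l1)) => //.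
  - by rewrite c1.
  - by rewrite -sz size_cat leq_add2l c2.
  - move=> i hi; rewrite nth_cat hi; have := mem_nth 0 hi; by rewrite mem_filter => /andP[].
  - move=> i /andP[h1 h2]; rewrite nth_cat ltnNge h1 /=.
    have h3 : (i - size l1 < size l2)%N by rewrite ltn_subLR // -size_cat sz.
    have := mem_nth 0 h3; rewrite mem_filter -leNgt le_eqVlt => /andP[/orP[/eqP x0|//] xl].
    by move: l_nz; rewrite -x0 xl.
exists B, C => N A N0 free de0; apply: hBC => // v hl hq hA inj.
apply: (free [ffun i => v ((q^-1)%g i)]).
- transitivity (lform (nth 0 (l1 ++ l2)) v); last exact: hl.
  rewrite /lform (reindex_inj (@perm_inj _ q)) /=; apply: eq_bigr => i _.
  by rewrite ffunE permK nq.
- transitivity (qform (nth 0 (l1 ++ l2)) v); last exact: hq.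
  rewrite /qform (reindex_inj (@perm_inj _ q)) /=; apply: eq_bigr => i _.
  by rewrite ffunE permK nq.
- by move=> i; rewrite ffunE.
- by move=> i j; rewrite !ffunE => /inj /perm_inj.
Qed.

Lemma In_mem (T : eqType) (x : T) (s : seq T) : List.In x s <-> x \in s.
Proof.
elim: s => [|y s IH] //=; rewrite inE IH eq_sym; split; first by case=> [->|->]; rewrite ?eqxx ?orbT.
by case/orP => [/eqP|]; [left|right].
Qed.

Lemma NoDup_uniq (T : eqType) (s : seq T) : List.NoDup s <-> uniq s.
Proof.
elim: s => [|y s IH] /=; first by split => // _; constructor.
split=> [h|/andP[ys us]].
  by inversion h; subst; apply/andP; split; [apply/negP => /In_mem|apply/IH].
by constructor; [move=> /In_mem; exact/negP|apply/IH].
Qed.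

Lemma wsum_sum (lam : seq Z) (ns : seq nat) f : size ns = size lam ->
  int_of_Z (wsum lam ns f) = \sum_(i < size lam) nth 0 (map int_of_Z lam) i * int_of_Z (f (Z.of_nat (nth 0%N ns i))).
Proof.
elim: lam ns => [|l lam IH] [|m ns] //= h; first by rewrite big_ord0.
have {}h : size ns = size lam by case: h.
rewrite big_ord_recl /= -[LHS]/(int_of_Z (l * f (Z.of_nat m) + wsum lam ns f)%R).
by rewrite rmorphD rmorphM /= IH.
Qed.

Lemma int_of_Z_nat n : int_of_Z (Z.of_nat n) = n%:Z.
Proof. lia. Qed.

Lemma admissible_seq (lam : seq Z) : admissible lam -> let l := map int_of_Z lam in
  [/\ (7 <= size l)%N, 0 \notin l, \sum_(x <- l) x = 0, (2 <= count (fun x => 0 < x)%R l)%N & (2 <= count (fun x => x < 0)%R l)%N].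
Proof.
move=> [s7 [nz [s0 [cp cn']]]] l; split.
- by rewrite size_map; apply/ssrnat.leP.
- apply/negP => /mapP[z zl z0]; have := proj1 (List.Forall_forall _ _) nz z (proj2 (In_mem _ _) zl).
  by apply; move: z0; clear; lia.
- have <- : int_of_Z (List.fold_right Z.add Z0 lam) = \sum_(x <- l) x.
    rewrite /l big_map; elim: lam {s7 nz s0 cp cn' l} => [|z lam IH]; first by rewrite big_nil.
    by rewrite big_cons -IH -rmorphD.
  by rewrite s0.
- rewrite (_ : count _ l = length (List.filter (fun l => Z.ltb Z0 l) lam)); first by apply/ssrnat.leP.
  rewrite /l; elim: lam {s7 nz s0 cp cn' l} => //= z lam ->.
  by rewrite (_ : (0 < int_of_Z z) = Z.ltb Z0 z); [case: Z.ltb|lia].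
- rewrite (_ : count _ l = length (List.filter (fun l => Z.ltb l Z0) lam)); first by apply/ssrnat.leP.
  rewrite /l; elim: lam {s7 nz s0 cp cn' l} => //= z lam ->.
  by rewrite (_ : (int_of_Z z < 0) = Z.ltb z Z0); [case: Z.ltb|lia].
Qed.

(** The list lives on 1, ..., N and the predicate on 0, ..., N - 1; the shift by one is harmless for
    a translation-invariant system and is undone in [solution_of_ffun]. *)
Lemma dens_list (A : seq nat) (N : nat) : uniq A -> (forall n, n \in A -> (1 <= n <= N)%N) ->
  (size A)%:R / N%:R <= dens (fun t => t.+1 \in A) N.
Proof.
move=> uA hA; rewrite /dens ler_wpM2r ?invr_ge0 //.
have -> : \sum_(n < N) indic (fun t => t.+1 \in A) n = (count (fun t => t.+1 \in A) (iota 0 N))%:R.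
  rewrite -(big_mkord xpredT (fun n => indic (fun t => t.+1 \in A) n)) -sum1_count natr_sum [RHS]big_mkcond /index_iota subn0.
  by apply: eq_bigr => i _; rewrite /indic; case: ifP.
rewrite ler_nat -size_filter -[X in (_ <= X)%N](size_map succn); apply: uniq_leq_size => // n nA.
have /andP[n1 nN] := hA n nA; apply/mapP; exists n.-1; last by rewrite prednK.
by rewrite mem_filter prednK // nA mem_iota /= add0n prednK.
Qed.

Lemma solution_of_ffun (lam : seq Z) (A : seq nat) (N : nat) (v : {ffun 'I_(size (map int_of_Z lam)) -> 'I_N}) :
  \sum_(x <- map int_of_Z lam) x = 0 ->
  lform (nth 0 (map int_of_Z lam)) v = 0 -> qform (nth 0 (map int_of_Z lam)) v = 0 -> (forall i, (v i).+1 \in A) -> injective v ->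
  exists ns, nontrivial_solution_in lam A ns.
Proof.
set l := map int_of_Z lam => l0 hl hq hA inj.
have sl : size l = size lam by rewrite size_map.
have s0 : \sum_(i < size l) l`_i = 0 by transitivity (\sum_(x <- l) x); [rewrite (big_nth 0) big_mkord|].
exists [seq (val (v i)).+1 | i <- enum 'I_(size l)].
have sz : size [seq (val (v i)).+1 | i <- enum 'I_(size l)] = size lam by rewrite size_map size_enum_ord.
have nthE (i : 'I_(size l)) : nth 0%N [seq (val (v i)).+1 | i <- enum 'I_(size l)] i = (v i).+1.
  by rewrite (nth_map i) ?size_enum_ord // nth_ord_enum.
have W f : int_of_Z (wsum lam [seq (val (v i)).+1 | i <- enum 'I_(size l)] f) = \sum_(i < size l) l`_i * int_of_Z (f (Z.of_nat (v i).+1)).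
  by rewrite wsum_sum // -sl; apply: eq_bigr => i _; rewrite nthE.
have inj0 z : int_of_Z z = 0 -> z = Z0 by clear; lia.
split; first exact: sz.
split; first by move=> n /In_mem /mapP[i _ ->]; apply/In_mem; exact: hA.
split; first by apply/NoDup_uniq; rewrite map_inj_uniq ?enum_uniq // => i j [] /val_inj /inj.
split; apply: inj0; rewrite W.
  rewrite (eq_bigr (fun i : 'I_(size l) => l`_i * (v i)%:Z + l`_i)); first by rewrite big_split /= s0 addr0.
  by move=> i _; rewrite int_of_Z_nat -addn1 PoszD mulrDr mulr1.
rewrite (eq_bigr (fun i : 'I_(size l) => l`_i * (v i)%:Z ^+ 2 + 2 * (l`_i * (v i)%:Z) + l`_i)).
  by rewrite !big_split /= s0 -mulr_sumr -/(lform _ v) -/(qform _ v) hl hq mulr0.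
have mm m : int_of_Z (Z.mul (Z.of_nat m) (Z.of_nat m)) = m%:Z * m%:Z.
  by transitivity (int_of_Z (Z.of_nat m) * int_of_Z (Z.of_nat m)); [exact: rmorphM|rewrite int_of_Z_nat].
by move=> i _; rewrite mm -addn1 PoszD; ring.
Qed.

(** With c = 1 / (2 B') and z = L^c one has L = z^(2 B'), so D >= 2 / z gives D^B' L >= (2 z)^B'.
    The factor 2 acts twice: with D <= 1 it forces z >= 2, which disposes of small L, and 2^B'
    exceeds C. *)
Lemma small_density (B : nat) (C : R) : exists2 c : R, 0 < c & forall D L : R, 0 < L -> D <= 1 ->
  2 * Rpower L (- c) <= D -> C < D ^+ B * L.
Proof.
have [B0 hB0] := @exponent_exists 1 (C + 1) ltr01.
have [B' B'E] : exists B', B' = (B + B0).+1 by eexists.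
have B'0 : (0 : R) < (2 * B')%N%:R by rewrite ltr0n muln_gt0 B'E.
exists ((2 * B')%N%:R^-1); first by rewrite invr_gt0.
move=> D L L0 D1 hD.
have [z zE] : exists z, z = Rpower L ((2 * B')%N%:R^-1) by eexists.
have z0 : 0 < z by rewrite zE /Rpower; exact: exp_gt0.
have hz : Rpower L (- (2 * B')%N%:R^-1) = z^-1 by rewrite zE -RinvE; exact: Rpower_Ropp.
have zL : z ^+ (2 * B') = L.
  transitivity (exp (ln L)); last exact: exp_lnK.
  by rewrite zE /Rpower -exp_muln; congr exp; rewrite RmultE mulrAC mulVf ?mul1r ?gt_eqF.
rewrite hz in hD.
have D0 : 0 < D by apply: lt_le_trans hD; rewrite divr_gt0.
have z2 : 2 <= z.
  by have := le_trans hD D1; rewrite ler_pdivrMr // mul1r.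
have h1 : 2 ^+ B' * z ^+ B' <= D ^+ B' * L.
  rewrite -zL mul2n -addnn exprD mulrA ler_wpM2r ?exprn_ge0 ?(ltW z0) //.
  rewrite -exprMn lerXn2r // ?nnegrE ?mulr_ge0 ?(ltW D0) ?(ltW z0) //.
  by move: hD; rewrite ler_pdivrMr.
apply: (@lt_le_trans _ _ (D ^+ B' * L)); last first.
  by rewrite ler_wpM2r ?(ltW L0) //; apply: ler_wiXn2l; rewrite ?(ltW D0) // B'E leqW // leq_addr.
apply: lt_le_trans h1; apply: (@lt_le_trans _ _ (2 ^+ B')).
  apply: (@lt_le_trans _ _ (C + 1)); first by rewrite ltrDl.
  apply: (le_trans hB0); rewrite (_ : 1 + 1 = 2) //.
  by rewrite ler_eXn2l ?ltr1n // B'E leqW // leq_addl.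
by rewrite ler_peMr ?exprn_ge0 // exprn_ege1 // (le_trans _ z2) // ler1n.
Qed.

Theorem nontrivial_solution_of_density (lam : list Z) : admissible lam ->
  exists c : R, Rlt 0 c /\
    forall (N : nat) (A : list nat), le 2 N -> List.NoDup A -> (forall n, List.In n A -> (le 1 n /\ le n N)) ->
      Rge (Rdiv (INR (length A)) (INR N)) (Rmult 2 (Rpower (Rpower.ln (INR N)) (Ropp c))) ->
      exists ns : list nat, nontrivial_solution_in lam A ns.
Proof.
move=> /admissible_seq[s7 nz l0 cp cn']; set l := map int_of_Z lam in s7 nz l0 cp cn'.
have [B [C hBC]] := sol_free_density_seq s7 nz l0 cp cn'.
have [c c0 hc] := small_density B C.
exists c; split; first exact/RltP.
move=> N A /ssrnat.leP N2 /NoDup_uniq uA hA /Rge_le /RleP hD.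
apply: boolp.contrapT => hno.
have N0 : (0 < N)%N by exact: ltnW.
have NR : (0 : R) < N%:R by rewrite ltr0n.
have L0 : 0 < ln N%:R by rewrite -ln_1; apply: ln_lt => //; rewrite ltr1n.
have hA' n : n \in A -> (1 <= n <= N)%N.
  by move=> /In_mem /hA [/ssrnat.leP h1 /ssrnat.leP h2]; rewrite h1 h2.
have hD2 : 2 * Rpower (ln N%:R) (- c) <= dens (fun t => t.+1 \in A) N.
  apply: le_trans (dens_list uA hA'); move: hD; rewrite !INRE RdivE RmultE RoppE //.
have := hc _ _ L0 (dens_le1 _ _) hD2; apply/negP; rewrite -leNgt; apply: hBC => //.
  move=> v hl hq hv inj; apply: hno; exact: (solution_of_ffun l0 hl hq hv inj).
by apply: lt_le_trans hD2; rewrite mulr_gt0 // /Rpower exp_gt0.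
Qed.

End QuadraticSystem.

Theorem mainTheorem1 (lam : list Z) (Hlam : admissible lam) :
  exists c : R, 0 < c /\
    forall (N : nat) (A : list nat),
      (2 <= N)%nat ->
      NoDup A ->
      (forall n, In n A -> (1 <= n <= N)%nat) ->
      INR (length A) / INR N >= 2 * Rpower (ln (INR N)) (- c) ->
      exists ns : list nat, nontrivial_solution_in lam A ns.
Proof. exact (QuadraticSystem.nontrivial_solution_of_density Hlam). Qed.
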